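(* Let $a,b,c$ be distinct primes with $a<b$ and $N(a,b,c)\ge 2$, and suppose $(a,b,c)\notin\{(2,3,5),(2,3,11),(2,5,3),(2,7,3),(3,5,2),(3,13,2)\}$. Then $b>10^9$ and $c>10^{18}$.
   Context: $N(a,b,c)$ denotes the number of triples $(x,y,z)$ of positive integers with $a^x+b^y=c^z$. *)

(* Defs.v *)
From mathcomp Require Import all_boot.
Set Implicit Arguments. Unset Strict Implicit. Unset Printing Implicit Defensive.

Definition is_sol (a b c : nat) (t : nat * nat * nat) : Prop :=
  let: (x, y, z) := t in
  0 < x /\ 0 < y /\ 0 < z /\ a ^ x + b ^ y = c ^ z.

Definition N_ge2 (a b c : nat) : Prop :=
  exists t1 t2, t1 <> t2 /\ is_sol a b c t1 /\ is_sol a b c t2.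

(* Main.v *)
(** Since [a < b], parity forces [a = 2] or [c = 2].  Once the parities of the exponents are
    fixed, a solution is a representation of [c ^ z] (of [4 * 2 ^ z] if [c = 2]) by a form
    [delta S^2 + eps T^2], that is, an element of a quadratic order whose norm is a power of
    the prime [c].  A descent replaces unique factorization: two representations are linked by an
    element whose norm is the quotient of the two powers of [c], and hence every representation
    is an odd power of the minimal one.  As [S] and [T] have to be powers of given primes, this
    forces a term of a Lucas sequence to be [1] or [-1], which divisibility and 2-adic arguments
    exclude, with a few exceptions.  So each parity class contains at most one solution.

    Congruences modulo 3 and powers of 2 leave two solutions in different classes only if
    [a = 2], one of them being [c = 2 ^ (2 alpha) + b ^ (2 beta)] and the other
    [c ^ f = 2 ^ j + b ^ y] with [y] odd.  As [c > b ^ 2], it remains to exclude [b < 10 ^ 9].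
    Comparing 2-adic valuations in the second equation determines [b] modulo a large power of 2,
    in finitely many families.  For each of them all [b < 10 ^ 9] are eliminated by a sieve which
    runs through the exponents modulo 12, 36, 144 and so on, keeps the residues of [b] modulo
    primes [p] with [p - 1] dividing the current period, and recovers [b] by Chinese remaindering. *)
From Stdlib Require Import ZArith Znumtheory Zpow_facts Lia Classical List NArith FMapPositive Bool.
From mathcomp Require Import all_boot.
Require Import Defs.
Local Open Scope Z_scope.
Local Arguments Z.pow : simpl never.
Local Arguments Z.mul : simpl never.
Local Arguments Z.add : simpl never.
Local Arguments Z.sub : simpl never.
Local Arguments Z.of_nat : simpl never.

(** A term of the Lucas sequence can be attacked in two ways. If the prime [b] divides the parameter
    [Q], a coordinate that is a power of [b] forces [b] into the index, and a term of index [b] is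
    too large for its norm equation. If [Q = 1] there is no such prime and only the exact 2-adic
    order of [w_ - 1] helps. This is why the descent carries a divisor [g] of [T]: it keeps the
    minimal representation away from [T0 = 1] where the first method is wanted.

    The sieve meets an obstacle of its own. For [f = 1] and [i = j] the equation would be the
    trivial identity if [e] and [y] were equal; only their opposite parity prevents this, and modulo
    a prime it is no contradiction as soon as [b] has odd order there. So congruences with fixed
    small moduli leave survivors. For this reason every surviving [b] is reconstructed as an
    integer, and the last test is made modulo [b] itself. The bound [10 ^ 9] is the range of this
    search; being below [2 ^ 30], it also bounds the 2-adic orders of [b - 1] and [b + 1] and so
    makes the number of families finite. *)

Notation zprime := Znumtheory.prime.

(** * Odd powers of a quadratic irrationality *)

(* [theta ^ (2 k + 1) = u_k sqrt Q + w_k sqrt (- P)] for [theta = sqrt Q + sqrt (- P)]. *)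
Fixpoint wu (P Q : Z) (k : nat) : Z * Z :=
  match k with
  | O => (1, 1)
  | S k => let (w, u) := wu P Q k in
           (w * (Q - P) + 2 * Q * u, u * (Q - P) - 2 * P * w)
  end.
Definition w_ P Q k := (wu P Q k).1.
Definition u_ P Q k := (wu P Q k).2.

Lemma w_S P Q k : w_ P Q k.+1 = w_ P Q k * (Q - P) + 2 * Q * u_ P Q k.
Proof. by rewrite /w_ /u_ /=; case: (wu P Q k). Qed.
Lemma u_S P Q k : u_ P Q k.+1 = u_ P Q k * (Q - P) - 2 * P * w_ P Q k.
Proof. by rewrite /w_ /u_ /=; case: (wu P Q k). Qed.

Lemma wu_norm P Q k :
  P * w_ P Q k ^ 2 + Q * u_ P Q k ^ 2 = (P + Q) * ((P + Q) ^ 2) ^ Z.of_nat k.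
Proof.
elim: k => [|k IH]; first by rewrite /w_ /u_ /= Z.pow_0_r; ring.
rewrite Nat2Z.inj_succ Z.pow_succ_r; last lia.
transitivity ((P + Q) ^ 2 * ((P + Q) * ((P + Q) ^ 2) ^ Z.of_nat k)); last ring.
by rewrite -IH w_S u_S; ring.
Qed.

(** Multiplying [theta] by a square root of -1 exchanges the roles of [P] and [Q]; the sign comes
    from the odd power of that root. *)
Lemma u_sym P Q k : u_ P Q k = (-1) ^ Z.of_nat k * w_ Q P k /\
                    w_ P Q k = (-1) ^ Z.of_nat k * u_ Q P k.
Proof.
elim: k => [|k [IHu IHw]]; first by [].
rewrite Nat2Z.inj_succ Z.pow_succ_r; last lia.
by rewrite !w_S !u_S IHu IHw; split; ring.
Qed.

(* [om k] is the pair of coordinates of [theta ^ (2 k)] in the basis [1, 2 sqrt (- P Q)]. *)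
Fixpoint om (P Q : Z) (k : nat) : Z * Z :=
  match k with
  | O => (1, 0)
  | S k => let (x, y) := om P Q k in (x * (Q - P) - 4 * P * Q * y, y * (Q - P) + x)
  end.
Lemma wu_om P Q k : w_ P Q k = (om P Q k).1 + 2 * Q * (om P Q k).2 /\
                    u_ P Q k = (om P Q k).1 - 2 * P * (om P Q k).2.
Proof.
elim: k => [|k [IHw IHu]]; first by rewrite /w_ /u_ /=; split; ring.
by rewrite w_S u_S IHw IHu /=; case: (om P Q k) => x y /=; split; ring.
Qed.
Lemma om_add P Q k m : om P Q (k + m) =
  ((om P Q k).1 * (om P Q m).1 - 4 * P * Q * (om P Q k).2 * (om P Q m).2,
   (om P Q k).1 * (om P Q m).2 + (om P Q k).2 * (om P Q m).1).
Proof.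
elim: k => [|k IH]; first by rewrite add0n /=; case: (om P Q m) => x y /=; congr (_, _); ring.
by rewrite addSn /= IH; case: (om P Q k) => a b /=; congr (_, _); ring.
Qed.
(** The power [theta ^ (2 k + 1) = u sqrt Q + w sqrt (- P)] is itself the [theta] of the parameters
    [P w ^ 2] and [Q u ^ 2]. The factor [w u] appears when [sqrt (- P Q w ^ 2 u ^ 2)] is written in
    terms of [sqrt (- P Q)]. *)
Lemma om_mul P Q k m :
  let w := w_ P Q k in let u := u_ P Q k in
  om P Q ((k.*2.+1) * m) =
  ((om (P * w ^ 2) (Q * u ^ 2) m).1, w * u * (om (P * w ^ 2) (Q * u ^ 2) m).2).
Proof.
move=> w u.
have E : om P Q k.*2.+1 = (Q * u ^ 2 - P * w ^ 2, w * u).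
  rewrite -addnn -addnS om_add /= /w /u.
  have [-> ->] := wu_om P Q k; case: (om P Q k) => x y /=; congr (_, _); ring.
elim: m => [|m IH]; first by rewrite muln0 /= Z.mul_0_r.
rewrite mulnS om_add E IH /=.
case: (om (P * w ^ 2) (Q * u ^ 2) m) => x y /=; congr (_, _); ring.
Qed.
Lemma wu_comp_aux P Q k m :
  let w := w_ P Q k in let u := u_ P Q k in
  w_ P Q (k + k.*2.+1 * m) = w * w_ (P * w ^ 2) (Q * u ^ 2) m /\
  u_ P Q (k + k.*2.+1 * m) = u * u_ (P * w ^ 2) (Q * u ^ 2) m.
Proof.
move=> w u.
have [-> ->] := wu_om P Q (k + k.*2.+1 * m).
have [-> ->] := wu_om (P * w ^ 2) (Q * u ^ 2) m.
rewrite om_add om_mul -/w -/u /=.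
have [Ew Eu] := wu_om P Q k.
case: (om _ _ m) => x y /=; move: Ew Eu; rewrite -/w -/u.
case: (om P Q k) => a b /= Ew Eu; split.
  transitivity (x * (a + 2 * Q * b) + 2 * Q * (w * u) * y * (a - 2 * P * b)); first ring.
  by rewrite -Ew -Eu; ring.
transitivity (x * (a - 2 * P * b) - 2 * P * (w * u) * y * (a + 2 * Q * b)); first ring.
by rewrite -Ew -Eu; ring.
Qed.

(** The hypothesis says [2 K + 1 = (2 k + 1) (2 m + 1)]. A factor of the odd index can thus be split
    off, at the price of new parameters; this is how a prime is removed from the index. *)
Lemma wu_comp P Q k m K : Z.of_nat K = Z.of_nat k + (2 * Z.of_nat k + 1) * Z.of_nat m ->
  w_ P Q K = w_ P Q k * w_ (P * w_ P Q k ^ 2) (Q * u_ P Q k ^ 2) m /\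
  u_ P Q K = u_ P Q k * u_ (P * w_ P Q k ^ 2) (Q * u_ P Q k ^ 2) m.
Proof.
move=> E; have -> : K = (k + k.*2.+1 * m)%N.
  by apply: Nat2Z.inj; rewrite -addnn -plusE -multE E; lia.
exact: wu_comp_aux.
Qed.

(** Binomial expansion of the odd power of [theta], keeping the term of lowest order in [Q]. *)
Lemma wu_modQ P Q k : exists x y, w_ P Q k = (- P) ^ Z.of_nat k + Q * x /\
                    u_ P Q k = (2 * Z.of_nat k + 1) * (- P) ^ Z.of_nat k + Q * y.
Proof.
elim: k => [|k [x [y [Ew Eu]]]].
  by exists 0, 0; rewrite /w_ /u_ /= !Z.pow_0_r; split; ring.
rewrite Nat2Z.inj_succ Z.pow_succ_r; last lia.
rewrite w_S u_S Ew Eu; set p := (- P) ^ _; set n := Z.of_nat k.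
exists (p + x * (Q - P) + 2 * ((2 * n + 1) * p + Q * y)).
exists ((2 * n + 1) * p + y * (Q - P) - 2 * P * x).
by split; rewrite /Z.succ; ring.
Qed.

(** The next term of the binomial expansion. The factors [- P] and 3 clear the exponent [n - 1] of
    [- P] and the denominator of the third binomial coefficient of [2 n + 1]. *)
Lemma wu_modQ2 P Q k : exists x y, let n := Z.of_nat k in
  (- P) * w_ P Q k = (- P) ^ n * (- P + Q * (n * (2 * n + 1))) + Q ^ 2 * x /\
  3 * (- P) * u_ P Q k = (2 * n + 1) * (- P) ^ n * (- 3 * P + Q * (n * (2 * n - 1))) + Q ^ 2 * y.
Proof.
elim: k => [|k [x [y [Ew Eu]]]].
  by exists 0, 0; rewrite /w_ /u_ /= !Z.pow_0_r; split; ring.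
have [x1 [y1 [_ Eu1]]] := wu_modQ P Q k; cbv zeta in *.
rewrite Nat2Z.inj_succ Z.pow_succ_r; last lia.
move: Ew Eu Eu1; rewrite w_S u_S; set p := (- P) ^ _; set n := Z.of_nat k => Ew Eu Eu1.
exists (p * (n * (2 * n + 1)) + x * (Q - P) - 2 * P * y1).
exists ((2 * n + 1) * p * (n * (2 * n - 1)) + y * (Q - P) - 6 * P * x); split.
  transitivity ((Q - P) * (- P * w_ P Q k) + (- P) * (2 * Q * u_ P Q k)); first ring.
  by rewrite Ew Eu1 /Z.succ; ring.
transitivity ((Q - P) * (3 * (- P) * u_ P Q k) - 6 * P * (- P * w_ P Q k)); first ring.
by rewrite Ew Eu /Z.succ; ring.
Qed.

Lemma wu_odd P Q k : Z.Odd (P + Q) -> Z.Odd (w_ P Q k) /\ Z.Odd (u_ P Q k).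
Proof.
move=> [c Ec]; elim: k => [|k [[a Ea] [b Eb]]].
  by rewrite /w_ /u_ /=; split; exists 0.
rewrite w_S u_S Ea Eb; have -> : Q = 2 * c + 1 - P by lia.
split; [exists (2 * a * c + a + c - 2 * a * P - P + (2 * c + 1 - P) * (2 * b + 1)) |
        exists (2 * b * c + b + c - 2 * b * P - P - P * (2 * a + 1))]; ring.
Qed.

(** * Divisibility by prime powers and elementary bounds *)

Lemma zprime_dvd_pow p a n : zprime p -> 0 <= n -> (p | a ^ n) -> (p | a).
Proof.
move=> pp n0; rewrite -(Z2Nat.id n) //; elim: (Z.to_nat n) => [|k IH].
  by rewrite Z.pow_0_r => /Z.divide_1_r; have := prime_ge_2 _ pp; lia.
rewrite Nat2Z.inj_succ Z.pow_succ_r; last lia.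
by case/(prime_mult _ pp).
Qed.

Lemma dvd_ppow p n d : zprime p -> 0 <= n -> 0 <= d -> (d | p ^ n) -> exists m, 0 <= m /\ d = p ^ m.
Proof.
move=> pp n0 d0 dv.
have [m Em] := Zdivide_power_2 d p n n0 d0 pp dv.
have p2 := prime_ge_2 _ pp.
have [mn|m0] := Z_lt_le_dec m 0; last by exists m.
have pn : 0 < p ^ n by apply: Z.pow_pos_nonneg; lia.
move: dv; rewrite Em Z.pow_neg_r // => /Z.divide_0_l; lia.
Qed.

Lemma dvd_ppow_abs p n d : zprime p -> 0 <= n -> (d | p ^ n) -> exists m, 0 <= m /\ Z.abs d = p ^ m.
Proof. by move=> pp n0 dv; apply: (dvd_ppow p n) => //; [lia | apply/Z.divide_abs_l]. Qed.

Lemma gauss_pow p n a b : zprime p -> 0 <= n -> ~ (p | a) -> (p ^ n | a * b) -> (p ^ n | b).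
Proof.
move=> pp n0 na dv; apply: (Gauss _ a) => //.
apply: rel_prime_sym; apply: rel_prime_Zpower_r => //.
by apply: rel_prime_sym; apply: prime_rel_prime.
Qed.

Lemma ppow_dvd p n : 1 <= n -> (p | p ^ n).
Proof.
move=> n1; exists (p ^ (n - 1)); have {1}-> : n = Z.succ (n - 1) by lia.
by rewrite Z.pow_succ_r; [ring | lia].
Qed.

Lemma pow_ge_mono p m n : 1 <= p -> 0 <= m <= n -> p ^ m <= p ^ n.
Proof. by move=> p1 mn; apply: Z.pow_le_mono_r; lia. Qed.

Lemma pow_ge_base p n : 1 <= p -> 1 <= n -> p <= p ^ n.
Proof. by move=> p1 n1; rewrite -{1}(Z.pow_1_r p); apply: pow_ge_mono; lia. Qed.

(** The size estimate that excludes an index [l = 2 m + 1]: the norm grows at least like [9 ^ m]. It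
    fails for [m = 1], which is why the prime 3 is treated apart. *)
Lemma sq_lt_9pow (m : nat) : (2 <= m)%coq_nat -> (2 * Z.of_nat m + 1) ^ 2 < 9 ^ Z.of_nat m.
Proof.
elim: m => [|m IH] m1; first lia.
have [->|m2] : m = 1%N \/ (2 <= m)%coq_nat by lia.
  by vm_compute.
move/IH: m2; rewrite !Nat2Z.inj_succ Z.pow_succ_r; [rewrite /Z.succ; nia | lia].
Qed.

Lemma sq_abs a : a ^ 2 = Z.abs a ^ 2.
Proof. by rewrite !Z.pow_2_r; lia. Qed.

Lemma abs_mul_1 a b : Z.abs (a * b) = 1 -> Z.abs a = 1 /\ Z.abs b = 1.
Proof. by rewrite Z.abs_mul => E; apply: Z.eq_mul_1_nonneg => //; apply: Z.abs_nonneg. Qed.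

Lemma odd_factors (k : nat) t l : 2 * Z.of_nat k + 1 = t * l -> 3 <= l ->
  exists m k' : nat, l = 2 * Z.of_nat m + 1 /\ t = 2 * Z.of_nat k' + 1.
Proof.
move=> E l3; have t0 : 0 < t by nia.
have [[a Ea]|[a Ea]] := Z.Even_or_Odd l.
  exfalso; have : 2 * Z.of_nat k + 1 = 2 * (t * a) by rewrite E Ea; ring.
  by clear; lia.
have [[b Eb]|[b Eb]] := Z.Even_or_Odd t.
  exfalso; have : 2 * Z.of_nat k + 1 = 2 * (b * l) by rewrite E Eb; ring.
  by clear; lia.
by exists (Z.to_nat a), (Z.to_nat b); clear E; lia.
Qed.

(* If [u_k] is a power of [l] and [l] divides [Q], then [l] divides the index [2k+1]; taking the
   [l]-th power out of the index makes the new quotient exactly [l], which is too small. *)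
Lemma wu_prime_step P l r k n :
  zprime l -> 3 <= l -> 0 < P -> 1 <= r -> ~ (l | P) -> P <> 10 -> 0 <= n ->
  Z.abs (w_ P (l ^ r) k) = 1 -> Z.abs (u_ P (l ^ r) k) = l ^ n -> k = 0%N.
Proof.
move=> lp l3 P0 r1 lP P10 n0 Ew Eu.
have [//|k1] : k = 0%N \/ (1 <= k)%coq_nat by lia.
have norm := wu_norm P (l ^ r) k.
have w2 : w_ P (l ^ r) k ^ 2 = 1 by rewrite sq_abs Ew.
have u2 : u_ P (l ^ r) k ^ 2 = (l ^ n) ^ 2 by rewrite sq_abs Eu.
have Q3 : 3 <= l ^ r.
  by have := pow_ge_base l r ltac:(lia) r1; lia.
have lQ : (l | l ^ r) by apply: ppow_dvd.
move: norm; rewrite w2 u2 => norm.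
have big (M : Z) (j : nat) : 3 <= M -> 9 ^ Z.of_nat j <= (M ^ 2) ^ Z.of_nat j.
  by move=> M3; apply: Z.pow_le_mono_l; clear - M3; nia.
(* If both coordinates were 1 or -1, the norm would be [P + Q] and not [(P + Q) ^ (2 k + 1)]. *)
have n1 : 1 <= n.
  have [En|] : n = 0 \/ 1 <= n by lia.
  - move: norm; rewrite En Z.pow_0_r => norm.
    have B := big (P + l ^ r) k ltac:(lia).
    have := pow_ge_base 9 (Z.of_nat k) ltac:(lia) ltac:(lia).
    nia.
  - by [].
have [x [y [_ EuQ]]] := wu_modQ P (l ^ r) k.
have lu : (l | u_ P (l ^ r) k) by apply/Z.divide_abs_r; rewrite Eu; apply: ppow_dvd.
have lt : (l | 2 * Z.of_nat k + 1).
  have : (l | (2 * Z.of_nat k + 1) * (- P) ^ Z.of_nat k).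
    have -> : (2 * Z.of_nat k + 1) * (- P) ^ Z.of_nat k = u_ P (l ^ r) k - l ^ r * y by lia.
    by apply: Z.divide_sub_r => //; apply: Z.divide_mul_l.
  case/(prime_mult _ lp) => // /zprime_dvd_pow; move/(_ lp ltac:(lia))/Z.divide_opp_r.
  by [].
(* Split [2 k + 1 = (2 k' + 1) l]. The inner power has [w = 1] or [-1] and [u] a power of [l] up to
   sign, so it leaves [P] alone and turns [Q] into a higher power of [l]; what remains is the index
   [l] itself. *)
case: lt => t' Et'.
have [m [k' [El Et]]] : exists m k' : nat, l = 2 * Z.of_nat m + 1 /\ t' = 2 * Z.of_nat k' + 1.
  exact: odd_factors Et' l3.
have m1 : (1 <= m)%coq_nat by clear - El l3; lia.
have [Cw Cu] : _ /\ _ := wu_comp P (l ^ r) k' m k ltac:(move: Et'; rewrite El Et; clear; lia).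
move: Ew; rewrite Cw => /abs_mul_1 [Ew' Ewm].
have [j [j0 Ej]] : exists j, 0 <= j /\ Z.abs (u_ P (l ^ r) k') = l ^ j.
  by apply: (dvd_ppow_abs l n) => //; rewrite -Eu Cu; apply/Z.divide_abs_r; exists (u_ (P * w_ P (l ^ r) k' ^ 2) (l ^ r * u_ P (l ^ r) k' ^ 2) m); ring.
have EP : P * w_ P (l ^ r) k' ^ 2 = P.
  by rewrite sq_abs Ew'; ring.
have EQ : l ^ r * u_ P (l ^ r) k' ^ 2 = l ^ (r + 2 * j).
  rewrite sq_abs Ej.
  rewrite Z.pow_add_r; [|clear - r1; lia|clear - j0; lia].
  by rewrite (Z.mul_comm 2) Z.pow_mul_r.
move: Ewm Cu; rewrite EP EQ => Ewm Cu.
have [i [i0 Ei]] : exists i, 0 <= i /\ Z.abs (u_ P (l ^ (r + 2 * j)) m) = l ^ i.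
  by apply: (dvd_ppow_abs l n) => //; rewrite -Eu Cu; apply/Z.divide_abs_r; exists (u_ P (l ^ r) k').
exfalso; have {EP EQ Cw Cu Et Et' n1 lu EuQ y x norm Eu Q3 lQ big u2 w2 Ew' Ej k1 n n0 t' k} r1' : 1 <= r + 2 * j by clear - r1 j0; lia.
move: (r + 2 * j) r1' Ewm Ei => {}r {}r1 Ew Ei.
have lQ : (l | l ^ r) by apply: ppow_dvd.
have Q3 : 3 <= l ^ r.
  by have := pow_ge_base l r ltac:(lia) r1; lia.
have [l5|l3'] : 5 <= l \/ l = 3 by lia.
(* By the second-order expansion [3 (- P) u / l] is a power of [- P] times [- 3 P] modulo [l], a
   unit since [l >= 5]. So [l] divides [u] at most once, which contradicts the size of the norm. *)
- have [x [y]] := wu_modQ2 P (l ^ r) m; cbv zeta; rewrite -El => -[_ E].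
  have i1 : i <= 1.
    have [//|i2] : i <= 1 \/ 2 <= i by lia.
    have l2u : (l ^ 2 | u_ P (l ^ r) m).
      apply/Z.divide_abs_r; rewrite Ei; exists (l ^ (i - 2)); rewrite -Z.pow_add_r; [f_equal; clear; lia | clear - i2; lia | by []].
    case: lQ => q Eq; case: l2u => v Ev.
    have : (l * l | l * ((- P) ^ Z.of_nat m * (- 3 * P + l ^ r * (Z.of_nat m * (2 * Z.of_nat m - 1))))).
      exists (3 * - P * v - q ^ 2 * y).
      transitivity (3 * - P * u_ P (l ^ r) m - (l ^ r) ^ 2 * y); first by rewrite E; ring.
      by rewrite Ev Eq; ring.
    move=> dd; exfalso.
    have : (l | (- P) ^ Z.of_nat m * (- 3 * P + l ^ r * (Z.of_nat m * (2 * Z.of_nat m - 1)))) by apply/(Z.mul_divide_cancel_l _ _ l) => //; clear - l3; lia.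
    case/(prime_mult _ lp).
      by move/zprime_dvd_pow; move/(_ lp (Nat2Z.is_nonneg _))/Z.divide_opp_r.
    case=> h Eh.
    have : (l | 3 * P) by exists (q * (Z.of_nat m * (2 * Z.of_nat m - 1)) - h); rewrite Eq in Eh; clear - Eh; lia.
    case/(prime_mult _ lp) => // /Z.divide_pos_le; clear - l5; lia.
  have norm := wu_norm P (l ^ r) m.
  move: norm; rewrite (sq_abs (w_ _ _ _)) (sq_abs (u_ _ _ _)) Ew Ei.
  have li : l ^ i <= l by rewrite -{2}(Z.pow_1_r l); apply: pow_ge_mono; lia.
  have li0 : 0 < l ^ i by apply: Z.pow_pos_nonneg; lia.
  have S9 := sq_lt_9pow m ltac:(lia).
  have : 9 ^ Z.of_nat m <= ((P + l ^ r) ^ 2) ^ Z.of_nat m by apply: Z.pow_le_mono_l; clear - P0 Q3; nia.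
  rewrite -El in S9.
  move: (((P + l ^ r) ^ 2) ^ Z.of_nat m) => B B9 norm.
  have : (l ^ i) ^ 2 <= l ^ 2 by clear - li li0; nia.
  have : (P + l ^ r) * (l ^ 2 + 1) <= (P + l ^ r) * B by apply: Z.mul_le_mono_nonneg_l; lia.
  clear - norm P0 Q3; nia.
(* For [l = 3] the conditions are [3 Q - P = 1] or [-1] and [Q - 3 P] a power of 3 up to sign, so
   [8 Q - 3] or [8 Q + 3] is a power of 3. Modulo 9 and by size only [Q = 3] remains. *)
- have Em : m = 1%N by lia.
  subst m l; move: Ew Ei; rewrite /w_ /u_ /= !Z.mul_1_l !Z.mul_1_r => Ew Ei.
  have [r2|r1'] : 2 <= r \/ r = 1 by lia.
  + have Er : 3 ^ r = 9 * 3 ^ (r - 2).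
      by have -> : 9 = 3 ^ 2 by []; rewrite -Z.pow_add_r; [f_equal; lia | lia | lia].
    have [i2|i1] : 2 <= i \/ i <= 1 by lia.
      have Ei' : 3 ^ i = 9 * 3 ^ (i - 2).
        by have -> : 9 = 3 ^ 2 by []; rewrite -Z.pow_add_r; [f_equal; lia | lia | lia].
      by move: Ew Ei; rewrite Er Ei'; clear; move: (3 ^ (r - 2)) (3 ^ (i - 2)) => x y; lia.
    have : 3 ^ i <= 3 by rewrite -{2}(Z.pow_1_r 3); apply: pow_ge_mono; lia.
    have : 9 <= 3 ^ r by apply: (pow_ge_mono 3 2 r); lia.
    move: Ew Ei; clear; move: (3 ^ r) (3 ^ i) => x y; lia.
  + subst r; move: Ew Ei; rewrite Z.pow_1_r => Ew Ei.
    have [EP|EP] : P = 8 \/ P = 10 by lia.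
      have {}Ei : 21 = 3 ^ i by rewrite -Ei EP.
      have [i2|i3] : i <= 2 \/ 3 <= i by clear; lia.
        have : 3 ^ i <= 3 ^ 2 by apply: pow_ge_mono; lia.
        by rewrite -Ei.
      have : 3 ^ 3 <= 3 ^ i by apply: pow_ge_mono; lia.
      by rewrite -Ei.
    (* A true exception: [P = 10] and [Q = 3] give [w = -1] and [u = -27] at the first step, that
       is, [10 + 3 * 27 ^ 2 = 13 ^ 3]. *)
    by exact: P10.
Qed.

(** * Descent to a minimal representation *)

Lemma zodd_ndvd a : Z.Odd a <-> ~ (2 | a).
Proof.
split; first by case=> k -> [q]; lia.
by move=> n2; case: (Z.Even_or_Odd a) => // -[k Ek]; case: n2; exists k; lia.
Qed.

Lemma dvd_mul_l d a b : (d | a) -> (d | a * b).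
Proof. by move=> H; apply: Z.divide_mul_l. Qed.
Lemma dvd_mul_r d a b : (d | b) -> (d | a * b).
Proof. by move=> H; apply: Z.divide_mul_r. Qed.

Section Descent.
Variables (c mu delta eps g h : Z).
Hypothesis cp : zprime c.
Hypothesis cmu : (c = 2 /\ mu = 2) \/ (Z.Odd c /\ mu = 1).
Hypothesis delta_gt0 : 0 < delta.
Hypothesis eps_gt0 : 0 < eps.
Hypothesis ndelta : ~ (c | delta).
Hypothesis neps : ~ (c | eps).
Hypothesis eps_odd : Z.Odd eps.
Hypothesis ng : ~ (c | g) /\ rel_prime g c.
Hypothesis nh : ~ (c | h) /\ rel_prime h c.

(** The element [(S sqrt delta + T sqrt (- eps)) / mu] has norm [c ^ z]. The denominator [mu = 2] is
    there for [c = 2], when [S] and [T] are both odd. The divisors [g] and [h] restrict the descent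
    to representations with prescribed factors. *)
Definition rep S T z :=
  [/\ delta * S ^ 2 + eps * T ^ 2 = mu ^ 2 * c ^ z, ~ (c | S), ~ (c | T), Z.Odd T
    & (g | T) /\ (h | S)].

Let c2 : 2 <= c. Proof. exact: prime_ge_2. Qed.
Let mu_neq0 : mu <> 0. Proof. by case: cmu => -[_ ->]. Qed.

Lemma ndvd_mul a b : ~ (c | a) -> ~ (c | b) -> ~ (c | a * b).
Proof. by move=> na nb /(prime_mult _ cp) []. Qed.

Lemma ndvd_1 : ~ (c | 1).
Proof. by move/Z.divide_1_r; lia. Qed.

Lemma mu_pow n : 0 <= n -> exists2 j, 0 <= j & mu * c ^ n = c ^ j.
Proof.
move=> n0; case: cmu => -[Ec Em].
  by exists (Z.succ n); [lia | rewrite Z.pow_succ_r // Em Ec].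
by exists n => //; rewrite Em; ring.
Qed.

Lemma gauss_mu a b n : 0 <= n -> ~ (c | a) -> (mu * c ^ n | a * b) -> (mu * c ^ n | b).
Proof. by move=> n0 na; have [j j0 ->] := mu_pow n n0; apply: gauss_pow. Qed.

Lemma gauss_mu2 a b n : 0 <= n -> ~ (c | a) -> (mu ^ 2 * c ^ n | a * b) -> (mu ^ 2 * c ^ n | b).
Proof.
move=> n0 na; have [j j0 Ej] := mu_pow n n0; have [i i0 Ei] := mu_pow j j0.
by have -> : mu ^ 2 * c ^ n = c ^ i; [rewrite -Ei -Ej; ring | apply: gauss_pow].
Qed.

Lemma unit_gauss u x n : rel_prime u c -> 0 <= n -> (u | mu * c ^ n * x) -> (u | x).
Proof.
move=> uc n0; have [j j0 ->] := mu_pow n n0 => dv.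
by apply: (Gauss _ (c ^ j)) => //; apply: rel_prime_Zpower_r.
Qed.

Lemma c_pow_gt0 n : 0 <= n -> 0 < c ^ n.
Proof. by move=> n0; apply: Z.pow_pos_nonneg => //; lia. Qed.

Lemma mu_pow_neq0 n : 0 <= n -> mu * c ^ n <> 0.
Proof. by move/c_pow_gt0 => cn; apply/Z.neq_mul_0; split => //; lia. Qed.

(** Once [mu] is removed from both factors, [c] cannot divide both of them, since it does not divide
    their sum; so one factor takes the whole power of [c]. *)
Lemma factor_split X Y m n :
  0 <= n -> X + Y = 2 * m -> ~ (c | m) -> (mu | X) -> (mu | Y) ->
  (mu ^ 2 * c ^ n | X * Y) -> (mu * c ^ n | X) \/ (mu * c ^ n | Y).
Proof.
move=> n0 E nm [X' EX] [Y' EY] [q Eq].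
have ns : ~ (c | X' + Y').
  case: cmu => -[Ec Em]; first by rewrite (_ : X' + Y' = m) //; lia.
  rewrite (_ : X' + Y' = 2 * m); last by rewrite -E EX EY Em; ring.
  apply: ndvd_mul => // /(prime_div_prime _ _ cp prime_2); move: Ec => [k Ek]; lia.
have dv : (c ^ n | X' * Y').
  exists q; apply: (Z.mul_reg_l _ _ (mu ^ 2)); first by apply: Z.pow_nonzero.
  transitivity (X * Y); first by rewrite EX EY; ring.
  by rewrite Eq; ring.
have [cX|nX] := classic (c | X').
  left; rewrite EX Z.mul_comm; apply: Z.mul_divide_mono_r.
  apply: (gauss_pow c n Y') => //; last by rewrite Z.mul_comm.
  by move=> cY; apply: ns; apply: Z.divide_add_r.
right; rewrite EY Z.mul_comm; apply: Z.mul_divide_mono_r.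
exact: gauss_pow dv.
Qed.

Lemma mu_dvd_odd a b : ~ (c | a) -> ~ (c | b) -> (mu | a + b) /\ (mu | a - b).
Proof.
case: cmu => -[Ec Em]; last by rewrite Em; split; apply: Z.divide_1_l.
rewrite Ec Em => /zodd_ndvd [x ->] /zodd_ndvd [y ->].
by split; [exists (x + y + 1) | exists (x - y)]; ring.
Qed.

(** Up to a conjugation, recorded by the sign [s], [mu] times the element
    [S sqrt delta + T sqrt (- eps)] is the product of the base element with
    [e - f sqrt (- delta eps)]. *)
Definition link S0 T0 S T s e f :=
  [/\ mu * S = S0 * e + eps * T0 * f, mu * T = s * (T0 * e - delta * S0 * f)
    & s = 1 \/ s = -1].

(** Division is multiplication by the conjugate of the base, followed by division by its norm. The
    product of [S T0 - T S0] and [S T0 + T S0], times [eps], is a combination of the two norms;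
    [factor_split] selects the conjugate for which the division is exact. *)
Lemma descent_quotient S0 T0 z0 S T z :
  0 <= z0 <= z -> rep S0 T0 z0 -> rep S T z ->
  exists s e f, [/\ link S0 T0 S T s e f, S * T0 - s * T * S0 = mu * c ^ z0 * f,
    e ^ 2 + delta * eps * f ^ 2 = mu ^ 2 * c ^ (z - z0) & Z.Odd c -> Z.Odd e].
Proof.
move=> z0z [N0 cS0 cT0 oT0 _] [N cS cT oT _].
have Ez : c ^ z = c ^ z0 * c ^ (z - z0) by rewrite -Z.pow_add_r; [f_equal; lia | lia | lia].
have Mn0 := mu_pow_neq0 z0 ltac:(lia).
have [s s1 [f Ef]] : exists2 s, s = 1 \/ s = -1 & (mu * c ^ z0 | S * T0 - s * T * S0).
  have [d1 d2] := mu_dvd_odd (S * T0) (T * S0) ltac:(exact: ndvd_mul) ltac:(exact: ndvd_mul).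
  have [||||||H|H] := @factor_split (S * T0 - T * S0) (S * T0 + T * S0) (S * T0) z0; try done.
  - lia.
  - by ring.
  - exact: ndvd_mul.
  - apply: (gauss_mu2 eps); [lia | done |].
    exists (S ^ 2 - c ^ (z - z0) * S0 ^ 2).
    transitivity (S ^ 2 * (eps * T0 ^ 2) - S0 ^ 2 * (eps * T ^ 2)); first ring.
    have -> : eps * T0 ^ 2 = mu ^ 2 * c ^ z0 - delta * S0 ^ 2 by rewrite -N0; ring.
    have -> : eps * T ^ 2 = mu ^ 2 * c ^ z - delta * S ^ 2 by rewrite -N; ring.
    by rewrite Ez; ring.
  - by exists 1; [left | rewrite Z.mul_1_l].
  - by exists (-1); [right | move: H; congr (_ | _); ring].
have s2 : s * s = 1 by case: s1 => ->.
have [e Ee] : (mu * c ^ z0 | delta * S * S0 + s * eps * T * T0).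
  apply: (gauss_mu T0) => //; first lia.
  exists (delta * S0 * f + s * T * mu).
  transitivity (delta * S0 * (S * T0 - s * T * S0) + s * T * (delta * S0 ^ 2 + eps * T0 ^ 2)).
    by ring.
  by rewrite Ef N0; ring.
have E1 : mu * S = S0 * e + eps * T0 * f.
  apply: (Z.mul_reg_l _ _ _ Mn0).
  transitivity (S * (delta * S0 ^ 2 + eps * T0 ^ 2)); first by rewrite N0; ring.
  transitivity (S0 * (e * (mu * c ^ z0)) + eps * T0 * (f * (mu * c ^ z0))); last ring.
  by rewrite -Ee -Ef; ring.
have E2 : mu * T = s * (T0 * e - delta * S0 * f).
  apply: (Z.mul_reg_l _ _ _ Mn0).
  transitivity (s * s * T * (delta * S0 ^ 2 + eps * T0 ^ 2)); first by rewrite N0 s2; ring.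
  transitivity (s * (T0 * (e * (mu * c ^ z0)) - delta * S0 * (f * (mu * c ^ z0)))); last ring.
  by rewrite -Ee -Ef; ring.
exists s, e, f; split; first by [].
- by rewrite Ef; ring.
- apply: (Z.mul_reg_l _ _ (mu * c ^ z0 * (mu * c ^ z0))); first by apply/Z.neq_mul_0.
  transitivity ((e * (mu * c ^ z0)) ^ 2 + delta * eps * (f * (mu * c ^ z0)) ^ 2); first ring.
  rewrite -Ee -Ef.
  transitivity ((delta * S ^ 2 + s * s * eps * T ^ 2) * (delta * S0 ^ 2 + eps * T0 ^ 2) +
    (s * s - 1) * delta * eps * (S ^ 2 * T0 ^ 2 + T ^ 2 * S0 ^ 2 - S ^ 2 * T0 ^ 2 - T ^ 2 * S0 ^ 2)).
    by ring.
  by rewrite s2 Z.mul_1_l N N0 Ez; ring.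
- move=> oc; have mu1 : mu = 1 by case: cmu => -[Ec Em] //; move: oc; rewrite Ec => -[k]; clear; lia.
  move/Z.odd_spec: eps_odd => oe; move/Z.odd_spec: oT0 => oT0'; move/Z.odd_spec: oT => oT'.
  have oc' : Z.odd (c ^ z0).
    have [->|zz] : z0 = 0 \/ 0 < z0 by clear - z0z; lia.
      by [].
    by rewrite Z.odd_pow //; apply/Z.odd_spec.
  have := f_equal Z.odd N0; have := f_equal Z.odd E2.
  rewrite mu1 Z.odd_add Z.odd_mul oT' !Z.pow_2_r !Z.odd_mul oe oT0' oc' Z.odd_sub !Z.odd_mul oT0'.
  have -> : Z.odd s by case: s1 => ->.
  move=> H1 H2; apply/Z.odd_spec; move: H1 H2; clear.
  by case: (Z.odd e); case: (Z.odd delta); case: (Z.odd S0).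
Qed.

Lemma zodd_of_ndvd a : ~ (c | a) -> (Z.Odd c -> Z.Odd a) -> Z.Odd a.
Proof. by case: cmu => -[Ec _] na oa; [apply/zodd_ndvd; rewrite -Ec | apply: oa]. Qed.

(** If [c] divided one of [e], [f], the norm equation would make it divide the other, and the link
    would give [c | S]. For [c = 2] the factor [mu] absorbs this gain, and the parity of the halves
    of [e] and [f] decides. *)
Lemma descent_quotient_unit S0 T0 S T s e f j :
  1 <= j -> ~ (c | S0) -> ~ (c | T0) -> Z.Odd T0 -> ~ (c | S) -> link S0 T0 S T s e f ->
  e ^ 2 + delta * eps * f ^ 2 = mu ^ 2 * c ^ j -> ~ (c | e) /\ ~ (c | f).
Proof.
move=> j1 cS0 cT0 oT0 cS [ES _ _] N.
have cj : (c | mu ^ 2 * c ^ j) by apply: dvd_mul_r; apply: ppow_dvd.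
have nde : ~ (c | delta * eps) by apply: ndvd_mul.
have both : (c | e) -> (c | f) -> False.
  move=> [e' Ee] [f' Ef]; case: cmu => -[Ec Em].
    rewrite Ec Em in Ee Ef ES N cS cS0 cT0 nde; apply: cS.
    have ES' : S = S0 * e' + eps * T0 * f'.
      by apply: (Z.mul_reg_l _ _ 2) => //; rewrite ES Ee Ef; ring.
    have N' : e' ^ 2 + delta * eps * f' ^ 2 = 2 ^ j.
      by apply: (Z.mul_reg_l _ _ 4) => //; move: N; rewrite Ee Ef => <-; ring.
    have : Z.odd (2 ^ j) = false.
      by have -> : j = Z.succ (j - 1); [lia | rewrite Z.pow_succ_r ?Z.odd_mul //; lia].
    have o1 := (proj2 (zodd_ndvd _) cS0); have o2 := (proj2 (zodd_ndvd _) nde).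
    move/Z.odd_spec: o1 => o1; move/Z.odd_spec: o2 => o2; move/Z.odd_spec: oT0 => o3.
    move/Z.odd_spec: eps_odd => o4.
    rewrite -N' Z.odd_add !Z.pow_2_r (Z.odd_mul (delta * eps)) o2 !Z.odd_mul => o5.
    apply: NNPP => /zodd_ndvd /Z.odd_spec.
    by rewrite ES' Z.odd_add !Z.odd_mul o1 o3 o4; move: o5; case: (Z.odd e'); case: (Z.odd f').
  apply: cS; move: ES; rewrite Em Z.mul_1_l => ->.
  by exists (S0 * e' + eps * T0 * f'); rewrite Ee Ef; ring.
have fe : (c | f) -> (c | e).
  move=> [f' Ef]; case: cj => q Eq; apply: (zprime_dvd_pow c e 2) => //.
  by exists (q - delta * eps * c * f' ^ 2); rewrite Z.mul_sub_distr_r -Eq -N Ef; ring.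
have ef : (c | e) -> (c | f).
  move=> [e' Ee]; case: cj => q Eq; apply: (zprime_dvd_pow c f 2) => //.
  have : (c | delta * eps * f ^ 2).
    by exists (q - c * e' ^ 2); rewrite Z.mul_sub_distr_r -Eq -N Ee; ring.
  by case/(prime_mult _ cp).
by split=> H; apply: both => //; [apply: ef | apply: fe].
Qed.

(** The base is multiplied by the conjugate of the quotient instead of the quotient. Conjugate prime
    factors above [c] then meet and a rational factor [c ^ m] splits off, which lowers the exponent
    by [2 m]. For [m] the smaller of [z0] and [j], and these two different, the result is again
    prime to [c]. *)
Lemma descent_conjugate S0 T0 z0 S T s e f j m :
  0 <= m <= z0 -> m <= j ->
  rep S0 T0 z0 -> rep S T (z0 + j) -> link S0 T0 S T s e f ->
  e ^ 2 + delta * eps * f ^ 2 = mu ^ 2 * c ^ j -> (Z.Odd c -> Z.Odd e) ->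
  exists S' T',
    [/\ mu * c ^ m * T' = T0 * e + delta * S0 * f /\ mu * c ^ m * S' = S0 * e - eps * T0 * f,
        delta * S' ^ 2 + eps * T' ^ 2 = mu ^ 2 * c ^ (z0 + j - 2 * m),
        (g | T') /\ (h | S'), Z.Odd c -> Z.Odd T'
      & ~ (c | e) -> m = z0 /\ m < j \/ m = j /\ m < z0 -> ~ (c | S') /\ ~ (c | T')].
Proof.
move=> m0 mj [N0 cS0 cT0 oT0 [gT0 hS0]] [N cS cT oT [gT hS]] [ES ET s1] Nef oe.
have s2 : s * s = 1 by case: s1 => ->.
have Ez0 : c ^ z0 = c ^ m * c ^ (z0 - m) by rewrite -Z.pow_add_r; [f_equal; lia | lia | lia].
have Ej : c ^ j = c ^ m * c ^ (j - m) by rewrite -Z.pow_add_r; [f_equal; lia | lia | lia].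
have Mn0 := mu_pow_neq0 m ltac:(lia).
have E1 : eps * T * (T0 * e + delta * S0 * f) =
          mu * c ^ m * (s * (e ^ 2 * c ^ (z0 - m) - delta * S0 ^ 2 * c ^ (j - m))).
  apply: (Z.mul_reg_l _ _ _ mu_neq0).
  transitivity (eps * (mu * T) * (T0 * e + delta * S0 * f)); first ring.
  rewrite ET; transitivity (s * (e ^ 2 * (delta * S0 ^ 2 + eps * T0 ^ 2)
    - delta * S0 ^ 2 * (e ^ 2 + delta * eps * f ^ 2))); first ring.
  by rewrite N0 Nef Ez0 Ej; ring.
have E2 : delta * S * (S0 * e - eps * T0 * f) =
          mu * c ^ m * (e ^ 2 * c ^ (z0 - m) - eps * T0 ^ 2 * c ^ (j - m)).
  apply: (Z.mul_reg_l _ _ _ mu_neq0).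
  transitivity (delta * (mu * S) * (S0 * e - eps * T0 * f)); first ring.
  rewrite ES; transitivity (e ^ 2 * (delta * S0 ^ 2 + eps * T0 ^ 2)
    - eps * T0 ^ 2 * (e ^ 2 + delta * eps * f ^ 2)); first ring.
  by rewrite N0 Nef Ez0 Ej; ring.
have [T' ET'] : (mu * c ^ m | T0 * e + delta * S0 * f).
  apply: (gauss_mu (eps * T)); [lia | exact: ndvd_mul |].
  by rewrite E1; apply: Z.divide_factor_l.
have [S' ES'] : (mu * c ^ m | S0 * e - eps * T0 * f).
  apply: (gauss_mu (delta * S)); [lia | exact: ndvd_mul |].
  by rewrite E2; apply: Z.divide_factor_l.
exists S', T'; split.
- by rewrite ET' ES'; split; ring.
- apply: (Z.mul_reg_l _ _ (mu * c ^ m * (mu * c ^ m))); first by apply/Z.neq_mul_0.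
  transitivity (delta * (S' * (mu * c ^ m)) ^ 2 + eps * (T' * (mu * c ^ m)) ^ 2); first ring.
  rewrite -ES' -ET'.
  transitivity ((delta * S0 ^ 2 + eps * T0 ^ 2) * (e ^ 2 + delta * eps * f ^ 2)); first ring.
  have -> : c ^ (z0 + j - 2 * m) = c ^ (z0 - m) * c ^ (j - m).
    by rewrite -Z.pow_add_r; [f_equal; lia | lia | lia].
  by rewrite N0 Nef Ez0 Ej; ring.
- split.
    apply: (unit_gauss _ _ m); [by case: ng | lia |].
    rewrite (Z.mul_comm _ T') -ET'.
    have -> : T0 * e + delta * S0 * f = 2 * (T0 * e) - s * s * (T0 * e - delta * S0 * f).
      by rewrite s2; ring.
    rewrite -(Z.mul_assoc s) -ET; apply: Z.divide_sub_r.
      by apply: dvd_mul_r; apply: dvd_mul_l.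
    by do 2!apply: dvd_mul_r.
  apply: (unit_gauss _ _ m); [by case: nh | lia |].
  rewrite (Z.mul_comm _ S') -ES'.
  have -> : S0 * e - eps * T0 * f = 2 * (S0 * e) - (S0 * e + eps * T0 * f) by ring.
  rewrite -ES; apply: Z.divide_sub_r; last by apply: dvd_mul_r.
  by apply: dvd_mul_r; apply: dvd_mul_l.
- move=> oc; have mu1 : mu = 1.
    by case: cmu => -[Ec Em] //; move: oc; rewrite Ec => -[k]; clear; lia.
  have o1 : Z.odd (T0 * e + delta * S0 * f).
    have -> : T0 * e + delta * S0 * f = 2 * (T0 * e) - s * T.
      have -> : T = s * (T0 * e - delta * S0 * f) by rewrite -ET mu1 Z.mul_1_l.
      by rewrite (Z.mul_assoc s) s2; ring.
    rewrite Z.odd_sub !Z.odd_mul; have -> : Z.odd s by case: s1 => ->.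
    by move/Z.odd_spec: oT => ->.
  by move: o1; rewrite ET' Z.odd_mul => /andP [/Z.odd_spec].
- move=> ce cases.
  have F1 : eps * T * T' = s * (e ^ 2 * c ^ (z0 - m) - delta * S0 ^ 2 * c ^ (j - m)).
    by apply: (Z.mul_reg_l _ _ _ Mn0); rewrite -E1 ET'; ring.
  have F2 : delta * S * S' = e ^ 2 * c ^ (z0 - m) - eps * T0 ^ 2 * c ^ (j - m).
    by apply: (Z.mul_reg_l _ _ _ Mn0); rewrite -E2 ES'; ring.
  have sq a : ~ (c | a) -> ~ (c | a ^ 2) by move=> na /zprime_dvd_pow H; apply: na; apply: H.
  have key a b : ~ (c | a) -> ~ (c | b) -> ~ (c | a * c ^ (z0 - m) - b * c ^ (j - m)).
    move=> na nb; case: cases => -[Em lt].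
      rewrite Em Z.sub_diag Z.pow_0_r Z.mul_1_r -Em => H; apply: na.
      have -> : a = a - b * c ^ (j - m) + b * c ^ (j - m) by ring.
      by apply: Z.divide_add_r => //; apply: dvd_mul_r; apply: ppow_dvd; lia.
    rewrite Em Z.sub_diag Z.pow_0_r Z.mul_1_r -Em => H; apply: nb.
    have -> : b = a * c ^ (z0 - m) - (a * c ^ (z0 - m) - b) by ring.
    by apply: Z.divide_sub_r => //; apply: dvd_mul_r; apply: ppow_dvd; lia.
  split=> H.
    apply: (key (e ^ 2) (eps * T0 ^ 2)); [exact: sq | by apply: ndvd_mul => //; apply: sq |].
    by rewrite -F2; apply: dvd_mul_r.
  apply: (key (e ^ 2) (delta * S0 ^ 2)); [exact: sq | by apply: ndvd_mul => //; apply: sq |].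
  have -> : e ^ 2 * c ^ (z0 - m) - delta * S0 ^ 2 * c ^ (j - m) = s * (eps * T * T').
    by rewrite F1 Z.mul_assoc s2; ring.
  by do 2!apply: dvd_mul_r.
Qed.

(** [K] is the set of admissible exponents, stable under the moves [z - 2 z0] and [2 z0 - z] of the
    descent. [K_0] keeps the descent from ending at exponent 0; for odd exponents it is vacuous. *)
Variable K : Z -> Prop.
Hypothesis K_sub : forall z n, K z -> K (z - 2 * n).
Hypothesis K_opp : forall z, K z -> K (- z).
Hypothesis K_0 : K 0 -> forall S T, (h | S) -> (g | T) -> (Z.Odd c -> Z.Odd T) ->
  delta * S ^ 2 + eps * T ^ 2 <> mu ^ 2.
(** This leaves only the units 1 and -1. With [mu = 2] the quotients are
    [(e + f sqrt (- delta eps)) / 2], and [delta eps = 3] would admit roots of unity of order 6. *)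
Hypothesis disc2 : c = 2 -> 4 < delta * eps.

Variables S0 T0 z0 : Z.
Hypothesis base : rep S0 T0 z0.
Hypothesis z0_gt0 : 1 <= z0.
Hypothesis z0_min : forall S T z, rep S T z -> K z -> 1 <= z -> z0 <= z.
Let P := delta * S0 ^ 2.
Let Q := eps * T0 ^ 2.

(** The sequence [wu] of the base, divided by [mu ^ 2] at every step. Integrality of the quotients
    and their coprimality to [c] are part of the data, because they are only known where the descent
    passes. *)
Inductive chain : nat -> Z -> Z -> Prop :=
| chain0 : chain 0 1 1
| chainS k w u w' u' : chain k w u ->
    mu ^ 2 * w' = w * (Q - P) + 2 * Q * u -> mu ^ 2 * u' = u * (Q - P) - 2 * P * w ->
    ~ (c | w') -> ~ (c | u') -> chain k.+1 w' u'.

Lemma chain_wu k w u : chain k w u ->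
  w_ P Q k = (mu ^ 2) ^ Z.of_nat k * w /\ u_ P Q k = (mu ^ 2) ^ Z.of_nat k * u.
Proof.
elim=> {k w u} [|k w u w' u' _ [IHw IHu] Ew Eu _ _].
  by rewrite /w_ /u_ /= Z.pow_0_r.
rewrite Nat2Z.inj_succ Z.pow_succ_r; last lia.
rewrite w_S u_S IHw IHu; split.
  transitivity ((mu ^ 2) ^ Z.of_nat k * (mu ^ 2 * w')); [rewrite Ew|]; ring.
transitivity ((mu ^ 2) ^ Z.of_nat k * (mu ^ 2 * u')); [rewrite Eu|]; ring.
Qed.

Lemma chain_unit k w u : chain k w u -> ~ (c | w) /\ ~ (c | u).
Proof. by case=> [|????? _ _ _ ??] //; split; apply: ndvd_1. Qed.

(** One step gives [mu ^ 2 (u' - w') = - (P + Q) (w + u)], where [P + Q] is the norm of the base and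
    [mu] divides [w + u]. This will rule out one of the two relative signs in the descent. *)
Lemma chain_congr k w u : chain k w u -> (mu * c ^ z0 | u - w).
Proof.
case=> [|{}k w' u' {}w {}u ch Ew Eu _ _]; first by rewrite Z.sub_diag; apply: Z.divide_0_r.
have [n1 n2] := chain_unit _ _ _ ch.
have [[q Eq] _] := mu_dvd_odd _ _ n1 n2.
have [N _ _ _ _] := base.
exists (- q); apply: (Z.mul_reg_l _ _ (mu ^ 2)); first exact: Z.pow_nonzero.
transitivity (mu ^ 2 * u - mu ^ 2 * w); first ring.
rewrite Ew Eu; transitivity (- (w' + u') * (P + Q)); first ring.
by rewrite Eq /P /Q N; ring.
Qed.

Lemma quotient_trivial e f : e ^ 2 + delta * eps * f ^ 2 = mu ^ 2 -> (Z.Odd c -> Z.Odd e) ->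
  f = 0 /\ (e = mu \/ e = - mu).
Proof.
have de : 0 < delta * eps by apply: Z.mul_pos_pos.
move=> N oe; have f0 : f = 0.
  case: cmu => -[Ec Em]; move: N; rewrite Em.
    have := disc2 Ec; clear; move: (delta * eps) => D D4 N.
    have [//|f1] : f = 0 \/ 1 <= f * f by clear; nia.
    by rewrite !Z.pow_2_r in N; nia.
  have [k Ek] := oe Ec; have : 1 <= e ^ 2 by rewrite Ek; clear; nia.
  move: de; clear; move: (delta * eps) => D D0 e1 N.
  have [//|f1] : f = 0 \/ 1 <= f * f by clear; nia.
  by rewrite !Z.pow_2_r in N, e1; nia.
split=> //; move: N; rewrite f0; clear => N.
have : (e - mu) * (e + mu) = 0 by lia.
by case/Z.mul_eq_0; [left|right]; lia.
Qed.

(** Euclid's algorithm on exponents. Between [z0] and [2 z0] the conjugate quotient yields an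
    exponent below the minimum, at [2 z0] it yields exponent 0, and beyond [2 z0] the exponent
    [z - 2 z0] is covered by induction. *)
Lemma descent_power S T z : rep S T z -> K z -> 1 <= z ->
  exists k w u s t, [/\ chain k w u, (s = 1 \/ s = -1) /\ (t = 1 \/ t = -1),
    S = s * (S0 * w) /\ T = t * (T0 * u) & z = z0 * (2 * Z.of_nat k + 1)].
Proof.
move En : (Z.to_nat z) => n.
elim/ltn_ind: n S T z En => n IH S T z En repST Kz z1.
have zz := z0_min _ _ _ repST Kz z1.
have [s [e [f [lnk _ N oe]]]] := descent_quotient _ _ z0 _ _ z ltac:(lia) base repST.
have [bN cS0 cT0 oT0 _] := base; have [rN cS cT oT _] := repST.
have [Ez|zlt] : z = z0 \/ z0 < z by clear - zz; lia.
  have [f0 e1] : f = 0 /\ (e = mu \/ e = - mu).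
    by apply: quotient_trivial => //; rewrite N Ez Z.sub_diag Z.pow_0_r Z.mul_1_r.
  have [t t1 Et] : exists2 t, t = 1 \/ t = -1 & e = mu * t.
    by case: e1 => ->; [exists 1 | exists (-1)]; try (by [left|right]); ring.
  case: lnk => ES ET s1; exists 0%N, 1, 1, t, (s * t); split.
  - exact: chain0.
  - by split=> //; case: s1 => ->; case: t1 => ->; [left|right|right|left].
  - split; apply: (Z.mul_reg_l _ _ _ mu_neq0).
      by rewrite ES f0 Et; ring.
    by rewrite ET f0 Et; ring.
  - by rewrite Ez /= Z.mul_1_r.
have [ce cf] := descent_quotient_unit _ _ _ _ _ _ _ (z - z0) ltac:(clear - zlt; lia) cS0 cT0 oT0 cS lnk N.
have repST' : rep S T (z0 + (z - z0)) by have -> : z0 + (z - z0) = z by clear; lia.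
have [z2|[Ez|z2]] : z < 2 * z0 \/ z = 2 * z0 \/ 2 * z0 < z by clear; lia.
- have [S' [T' [_ N' gh oT' un]]] :=
    descent_conjugate S0 T0 z0 _ _ _ _ _ (z - z0) (z - z0) ltac:(clear - zlt z2; lia) ltac:(clear; lia) base repST' lnk N oe.
  have [cS' cT'] := un ce ltac:(right; clear - z2 zlt; lia).
  have r' : rep S' T' (2 * z0 - z).
    split=> //; last by apply: zodd_of_ndvd.
    by rewrite N'; do 2!f_equal; clear; lia.
  have := z0_min _ _ _ r' _ ltac:(clear - z2; lia).
  have K' : K (2 * z0 - z).
    have -> : 2 * z0 - z = - (z - 2 * z0) by clear; lia.
    by apply: K_opp; apply: K_sub.
  by move/(_ K'); clear - zlt; lia.
- have [S' [T' [_ N' [gT' hS'] oT' _]]] :=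
    descent_conjugate S0 T0 z0 _ _ _ _ _ (z - z0) z0 ltac:(clear - z0_gt0; lia) ltac:(clear - Ez; lia) base repST' lnk N oe.
  exfalso; apply: (K_0 _ S' T') => //.
    have -> : 0 = z - 2 * z0 by clear - Ez; lia.
    exact: K_sub.
  rewrite N' (_ : z0 + (z - z0) - 2 * z0 = 0) ?Z.pow_0_r ?Z.mul_1_r //; clear - Ez; lia.
have [S' [T' [[ET' ES'] N' gh oT' un]]] :=
    descent_conjugate S0 T0 z0 _ _ _ _ _ (z - z0) z0 ltac:(clear - z0_gt0; lia) ltac:(clear - z2; lia) base repST' lnk N oe.
have [cS' cT'] := un ce ltac:(left; clear - z2; lia).
have r' : rep S' T' (z - 2 * z0).
  split=> //; last by apply: zodd_of_ndvd.
  by rewrite N'; do 2!f_equal; clear; lia.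
have lt : (Z.to_nat (z - 2 * z0) < n)%N by apply/ltP; clear - En z2 z0_gt0; lia.
have z1' : 1 <= z - 2 * z0 by clear - z2; lia.
have [k [w [u [s' [t' [ch [s1' t1'] [EwS EuT] Ez]]]]]] :=
  IH _ lt S' T' _ erefl r' (K_sub _ z0 Kz) z1'.
have Mn0 := mu_pow_neq0 z0 ltac:(clear - z0_gt0; lia).
have Ee : mu * e = delta * S0 * S' + eps * T0 * T'.
  apply: (Z.mul_reg_l _ _ _ Mn0).
  transitivity (e * (delta * S0 ^ 2 + eps * T0 ^ 2)); first by rewrite bN; ring.
  transitivity (delta * S0 * (mu * c ^ z0 * S') + eps * T0 * (mu * c ^ z0 * T')); last ring.
  by rewrite ES' ET'; ring.
have Ef : mu * f = S0 * T' - T0 * S'.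
  apply: (Z.mul_reg_l _ _ _ Mn0).
  transitivity (f * (delta * S0 ^ 2 + eps * T0 ^ 2)); first by rewrite bN; ring.
  transitivity (S0 * (mu * c ^ z0 * T') - T0 * (mu * c ^ z0 * S')); last ring.
  by rewrite ES' ET'; ring.
have [ES ET s1] := lnk; have s2 : s * s = 1 by case: s1 => ->.
(* Equal signs would put [c] into [f] by [chain_congr]. With opposite signs, multiplying back by the
   square of the base is precisely one more step of the chain. *)
have [Est|Est] : s' = t' \/ s' = - t' by case: s1' => ->; case: t1' => ->; [left|right|right|left].
  exfalso; apply: cf; case: (chain_congr _ _ _ ch) => q Eq.
  have Ef' : f = c ^ z0 * (s' * S0 * T0 * q).
    apply: (Z.mul_reg_l _ _ _ mu_neq0).
    rewrite Ef EwS EuT -Est; transitivity (s' * S0 * T0 * (u - w)); first ring.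
    by rewrite Eq; ring.
  by rewrite Ef'; apply: dvd_mul_l; apply: ppow_dvd.
have t2 : t' * t' = 1 by case: t1' => ->.
have FS : mu ^ 2 * (t' * S) = S0 * (w * (Q - P) + 2 * Q * u).
  transitivity (t' * (S0 * (mu * e) + eps * T0 * (mu * f))).
    by transitivity (t' * mu * (mu * S)); [ring | rewrite ES; ring].
  rewrite Ee Ef EwS EuT Est.
  by transitivity (t' * t' * (S0 * (w * (Q - P) + 2 * Q * u))); [rewrite /P /Q; ring | rewrite t2; ring].
have FT : mu ^ 2 * (s * t' * T) = T0 * (u * (Q - P) - 2 * P * w).
  transitivity (s * s * t' * (T0 * (mu * e) - delta * S0 * (mu * f))).
    by transitivity (s * t' * mu * (mu * T)); [ring | rewrite ET; ring].
  rewrite Ee Ef EwS EuT Est s2.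
  by transitivity (t' * t' * (T0 * (u * (Q - P) - 2 * P * w))); [rewrite /P /Q; ring | rewrite t2; ring].
have mu2n : mu ^ 2 <> 0 by apply: Z.pow_nonzero.
have [w' Ew'] : (mu ^ 2 | w * (Q - P) + 2 * Q * u).
  have := gauss_mu2 S0 (w * (Q - P) + 2 * Q * u) 0; rewrite Z.pow_0_r Z.mul_1_r; apply => //.
  by rewrite -FS; apply: Z.divide_factor_l.
have [u' Eu'] : (mu ^ 2 | u * (Q - P) - 2 * P * w).
  have := gauss_mu2 T0 (u * (Q - P) - 2 * P * w) 0; rewrite Z.pow_0_r Z.mul_1_r; apply => //.
  by rewrite -FT; apply: Z.divide_factor_l.
have GS : S = t' * (S0 * w').
  apply: (Z.mul_reg_l _ _ _ mu2n).
  transitivity (t' * (mu ^ 2 * (t' * S))).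
    by transitivity (t' * t' * (mu ^ 2 * S)); [rewrite t2; ring | ring].
  by rewrite FS Ew'; ring.
have GT : T = s * t' * (T0 * u').
  apply: (Z.mul_reg_l _ _ _ mu2n).
  transitivity (s * t' * (mu ^ 2 * (s * t' * T))).
    by transitivity (s * s * (t' * t') * (mu ^ 2 * T)); [rewrite s2 t2; ring | ring].
  by rewrite FT Eu'; ring.
exists k.+1, w', u', t', (s * t'); split.
- apply: (chainS _ _ _ _ _ ch).
  + by rewrite Ew'; ring.
  + by rewrite Eu'; ring.
  + by move=> H; apply: cS; rewrite GS; do 2!apply: dvd_mul_r.
  + by move=> H; apply: cT; rewrite GT; do 2!apply: dvd_mul_r.
- by split=> //; case: s1 => ->; case: t1' => ->; [left|right|right|left].
- by [].
- by move: Ez; rewrite Nat2Z.inj_succ; clear; lia.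
Qed.

End Descent.

(** * Uniqueness within a parity class, for odd c *)

Lemma min_exponent (R : Z -> Z -> Z -> Prop) S T z : R S T z -> 1 <= z ->
  exists S0 T0 z0, [/\ R S0 T0 z0, 1 <= z0 & forall S T z, R S T z -> 1 <= z -> z0 <= z].
Proof.
move En : (Z.to_nat z) => n; elim/ltn_ind: n S T z En => n IH S T z En r z1.
have [[S' [T' [z' [r' z1' lt]]]]|no] :=
  classic (exists S' T' z', [/\ R S' T' z', 1 <= z' & z' < z]).
  by apply: (IH (Z.to_nat z') _ S' T' z') => //; apply/ltP; clear - En lt z1'; lia.
exists S, T, z; split=> // S' T' z' r' z1'.
have [//|lt] : z <= z' \/ z' < z by clear; lia.
by case: no; exists S', T', z'.
Qed.

Definition okz delta eps z := Z.Odd z \/ (delta = 2 /\ eps <> 1).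

Lemma okz_sub delta eps z n : okz delta eps z -> okz delta eps (z - 2 * n).
Proof. by case=> [[k ->]|H]; [left; exists (k - n); ring | right]. Qed.
Lemma okz_opp delta eps z : okz delta eps z -> okz delta eps (- z).
Proof. by case=> [[k ->]|H]; [left; exists (- k - 1); ring | right]. Qed.

Lemma pow2_odd_dvd w s : 0 <= s -> Z.Odd w -> (w | 2 ^ s) -> Z.abs w = 1.
Proof.
move=> s0 ow dv; have [m [m0 Em]] := dvd_ppow_abs 2 s w prime_2 s0 dv.
have [E|m1] : m = 0 \/ 1 <= m by clear - m0; lia.
  by rewrite Em E.
exfalso; move/zodd_ndvd: ow; apply; apply/Z.divide_abs_r; rewrite Em; exact: ppow_dvd.
Qed.

Lemma prime_ndvd_pow p q n : zprime p -> zprime q -> p <> q -> 0 <= n -> ~ (p | q ^ n).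
Proof. by move=> pp pq ne n0 /(zprime_dvd_pow _ _ _ pp n0) /(prime_div_prime _ _ pp pq). Qed.

Lemma pow_inj p m n : 2 <= p -> 0 <= m -> 0 <= n -> p ^ m = p ^ n -> m = n.
Proof. by move=> p2 m0 n0; apply: Z.pow_inj_r; lia. Qed.

Lemma rel_prime_1_l x : rel_prime 1 x.
Proof. by apply: rel_prime_1. Qed.

Section OddBase.
Variables (b c delta eps g : Z).
Hypothesis cp : zprime c.
Hypothesis c3 : 3 <= c.
Hypothesis bp : zprime b.
Hypothesis b3 : 3 <= b.
Hypothesis bc : b <> c.
Hypothesis delta12 : delta = 1 \/ delta = 2.
Hypothesis eps1b : eps = 1 \/ eps = b.
Hypothesis g1b : g = 1 \/ g = b.

Lemma odd_prime p : zprime p -> 3 <= p -> Z.Odd p.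
Proof.
move=> pp p3; apply/zodd_ndvd => /(prime_div_prime _ _ prime_2 pp); lia.
Qed.

Let oc : Z.Odd c. Proof. exact: odd_prime. Qed.
Let ob : Z.Odd b. Proof. exact: odd_prime. Qed.
Let cmu : (c = 2 /\ 1 = 2) \/ (Z.Odd c /\ 1 = 1). Proof. by right. Qed.
Let delta_gt0 : 0 < delta. Proof. by case: delta12 => ->. Qed.
Let eps_gt0 : 0 < eps. Proof. by case: eps1b => ->; lia. Qed.
Let ndelta : ~ (c | delta).
Proof.
by move=> H; have := Z.divide_pos_le _ _ delta_gt0 H; case: delta12 => ->; lia.
Qed.
Let nb : ~ (c | b). Proof. by move/(prime_div_prime _ _ cp bp) => E; apply: bc. Qed.
Let n1 : ~ (c | 1). Proof. by move/Z.divide_1_r; lia. Qed.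
Let neps : ~ (c | eps). Proof. by case: eps1b => ->. Qed.
Let eps_odd : Z.Odd eps. Proof. by case: eps1b => -> //; exists 0. Qed.
Let ng : ~ (c | g) /\ rel_prime g c.
Proof.
case: g1b => ->; split=> //; first exact: rel_prime_1_l.
by apply: rel_prime_sym; apply: prime_rel_prime.
Qed.
Let n1' : ~ (c | 1) /\ rel_prime 1 c.
Proof. by split=> //; apply: rel_prime_1_l. Qed.

Definition orep := rep c 1 delta eps g 1.
Let K := okz delta eps.

Let K_0 : K 0 -> forall S T, (1 | S) -> (g | T) -> (Z.Odd c -> Z.Odd T) ->
  delta * S ^ 2 + eps * T ^ 2 <> 1 ^ 2.
Proof.
case=> [[k Ek]|[Ed Ee] S T _ _ /(_ oc) [k ->]]; first by clear - Ek; lia.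
have -> : eps = b by case: eps1b.
rewrite Ed Z.pow_1_l //; clear - b3; nia.
Qed.
Let disc2 : c = 2 -> 4 < delta * eps.
Proof. by move=> E; exfalso; lia. Qed.

Lemma orep_sol s t z : 0 <= s -> 0 <= t -> (g = 1 \/ 1 <= t) ->
  delta * (2 ^ s) ^ 2 + eps * (b ^ t) ^ 2 = c ^ z -> orep (2 ^ s) (b ^ t) z.
Proof.
move=> s0 t0 gt E; split.
- by rewrite E Z.pow_1_l // Z.mul_1_l.
- by apply: prime_ndvd_pow => //; [exact: prime_2 | lia].
- by apply: prime_ndvd_pow => //; lia.
- have [->|t1] : t = 0 \/ 0 < t by lia.
    by exists 0.
  by apply/Z.odd_spec; rewrite Z.odd_pow //; apply/Z.odd_spec.
- split; last exact: Z.divide_1_l.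
  case: g1b => Eg; rewrite Eg; first exact: Z.divide_1_l.
  by case: gt => [Eg1|]; [exfalso; lia | exact: ppow_dvd].
Qed.

Variables S0 T0 z0 : Z.
Hypothesis base : orep S0 T0 z0.
Hypothesis z0_gt0 : 1 <= z0.
Hypothesis z0_min : forall S T z, orep S T z -> K z -> 1 <= z -> z0 <= z.

(** In [2 ^ s = |S0| |w|] the factor [w] is odd, hence 1 or -1, and [u] is a power of [b] up to
    sign. So [wu_prime_step] gives [k = 0] as soon as [b] divides [Q = eps T0 ^ 2]; only [Q = 1]
    escapes. *)
Lemma odd_power s t z : 0 <= s -> 0 <= t -> orep (2 ^ s) (b ^ t) z -> K z -> 1 <= z ->
  exists k t0, [/\ Z.abs S0 = 2 ^ s, 0 <= t0 /\ Z.abs T0 = b ^ t0,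
    Z.abs (w_ (delta * S0 ^ 2) (eps * T0 ^ 2) k) = 1,
    b ^ t = b ^ t0 * Z.abs (u_ (delta * S0 ^ 2) (eps * T0 ^ 2) k)
    & z = z0 * (2 * Z.of_nat k + 1) /\ (k = 0%N \/ eps = 1 /\ t0 = 0)].
Proof.
move=> s0 t0 r Kz z1.
have [k [w [u [si [ta [ch [si1 ta1] [ES ET] Ez]]]]]] :=
  descent_power c 1 delta eps g 1 cp cmu delta_gt0 eps_gt0 ndelta neps eps_odd ng n1' K
   (okz_sub delta eps) (okz_opp delta eps) K_0 disc2 S0 T0 z0 base z0_gt0 z0_min _ _ _ r Kz z1.
have [] := chain_wu _ _ _ _ cp _ _ _ _ _ ch.
rewrite !Z.pow_1_l; [|lia|lia]; rewrite !Z.mul_1_l => Ew Eu.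
have [N _ _ _ _] := base; rewrite Z.pow_1_l // Z.mul_1_l in N.
have oPQ : Z.Odd (delta * S0 ^ 2 + eps * T0 ^ 2).
  by rewrite N; apply/Z.odd_spec; rewrite Z.odd_pow; [apply/Z.odd_spec | lia].
have [ow _] := wu_odd _ _ k oPQ.
have aS : 2 ^ s = Z.abs S0 * Z.abs w.
  rewrite -[LHS]Z.abs_eq; last by apply: Z.pow_nonneg.
  by rewrite ES !Z.abs_mul; case: si1 => ->; rewrite Z.mul_1_l.
have aT : b ^ t = Z.abs T0 * Z.abs u.
  rewrite -[LHS]Z.abs_eq; last by apply: Z.pow_nonneg; lia.
  by rewrite ET !Z.abs_mul; case: ta1 => ->; rewrite Z.mul_1_l.
have w1 : Z.abs w = 1.
  rewrite -Ew; apply: (pow2_odd_dvd _ s) => //; apply/Z.divide_abs_l.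
  by exists (Z.abs S0); rewrite aS Ew.
have [t' [t'0 ET0]] : exists t', 0 <= t' /\ Z.abs T0 = b ^ t'.
  by apply: (dvd_ppow_abs b t) => //; apply/Z.divide_abs_l; exists (Z.abs u); rewrite aT; ring.
have [n [n0 En]] : exists n, 0 <= n /\ Z.abs u = b ^ n.
  by apply: (dvd_ppow_abs b t) => //; apply/Z.divide_abs_l; exists (Z.abs T0); rewrite aT.
rewrite w1 Z.mul_1_r in aS.
exists k, t'; split=> //; [by rewrite Ew | by rewrite Eu -ET0 |].
split=> //.
have EP : delta * S0 ^ 2 = delta * 2 ^ (2 * s).
  by rewrite (sq_abs S0) -aS (Z.mul_comm 2) Z.pow_mul_r.
have EQ : exists r, eps * T0 ^ 2 = b ^ r /\ 0 <= r /\ (1 <= r \/ eps = 1 /\ t' = 0).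
  have E2 : T0 ^ 2 = b ^ (2 * t') by rewrite (sq_abs T0) ET0 (Z.mul_comm 2) Z.pow_mul_r.
  case: eps1b => Ee; [exists (2 * t') | exists (Z.succ (2 * t'))].
    by rewrite Ee E2 Z.mul_1_l; clear - t'0; lia.
  by rewrite Ee E2 Z.pow_succ_r; clear - t'0; lia.
case: EQ => q [EQ [q0 [q1|]]]; last by right.
left; apply: (wu_prime_step (delta * S0 ^ 2) b q k n) => //.
- rewrite EP; apply: Z.mul_pos_pos => //; apply: Z.pow_pos_nonneg; [by [] | clear - s0; lia].
- rewrite EP => /(prime_mult _ bp) [].
    by move/Z.divide_pos_le; case: delta12 => ->; clear - b3; lia.
  by apply: prime_ndvd_pow => //; [exact: prime_2 | clear - b3; lia | clear - s0; lia].
(* [P] is one of 1, 2, 4, 8 or at least 16, so the exception 10 does not occur. *)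
- rewrite EP.
  have [lt|le] : 2 * s < 4 \/ 4 <= 2 * s by clear; lia.
    have [->|->] : s = 0 \/ s = 1 by clear - s0 lt; lia.
      by case: delta12 => ->.
    by case: delta12 => ->.
  have : 2 ^ 4 <= 2 ^ (2 * s) by apply: pow_ge_mono; clear - le; lia.
  by have -> : 2 ^ 4 = 16 by []; clear - delta12; case: delta12 => ->; lia.
- by rewrite -EQ Ew.
- by rewrite -EQ Eu.
Qed.
End OddBase.

Lemma unique_in_class b c delta eps s t z s' t' z' :
  zprime b -> zprime c -> 3 <= b -> 3 <= c -> b <> c ->
  delta = 1 \/ delta = 2 -> eps = 1 \/ eps = b ->
  0 <= s -> 0 <= t -> 0 <= s' -> 0 <= t' -> (eps = 1 -> 1 <= t /\ 1 <= t') ->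
  1 <= z -> 1 <= z' -> okz delta eps z -> okz delta eps z' ->
  delta * (2 ^ s) ^ 2 + eps * (b ^ t) ^ 2 = c ^ z ->
  delta * (2 ^ s') ^ 2 + eps * (b ^ t') ^ 2 = c ^ z' ->
  [/\ s = s', t = t' & z = z'].
Proof.
move=> bp cp b3 c3 bc d12 e1b s0 t0 s0' t0' et z1 z1' kz kz' E E'.
(* For [eps = 1] the condition [b | T] is imposed on all representations, so that the minimal one
   cannot have [T0 = 1], the case left open by [odd_power]. *)
pose g := if eps =? 1 then b else 1.
have gE : (eps = 1 /\ g = b) \/ (eps = b /\ g = 1).
  rewrite /g; case: Z.eqb_spec => [|ne]; first by left.
  by case: e1b => //; right.
have g1b : g = 1 \/ g = b by case: gE => -[_ ->]; [right|left].
have gt : g = 1 \/ 1 <= t by case: gE => -[? ?]; [right; case: et|left].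
have gt' : g = 1 \/ 1 <= t' by case: gE => -[? ?]; [right; case: et|left].
have r := orep_sol b c delta eps g cp c3 bp b3 bc d12 e1b g1b s t z s0 t0 gt E.
have r' := orep_sol b c delta eps g cp c3 bp b3 bc d12 e1b g1b s' t' z' s0' t0' gt' E'.
have [S0 [T0 [z0 [[base kz0] z01 mn]]]] :=
  min_exponent (fun S T z => orep c delta eps g S T z /\ okz delta eps z) _ _ z (conj r kz) z1.
have {}mn S T n : orep c delta eps g S T n -> okz delta eps n -> 1 <= n -> z0 <= n.
  by move=> rn kn; apply: mn; split; [exact: rn | exact: kn].
have main s1 t1 zz : 0 <= s1 -> 0 <= t1 -> orep c delta eps g (2 ^ s1) (b ^ t1) zz ->
    okz delta eps zz -> 1 <= zz -> [/\ Z.abs S0 = 2 ^ s1, Z.abs T0 = b ^ t1 & zz = z0].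
  move=> s10 t10 r1 kzz z11.
  have [k [j [ES [j0 ET] _ Eu [Ez [k0|[e1 jz]]]]]] :=
    odd_power b c delta eps g cp c3 bp b3 bc d12 e1b g1b S0 T0 z0 base z01 mn s1 t1 zz
      s10 t10 r1 kzz z11.
    split=> //; last by rewrite Ez k0 /=; clear; lia.
    by rewrite ET Eu k0 /u_ /=; clear; lia.
  exfalso; case: gE => -[Ee Eg]; last by clear - b3 e1 Ee; lia.
  case: base => _ _ _ _ [/Z.divide_abs_r]; rewrite ET jz Eg Z.pow_0_r => /Z.divide_1_r.
  by clear - b3; lia.
have [A1 A2 ->] := main _ _ _ s0 t0 r kz z1.
have [B1 B2 ->] := main _ _ _ s0' t0' r' kz' z1'.
split=> //; first by apply: (pow_inj 2) => //; rewrite -A1.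
by apply: (pow_inj b) => //; [clear - b3; lia | rewrite -A2].
Qed.

(** If [c] is the norm of [e + f sqrt (- delta eps)], the prime ideals above [c] are principal and
    their powers never lie in the class of the other form. In elementary terms: a representation of
    [c ^ z] can be divided by this element until [z = 0], where [eps >= 3] and [T] odd are
    contradictory. *)
Lemma no_twist c delta eps e f S T z :
  zprime c -> Z.Odd c -> 0 < delta -> 3 <= eps -> ~ (c | eps) -> Z.Odd eps -> Z.Odd e ->
  e ^ 2 + delta * eps * f ^ 2 = c -> 0 <= z -> Z.Odd T ->
  delta * S ^ 2 + eps * T ^ 2 <> c ^ z.
Proof.
move=> cp oc d0 e3 nce oeps oe Nc; have c2 := prime_ge_2 _ cp.
move En : (Z.to_nat z) => n; elim/ltn_ind: n S T z En => n IH S T z En z0 oT E.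
have [zz|z1] : z = 0 \/ 1 <= z by clear - z0; lia.
  move: E; rewrite zz Z.pow_0_r; case: oT => k ->; clear - d0 e3; nia.
have ocz : Z.odd (c ^ z) by rewrite Z.odd_pow; [apply/Z.odd_spec | clear - z1; lia].
have Ez : c ^ z = c * c ^ (z - 1).
  have {1}-> : z = Z.succ (z - 1) by clear; lia.
  by rewrite Z.pow_succ_r //; clear - z1; lia.
have oS : Z.odd (delta * S) = false.
  have := f_equal Z.odd E; rewrite ocz Z.odd_add !Z.pow_2_r !Z.odd_mul.
  move/Z.odd_spec: oT => ->; move/Z.odd_spec: oeps => ->.
  by case: (Z.odd delta); case: (Z.odd S).
have [cS|cS] := classic (c | S).
  have cT : (c | T).
    apply: (zprime_dvd_pow c T 2) => //.
    have : (c | eps * T ^ 2).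
      case: cS => q Eq; exists (c ^ (z - 1) - delta * q ^ 2 * c).
      by rewrite Z.mul_sub_distr_r (Z.mul_comm _ c) -Ez -E Eq; ring.
    by case/(prime_mult _ cp).
  case: cS => q Eq; case: cT => r Er.
  have E1 : c * (delta * q ^ 2 + eps * r ^ 2) = c ^ (z - 1).
    apply: (Z.mul_reg_l _ _ c); first by clear - c2; lia.
    by rewrite -Ez -E Eq Er; ring.
  have [zz|z2] : z = 1 \/ 2 <= z by clear - z1; lia.
    move: E1; rewrite zz Z.pow_0_r => E1.
    by have /Z.divide_1_r : (c | 1); [exists (delta * q ^ 2 + eps * r ^ 2); rewrite -E1; ring | clear - c2; lia].
  apply: (IH (Z.to_nat (z - 2)) _ q r (z - 2)) => //.
  - by apply/ltP; clear - En z2; lia.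
  - by clear - z2; lia.
  - move/Z.odd_spec: oT; rewrite Er Z.odd_mul => /andP [or _]; exact/Z.odd_spec.
  - apply: (Z.mul_reg_l _ _ c); first by clear - c2; lia.
    rewrite E1; have -> : z - 1 = Z.succ (z - 2) by clear; lia.
    by rewrite Z.pow_succ_r //; clear - z2; lia.
have [si si1 [S1 ES1]] : exists2 si, si = 1 \/ si = -1 & (c | S * e + si * eps * T * f).
  have : (c | (S * e + eps * T * f) * (S * e - eps * T * f)).
    exists (S ^ 2 - eps * f ^ 2 * c ^ (z - 1)).
    transitivity (S ^ 2 * e ^ 2 - eps ^ 2 * T ^ 2 * f ^ 2); first ring.
    transitivity (c * S ^ 2 - eps * f ^ 2 * (c * c ^ (z - 1))); last ring.
    by rewrite -Ez -E -Nc; ring.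
  case/(prime_mult _ cp) => H; [exists 1|exists (-1)]; try (by [left|right]).
    by move: H; congr (_ | _); ring.
  by move: H; congr (_ | _); ring.
have s2 : si * si = 1 by case: si1 => ->.
have [T1 ET1] : (c | T * e - si * delta * S * f).
  have : (c | S * (T * e - si * delta * S * f)).
    exists (T * S1 - si * f * c ^ (z - 1)).
    transitivity (T * (S * e + si * eps * T * f) - si * f * (delta * S ^ 2 + eps * T ^ 2)); first ring.
    by rewrite ES1 E Ez; ring.
  by case/(prime_mult _ cp).
apply: (IH (Z.to_nat (z - 1)) _ S1 T1 (z - 1)) => //.
- by apply/ltP; clear - En z1; lia.
- by clear - z1; lia.
- have : Z.odd (T * e - si * delta * S * f).
    rewrite Z.odd_sub -(Z.mul_assoc si) !Z.odd_mul in oS *; rewrite oS.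
    move/Z.odd_spec: oT => ->; move/Z.odd_spec: oe => ->.
    by case: (Z.odd si).
  by rewrite ET1 Z.odd_mul => /andP [/Z.odd_spec].
- apply: (Z.mul_reg_l _ _ (c * c)); first by clear - c2; nia.
  transitivity (c * (c * c ^ (z - 1))); last ring.
  rewrite -Ez -E; transitivity (delta * (S1 * c) ^ 2 + eps * (T1 * c) ^ 2); first ring.
  rewrite -ES1 -ET1.
  transitivity (delta * S ^ 2 * (e ^ 2 + si * si * (delta * eps * f ^ 2)) +
                eps * T ^ 2 * (e ^ 2 + si * si * (delta * eps * f ^ 2))); first ring.
  by rewrite s2 -[X in _ = X * _]Nc; ring.
Qed.

(** Pigeonhole: with [k] the integer square root of [c], there are more than [c] pairs with entries
    from 0 to [k], so two of them give the same [T i + S j] modulo [c]; the differences of their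
    entries are [x] and [y]. *)
Lemma thue_small c S T : zprime c ->
  exists x y, [/\ (c | T * x - S * y), x ^ 2 < c, y ^ 2 < c & 0 < x ^ 2 \/ x = 0 /\ 0 < y ^ 2].
Proof.
move=> cp; have c2 := prime_ge_2 _ cp.
have [k0 kc] := Z.sqrt_spec c ltac:(lia).
set k := Z.sqrt c in k0 kc.
have kn : 0 <= k by apply: Z.sqrt_nonneg.
have kc' : k * k < c.
  have [//|E] : k * k < c \/ k * k = c by clear - k0; lia.
  have [] := prime_divisors _ cp k ltac:(by exists k); clear - E c2; nia.
pose n := Z.to_nat k.
pose f (p : 'I_n.+1 * 'I_n.+1) : 'I_(Z.to_nat c).-1.+1 :=
  inord (Z.to_nat ((T * Z.of_nat p.1 + S * Z.of_nat p.2) mod c)).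
have : ~~ injectiveb f.
  apply/negP => /injectiveP inj.
  have := leq_card f inj; rewrite card_prod !card_ord => /leP.
  by rewrite -multE; clear - kc c2 kn; nia.
case/injectivePn => -[i1 j1] [[i2 j2] ne fe].
have dvd : (c | T * (Z.of_nat i1 - Z.of_nat i2) - S * (Z.of_nat j2 - Z.of_nat j1)).
  have b m : 0 <= m mod c < c by apply: Z.mod_pos_bound; clear - c2; lia.
  have := f_equal (@nat_of_ord _) fe; rewrite /f !inordK /=; last 2 first.
  - by apply/ltP; have := b (T * Z.of_nat i2 + S * Z.of_nat j2); clear; lia.
  - by apply/ltP; have := b (T * Z.of_nat i1 + S * Z.of_nat j1); clear; lia.
  move=> Em.
  have {}Em : (T * Z.of_nat i1 + S * Z.of_nat j1) mod c = (T * Z.of_nat i2 + S * Z.of_nat j2) mod c.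
    have := b (T * Z.of_nat i2 + S * Z.of_nat j2).
    by have := b (T * Z.of_nat i1 + S * Z.of_nat j1); move: Em; clear; lia.
  have H1 := Z.div_mod (T * Z.of_nat i1 + S * Z.of_nat j1) c ltac:(clear - c2; lia).
  have H2 := Z.div_mod (T * Z.of_nat i2 + S * Z.of_nat j2) c ltac:(clear - c2; lia).
  exists ((T * Z.of_nat i1 + S * Z.of_nat j1) / c - (T * Z.of_nat i2 + S * Z.of_nat j2) / c).
  rewrite Em in H1; move: H1 H2; move: ((T * Z.of_nat i1 + S * Z.of_nat j1) / c) => a.
  move: ((T * Z.of_nat i2 + S * Z.of_nat j2) / c) (_ mod c) => d e; clear; lia.
have bnd (i j : 'I_n.+1) : (Z.of_nat i - Z.of_nat j) ^ 2 < c.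
  have := ltn_ord i; have := ltn_ord j; move=> /ltP li /ltP lj.
  rewrite Z.pow_2_r; move: li lj; rewrite /n; clear - kc' kn; nia.
set x := Z.of_nat i1 - Z.of_nat i2 in dvd; set y := Z.of_nat j2 - Z.of_nat j1 in dvd.
exists x, y; split; [exact: dvd | by apply: bnd | by apply: bnd |].
have [x0|x0] : x = 0 \/ 0 < x ^ 2 by rewrite Z.pow_2_r; clear; nia.
  have [y0|y0] : y = 0 \/ 0 < y ^ 2 by rewrite Z.pow_2_r; clear; nia.
    exfalso; move/eqP: ne; apply; congr (_, _); apply: val_inj => /=.
      by move: x0; rewrite /x; clear; lia.
    by move: y0; rewrite /y; clear; lia.
  by right.
by left.
Qed.

(** A substitute for the reduction of quadratic forms: only the few multiples [m c] with [m <= D]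
    have to be discussed. *)
Lemma thue c D S T : zprime c -> 1 <= D -> ~ (c | T) -> (c | S ^ 2 + D * T ^ 2) ->
  exists x y m, x ^ 2 + D * y ^ 2 = m * c /\ 1 <= m <= D.
Proof.
move=> cp D1 nT dv; have c2 := prime_ge_2 _ cp.
have [x [y [dvd bx by' pos0]]] := thue_small c S T cp.
have [m Em] : (c | x ^ 2 + D * y ^ 2).
  have : (c | T ^ 2 * (x ^ 2 + D * y ^ 2)).
    have -> : T ^ 2 * (x ^ 2 + D * y ^ 2) =
      (T * x - S * y) * (T * x + S * y) + y ^ 2 * (S ^ 2 + D * T ^ 2) by ring.
    by apply: Z.divide_add_r; [apply: dvd_mul_l | apply: dvd_mul_r].
  by case/(prime_mult _ cp) => // /(zprime_dvd_pow _ _ 2 cp) H; case: nT; apply: H.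
exists x, y, m; split=> //.
have x20 : 0 <= x ^ 2 by rewrite Z.pow_2_r; clear; nia.
have y20 : 0 <= y ^ 2 by rewrite Z.pow_2_r; clear; nia.
have pos : 0 < x ^ 2 + D * y ^ 2.
  case: pos0 => [x0|[-> y0]]; first by move: D1 x0 y20; clear; nia.
  by move: D1 y0; clear; nia.
by move: (x ^ 2) (y ^ 2) Em bx by' pos x20 y20 c2 D1 => X Y; clear; nia.
Qed.

(** * Lucas terms equal to 1 or -1 *)

(* If [tight P r n], then [theta ^ (2 n m) - 1] has an exactly known 2-adic order for all [m]; this
   is Skolem's method for the terms [w_k = 1] of the Lucas sequence with [Q = 1]. *)
Definition tight P r n := exists e f,
  om P 1 n = (1 + 2 ^ r * (4 * e), 2 ^ r * (2 * f + 1)).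

Lemma tight_double P r n : 1 <= r -> tight P r n -> tight P (r + 1) (n + n).
Proof.
move=> r1 [e [f E]].
exists (e + 2 ^ (r - 1) * (4 * e ^ 2 - P * (2 * f + 1) ^ 2)), (f + 2 ^ r * (2 * e) * (2 * f + 1)).
rewrite om_add E /=.
have Er : 2 ^ r = 2 * 2 ^ (r - 1).
  have {1}-> : r = Z.succ (r - 1) by clear; lia.
  by rewrite Z.pow_succ_r //; clear - r1; lia.
have Er1 : 2 ^ (r + 1) = 2 * 2 ^ r by rewrite -Z.pow_succ_r //; clear - r1; lia.
by congr (_, _); rewrite Er1 Er; ring.
Qed.

Lemma tight_add P r r' n n' : 1 <= r < r' -> tight P r n -> tight P r' n' -> tight P r (n + n').
Proof.
move=> rr [e [f E]] [e' [f' E']].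
have Er : 2 ^ r' = 2 ^ r * (2 * 2 ^ (r' - r - 1)).
  rewrite -Z.pow_succ_r; last by clear - rr; lia.
  by rewrite -Z.pow_add_r; [f_equal | |]; clear - rr; lia.
set q := 2 ^ (r' - r - 1) in Er.
exists (e + 2 * q * (e' * (1 + 2 ^ r * (4 * e)) - P * 2 ^ r * (2 * f + 1) * (2 * f' + 1))).
exists (f + q * ((1 + 2 ^ r * (4 * e)) * (2 * f' + 1) + 2 ^ r * (2 * f + 1) * (4 * e'))).
by rewrite om_add E E' /=; congr (_, _); rewrite Er; ring.
Qed.

(** Binary expansion of [m]: doubling raises the order by one, and adding [n] to an even multiple of
    [n], which has strictly larger order, brings the order back to [r]. *)
Lemma tight_mul P r n (m : nat) : 1 <= r -> tight P r n -> (1 <= m)%coq_nat ->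
  exists2 r', r <= r' & tight P r' (n * m).
Proof.
move=> r1 tn m1.
suff [r' [rr' _ t']] : exists r', [/\ r <= r', ~~ odd m -> r < r' & tight P r' (n * m)] by exists r'.
elim/ltn_ind: m m1 => m IH m1.
have [Em|Em] : m = (m./2 + m./2)%N \/ m = (1 + (m./2 + m./2))%N.
  by have := odd_double_half m; case: (odd m); rewrite -addnn => /esym E; [right|left].
  have lt : (m./2 < m)%N by apply/ltP; move: Em m1; rewrite -plusE; clear; lia.
  have h1 : (1 <= m./2)%coq_nat by move: Em m1; rewrite -plusE; clear; lia.
  have [r' [rr' _ t']] := IH _ lt h1.
  exists (r' + 1); split; try (by clear - rr'; lia).
  by rewrite Em mulnDr; apply: tight_double => //; clear - r1 rr'; lia.
have [h0|h1] : m./2 = 0%N \/ (1 <= m./2)%coq_nat by clear; lia.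
  exists r; split; [by clear; lia | by rewrite Em h0 | by rewrite Em h0 muln1].
have lt : (m./2 < m)%N by apply/ltP; move: Em m1; rewrite -plusE; clear; lia.
have [r' [rr' _ t']] := IH _ lt h1.
exists r; split; [by clear; lia | by rewrite Em addnn oddD odd_double |].
rewrite Em mulnDr muln1 mulnDr; apply: (tight_add _ _ (r' + 1)) => //; first by clear - r1 rr'; lia.
by apply: tight_double => //; clear - r1 rr'; lia.
Qed.

Lemma tight_w_neq P r n : 1 <= r -> tight P r n -> w_ P 1 n <> 1.
Proof.
move=> r1 [e [f E]]; have [-> _] := wu_om P 1 n; rewrite E /= => H.
have : 2 ^ r * (2 * (2 * (e + f) + 1)) = 0 by move: H; clear; lia.
by case/Z.mul_eq_0; [apply: Z.pow_nonzero; clear - r1; lia | clear; lia].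
Qed.

Lemma wu_period P Q M k N : (M | w_ P Q N - 1) -> (M | u_ P Q N - 1) ->
  (M | w_ P Q (N + k) - w_ P Q k) /\ (M | u_ P Q (N + k) - u_ P Q k).
Proof.
move=> dw du; elim: k => [|k [IHw IHu]].
  by rewrite addn0; split; rewrite /w_ /u_ /= in dw du *.
rewrite addnS !w_S !u_S; split.
  have -> : w_ P Q (N + k) * (Q - P) + 2 * Q * u_ P Q (N + k) -
    (w_ P Q k * (Q - P) + 2 * Q * u_ P Q k) =
    (w_ P Q (N + k) - w_ P Q k) * (Q - P) + 2 * Q * (u_ P Q (N + k) - u_ P Q k) by ring.
  by apply: Z.divide_add_r; [apply: dvd_mul_l | apply: dvd_mul_r].
have -> : u_ P Q (N + k) * (Q - P) - 2 * P * w_ P Q (N + k) -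
  (u_ P Q k * (Q - P) - 2 * P * w_ P Q k) =
  (u_ P Q (N + k) - u_ P Q k) * (Q - P) - 2 * P * (w_ P Q (N + k) - w_ P Q k) by ring.
by apply: Z.divide_sub_r; [apply: dvd_mul_l | apply: dvd_mul_r].
Qed.

Lemma w_mod4 P M : (M | w_ P 1 4 - 1) -> (M | u_ P 1 4 - 1) ->
  forall k a, (M | w_ P 1 (4 * k + a) - w_ P 1 a).
Proof.
move=> dw du; elim=> [|k IH] a; first by rewrite muln0 add0n Z.sub_diag; apply: Z.divide_0_r.
rewrite mulnS -addnA.
have [H _] := wu_period P 1 M (4 * k + a) 4 dw du.
have -> : w_ P 1 (4 + (4 * k + a)) - w_ P 1 a =
  (w_ P 1 (4 + (4 * k + a)) - w_ P 1 (4 * k + a)) + (w_ P 1 (4 * k + a) - w_ P 1 a) by ring.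
by apply: Z.divide_add_r.
Qed.

Lemma nat_mod4 (k : nat) : exists m a : nat, k = (4 * m + a)%N /\
  [\/ a = 0%N, a = 1%N, a = 2%N | a = 3%N].
Proof.
exists (k %/ 4)%N, (k %% 4)%N; rewrite mulnC -divn_eq; split=> //.
by have := ltn_pmod k (isT : 0 < 4)%N; case: (k %% 4)%N => [|[|[|[|?]]]] // _; constructor.
Qed.

(** The sequence has period 4 modulo 8, which leaves [k] congruent to 0 or 1 modulo 4. There the
    values beyond the first differ from 1 or from -1 by [2 ^ (r + 1)] times an odd number with
    [r >= 2], which is neither 0 nor 2 in absolute value. The index 1 does occur, as
    [w_1 = 3 - P]. *)
Lemma w_unit_small P k : P = 2 \/ P = 4 -> Z.abs (w_ P 1 k) = 1 -> k = 0%N \/ k = 1%N.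
Proof.
move=> P24 aw.
have [m [a [Ek ca]]] := nat_mod4 k.
have t4 : tight P 2 4.
  by case: P24 => ->; [exists 1, 3 | exists (-33), 10]; rewrite /=; congr (_, _).
have d8 : (8 | w_ P 1 k - w_ P 1 a).
  rewrite Ek; apply: w_mod4; case: P24 => ->; apply/Z.mod_divide => //; by vm_compute.
have a01 : a = 0%N \/ a = 1%N.
  have v : [/\ w_ 2 1 2 = -11, w_ 2 1 3 = 13, w_ 4 1 2 = -19 & w_ 4 1 3 = 139] by vm_compute.
  case: v => v1 v2 v3 v4; case: d8 => q.
  by case: P24 aw => ->; case: ca => ->; auto; rewrite ?v1 ?v2 ?v3 ?v4; clear; lia.
have [m0|m1] : m = 0%N \/ (1 <= m)%coq_nat by clear; lia.
  by rewrite Ek m0 muln0 add0n; case: a01 => ->; auto.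
exfalso; have [r r2 [e [f E]]] := tight_mul P 2 4 m ltac:(by []) t4 m1.
have r0 : 2 ^ r <> 0 by apply: Z.pow_nonzero; clear - r2; lia.
have Er : 2 ^ r = 4 * 2 ^ (r - 2).
  have -> : 4 = 2 ^ 2 by []; rewrite -Z.pow_add_r; [f_equal| |]; clear - r2; lia.
have imp t : Z.abs (1 + 2 ^ r * (2 * (2 * t + 1))) <> 1.
  have E1 : 2 ^ r * (2 * (2 * t + 1)) = 8 * (2 ^ (r - 2) * (2 * t + 1)) by rewrite Er; ring.
  have [/Z.mul_eq_0 [|]|ne] := classic (2 ^ r * (2 * (2 * t + 1)) = 0).
  - by [].
  - by clear; lia.
  - by move: ne; rewrite E1; clear; lia.
have [Ew _] := wu_om P 1 k; move: aw; rewrite Ew Ek om_add E.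
case: a01 => ->; case: P24 => -> /=.
- by move=> aw; apply: (imp (e + f)); apply: etrans aw; f_equal; ring.
- by move=> aw; apply: (imp (e + f)); apply: etrans aw; f_equal; ring.
- by move=> aw; apply: (imp (e - 5 * f - 3)); apply: etrans aw; f_equal; ring.
- by move=> aw; apply: (imp (e + 11 * f + 5)); rewrite -Z.abs_opp; apply: etrans aw; f_equal; ring.
Qed.

Lemma wu_congr M P P' Q k : (M | P - P') ->
  (M | w_ P Q k - w_ P' Q k) /\ (M | u_ P Q k - u_ P' Q k).
Proof.
move=> dP; elim: k => [|k [IHw IHu]].
  by rewrite /w_ /u_ /= Z.sub_diag; split; apply: Z.divide_0_r.
rewrite !w_S !u_S; split.
  have -> : w_ P Q k * (Q - P) + 2 * Q * u_ P Q k - (w_ P' Q k * (Q - P') + 2 * Q * u_ P' Q k) =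
    (w_ P Q k - w_ P' Q k) * (Q - P) + 2 * Q * (u_ P Q k - u_ P' Q k) - w_ P' Q k * (P - P') by ring.
  by apply: Z.divide_sub_r; [apply: Z.divide_add_r; [by apply: dvd_mul_l|]|]; apply: dvd_mul_r.
have -> : u_ P Q k * (Q - P) - 2 * P * w_ P Q k - (u_ P' Q k * (Q - P') - 2 * P' * w_ P' Q k) =
  (u_ P Q k - u_ P' Q k) * (Q - P) - 2 * P * (w_ P Q k - w_ P' Q k)
   - (u_ P' Q k + 2 * w_ P' Q k) * (P - P') by ring.
by apply: Z.divide_sub_r; [apply: Z.divide_sub_r; [by apply: dvd_mul_l|]|]; apply: dvd_mul_r.
Qed.

Lemma wu_01 k : w_ 0 1 k = 2 * Z.of_nat k + 1 /\ u_ 0 1 k = 1.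
Proof.
elim: k => [|k [IHw IHu]]; first by [].
by rewrite w_S u_S IHw IHu Nat2Z.inj_succ; split; clear; lia.
Qed.

(** Modulo 16 the sequence is [2 k + 1]. So [w = 1] makes 8 divide [k], where the exact 2-adic order
    applies; [w = -1] makes [k] congruent to 3 modulo 4, where the sequence is 1 modulo 3. *)
Lemma w_unit_big P k : (16 | P) -> (3 | P - 1) -> Z.abs (w_ P 1 k) = 1 -> k = 0%N.
Proof.
move=> P16 P3 aw.
have [[q Eq] _] := wu_congr 16 P 0 1 k ltac:(by rewrite Z.sub_0_r).
have [E0 _] := wu_01 k; rewrite E0 in Eq.
have [[q3 Eq3] _] := wu_congr 3 P 1 1 k P3.
have [w1|w1] : w_ P 1 k = 1 \/ w_ P 1 k = -1 by move: aw; clear; lia.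
  have [j Ek] : exists j : nat, k = (2 * (4 * j))%N.
    exists (Z.to_nat (Z.of_nat k / 8)); apply: Nat2Z.inj.
    rewrite -!multE !Nat2Z.inj_mul Z2Nat.id; last by apply: Z.div_pos; clear; lia.
    have d : (8 | Z.of_nat k) by exists (- q); move: Eq; rewrite w1; clear; lia.
    by case: d => y ->; rewrite Z.div_mul; clear; lia.
  have [j0|j1] : j = 0%N \/ (1 <= j)%coq_nat by clear; lia.
    by rewrite Ek j0 !muln0.
  exfalso.
  have t2 : tight P 1 2.
    case: P16 => p Ep; exists (32 * p ^ 2 - 12 * p), (- 8 * p).
    by rewrite /= Ep; congr (_, _); rewrite ?Z.pow_1_r; ring.
  have [r r1 t'] := tight_mul P 1 2 (4 * j) ltac:(by []) t2 ltac:(rewrite -multE; clear - j1; lia).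
  by apply: (tight_w_neq P r (2 * (4 * j))) => //; rewrite -Ek.
have [m [a [Ek ca]]] := nat_mod4 k.
have a3 : a = 3%N.
  move: Eq; rewrite w1 Ek -plusE -multE Nat2Z.inj_add Nat2Z.inj_mul.
  by case: ca => ->; clear; lia.
have [q' Eq'] : (3 | w_ 1 1 (4 * m + 3) - w_ 1 1 3).
  by apply: w_mod4; apply/Z.mod_divide.
have v : w_ 1 1 3 = -8 by [].
rewrite a3 in Ek; rewrite -Ek v in Eq'.
by move: Eq3 Eq'; rewrite w1; clear; lia.
Qed.

Lemma mod3_pow2 x : 0 <= x -> (3 | 2 ^ x - (-1) ^ x).
Proof.
move=> x0; rewrite -(Z2Nat.id x) //; elim: (Z.to_nat x) => [|n [q IH]].
  by rewrite !Z.pow_0_r; exists 0.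
rewrite Nat2Z.inj_succ !Z.pow_succ_r; [|clear; lia|clear; lia].
by exists (2 * q + (-1) ^ Z.of_nat n); move: IH; clear; lia.
Qed.

Lemma pow_m1 x : 0 <= x -> (Z.Even x -> (-1) ^ x = 1) /\ (Z.Odd x -> (-1) ^ x = -1).
Proof.
move=> x0; split=> -[y Ey].
  by rewrite Ey Z.pow_mul_r ?Z.pow_1_l //; clear - Ey x0; lia.
have {1}-> : x = Z.succ (2 * y) by rewrite Ey; clear; lia.
by rewrite Z.pow_succ_r ?Z.pow_mul_r ?Z.pow_1_l //; clear - Ey x0; lia.
Qed.

Lemma pow3_mod8 n : 0 <= n -> (8 | 3 ^ (2 * n) - 1).
Proof.
move=> n0; rewrite Z.pow_mul_r //; have -> : 3 ^ 2 = 9 by [].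
rewrite -(Z2Nat.id n) //; elim: (Z.to_nat n) => [|k [q IH]]; first by exists 0.
rewrite Nat2Z.inj_succ Z.pow_succ_r; last by clear; lia.
by exists (9 * q + 1); move: IH; clear; lia.
Qed.

Lemma pow2_ge8 x : 3 <= x -> (8 | 2 ^ x).
Proof.
move=> x3; exists (2 ^ (x - 3)); have -> : 8 = 2 ^ 3 by [].
by rewrite -Z.pow_add_r; [f_equal| |]; clear - x3; lia.
Qed.

(** Even [x >= 4] makes [2 ^ x] divisible by 16 and congruent to 1 modulo 3. Odd [x >= 3] makes 3
    divide [1 + 2 ^ x], so [c = 3]; but odd powers of 3 are 3 modulo 8. *)
Lemma w_unit c x z0 k : zprime c -> 1 <= x -> 0 <= z0 -> Z.Odd z0 -> 1 + 2 ^ x = c ^ z0 ->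
  Z.abs (w_ (2 ^ x) 1 k) = 1 -> k = 0%N \/ k = 1%N /\ (x = 1 \/ x = 2).
Proof.
move=> cp x1 z00 oz E aw.
have [x12|x3] : (x = 1 \/ x = 2) \/ 3 <= x by clear - x1; lia.
  have [|k0|k1] := w_unit_small (2 ^ x) k _ aw; [|by left|by right].
  by case: x12 => ->; auto.
have x0 : 0 <= x by clear - x3; lia.
have [d3 dm] := (mod3_pow2 x x0, pow_m1 x x0).
have [ex|ox] := Z.Even_or_Odd x.
  left; apply: (w_unit_big (2 ^ x)) => //; last by rewrite (proj1 dm ex) in d3.
  have x4 : 4 <= x by case: ex => y; clear - x3; lia.
  exists (2 ^ (x - 4)); have -> : 16 = 2 ^ 4 by [].
  by rewrite -Z.pow_add_r; [f_equal| |]; clear - x4; lia.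
exfalso; rewrite (proj2 dm ox) in d3.
have c3 : c = 3.
  have : (3 | c ^ z0) by rewrite -E; move: d3; congr (_ | _); ring.
  by move/(zprime_dvd_pow 3 c z0 prime_3 z00)/(prime_div_prime _ _ prime_3 cp).
case: oz E => y Ey; rewrite c3 Ey => E.
have [q Eq] := pow2_ge8 x x3.
have [r Er] := pow3_mod8 y ltac:(clear - Ey z00; lia).
move: E; rewrite Z.pow_add_r; [|clear - Ey z00; lia|by []].
by rewrite Z.pow_1_r; move: Eq Er; clear; move: (2 ^ x) (3 ^ (2 * y)) => X Y; lia.
Qed.

(** * Sums that are squares *)

Lemma pow_diff2 p i j : zprime p -> 0 <= i -> 0 <= j -> p ^ i + 2 = p ^ j ->
  p ^ i = 1 \/ p = 2 /\ i = 1.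
Proof.
move=> pp i0 j0 E; have p2 := prime_ge_2 _ pp.
have [->|i1] : i = 0 \/ 1 <= i by clear - i0; lia.
  by left; rewrite Z.pow_0_r.
right; have pi := pow_ge_base p i ltac:(clear - p2; lia) i1.
have j1 : 1 <= j.
  have [E0|//] : j = 0 \/ 1 <= j by clear - j0; lia.
  by move: E; rewrite E0 Z.pow_0_r; clear - pi p2; lia.
have p2' : p = 2.
  have : (p | 2).
    have -> : 2 = p ^ j - p ^ i by rewrite -E; ring.
    by apply: Z.divide_sub_r; apply: ppow_dvd.
  by move/(prime_div_prime _ _ pp prime_2).
split=> //; move: E; rewrite p2' => E.
have [//|i2] : i = 1 \/ 2 <= i by clear - i1; lia.
have Ei : 2 ^ i = 4 * 2 ^ (i - 2).
  have -> : 4 = 2 ^ 2 by []; rewrite -Z.pow_add_r; [f_equal| |]; clear - i2; lia.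
have [j2|j1'] : 2 <= j \/ j = 1 by clear - j1; lia.
  have Ej : 2 ^ j = 4 * 2 ^ (j - 2).
    have -> : 4 = 2 ^ 2 by []; rewrite -Z.pow_add_r; [f_equal| |]; clear - j2; lia.
  by move: E; rewrite Ei Ej; clear; lia.
by move: E pi; rewrite j1' p2' Z.pow_1_r; clear; lia.
Qed.

Lemma pow3_mod8_odd n : 0 <= n -> exists q, 3 ^ n = 8 * q + 1 /\ Z.Even n \/ 3 ^ n = 8 * q + 3 /\ Z.Odd n.
Proof.
move=> n0; have [[m Em]|[m Em]] := Z.Even_or_Odd n.
  have [q Eq] := pow3_mod8 m ltac:(clear - n0 Em; lia).
  by exists q; left; split; [rewrite Em; move: Eq; clear; lia | exists m].
have [q Eq] := pow3_mod8 m ltac:(clear - n0 Em; lia).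
exists (3 * q); right; split; last by exists m.
rewrite Em Z.pow_add_r; [|clear - n0 Em; lia|by []].
by rewrite Z.pow_1_r; move: Eq; clear; lia.
Qed.

(** For [e >= 2] the exponent [m] is even by a congruence modulo 4, and then [3 ^ (m / 2) - 1] and
    [3 ^ (m / 2) + 1] are powers of 2 at distance 2. *)
Lemma pow3_eq_pow2_succ m e : 0 <= m -> 1 <= e -> 3 ^ m = 2 ^ e + 1 ->
  m = 1 /\ e = 1 \/ m = 2 /\ e = 3.
Proof.
move=> m0 e1 E.
have [Ee|e2] : e = 1 \/ 2 <= e by clear - e1; lia.
  left; split=> //; apply: (pow_inj 3) => //.
  by rewrite E Ee.
have Ee : 2 ^ e = 4 * 2 ^ (e - 2).
  have -> : 4 = 2 ^ 2 by []; rewrite -Z.pow_add_r; [f_equal| |]; clear - e2; lia.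
have [q [[Eq [n En]]|[Eq _]]] := pow3_mod8_odd m m0; last by move: Eq; rewrite E Ee; clear; lia.
have n0 : 0 <= n by clear - En m0; lia.
have fac : (3 ^ n - 1) * (3 ^ n + 1) = 2 ^ e.
  have -> : 2 ^ e = 3 ^ m - 1 by rewrite E; ring.
  by rewrite En (Z.mul_comm 2) Z.pow_mul_r //; ring.
have p1 : 1 <= 3 ^ n by have := Z.pow_pos_nonneg 3 n ltac:(by []) n0; clear; lia.
have e0 : 0 <= e by clear - e1; lia.
have [i [i0 Ei]] := dvd_ppow 2 e (3 ^ n - 1) prime_2 e0 ltac:(clear - p1; lia)
  ltac:(exists (3 ^ n + 1); rewrite -fac; ring).
have [j [j0 Ej]] := dvd_ppow 2 e (3 ^ n + 1) prime_2 e0 ltac:(clear - p1; lia)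
  ltac:(exists (3 ^ n - 1); rewrite -fac; ring).
right; case: (pow_diff2 2 i j prime_2 i0 j0 ltac:(rewrite -Ei -Ej; ring)) => [i1|[_ i1]].
  move: (Ei); rewrite i1 => E2; exfalso.
  have [n1|n1] : n = 0 \/ 1 <= n by clear - n0; lia.
    by move: E2; rewrite n1.
  by have := pow_ge_base 3 n ltac:(by []) n1; move: E2; clear; lia.
have n1 : n = 1.
  by apply: (pow_inj 3) => //; move: Ei; rewrite i1 Z.pow_1_r; clear; lia.
rewrite En n1; split=> //; apply: (pow_inj 2) => //.
by rewrite -fac n1.
Qed.

Lemma pow3_eq_pow2_pred m e : 0 <= m -> 0 <= e -> 3 ^ m = 2 ^ e - 1 -> e <= 2.
Proof.
move=> m0 e0 E; have [//|e3] : e <= 2 \/ 3 <= e by clear; lia.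
have [q Eq] := pow2_ge8 e e3.
by have [r [[Er _]|[Er _]]] := pow3_mod8_odd m m0; move: Er; rewrite E Eq; clear; lia.
Qed.

Lemma ppow_eq_prime p q n : zprime p -> zprime q -> 0 <= n -> p ^ n = q -> p = q /\ n = 1.
Proof.
move=> pp pq n0 E; have p2 := prime_ge_2 _ pp; have q2 := prime_ge_2 _ pq.
have n1 : 1 <= n.
  have [E0|//] : n = 0 \/ 1 <= n by clear - n0; lia.
  by move: E; rewrite E0 Z.pow_0_r; clear - q2; lia.
have pe : p = q.
  have : (p | q) by rewrite -E; apply: ppow_dvd.
  by move/(prime_div_prime _ _ pp pq).
split=> //; apply: (pow_inj p) => //; last by rewrite Z.pow_1_r E.
Qed.

(** A difference of squares. Its factors are powers of 2, the smaller being 2, so [c ^ w] and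
    [b ^ t] are [2 ^ n + 1] and [2 ^ n - 1]. One of these is divisible by 3, which makes [b] or [c]
    equal to 3. *)
Lemma special_yz b c x t w : zprime b -> zprime c -> 3 <= b -> 3 <= c ->
  1 <= x -> 1 <= t -> 1 <= w -> 2 ^ x + b ^ (2 * t) = c ^ (2 * w) ->
  b = 7 /\ c = 3 \/ b = 3 /\ c = 5.
Proof.
move=> bp cp b3 c3 x1 t1 w1 E.
have x0 : 0 <= x by clear - x1; lia.
have t0 : 0 <= t by clear - t1; lia.
have w0 : 0 <= w by clear - w1; lia.
have fac : (c ^ w - b ^ t) * (c ^ w + b ^ t) = 2 ^ x.
  have -> : 2 ^ x = c ^ (2 * w) - b ^ (2 * t) by rewrite -E; ring.
  by rewrite !(Z.mul_comm 2) !Z.pow_mul_r //; ring.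
have px : 0 < 2 ^ x by apply: Z.pow_pos_nonneg.
have pc : 3 <= c ^ w by have := pow_ge_base c w ltac:(clear - c3; lia) w1; clear - c3; lia.
have pb : 3 <= b ^ t by have := pow_ge_base b t ltac:(clear - b3; lia) t1; clear - b3; lia.
have d0 : 0 <= c ^ w - b ^ t by move: fac px pc pb; clear; nia.
have [i [i0 Ei]] := dvd_ppow 2 x (c ^ w - b ^ t) prime_2 x0 d0
  ltac:(exists (c ^ w + b ^ t); rewrite -fac; ring).
have [j [j0 Ej]] := dvd_ppow 2 x (c ^ w + b ^ t) prime_2 x0 ltac:(clear - pb pc; lia)
  ltac:(exists (c ^ w - b ^ t); rewrite -fac; ring).
have ob : Z.Odd (b ^ t).
  by apply/Z.odd_spec; rewrite Z.odd_pow; [apply/Z.odd_spec; exact: odd_prime | clear - t1; lia].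
have oc : Z.Odd (c ^ w).
  by apply/Z.odd_spec; rewrite Z.odd_pow; [apply/Z.odd_spec; exact: odd_prime | clear - w1; lia].
have i1 : i = 1.
  have [ii|[//|i2]] : i = 0 \/ i = 1 \/ 2 <= i by clear - i0; lia.
    by move: Ei; rewrite ii Z.pow_0_r; case: ob => u ->; case: oc => v ->; clear; lia.
  have Ei2 : 2 ^ i = 4 * 2 ^ (i - 2).
    have -> : 4 = 2 ^ 2 by []; rewrite -Z.pow_add_r; [f_equal| |]; clear - i2; lia.
  have j2 : 2 <= j.
    have [//|j2] : 2 <= j \/ j <= 1 by clear; lia.
    by have := pow_ge_mono 2 j 1 ltac:(by []) ltac:(clear - j0 j2; lia); rewrite -Ej; clear - pb pc; lia.
  have Ej2 : 2 ^ j = 4 * 2 ^ (j - 2).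
    have -> : 4 = 2 ^ 2 by []; rewrite -Z.pow_add_r; [f_equal| |]; clear - j2; lia.
  by move: Ei Ej; rewrite Ei2 Ej2; case: ob => u ->; case: oc => v ->; clear; lia.
have j2 : 2 <= j.
  have [//|j2] : 2 <= j \/ j <= 1 by clear; lia.
  by have := pow_ge_mono 2 j 1 ltac:(by []) ltac:(clear - j0 j2; lia); rewrite -Ej; clear - pb pc; lia.
have Ej2 : 2 ^ j = 2 * 2 ^ (j - 1).
  by have {1}-> : j = Z.succ (j - 1); [clear; lia | rewrite Z.pow_succ_r //; clear - j2; lia].
rewrite i1 Z.pow_1_r in Ei.
have Ec : c ^ w = 2 ^ (j - 1) + 1 by move: Ei Ej; rewrite Ej2; clear; lia.
have Eb : b ^ t = 2 ^ (j - 1) - 1 by move: Ei Ej; rewrite Ej2; clear; lia.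
have [d3 dm] := (mod3_pow2 (j - 1) ltac:(clear - j2; lia), pow_m1 (j - 1) ltac:(clear - j2; lia)).
have [ev|od] := Z.Even_or_Odd (j - 1).
  rewrite (proj1 dm ev) -Eb in d3; right.
  have Eb3 : b = 3 by move/(zprime_dvd_pow 3 _ _ prime_3 t0)/(prime_div_prime _ _ prime_3 bp): d3.
  rewrite Eb3 in Eb; split=> //.
  have := pow3_eq_pow2_pred t (j - 1) t0 ltac:(clear - j2; lia) Eb => jj.
  have j3 : j - 1 = 2.
    have [E1|//] : j - 1 = 1 \/ j - 1 = 2 by clear - jj j2; lia.
    by case: ev => u; rewrite E1; clear; lia.
  rewrite j3 in Ec; have [] := ppow_eq_prime c 5 w cp _ w0 Ec => //.
  by apply: prime_intro => // n n5; apply/Zgcd_1_rel_prime; have [->|[->|[->|->]]] : n = 1 \/ n = 2 \/ n = 3 \/ n = 4 by clear - n5; lia.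
rewrite (proj2 dm od) in d3; left.
have Ec3 : c = 3.
  have : (3 | c ^ w) by rewrite Ec; move: d3; congr (_ | _); ring.
  by move/(zprime_dvd_pow 3 _ _ prime_3 w0)/(prime_div_prime _ _ prime_3 cp).
split=> //; rewrite Ec3 in Ec.
have [[_ ee]|[_ ee]] := pow3_eq_pow2_succ w (j - 1) w0 ltac:(clear - j2; lia) Ec.
  by move: Eb pb; rewrite ee; clear; lia.
rewrite ee in Eb; have [] := ppow_eq_prime b 7 t bp _ t0 Eb => //.
by apply: prime_intro => // n n5; apply/Zgcd_1_rel_prime; have [->|[->|[->|[->|[->|->]]]]] : n = 1 \/ n = 2 \/ n = 3 \/ n = 4 \/ n = 5 \/ n = 6 by clear - n5; lia.
Qed.

(** Here the factors are powers of [b] without common divisor, so [c ^ w = 2 ^ u + 1] and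
    [b ^ y = 2 ^ (u + 1) + 1]. One of the exponents [u], [u + 1] is odd, and the corresponding prime
    is 3. The value [b = 17] belongs to [64 + 17 = 81]. *)
Lemma special_xz b c u y w : zprime b -> zprime c -> 3 <= b -> 3 <= c ->
  1 <= u -> 1 <= y -> 1 <= w -> 2 ^ (2 * u) + b ^ y = c ^ (2 * w) ->
  [\/ b = 5 /\ c = 3, b = 17 /\ c = 3 /\ u = 3 /\ y = 1 /\ w = 2 | b = 3 /\ c = 5].
Proof.
move=> bp cp b3 c3 u1 y1 w1 E.
have u0 : 0 <= u by clear - u1; lia.
have y0 : 0 <= y by clear - y1; lia.
have w0 : 0 <= w by clear - w1; lia.
have fac : (c ^ w - 2 ^ u) * (c ^ w + 2 ^ u) = b ^ y.
  have -> : b ^ y = c ^ (2 * w) - 2 ^ (2 * u) by rewrite -E; ring.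
  by rewrite !(Z.mul_comm 2) !Z.pow_mul_r //; ring.
have px : 0 < b ^ y by apply: Z.pow_pos_nonneg; clear - b3 y0; lia.
have pc : 0 < c ^ w by apply: Z.pow_pos_nonneg; clear - c3 w0; lia.
have pu : 0 < 2 ^ u by apply: Z.pow_pos_nonneg.
have d0 : 0 <= c ^ w - 2 ^ u by move: fac px pc pu; clear; nia.
have [i [i0 Ei]] := dvd_ppow b y (c ^ w - 2 ^ u) bp y0 d0
  ltac:(exists (c ^ w + 2 ^ u); rewrite -fac; ring).
have [j [j0 Ej]] := dvd_ppow b y (c ^ w + 2 ^ u) bp y0 ltac:(clear - pu pc; lia)
  ltac:(exists (c ^ w - 2 ^ u); rewrite -fac; ring).
have nb2 n : 0 <= n -> ~ (b | 2 ^ n).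
  by move=> n0; apply: prime_ndvd_pow => //; [exact: prime_2 | clear - b3; lia].
have i1 : i = 0.
  have [//|i1] : i = 0 \/ 1 <= i by clear - i0; lia.
  have j1 : 1 <= j.
    have [j00|//] : j = 0 \/ 1 <= j by clear - j0; lia.
    by have := pow_ge_base b i ltac:(clear - b3; lia) i1; move: Ej; rewrite j00 Z.pow_0_r -Ei; clear - pc pu b3; lia.
  case: (nb2 (Z.succ u) ltac:(clear - u0; lia)); rewrite Z.pow_succ_r //.
  have -> : 2 * 2 ^ u = b ^ j - b ^ i by rewrite -Ei -Ej; ring.
  by apply: Z.divide_sub_r; apply: ppow_dvd.
rewrite i1 Z.pow_0_r in Ei; rewrite Ei Z.mul_1_l in fac.
have Ec : c ^ w = 2 ^ u + 1 by move: Ei; clear; lia.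
have Eb : b ^ y = 2 ^ (Z.succ u) + 1 by rewrite Z.pow_succ_r // -fac Ec; ring.
have dvd3 p n v : zprime p -> 0 <= n -> 0 <= v -> Z.Odd v -> p ^ n = 2 ^ v + 1 -> p = 3.
  move=> pp n0 v0 ov Ep.
  have : (3 | p ^ n).
    by have := mod3_pow2 v v0; rewrite Ep (proj2 (pow_m1 v v0) ov); congr (_ | _); ring.
  by move/(zprime_dvd_pow 3 _ _ prime_3 n0)/(prime_div_prime _ _ prime_3 pp).
have p5 : zprime 5.
  by apply: prime_intro => // n n5; apply/Zgcd_1_rel_prime; have [->|[->|[->|->]]] : n = 1 \/ n = 2 \/ n = 3 \/ n = 4 by clear - n5; lia.
have [[v Ev]|od] := Z.Even_or_Odd u.
  have b3' : b = 3 by apply: (dvd3 b y (Z.succ u)) => //; [clear - u0; lia | exists v; clear - Ev; lia].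
  rewrite b3' in Eb.
  have [[_ uu]|[_ uu]] := pow3_eq_pow2_succ y (Z.succ u) y0 ltac:(clear - u0; lia) Eb; first by clear - uu u1; lia.
  have u2 : u = 2 by clear - uu; lia.
  by rewrite u2 in Ec; have [] := ppow_eq_prime c 5 w cp p5 w0 Ec; constructor 3.
have c3' : c = 3 by apply: (dvd3 c w u).
rewrite c3' in Ec.
have [[_ uu]|[ww uu]] := pow3_eq_pow2_succ w u w0 u1 Ec.
  by rewrite uu in Eb; have [] := ppow_eq_prime b 5 y bp p5 y0 Eb; constructor 1.
have p17 : zprime 17.
  apply: prime_intro => // n n5; apply/Zgcd_1_rel_prime.
  have : List.In n (List.map Z.of_nat (List.seq 1 16)).
    by rewrite List.in_map_iff; exists (Z.to_nat n); split; [|apply/List.in_seq]; clear - n5; lia.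
  by move=> /= H; repeat case: H => [<- //|H].
by rewrite uu in Eb; have [] := ppow_eq_prime b 17 y bp p17 y0 Eb; constructor 2.
Qed.

(** * The case a = 2, c = 3 *)

Lemma pow_congr m a r n : 0 <= n -> (m | a - r) -> (m | a ^ n - r ^ n).
Proof.
move=> n0 d; rewrite -(Z2Nat.id n) //; elim: (Z.to_nat n) => [|k IH].
  by rewrite !Z.pow_0_r; exists 0.
rewrite Nat2Z.inj_succ !Z.pow_succ_r; [|clear; lia|clear; lia].
have -> : a * a ^ Z.of_nat k - r * r ^ Z.of_nat k =
  (a - r) * a ^ Z.of_nat k + r * (a ^ Z.of_nat k - r ^ Z.of_nat k) by ring.
by apply: Z.divide_add_r; [apply: dvd_mul_l | apply: dvd_mul_r].
Qed.

Lemma mod3_unit b : ~ (3 | b) -> (3 | b - 1) \/ (3 | b - (-1)).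
Proof.
move=> n3; have H := Z.div_mod b 3 ltac:(by []); have B := Z.mod_pos_bound b 3 ltac:(by []).
have [E|[E|E]] : b mod 3 = 0 \/ b mod 3 = 1 \/ b mod 3 = 2 by clear - B; lia.
- by case: n3; exists (b / 3); move: H; rewrite E; clear; lia.
- by left; exists (b / 3); move: H; rewrite E; clear; lia.
- by right; exists (b / 3 + 1); move: H; rewrite E; clear; lia.
Qed.

Lemma zprime5 : zprime 5.
Proof.
apply: prime_intro => // n n5; apply/Zgcd_1_rel_prime.
by have [->|[->|[->|->]]] : n = 1 \/ n = 2 \/ n = 3 \/ n = 4 by clear - n5; lia.
Qed.

Lemma sq_pow p n : 0 <= n -> (p ^ n) ^ 2 = p ^ (2 * n).
Proof. by move=> n0; rewrite (Z.mul_comm 2) Z.pow_mul_r. Qed.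

Lemma half_even x : 1 <= x -> Z.Even x -> exists2 s, 1 <= s & x = 2 * s.
Proof. by move=> x1 [s Es]; exists s; [clear - x1 Es; lia |]. Qed.
Lemma half_odd x : 1 <= x -> Z.Odd x -> exists2 s, 0 <= s & x = 2 * s + 1.
Proof. by move=> x1 [s Es]; exists s; [clear - x1 Es; lia |]. Qed.

Lemma pow_dbl_succ p n : 0 <= n -> p ^ (2 * n + 1) = p * (p ^ n) ^ 2.
Proof. by move=> n0; rewrite sq_pow // Z.add_1_r Z.pow_succ_r //; clear - n0; lia. Qed.

Lemma pow2_even x : 1 <= x -> exists q, 2 ^ x = 2 * q.
Proof.
move=> x1; exists (2 ^ (x - 1)); rewrite -Z.pow_succ_r; last by clear - x1; lia.
by f_equal; clear; lia.
Qed.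
Lemma pow2_div4 x : 2 <= x -> exists q, 2 ^ x = 4 * q.
Proof.
move=> x2; exists (2 ^ (x - 2)); have -> : 4 = 2 ^ 2 by [].
by rewrite -Z.pow_add_r; [f_equal| |]; clear - x2; lia.
Qed.

(** The form takes the value 3 at [S = T = 1], so the sequence has [P = 2] and [Q = 1]. Its only
    nontrivial index with [w = 1] or [-1] has [u = -5]. *)
Lemma oe_c3 b s t z : zprime b -> 5 <= b -> 0 <= s -> 1 <= t -> 1 <= z -> Z.Odd z ->
  2 * (2 ^ s) ^ 2 + (b ^ t) ^ 2 = 3 ^ z -> b = 5.
Proof.
move=> bp b5 s0 t1 z1 oz E.
have c3 : 3 <= 3 by [].
have b3 : 3 <= b by clear - b5; lia.
have bc : b <> 3 by clear - b5; lia.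
have d12 : 2 = 1 \/ 2 = 2 by right.
have e1b : 1 = 1 \/ 1 = b by left.
have t0 : 0 <= t by clear - t1; lia.
have E' : 2 * (2 ^ s) ^ 2 + 1 * (b ^ t) ^ 2 = 3 ^ z by rewrite Z.mul_1_l.
have r := orep_sol b 3 2 1 1 prime_3 c3 bp b3 bc d12 e1b (or_introl erefl) s t z s0 t0 (or_introl erefl) E'.
have base : orep 3 2 1 1 1 1 1.
  by split; [| case/Z.divide_1_r | case/Z.divide_1_r | exists 0 | split; exists 1].
have [k [j [ES [j0 ET] Ew Eu [Ez kk]]]] := odd_power b 3 2 1 1 prime_3 c3 bp b3 bc d12 e1b (or_introl erefl)
  1 1 1 base ltac:(by []) (fun _ _ _ _ _ H => H) s t z s0 t0 r (or_introl oz) z1.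
have j00 : j = 0.
  have [//|j1] : j = 0 \/ 1 <= j by clear - j0; lia.
  by have := pow_ge_base b j ltac:(clear - b5; lia) j1; rewrite -ET; clear - b5; lia.
rewrite j00 Z.pow_0_r Z.mul_1_l in Eu.
have [k0|k1] := w_unit_small 2 k ltac:(by left) Ew.
  move: Eu; rewrite k0 => Eu; have := pow_ge_base b t ltac:(clear - b5; lia) t1.
  by rewrite Eu; clear - b5; rewrite /u_ /=; lia.
have Eu5 : b ^ t = 5 by rewrite Eu k1.
by have [] := ppow_eq_prime b 5 t bp zprime5 t0 Eu5.
Qed.

Lemma even_odd_odd b : Z.Even b -> Z.Odd b -> False.
Proof. by case=> k -> [j]; lia. Qed.

(** Once odd [x] with even [y] is excluded, the residue of [b] modulo 3 fixes both parities. For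
    even [x] the class lemma needs [z] odd; an even [z] is a difference of squares and leaves only
    [64 + 17 = 81], and for [b = 17] odd [z] is impossible modulo 4. *)
Lemma c3_unique b x y z x' y' z' : zprime b -> 5 <= b -> b <> 5 -> b <> 7 ->
  1 <= x -> 1 <= y -> 1 <= z -> 1 <= x' -> 1 <= y' -> 1 <= z' ->
  2 ^ x + b ^ y = 3 ^ z -> 2 ^ x' + b ^ y' = 3 ^ z' -> [/\ x = x', y = y' & z = z'].
Proof.
move=> bp b5 nb5 nb7.
have b3 : 3 <= b by clear - b5; lia.
have oe_no x0 y0 z0 : 1 <= x0 -> 1 <= y0 -> 1 <= z0 -> Z.Odd x0 -> Z.Even y0 ->
    2 ^ x0 + b ^ y0 <> 3 ^ z0.
  move=> x1 y1 z1 ox ey E.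
  have [t t1 Ey] := half_even _ y1 ey; have [s s0 Ex] := half_odd _ x1 ox.
  have [ez|oz] := Z.Even_or_Odd z0.
    have [w w1 Ew] := half_even _ z1 ez; move: E; rewrite Ew Ey => E.
    by case: (special_yz b 3 x0 t w bp prime_3 b3 ltac:(by []) x1 t1 w1 E) => -[]; clear - b5 nb7; lia.
  apply: nb5; apply: (oe_c3 b s t z0) => //.
  by rewrite -E Ex Ey pow_dbl_succ // (sq_pow b) //; clear - t1; lia.
have nb0 : ~ (3 | b).
  by move/(prime_div_prime _ _ prime_3 bp); clear - b5; lia.
have m3 x0 y0 z0 r : 1 <= x0 -> 1 <= y0 -> 1 <= z0 -> (3 | b - r) -> 2 ^ x0 + b ^ y0 = 3 ^ z0 ->
    (3 | (-1) ^ x0 + r ^ y0).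
  move=> x1 y1 z1 br E.
  have -> : (-1) ^ x0 + r ^ y0 = 3 ^ z0 - (2 ^ x0 - (-1) ^ x0) - (b ^ y0 - r ^ y0) by rewrite -E; ring.
  apply: Z.divide_sub_r; first apply: Z.divide_sub_r.
  - exact: ppow_dvd.
  - by apply: mod3_pow2; clear - x1; lia.
  - by apply: pow_congr => //; clear - y1; lia.
case: (mod3_unit b nb0) => br.
  have cls x0 y0 z0 : 1 <= x0 -> 1 <= y0 -> 1 <= z0 -> 2 ^ x0 + b ^ y0 = 3 ^ z0 -> Z.Odd x0 /\ Z.Odd y0.
    move=> x1 y1 z1 E; have := m3 _ _ _ _ x1 y1 z1 br E.
    rewrite Z.pow_1_l; last by clear - y1; lia.
    have [px pox] := pow_m1 x0 ltac:(clear - x1; lia).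
    have [ex|ox] := Z.Even_or_Odd x0; first by rewrite px // => -[q]; clear; lia.
    have [ey|//] := Z.Even_or_Odd y0.
    by case: (oe_no x0 y0 z0 x1 y1 z1 ox ey E).
  move=> x1 y1 z1 x1' y1' z1' E E'.
  have [ox oy] := cls _ _ _ x1 y1 z1 E; have [ox' oy'] := cls _ _ _ x1' y1' z1' E'.
  have [s s0 Ex] := half_odd _ x1 ox; have [t t0 Ey] := half_odd _ y1 oy.
  have [s' s0' Ex'] := half_odd _ x1' ox'; have [t' t0' Ey'] := half_odd _ y1' oy'.
  move: E E'; rewrite Ex Ey Ex' Ey' !pow_dbl_succ // => E E'.
  have bn1 : b <> 1 by clear - b5; lia.
  have [-> -> ->] : [/\ s = s', t = t' & z = z'].
    apply: (unique_in_class b 3 2 b) => //; try exact: prime_3; try (by right); try (by auto);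
      try (by move/bn1); by clear - b5; lia.
  by [].
have cls x0 y0 z0 : 1 <= x0 -> 1 <= y0 -> 1 <= z0 -> 2 ^ x0 + b ^ y0 = 3 ^ z0 -> Z.Even x0 /\ Z.Odd y0.
  move=> x1 y1 z1 E; have := m3 _ _ _ _ x1 y1 z1 br E.
  have [px pox] := pow_m1 x0 ltac:(clear - x1; lia).
  have [py poy] := pow_m1 y0 ltac:(clear - y1; lia).
  have [ex|ox] := Z.Even_or_Odd x0; have [ey|oy] := Z.Even_or_Odd y0 => //.
  - by rewrite px // py // => -[q]; clear; lia.
  - by case: (oe_no x0 y0 z0 x1 y1 z1 ox ey E).
  - by rewrite pox // poy // => -[q]; clear; lia.
have b17 x0 y0 z0 : 1 <= x0 -> 1 <= y0 -> 1 <= z0 -> 2 ^ x0 + b ^ y0 = 3 ^ z0 -> Z.Even z0 ->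
    [/\ b = 17, x0 = 6, y0 = 1 & z0 = 4].
  move=> x1 y1 z1 E ez; have [ex oy] := cls _ _ _ x1 y1 z1 E.
  have [w w1 Ew] := half_even _ z1 ez; have [u u1 Eu] := half_even _ x1 ex.
  move: E; rewrite Ew Eu => E.
  case: (special_xz b 3 u y0 w bp prime_3 b3 ltac:(by []) u1 y1 w1 E) => [[e5 _]|[-> [_ [-> [-> ->]]]]|[e3 _]].
  - by case: nb5.
  - by [].
  - by exfalso; clear - b5 e3; lia.
have od17 x0 y0 z0 : b = 17 -> 1 <= x0 -> 1 <= y0 -> 1 <= z0 -> 2 ^ x0 + b ^ y0 = 3 ^ z0 -> Z.Even z0.
  move=> Eb x1 y1 z1 E; have [//|oz] := Z.Even_or_Odd z0; exfalso.
  have [ex oy] := cls _ _ _ x1 y1 z1 E.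
  have [u u1 Eu] := half_even _ x1 ex.
  have [q Eq] := pow2_div4 x0 ltac:(clear - Eu u1; lia).
  have [r Er] : (8 | b ^ y0 - 1 ^ y0) by apply: pow_congr; [clear - y1; lia | rewrite Eb; exists 2].
  rewrite Z.pow_1_l in Er; last by clear - y1; lia.
  have [m [[_ em]|[Em _]]] := pow3_mod8_odd z0 ltac:(clear - z1; lia).
    exact: (even_odd_odd _ em oz).
  by move: E; rewrite Eq Em; move: Er; clear; lia.
move=> x1 y1 z1 x1' y1' z1' E E'.
have both : b = 17 -> [/\ x = x', y = y' & z = z'].
  move=> Eb; have [_ -> -> ->] := b17 _ _ _ x1 y1 z1 E (od17 _ _ _ Eb x1 y1 z1 E).
  by have [_ -> -> ->] := b17 _ _ _ x1' y1' z1' E' (od17 _ _ _ Eb x1' y1' z1' E').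
have [ez|oz] := Z.Even_or_Odd z; first by have [Eb _ _ _] := b17 _ _ _ x1 y1 z1 E ez; apply: both.
have [ez'|oz'] := Z.Even_or_Odd z'; first by have [Eb _ _ _] := b17 _ _ _ x1' y1' z1' E' ez'; apply: both.
have [ex oy] := cls _ _ _ x1 y1 z1 E; have [ex' oy'] := cls _ _ _ x1' y1' z1' E'.
have [s s0 Ex] := half_even _ x1 ex; have [t t0 Ey] := half_odd _ y1 oy.
have [s' s0' Ex'] := half_even _ x1' ex'; have [t' t0' Ey'] := half_odd _ y1' oy'.
have s00 : 0 <= s by clear - s0; lia.
have s00' : 0 <= s' by clear - s0'; lia.
move: E E'; rewrite Ex Ey Ex' Ey' !pow_dbl_succ // -!sq_pow // => E E'.
have [-> -> ->] : [/\ s = s', t = t' & z = z'].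
  apply: (unique_in_class b 3 1 b) => //; try exact: prime_3; try (by right); try (by left);
    try (by rewrite Z.mul_1_l); by clear - b5; lia.
by [].
Qed.

(** * The case a = 2, b = 3 *)

Lemma rep_prime_units c delta eps S T : zprime c -> ~ (c | eps) -> Z.Odd T -> 0 < delta -> 0 < eps ->
  delta * S ^ 2 + eps * T ^ 2 = c -> ~ (c | S) /\ ~ (c | T).
Proof.
move=> cp nce oT d0 e0 E; have c2 := prime_ge_2 _ cp.
have nT : ~ (c | T).
  case=> q Eq; have q0 : q <> 0 by move: oT Eq => [k ->] Eq q0; rewrite q0 in Eq; clear - Eq; lia.
  have S0 : 0 <= S ^ 2 by rewrite Z.pow_2_r; clear; nia.
  have q1 : 1 <= q ^ 2 by rewrite Z.pow_2_r; clear - q0; nia.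
  move: E; rewrite Eq; have -> : (q * c) ^ 2 = q ^ 2 * (c * c) by ring.
  have : 0 <= delta * S ^ 2 by apply: Z.mul_nonneg_nonneg => //; clear - d0; lia.
  move: (delta * S ^ 2) (q ^ 2) q1 => X Y Y1 X0 E.
  have eY : 1 <= eps * Y by clear - e0 Y1; nia.
  have cc : 2 * c <= c * c by clear - c2; nia.
  have : 1 * (c * c) <= eps * Y * (c * c) by apply: Z.mul_le_mono_nonneg_r => //; clear - c2; nia.
  by move: E; rewrite Z.mul_assoc; move: (eps * Y * (c * c)) => V; clear - X0 c2 cc; lia.
split=> // cS; apply: nT.
have : (c | eps * T ^ 2).
  have -> : eps * T ^ 2 = c - delta * S ^ 2 by rewrite -E; ring.
  by apply: Z.divide_sub_r; [exists 1; ring | apply: dvd_mul_r; rewrite Z.pow_2_r; apply: dvd_mul_l].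
by case/(prime_mult _ cp) => // H; apply: (zprime_dvd_pow c T 2).
Qed.

(** Two classes of forms exist in discriminant -24, and a prime congruent to 2 modulo 3 is not a
    value of [X ^ 2 + 6 Y ^ 2]. Each multiple [m c] supplied by Thue's lemma is transformed by hand
    into the other form or excluded. *)
Lemma form6 c x y m : (3 | c + 1) -> Z.Odd c -> x ^ 2 + 6 * y ^ 2 = m * c -> 1 <= m <= 6 ->
  exists S T, 2 * S ^ 2 + 3 * T ^ 2 = c.
Proof.
move=> [q Eq] [r Er].
rewrite !Z.pow_2_r => E m6.
have m3 z : exists a b, z * z = 3 * a + b /\ (b = 0 /\ (exists z', z = 3 * z') \/ b = 1).
  have H := Z.div_mod z 3 ltac:(by []); have B := Z.mod_pos_bound z 3 ltac:(by []).
  move: H B; move: (z / 3) (z mod 3) => d e -> B.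
  have [->|[->|->]] : e = 0 \/ e = 1 \/ e = 2 by clear - B; lia.
  - by exists (3 * d * d), 0; split; [ring | left; split=> //; exists d; ring].
  - by exists (3 * d * d + 2 * d), 1; split; [ring | right].
  - by exists (3 * d * d + 4 * d + 1), 1; split; [ring | right].
have no1 X Y : X * X + 6 * (Y * Y) <> c.
  by have [a [b [-> H]]] := m3 X; move: (Y * Y) => YY; move: H Eq; clear; lia.
have even2 z w : z * z = 2 * w -> exists z', z = 2 * z'.
  by have [[d ->]|[d ->]] := Z.Even_or_Odd z; [exists d | clear; nia].
have [E1|[E1|[E1|[E1|[E1|E1]]]]] : m = 1 \/ m = 2 \/ m = 3 \/ m = 4 \/ m = 5 \/ m = 6 by clear - m6; lia.
- by case: (no1 x y); rewrite E E1; ring.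
- have [x' Ex] := even2 x (c - 3 * (y * y)) ltac:(move: E; rewrite E1; clear; lia).
  by exists x', y; rewrite !Z.pow_2_r; move: E; rewrite E1 Ex; clear; lia.
- have [a [b [Ea [[_ [x' Ex]]|b1]]]] := m3 x.
    by exists y, x'; rewrite !Z.pow_2_r; move: E; rewrite E1 Ex; clear; lia.
  by exfalso; move: E Ea; rewrite E1 b1; move: (y * y) => yy; clear; lia.
- have [x' Ex] := even2 x (2 * c - 3 * (y * y)) ltac:(move: E; rewrite E1; clear; lia).
  have [y' Ey] : exists y', y = 2 * y'.
    have [[d ->]|[d Ed]] := Z.Even_or_Odd y; first by exists d.
    exfalso; move: E; rewrite E1 Ex Ed; clear.
    by have : exists u, u = x' * x' - c + 6 * d * d + 6 * d; [eexists; reflexivity | case=> u; lia].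
  by case: (no1 x' y'); move: E; rewrite E1 Ex Ey; clear; lia.
- have p5 : (5 | (x - 2 * y) * (x + 2 * y)).
    by exists (c - 2 * (y * y)); move: E; rewrite E1; clear; lia.
  case/(prime_mult _ zprime5): p5 => -[v Ev].
    exists (v + y), v; have -> : c = 2 * (v + y) ^ 2 + 3 * v ^ 2; last by [].
    have {Ev} Ex : x = 5 * v + 2 * y by clear - Ev; lia.
    by move: E; rewrite E1 Ex !Z.pow_2_r; clear; lia.
  exists (v - y), v; have -> : c = 2 * (v - y) ^ 2 + 3 * v ^ 2; last by [].
  have {Ev} Ex : x = 5 * v - 2 * y by clear - Ev; lia.
  by move: E; rewrite E1 Ex !Z.pow_2_r; clear; lia.
- have [a [b [Ea [[_ [x3 Ex3]]|b1]]]] := m3 x; last first.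
    by exfalso; move: E Ea; rewrite E1 b1; move: (y * y) => yy; clear; lia.
  have [x' Ex] := even2 x3 (c - y * y - x3 * x3)
     ltac:(move: E; rewrite E1 Ex3; clear; lia).
  by case: (no1 y x'); move: E; rewrite E1 Ex3 Ex; clear; lia.
Qed.

Lemma pow_odd_congr m c r z : 1 <= z -> Z.Odd z -> (m | c - r) -> r * r = 1 -> (m | c ^ z - r).
Proof.
move=> z1 [k Ek] d r2.
have <- : r ^ z = r.
  rewrite Ek Z.pow_add_r; [|clear - Ek z1; lia|by []].
  rewrite Z.pow_mul_r //; last by clear - Ek z1; lia.
  by rewrite Z.pow_2_r r2 Z.pow_1_l; [ring | clear - Ek z1; lia].
by apply: pow_congr => //; clear - z1; lia.
Qed.

Lemma pow_odd_mod8 c z : 1 <= z -> Z.Odd z -> Z.Odd c -> (8 | c ^ z - c).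
Proof.
move=> z1 [k Ek] oc.
have -> : c ^ z - c = c * ((c * c) ^ k - 1 ^ k).
  rewrite Ek Z.pow_add_r; [|clear - Ek z1; lia|by []].
  rewrite Z.pow_mul_r //; last by clear - Ek z1; lia.
  by rewrite Z.pow_2_r Z.pow_1_l; [ring | clear - Ek z1; lia].
apply: dvd_mul_r; apply: pow_congr; first by clear - Ek z1; lia.
case: oc => j ->; have [[i ->]|[i ->]] := Z.Even_or_Odd j.
  by exists (i * (2 * i + 1)); ring.
by exists ((i + 1) * (2 * i + 1)); ring.
Qed.

Lemma pow9_mod8 t : 0 <= t -> (8 | (3 ^ t) ^ 2 - 1).
Proof. by move=> t0; rewrite sq_pow //; apply: pow3_mod8. Qed.

(** For [t' >= 1] the equation modulo 9 makes 3 divide [s'], so [4 ^ s'] is a power of 64, which is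
    1 modulo 63. Modulo 7 this leaves [9 ^ t = 3 * 9 ^ t'], impossible since 3 is not a square
    there. *)
Lemma b3_final t s' t' : 1 <= t -> 1 <= s' -> 0 <= t' ->
  2 + (3 ^ t) ^ 2 = 2 * (2 ^ s') ^ 2 + 3 * (3 ^ t') ^ 2 -> t = 1.
Proof.
move=> t1 s1 t0' E.
have t0 : 0 <= t by clear - t1; lia.
have s0' : 0 <= s' by clear - s1; lia.
have [Et|t1'] : t' = 0 \/ 1 <= t' by clear - t0'; lia.
  have H : 3 ^ (2 * t) = 2 ^ (2 * s' + 1) + 1.
    by rewrite pow_dbl_succ // -sq_pow //; move: E; rewrite Et Z.pow_0_r Z.pow_1_l //; clear; lia.
  by case: (pow3_eq_pow2_succ (2 * t) (2 * s' + 1) ltac:(clear - t0; lia) ltac:(clear - s1; lia) H);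
    clear; lia.
exfalso.
have p9 n : 1 <= n -> exists q, (3 ^ n) ^ 2 = 9 * q.
  move=> n1; have [q Eq] := ppow_dvd 3 n n1; exists (q ^ 2); rewrite Eq; ring.
have [q Eq] := p9 t t1; have [q' Eq'] := p9 t' t1'.
have nn : s' = 3 * (s' / 3) + s' mod 3 by apply: Z.div_mod.
have rr := Z.mod_pos_bound s' 3 ltac:(by []).
have n0 : 0 <= s' / 3 by apply: Z.div_pos; [clear - s0'; lia|].
move: nn rr n0; move: (s' / 3) (s' mod 3) => n r Es rr n0.
have E4 : (2 ^ s') ^ 2 = 64 ^ n * 4 ^ r.
  rewrite sq_pow // Es Z.mul_add_distr_l Z.pow_add_r; [|clear - n0; lia|clear - rr; lia].
  by rewrite (_ : 2 * (3 * n) = 6 * n) ?Z.pow_mul_r //; [clear - rr; lia | clear; ring].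
have [j Ej] : (63 | 64 ^ n - 1 ^ n) by apply: pow_congr => //; exists 1.
rewrite Z.pow_1_l // in Ej.
have r0 : r = 0.
  have [//|[rr'|rr']] : r = 0 \/ r = 1 \/ r = 2 by clear - rr; lia.
    by move: E; rewrite E4 rr' Eq Eq' Z.pow_1_r; move: Ej; clear; lia.
  have -> : r = 2 by [].
  by exfalso; move: E; rewrite E4 rr' Eq Eq' Z.pow_2_r; move: Ej; clear; lia.
rewrite r0 Z.pow_0_r Z.mul_1_r in E4.
have p7 m : 0 <= m -> exists i, [\/ (3 ^ m) ^ 2 = 7 * i + 1, (3 ^ m) ^ 2 = 7 * i + 2 | (3 ^ m) ^ 2 = 7 * i + 4].
  move=> m0; rewrite -(Z2Nat.id m) //; elim: (Z.to_nat m) => [|l [i IH]]; first by exists 0; constructor 1.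
  rewrite Nat2Z.inj_succ Z.pow_succ_r; last by clear; lia.
  have -> : (3 * 3 ^ Z.of_nat l) ^ 2 = 9 * (3 ^ Z.of_nat l) ^ 2 by ring.
  case: IH => ->; [exists (9 * i + 1); constructor 2 | exists (9 * i + 2); constructor 3 | exists (9 * i + 5); constructor 1]; ring.
have [i1 H1] := p7 t t0; have [i2 H2] := p7 t' t0'.
move: E; rewrite E4; move: Ej; move: (64 ^ n) => X Ej E.
by case: H1 => H1; case: H2 => H2; move: E; rewrite H1 H2; move: Ej; clear; lia.
Qed.

(** Two different forms, both representing odd powers of [c]. In each of them [c] itself is
    represented, so both exponents are 1, and the two values of [c] can be compared directly. The
    excluded 11 is [2 + 9 = 8 + 3]. *)
Lemma b3_cross c s t z s' t' z' : zprime c -> 5 <= c -> c <> 11 -> (3 | c + 1) ->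
  0 <= s -> 1 <= t -> 1 <= z -> Z.Odd z -> 0 <= s' -> 0 <= t' -> 1 <= z' -> Z.Odd z' ->
  2 * (2 ^ s) ^ 2 + (3 ^ t) ^ 2 = c ^ z -> 2 * (2 ^ s') ^ 2 + 3 * (3 ^ t') ^ 2 = c ^ z' -> False.
Proof.
move=> cp c5 n11 c2m s0 t1 z1 oz s0' t0' z1' oz' E E'.
have c3 : 3 <= c by clear - c5; lia.
have oc := odd_prime c cp c3.
have t0 : 0 <= t by clear - t1; lia.
have p4 n : 1 <= n -> exists q, (2 ^ n) ^ 2 = 4 * q.
  by move=> n1; have [q Eq] := ppow_dvd 2 n n1; exists (q ^ 2); rewrite Eq; ring.
have [[q1 C1] [q2 C2]] := (pow_odd_mod8 c z z1 oz oc, pow_odd_mod8 c z' z1' oz' oc).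
have [[r1 R1] [r2 R2]] := (pow9_mod8 t t0, pow9_mod8 t' t0').
(* Odd powers of [c] are congruent to [c] modulo 8. The first form gives 3 or 1 and the second 5 or
   3; the common value 3 needs [s = 0] and [s' >= 1]. *)
have [s00 s1'] : s = 0 /\ 1 <= s'.
  have [a|a] : s = 0 \/ 1 <= s by clear - s0; lia.
    have [d|//] : s' = 0 \/ 1 <= s' by clear - s0'; lia.
    exfalso; move: E E'; rewrite a d Z.pow_0_r Z.pow_1_l //.
    by move: C1 C2 R1 R2; clear; lia.
  have [q Eq] := p4 s a; exfalso.
  have [d|d] : s' = 0 \/ 1 <= s' by clear - s0'; lia.
    move: E E'; rewrite d Z.pow_0_r Z.pow_1_l // Eq.
    by move: C1 C2 R1 R2; clear; lia.
  have [q' Eq'] := p4 s' d; move: E E'; rewrite Eq Eq'.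
  by move: C1 C2 R1 R2; clear; lia.
rewrite s00 in E.
have ndc3 : ~ (c | 3) by move/(prime_div_prime _ _ cp prime_3); clear - c5; lia.
have n2 n : 0 <= n -> ~ (c | 2 ^ n).
  by move=> n0; apply: prime_ndvd_pow => //; [exact: prime_2 | clear - c5; lia].
have n1 : ~ (c | 1) by move/Z.divide_1_r; clear - c5; lia.
have cz n : 1 <= n -> (c | c ^ n) by exact: ppow_dvd.
have bc : 3 <> c by clear - c5; lia.
have d12 : 2 = 1 \/ 2 = 2 by right.
(* Thue's lemma represents [c] itself, so the minimal exponent is 1. The degenerate alternative of
   [odd_power] would give [S0] and [T0] equal to 1 or -1, hence [c = 3]. *)
have Ez1 : z = 1.
  have d2 : (c | (3 ^ t) ^ 2 + 2 * 1 ^ 2).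
    have -> : (3 ^ t) ^ 2 + 2 * 1 ^ 2 = c ^ z by rewrite -E Z.pow_0_r; ring.
    exact: cz.
  have [x [y [m [Exy m12]]]] := thue c 2 (3 ^ t) 1 cp ltac:(by []) n1 d2.
  have [S [T EST]] : exists S T, 2 * S ^ 2 + 1 * T ^ 2 = c.
    have [m1|m2] : m = 1 \/ m = 2 by clear - m12; lia.
      by exists y, x; rewrite m1 in Exy; move: Exy; clear; lia.
    rewrite m2 in Exy.
    have [[d Ed]|[d Ed]] := Z.Even_or_Odd x.
      by exists d, y; rewrite Ed in Exy; move: Exy; rewrite !Z.pow_2_r; clear; lia.
    by exfalso; move: Exy; rewrite Ed Z.pow_2_r; move: (y ^ 2) => Y; clear; lia.
  have oT : Z.Odd T.
    have [[d Ed]|//] := Z.Even_or_Odd T; exfalso.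
    by move: EST oc; rewrite Ed => <- -[k]; rewrite !Z.pow_2_r; move: (S * S) => SS; clear; lia.
  have [cS cT] := rep_prime_units c 2 1 S T cp n1 oT ltac:(by []) ltac:(by []) EST.
  have base : orep c 2 1 1 S T 1.
    by split=> //; [rewrite EST Z.pow_1_r; ring | split; apply: Z.divide_1_l].
  have E1 : 2 * (2 ^ 0) ^ 2 + 1 * (3 ^ t) ^ 2 = c ^ z by rewrite -E; ring.
  have r := orep_sol 3 c 2 1 1 cp c3 prime_3 ltac:(by []) bc d12 (or_introl erefl) (or_introl erefl)
    0 t z ltac:(by []) t0 (or_introl erefl) E1.
  have [k [j [ES [j0 ET] Ew Eu [Ez kk]]]] := odd_power 3 c 2 1 1 cp c3 prime_3 ltac:(by []) bc d12
    (or_introl erefl) (or_introl erefl) S T 1 base ltac:(by []) (fun _ _ _ _ _ H => H) 0 t z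
    ltac:(by []) t0 r (or_introl oz) z1.
  case: kk => [k0|[_ jz]]; first by rewrite Ez k0.
  exfalso; move: EST; rewrite (sq_abs S) (sq_abs T) ES ET jz !Z.pow_0_r; clear - c5.
  by rewrite !Z.pow_1_l //; lia.
have Ez2 : z' = 1.
  have d6 : (c | (3 * 3 ^ t') ^ 2 + 6 * (2 ^ s') ^ 2).
    have -> : (3 * 3 ^ t') ^ 2 + 6 * (2 ^ s') ^ 2 = 3 * c ^ z' by rewrite -E'; ring.
    by apply: dvd_mul_r; exact: cz.
  have [x [y [m [Exy m16]]]] := thue c 6 (3 * 3 ^ t') (2 ^ s') cp ltac:(by []) (n2 s' s0') d6.
  have [S [T EST]] := form6 c x y m c2m oc Exy m16.
  have oT : Z.Odd T.
    have [[d Ed]|//] := Z.Even_or_Odd T; exfalso.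
    by move: EST oc; rewrite Ed => <- -[k]; rewrite !Z.pow_2_r; move: (S * S) => SS; clear; lia.
  have [cS cT] := rep_prime_units c 2 3 S T cp ndc3 oT ltac:(by []) ltac:(by []) EST.
  have base : orep c 2 3 1 S T 1.
    by split=> //; [rewrite EST Z.pow_1_r; ring | split; apply: Z.divide_1_l].
  have r := orep_sol 3 c 2 3 1 cp c3 prime_3 ltac:(by []) bc d12 (or_intror erefl) (or_introl erefl)
    s' t' z' s0' t0' (or_introl erefl) E'.
  have [k [j [ES [j0 ET] Ew Eu [Ez kk]]]] := odd_power 3 c 2 3 1 cp c3 prime_3 ltac:(by []) bc d12
    (or_intror erefl) (or_introl erefl) S T 1 base ltac:(by []) (fun _ _ _ _ _ H => H) s' t' z'
    s0' t0' r (or_introl oz') z1'.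
  by case: kk => [k0|[]//]; rewrite Ez k0.
rewrite Ez1 Ez2 Z.pow_1_r in E E'.
have tt : t = 1.
  apply: (b3_final t s' t') => //; rewrite E' -E Z.pow_0_r Z.pow_1_l //; clear; lia.
by apply: n11; rewrite -E tt.
Qed.

(** As [z] is odd, [c] modulo 3 determines the parity of [x]. Two solutions with different parities
    of [y] are separated modulo 4 when [x] is even, and fall under [b3_cross] when [x] is odd. *)
Lemma b3_unique c x y z x' y' z' : zprime c -> 5 <= c -> c <> 5 -> c <> 11 ->
  1 <= x -> 1 <= y -> 1 <= z -> 1 <= x' -> 1 <= y' -> 1 <= z' ->
  2 ^ x + 3 ^ y = c ^ z -> 2 ^ x' + 3 ^ y' = c ^ z' -> [/\ x = x', y = y' & z = z'].
Proof.
move=> cp c5 n5 n11.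
have c3 : 3 <= c by clear - c5; lia.
have oc := odd_prime c cp c3.
have nc3 : ~ (3 | c) by move/(prime_div_prime _ _ prime_3 cp); clear - c5; lia.
have bc : 3 <> c by clear - c5; lia.
have xz_no x0 y0 z0 : 1 <= x0 -> 1 <= y0 -> 1 <= z0 -> Z.Even x0 -> Z.Even z0 ->
    2 ^ x0 + 3 ^ y0 <> c ^ z0.
  move=> x1 y1 z1 ex ez E.
  have [w w1 Ew] := half_even _ z1 ez; have [u u1 Eu] := half_even _ x1 ex.
  move: E; rewrite Ew Eu => E.
  by case: (special_xz 3 c u y0 w prime_3 cp ltac:(by []) c3 u1 y1 w1 E) => [[]|[]|[_]].
have m3 x0 y0 z0 r : 1 <= x0 -> 1 <= y0 -> 1 <= z0 -> (3 | c - r) -> 2 ^ x0 + 3 ^ y0 = c ^ z0 ->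
    (3 | (-1) ^ x0 - r ^ z0).
  move=> x1 y1 z1 cr E.
  have -> : (-1) ^ x0 - r ^ z0 = (c ^ z0 - r ^ z0) - (2 ^ x0 - (-1) ^ x0) - 3 ^ y0 by rewrite -E; ring.
  apply: Z.divide_sub_r; first apply: Z.divide_sub_r.
  - by apply: pow_congr => //; clear - z1; lia.
  - by apply: mod3_pow2; clear - x1; lia.
  - exact: ppow_dvd.
move=> x1 y1 z1 x1' y1' z1' E E'.
have oz x0 y0 z0 : 1 <= x0 -> 1 <= y0 -> 1 <= z0 -> 2 ^ x0 + 3 ^ y0 = c ^ z0 -> Z.Odd z0.
  move=> x01 y01 z01 E0; have [ez|//] := Z.Even_or_Odd z0.
  have [ex|ox] := Z.Even_or_Odd x0; first by case: (xz_no x0 y0 z0).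
  have [px pox] := pow_m1 x0 ltac:(clear - x01; lia).
  have [pz poz] := pow_m1 z0 ltac:(clear - z01; lia).
  case: (mod3_unit c nc3) => cr; have := m3 _ _ _ _ x01 y01 z01 cr E0; rewrite pox //.
    by rewrite Z.pow_1_l; [case=> q; clear; lia | clear - z01; lia].
  by rewrite pz // => -[q]; clear; lia.
have zo := oz _ _ _ x1 y1 z1 E; have zo' := oz _ _ _ x1' y1' z1' E'.
have uniq d e s t s' t' : d = 1 \/ d = 2 -> e = 1 \/ e = 3 -> 0 <= s -> 0 <= t -> 0 <= s' -> 0 <= t' ->
    (e = 1 -> 1 <= t /\ 1 <= t') -> d * (2 ^ s) ^ 2 + e * (3 ^ t) ^ 2 = c ^ z ->
    d * (2 ^ s') ^ 2 + e * (3 ^ t') ^ 2 = c ^ z' -> [/\ s = s', t = t' & z = z'].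
  move=> d12 e13 s0 t0 s0' t0' et F F'.
  by apply: (unique_in_class 3 c d e) => //; [exact: prime_3 | left | left].
have cases x0 y0 : 1 <= x0 -> 1 <= y0 -> exists d e s t,
   [/\ d = 1 \/ d = 2, e = 1 \/ e = 3, 0 <= s /\ 0 <= t, (e = 1 -> 1 <= t) /\ (d = 1 -> 1 <= s) &
   [/\ x0 = 2 * s + (d - 1), y0 = 2 * t + (if e =? 1 then 0 else 1) & 2 ^ x0 + 3 ^ y0 = d * (2 ^ s) ^ 2 + e * (3 ^ t) ^ 2]].
  move=> x01 y01.
  have [d [s [d12 [s0 ds] [Ex EX]]]] : exists d s, [/\ d = 1 \/ d = 2, 0 <= s /\ (d = 1 -> 1 <= s)
     & x0 = 2 * s + (d - 1) /\ 2 ^ x0 = d * (2 ^ s) ^ 2].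
    have [ex|ox] := Z.Even_or_Odd x0.
      have [s s1 Es] := half_even _ x01 ex; have s0 : 0 <= s by clear - s1; lia.
      by exists 1, s; split; [left | | rewrite sq_pow // Es Z.mul_1_l; split=> //; ring].
    have [s s0 Es] := half_odd _ x01 ox.
    by exists 2, s; split; [right | | rewrite Es pow_dbl_succ].
  have [e [t [e13 [t0 et] [Ey EY]]]] : exists e t, [/\ e = 1 \/ e = 3, 0 <= t /\ (e = 1 -> 1 <= t)
     & y0 = 2 * t + (if e =? 1 then 0 else 1) /\ 3 ^ y0 = e * (3 ^ t) ^ 2].
    have [ex|ox] := Z.Even_or_Odd y0.
      have [s' s1 Es] := half_even _ y01 ex; have s0' : 0 <= s' by clear - s1; lia.
      by exists 1, s'; split; [left | | rewrite sq_pow // Es Z.mul_1_l; split=> //=; ring].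
    have [s' s0' Es] := half_odd _ y01 ox.
    by exists 3, s'; split; [right | | rewrite Es pow_dbl_succ].
  by exists d, e, s, t; split=> //; split=> //; rewrite EX EY.
have [d [e [s [t [d12 e13 [s0 t0] [et ds] [Ex Ey F]]]]]] := cases x y x1 y1.
have [d' [e' [s' [t' [d12' e13' [s0' t0'] [et' ds'] [Ex' Ey' F']]]]]] := cases x' y' x1' y1'.
rewrite F in E; rewrite F' in E'.
have [[Ed Ee]|ne] := classic (d = d' /\ e = e').
  rewrite -Ed -Ee in E' et' Ex' Ey'.
  have [Es Et Ez] := uniq d e s t s' t' d12 e13 s0 t0 s0' t0' (fun h => conj (et h) (et' h)) E E'.
  by rewrite Ex Ey Ex' Ey' Es Et Ez.
exfalso.
have par : d = d' /\ (d = 1 \/ (3 | c + 1)).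
  have dd x0 z0 : 1 <= x0 -> 1 <= z0 -> Z.Odd z0 -> forall r, (r = 1 \/ r = -1) -> (3 | (-1) ^ x0 - r ^ z0) -> 
     (r = 1 -> Z.Even x0) /\ (r = -1 -> Z.Odd x0).
    move=> x01 z01 o0 r r1 D.
    have [px pox] := pow_m1 x0 ltac:(clear - x01; lia).
    have [pz poz] := pow_m1 z0 ltac:(clear - z01; lia).
    split=> Er; rewrite Er in D.
      have [//|ox] := Z.Even_or_Odd x0; move: D; rewrite pox // Z.pow_1_l; last by clear - z01; lia.
      by case=> q; clear; lia.
    have [ex|//] := Z.Even_or_Odd x0; move: D; rewrite px // poz // => -[q]; clear; lia.
  have ev u v : (v = 1 \/ v = 2) -> (Z.Even (2 * u + (v - 1)) -> v = 1) /\ (Z.Odd (2 * u + (v - 1)) -> v = 2).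
    by case=> ->; split=> // -[k]; clear; lia.
  rewrite -F in E; rewrite -F' in E'.
  case: (mod3_unit c nc3) => cr.
    have [A _] := dd _ _ x1 z1 zo 1 ltac:(by left) (m3 _ _ _ _ x1 y1 z1 cr E).
    have [A' _] := dd _ _ x1' z1' zo' 1 ltac:(by left) (m3 _ _ _ _ x1' y1' z1' cr E').
    rewrite Ex in A; rewrite Ex' in A'.
    have -> := (proj1 (ev s d d12)) (A erefl); have -> := (proj1 (ev s' d' d12')) (A' erefl).
    by split=> //; left.
  have [_ A] := dd _ _ x1 z1 zo (-1) ltac:(by right) (m3 _ _ _ _ x1 y1 z1 cr E).
  have [_ A'] := dd _ _ x1' z1' zo' (-1) ltac:(by right) (m3 _ _ _ _ x1' y1' z1' cr E').
  rewrite Ex in A; rewrite Ex' in A'.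
  have -> := (proj2 (ev s d d12)) (A erefl); have -> := (proj2 (ev s' d' d12')) (A' erefl).
  split=> //; right; move: cr; congr (_ | _); ring.
case: par => Ed dc; rewrite -Ed in E' ds' ne d12'.
have ee : e <> e' by move=> H; apply: ne.
have sw a b a' b' : 0 <= a -> 1 <= b -> 0 <= a' -> 0 <= b' -> forall u v, 1 <= u -> 1 <= v -> Z.Odd u -> Z.Odd v ->
   (d = 1 -> 1 <= a /\ 1 <= a') -> d * (2 ^ a) ^ 2 + 1 * (3 ^ b) ^ 2 = c ^ u -> d * (2 ^ a') ^ 2 + 3 * (3 ^ b') ^ 2 = c ^ v -> False.
  move=> a0 b1 a0' b0' u v u1 v1 ou ov da G G'.
  have [d1|d2] := d12.
    have [a1 a1'] := da d1; rewrite d1 in G G'.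
    have [q1 C1] := pow_odd_mod8 c u u1 ou oc; have [q2 C2] := pow_odd_mod8 c v v1 ov oc.
    have [r1 R1] := pow9_mod8 b ltac:(clear - b1; lia); have [r2 R2] := pow9_mod8 b' b0'.
    have [p1 P1] := pow2_div4 (2 * a) ltac:(clear - a1; lia).
    have [p2 P2] := pow2_div4 (2 * a') ltac:(clear - a1'; lia).
    move: G G'; rewrite !(sq_pow 2) // P1 P2; move: C1 C2 R1 R2; clear; lia.
  have c1 : (3 | c + 1) by case: dc => // d1; exfalso; clear - d1 d2; lia.
  by rewrite d2 Z.mul_1_l in G G' *; apply: (b3_cross c a b u a' b' v).
have pp : (d = 1 -> 1 <= s /\ 1 <= s') /\ (d = 1 -> 1 <= s' /\ 1 <= s).
  by split=> h; split; auto.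
case: e13 => e1; case: e13' => e1'; rewrite e1 e1' in ee et et' E E'; try by case: ee.
  by apply: (sw s t s' t' s0 (et erefl) s0' t0' z z' z1 z1' zo zo' (proj1 pp)).
by apply: (sw s' t' s t s0' (et' erefl) s0 t0 z' z z1' z1 zo' zo (proj2 pp)).
Qed.

(** * The case c = 2 *)

(** With a norm divisible by 8 every step contributes exactly the factor [mu ^ 2 = 4]; the cofactors
    are odd and congruent modulo 4. *)
Lemma wu_pow4 P Q N k : P + Q = 8 * N -> Z.Odd Q ->
  exists w r, [/\ Z.Odd w, w_ P Q k = 4 ^ Z.of_nat k * w & u_ P Q k = 4 ^ Z.of_nat k * (w - 4 * r)].
Proof.
move=> E oQ; elim: k => [|k [w [r [ow Ew Eu]]]].
  by exists 1, 0; split; [exists 0 | rewrite /w_ /= Z.pow_0_r | rewrite /u_ /= Z.pow_0_r].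
have EP : P = 8 * N - Q by rewrite -E; ring.
exists (Q * (w - 2 * r) - 2 * N * w), (N * (w - 2 * r)); split.
- by case: ow => x ->; case: oQ => y ->; exists (y * (2 * x + 1 - 2 * r) + x - r - N * (2 * x + 1)); ring.
- rewrite w_S Ew Eu EP Nat2Z.inj_succ Z.pow_succ_r; [ring | clear; lia].
- rewrite u_S Ew Eu EP Nat2Z.inj_succ Z.pow_succ_r; [ring | clear; lia].
Qed.

Lemma w_scale l P Q k : w_ (l * P) (l * Q) k = l ^ Z.of_nat k * w_ P Q k /\
  u_ (l * P) (l * Q) k = l ^ Z.of_nat k * u_ P Q k.
Proof.
elim: k => [|k [IHw IHu]]; first by rewrite /w_ /u_ /= Z.pow_0_r.
by rewrite !w_S !u_S IHw IHu Nat2Z.inj_succ Z.pow_succ_r; [split; ring | clear; lia].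
Qed.

Lemma wu_modP P Q k : exists y, w_ P Q k = (-1) ^ Z.of_nat k * ((2 * Z.of_nat k + 1) * (- Q) ^ Z.of_nat k + P * y).
Proof.
have [_ ->] := u_sym P Q k; have [x [y [_ ->]]] := wu_modQ Q P k.
by exists y.
Qed.

Lemma prime_odd_sq_mod8 s : Z.Odd s -> exists q, s ^ 2 = 8 * q + 1.
Proof.
case=> j ->; have [[i ->]|[i ->]] := Z.Even_or_Odd j.
  by exists (i * (2 * i + 1)); ring.
by exists ((i + 1) * (2 * i + 1)); ring.
Qed.

Lemma four_pow_bound (m : nat) : (3 <= m)%coq_nat -> (2 * Z.of_nat m + 1) ^ 2 < 4 ^ Z.of_nat m.
Proof.
elim: m => [|m IH] m3; first by exfalso; lia.
have [->|m4] : m = 2%N \/ (3 <= m)%coq_nat by clear - m3; lia.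
  by vm_compute.
have := IH m4; rewrite !Nat2Z.inj_succ Z.pow_succ_r /Z.succ; last by clear; lia.
by move: (4 ^ _) => F; rewrite !Z.pow_2_r; clear - m4; nia.
Qed.

(** The counterpart of [wu_prime_step] for [c = 2] and the index [b]. Modulo [a], [w] is [b] times a
    power of [b] up to sign, so [a] does not divide it. For [b >= 5] the prime [b] divides [u] at
    most once, and the norm bounds everything. The survivors are [3 + 5 = 8], read in both ways, and
    [13 + 3 = 16]. *)
Lemma two_prime_step a b p q Z0 m i j : zprime a -> zprime b -> 3 <= a -> a <> b ->
  b = 2 * Z.of_nat m + 1 -> (1 <= m)%coq_nat -> 1 <= p -> 1 <= q -> 3 <= Z0 -> 0 <= i -> 0 <= j ->
  a ^ p + b ^ q = 2 ^ Z0 ->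
  Z.abs (w_ (a ^ p) (b ^ q) m) = 4 ^ Z.of_nat m * a ^ i ->
  Z.abs (u_ (a ^ p) (b ^ q) m) = 4 ^ Z.of_nat m * b ^ j ->
  [\/ a = 3 /\ b = 5, a = 5 /\ b = 3 | a = 13 /\ b = 3].
Proof.
move=> ap bp a3 ab Eb m1 p1 q1 z3 i0 j0 E Ew Eu.
have b3 : 3 <= b by clear - Eb m1; lia.
have ba : b <> a by move=> H; apply: ab.
have m0 : 0 <= Z.of_nat m by clear; lia.
have f4 : 0 < 4 ^ Z.of_nat m by apply: Z.pow_pos_nonneg.
have na4 : ~ (a | 4 ^ Z.of_nat m).
  have -> : 4 = 2 ^ 2 by []; rewrite -Z.pow_mul_r //.
  by apply: prime_ndvd_pow => //; [exact: prime_2 | clear - a3; lia | clear; lia].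
have nb4 : ~ (b | 4 ^ Z.of_nat m).
  have -> : 4 = 2 ^ 2 by []; rewrite -Z.pow_mul_r //.
  by apply: prime_ndvd_pow => //; [exact: prime_2 | clear - b3; lia | clear; lia].
have i00 : i = 0.
  have [//|i1] : i = 0 \/ 1 <= i by clear - i0; lia.
  have aw : (a | w_ (a ^ p) (b ^ q) m).
    by apply/Z.divide_abs_r; rewrite Ew; apply: dvd_mul_r; apply: ppow_dvd.
  have [y Ey] := wu_modP (a ^ p) (b ^ q) m; rewrite Ey -Eb in aw; exfalso.
  case/(prime_mult _ ap): aw => [/zprime_dvd_pow H|].
    by have /Z.divide_opp_r/Z.divide_1_r := H ap m0; clear - a3; lia.
  have -> : b * (- b ^ q) ^ Z.of_nat m + a ^ p * y = a ^ p * y - - (b * (- b ^ q) ^ Z.of_nat m) by ring.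
  move=> H; have : (a | b * (- b ^ q) ^ Z.of_nat m).
    apply/Z.divide_opp_r.
    have -> : - (b * (- b ^ q) ^ Z.of_nat m) = a ^ p * y - (a ^ p * y - - (b * (- b ^ q) ^ Z.of_nat m)) by ring.
    by apply: Z.divide_sub_r => //; apply: dvd_mul_l; apply: ppow_dvd.
  case/(prime_mult _ ap); first by move/(prime_div_prime _ _ ap bp).
  move/(zprime_dvd_pow _ _ _ ap m0)/Z.divide_opp_r/(zprime_dvd_pow _ _ _ ap).
  by move/(_ ltac:(clear - q1; lia))/(prime_div_prime _ _ ap bp).
rewrite i00 Z.pow_0_r Z.mul_1_r in Ew.
have pa : 3 <= a ^ p by have := pow_ge_base a p ltac:(clear - a3; lia) p1; clear - a3; lia.
have qb : 3 <= b ^ q by have := pow_ge_base b q ltac:(clear - b3; lia) q1; clear - b3; lia.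
have Z8 : 2 ^ Z0 = 4 * 2 ^ (Z0 - 2).
  have -> : 4 = 2 ^ 2 by []; rewrite -Z.pow_add_r; [f_equal| |]; clear - z3; lia.
have Z2 : 2 <= 2 ^ (Z0 - 2) by apply: pow_ge_base => //; clear - z3; lia.
have [b5|b3'] : 5 <= b \/ b = 3 by clear - Eb b3; lia.
  have j1 : j <= 1.
    have [//|j2] : j <= 1 \/ 2 <= j by clear; lia.
    have [x [y]] := wu_modQ2 (a ^ p) (b ^ q) m; cbv zeta; rewrite -Eb => -[_ E3].
    have b2u : (b ^ 2 | u_ (a ^ p) (b ^ q) m).
      apply/Z.divide_abs_r; rewrite Eu; apply: dvd_mul_r; exists (b ^ (j - 2)).
      by rewrite -Z.pow_add_r; [f_equal; clear; lia | clear - j2; lia | by []].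
    case: (ppow_dvd b q q1) => q' Eq; case: b2u => v Ev.
    have dd : (b * b | b * ((- a ^ p) ^ Z.of_nat m * (- 3 * a ^ p + b ^ q * (Z.of_nat m * (2 * Z.of_nat m - 1))))).
      exists (3 * - a ^ p * v - q' ^ 2 * y).
      transitivity (3 * - a ^ p * u_ (a ^ p) (b ^ q) m - (b ^ q) ^ 2 * y); first by rewrite E3; ring.
      by rewrite Ev Eq; ring.
    have nba : ~ (b | a ^ p) by apply: prime_ndvd_pow => //; clear - p1; lia.
    have : (b | (- a ^ p) ^ Z.of_nat m * (- 3 * a ^ p + b ^ q * (Z.of_nat m * (2 * Z.of_nat m - 1)))).
      by apply/(Z.mul_divide_cancel_l _ _ b) => //; clear - b3; lia.
    case/(prime_mult _ bp).
      by move/(zprime_dvd_pow _ _ _ bp m0)/Z.divide_opp_r.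
    case=> h Eh.
    have : (b | 3 * a ^ p) by exists (q' * (Z.of_nat m * (2 * Z.of_nat m - 1)) - h); rewrite Eq in Eh; clear - Eh; lia.
    by case/(prime_mult _ bp) => // /Z.divide_pos_le; clear - b5; lia.
  have bj : b ^ j <= b by rewrite -{2}(Z.pow_1_r b); apply: pow_ge_mono; [clear - b3 | clear - j0 j1]; lia.
  have bj0 : 0 < b ^ j by apply: Z.pow_pos_nonneg; [clear - b3; lia|].
  have norm := wu_norm (a ^ p) (b ^ q) m.
  rewrite (sq_abs (w_ _ _ _)) (sq_abs (u_ _ _ _)) Ew Eu E Z8 in norm.
  set M := 2 ^ (Z0 - 2) in Z2 Z8 norm.
  have E16 : ((4 * M) ^ 2) ^ Z.of_nat m = (4 ^ Z.of_nat m) ^ 2 * (M ^ 2) ^ Z.of_nat m.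
    have -> : (4 ^ Z.of_nat m) ^ 2 = (4 ^ 2) ^ Z.of_nat m by rewrite -!Z.pow_mul_r // Z.mul_comm.
    rewrite -Z.pow_mul_l.
    by congr (_ ^ _); ring.
  have norm2 : a ^ p + b ^ q * (b ^ j) ^ 2 = 4 * M * (M ^ 2) ^ Z.of_nat m.
    apply: (Z.mul_reg_l _ _ ((4 ^ Z.of_nat m) ^ 2)).
      by apply: Z.pow_nonzero => //; clear - f4; lia.
    transitivity (a ^ p * (4 ^ Z.of_nat m) ^ 2 + b ^ q * (4 ^ Z.of_nat m * b ^ j) ^ 2); first ring.
    by rewrite norm E16; ring.
  have bj2 : (b ^ j) ^ 2 <= b ^ 2 by clear - bj bj0; rewrite !Z.pow_2_r; nia.
  have le : 4 * M * (M ^ 2) ^ Z.of_nat m < 4 * M * b ^ 2.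
    rewrite -norm2 -Z8 -E; clear - bj2 b3 pa qb; rewrite (Z.pow_2_r b) in bj2 *; nia.
  have le2 : (M ^ 2) ^ Z.of_nat m < b ^ 2 by clear - le Z2; nia.
  have [m2|m3] : m = 2%N \/ (3 <= m)%coq_nat by clear - Eb b5; lia.
    have b55 : b = 5 by rewrite Eb m2.
    have M2 : M = 2.
      have [//|M4] : M = 2 \/ 3 <= M by clear - Z2; lia.
      by exfalso; move: le2; rewrite m2 b55 !Z.pow_2_r; clear - M4; nia.
    rewrite Z8 M2 in E.
    constructor 1; split=> //.
    have b5q : 5 <= b ^ q by have := pow_ge_base b q ltac:(clear - b3; lia) q1; clear - b55; lia.
    have := ppow_eq_prime a 3 p ap prime_3 ltac:(clear - p1; lia) ltac:(clear - E b5q pa; lia).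
    by case.
  exfalso; have := four_pow_bound m m3; rewrite -Eb.
  have : 4 ^ Z.of_nat m <= (M ^ 2) ^ Z.of_nat m by apply: Z.pow_le_mono_l; clear - Z2; nia.
  by clear - le2; lia.
have mm : m = 1%N by clear - Eb b3'; lia.
rewrite mm b3' /w_ /u_ /= in Ew Eu.
rewrite !Z.mul_1_l !Z.mul_1_r in Ew Eu; rewrite b3' in E qb.
have Z02 : 1 <= Z0 - 2 by clear - z3; lia.
have q0 : 0 <= q by clear - q1; lia.
have p0 : 0 <= p by clear - p1; lia.
have [H|H] : 3 ^ q = 2 ^ (Z0 - 2) + 1 \/ 3 ^ q = 2 ^ (Z0 - 2) - 1.
  have {}Ew : Z.abs (3 ^ q - a ^ p + 2 * 3 ^ q) = 4 by exact: Ew.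
  by move: E Ew; rewrite Z8; clear; lia.
- have [[Eq Ez]|[Eq Ez]] := pow3_eq_pow2_succ q (Z0 - 2) q0 Z02 H.
    constructor 2; split=> //.
    rewrite Eq Z8 Ez in E.
    by have [] := ppow_eq_prime a 5 p ap zprime5 p0 ltac:(move: E; clear; lia).
  (* The sum [23 + 9 = 32] satisfies the condition on [w], but its [u] is [-60], and 15 is not a
     power of 3. *)
  exfalso; rewrite Eq Z8 Ez in E.
  have Ea : a ^ p = 23 by move: E; clear; lia.
  have {Eu} : 60 = 4 * 3 ^ j by rewrite Eq Ea in Eu; exact: Eu.
  have [jj|jj] : j <= 2 \/ 3 <= j by clear; lia.
    by have := pow_ge_mono 3 j 2 ltac:(by []) ltac:(clear - j0 jj; lia); rewrite (_ : 3 ^ 2 = 9) //; clear; lia.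
  by have := pow_ge_mono 3 3 j ltac:(by []) ltac:(clear - jj; lia); rewrite (_ : 3 ^ 3 = 27) //; clear; lia.
- have z4 := pow3_eq_pow2_pred q (Z0 - 2) q0 ltac:(clear - Z02; lia) H.
  have [Ez|Ez] : Z0 - 2 = 1 \/ Z0 - 2 = 2 by clear - Z02 z4; lia.
    by exfalso; move: H qb; rewrite Ez; clear; lia.
  constructor 3; split=> //.
  have p13 : zprime 13.
    apply: prime_intro => // n n5; apply/Zgcd_1_rel_prime.
    have : List.In n (List.map Z.of_nat (List.seq 1 12)).
      by rewrite List.in_map_iff; exists (Z.to_nat n); split; [|apply/List.in_seq]; clear - n5; lia.
    by move=> /= Hn; repeat case: Hn => [<- //|Hn].
  rewrite Z8 Ez in E; rewrite Ez in H.
  by have [] := ppow_eq_prime a 13 p ap p13 p0 ltac:(move: E H; clear; lia).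
Qed.
(** Since [b] divides [u], it divides [2 k + 1 = (2 k' + 1) b]. The inner power multiplies both
    parameters by [16 ^ k']; with this scaled away, they are again powers of [a] and [b] whose sum
    is a power of 2, and the index is [b]. *)
Lemma two_step a b p q Z0 k i j : zprime a -> zprime b -> 3 <= a -> 3 <= b -> a <> b ->
  1 <= p -> 1 <= q -> 3 <= Z0 -> 0 <= i -> 1 <= j ->
  a ^ p + b ^ q = 2 ^ Z0 ->
  Z.abs (w_ (a ^ p) (b ^ q) k) = 4 ^ Z.of_nat k * a ^ i ->
  Z.abs (u_ (a ^ p) (b ^ q) k) = 4 ^ Z.of_nat k * b ^ j ->
  [\/ a = 3 /\ b = 5, a = 5 /\ b = 3 | a = 13 /\ b = 3].
Proof.
move=> ap bp a3 b3 ab p1 q1 z3 i0 j1 E Ew Eu.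
have k0 : 0 <= Z.of_nat k by clear; lia.
have j0 : 0 <= j by clear - j1; lia.
have p0 : 0 <= p by clear - p1; lia.
have q0 : 0 <= q by clear - q1; lia.
have oa := odd_prime a ap a3; have ob := odd_prime b bp b3.
have bu : (b | u_ (a ^ p) (b ^ q) k).
  by apply/Z.divide_abs_r; rewrite Eu; apply: dvd_mul_r; apply: ppow_dvd.
have bt : (b | 2 * Z.of_nat k + 1).
  have [x [y [_ EuQ]]] := wu_modQ (a ^ p) (b ^ q) k.
  have : (b | (2 * Z.of_nat k + 1) * (- a ^ p) ^ Z.of_nat k).
    have -> : (2 * Z.of_nat k + 1) * (- a ^ p) ^ Z.of_nat k = u_ (a ^ p) (b ^ q) k - b ^ q * y.
      by rewrite EuQ; ring.
    by apply: Z.divide_sub_r => //; apply: dvd_mul_l; apply: ppow_dvd.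
  case/(prime_mult _ bp) => // /(zprime_dvd_pow _ _ _ bp k0)/Z.divide_opp_r.
  by move/(zprime_dvd_pow _ _ _ bp p0)/(prime_div_prime _ _ bp ap) => H; case: ab.
case: bt => t' Et'.
have [m [k' [El Et]]] := odd_factors k t' b Et' b3.
have m1 : (1 <= m)%coq_nat by clear - El b3; lia.
have Ek : Z.of_nat k = Z.of_nat k' + (2 * Z.of_nat k' + 1) * Z.of_nat m.
  by move: Et'; rewrite El Et; clear; lia.
have [Cw Cu] := wu_comp (a ^ p) (b ^ q) k' m k Ek.
have [N EN] : exists N, a ^ p + b ^ q = 8 * N.
  by rewrite E; have [N EN] := pow2_ge8 Z0 z3; exists N; rewrite EN; ring.
have obq : Z.Odd (b ^ q) by apply/Z.odd_spec; rewrite Z.odd_pow; [apply/Z.odd_spec | clear - q1; lia].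
have [w [r [ow Ew' Eu']]] := wu_pow4 _ _ N k' EN obq.
set u := w - 4 * r in Eu'.
have ou : Z.Odd u by case: ow => x Ex; exists (x - 2 * r); rewrite /u Ex; ring.
set L := (4 ^ Z.of_nat k') ^ 2 in Ew' Eu'.
have EP : a ^ p * w_ (a ^ p) (b ^ q) k' ^ 2 = (4 ^ Z.of_nat k') ^ 2 * (a ^ p * w ^ 2) by rewrite Ew'; ring.
have EQ : b ^ q * u_ (a ^ p) (b ^ q) k' ^ 2 = (4 ^ Z.of_nat k') ^ 2 * (b ^ q * u ^ 2) by rewrite Eu'; ring.
have [Sw Su] := w_scale ((4 ^ Z.of_nat k') ^ 2) (a ^ p * w ^ 2) (b ^ q * u ^ 2) m.
rewrite EP EQ Sw Ew' in Cw; rewrite EP EQ Su Eu' in Cu.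
have E4 : 4 ^ Z.of_nat k = 4 ^ Z.of_nat k' * ((4 ^ Z.of_nat k') ^ 2) ^ Z.of_nat m * 4 ^ Z.of_nat m.
  rewrite -!Z.pow_mul_r; try by clear; lia.
  by rewrite -!Z.pow_add_r; [f_equal; rewrite Ek; ring | clear; lia ..].
set F := 4 ^ Z.of_nat k' * ((4 ^ Z.of_nat k') ^ 2) ^ Z.of_nat m in E4.
have F0 : 0 < F.
  by apply: Z.mul_pos_pos; do ?apply: Z.pow_pos_nonneg => //; clear; lia.
have f4 : 0 < 4 ^ Z.of_nat m by apply: Z.pow_pos_nonneg => //; clear; lia.
have Aw : Z.abs w * Z.abs (w_ (a ^ p * w ^ 2) (b ^ q * u ^ 2) m) = 4 ^ Z.of_nat m * a ^ i.
  rewrite -Z.abs_mul; apply: (Z.mul_reg_l _ _ F); first by clear - F0; lia.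
  rewrite Z.mul_assoc -E4 -Ew -(Z.abs_eq F); last by clear - F0; lia.
  by rewrite -Z.abs_mul Cw; f_equal; rewrite /F; ring.
have Au : Z.abs u * Z.abs (u_ (a ^ p * w ^ 2) (b ^ q * u ^ 2) m) = 4 ^ Z.of_nat m * b ^ j.
  rewrite -Z.abs_mul; apply: (Z.mul_reg_l _ _ F); first by clear - F0; lia.
  rewrite Z.mul_assoc -E4 -Eu -(Z.abs_eq F); last by clear - F0; lia.
  by rewrite -Z.abs_mul Cu; f_equal; rewrite /F; ring.
have split_pow l v e X : zprime l -> 0 <= e -> Z.Odd v -> Z.abs v * X = 4 ^ Z.of_nat m * l ^ e ->
    exists e', [/\ 0 <= e' <= e, Z.abs v = l ^ e' & X = 4 ^ Z.of_nat m * l ^ (e - e')].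
  move=> lp e0 ov H; have l2 := prime_ge_2 _ lp.
  have dv : (v | l ^ e).
    apply: (Gauss _ (4 ^ Z.of_nat m)).
      by apply/Z.divide_abs_l; exists X; rewrite -H; ring.
    apply: rel_prime_sym; have -> : 4 = 2 ^ 2 by [].
    rewrite -Z.pow_mul_r; [|by []|clear; lia].
    apply: rel_prime_sym; apply: rel_prime_Zpower_r; first by clear; lia.
    by apply: rel_prime_sym; apply: prime_rel_prime; [exact: prime_2 | apply/zodd_ndvd].
  have [e' [e0' Ee']] := dvd_ppow_abs l e v lp e0 dv.
  have ple : l ^ e' <= l ^ e.
    apply: Z.divide_pos_le; first by apply: Z.pow_pos_nonneg; [clear - l2; lia|].
    by rewrite -Ee'; apply/Z.divide_abs_l.
  have e'e : e' <= e.
    have [//|lt] : e' <= e \/ e < e' by clear; lia.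
    by have := Z.pow_lt_mono_r l e e' ltac:(clear - l2; lia) ltac:(clear - e0'; lia) lt; clear - ple; lia.
  exists e'; split=> //; apply: (Z.mul_reg_l _ _ (l ^ e')).
    by apply: Z.pow_nonzero => //; clear - l2; lia.
  rewrite -{1}Ee' H.
  have -> : l ^ e = l ^ e' * l ^ (e - e') by rewrite -Z.pow_add_r; [f_equal| |]; clear - e0' e'e; lia.
  by ring.
have [i' [i0' Ewa Ewm]] := split_pow a w i _ ap i0 ow Aw.
have [j' [j0' Eua Eum]] := split_pow b u j _ bp j0 ou Au.
have Ea : a ^ p * w ^ 2 = a ^ (p + 2 * i').
  by rewrite sq_abs Ewa sq_pow -?Z.pow_add_r //; clear - p0 i0'; lia.
have Eb : b ^ q * u ^ 2 = b ^ (q + 2 * j').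
  by rewrite (sq_abs u) Eua sq_pow -?Z.pow_add_r //; clear - q0 j0'; lia.
rewrite Ea Eb in Ewm Eum.
have NN : a ^ (p + 2 * i') + b ^ (q + 2 * j') = 2 ^ (Z0 + (2 * Z0 - 4) * Z.of_nat k').
  have := wu_norm (a ^ p) (b ^ q) k'; rewrite EP EQ Ea Eb E => H.
  apply: (Z.mul_reg_l _ _ ((4 ^ Z.of_nat k') ^ 2)).
    by apply: Z.pow_nonzero => //; apply: Z.pow_nonzero => //; clear; lia.
  rewrite Z.mul_add_distr_l H.
  have -> : 4 = 2 ^ 2 by [].
  rewrite -!Z.pow_mul_r; try by clear - z3; lia.
  by rewrite -!Z.pow_add_r; [f_equal; ring | clear - z3; nia ..].
apply: (two_prime_step a b (p + 2 * i') (q + 2 * j') _ m (i - i') (j - j') _ _ _ _ _ _ _ _ _ _ _ NN) => //;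
  try (by clear - i0' j0' p1 q1; lia).
by clear - z3; nia.
Qed.

(** If neither prime occurs in the coordinates, comparing norms gives [k = 0]. Otherwise [u_sym]
    lets either prime play the role of [b]. *)
Lemma two_power a b p q Z0 k i j : zprime a -> zprime b -> 3 <= a -> 3 <= b -> a <> b ->
  1 <= p -> 1 <= q -> 3 <= Z0 -> 0 <= i -> 0 <= j ->
  a ^ p + b ^ q = 2 ^ Z0 ->
  Z.abs (w_ (a ^ p) (b ^ q) k) = 4 ^ Z.of_nat k * a ^ i ->
  Z.abs (u_ (a ^ p) (b ^ q) k) = 4 ^ Z.of_nat k * b ^ j ->
  k = 0%N \/ [\/ a = 3 /\ b = 5, a = 5 /\ b = 3, a = 13 /\ b = 3 | a = 3 /\ b = 13].
Proof.
move=> ap bp a3 b3 ab p1 q1 z3 i0 j0 E Ew Eu.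
have [j00|j1] : j = 0 \/ 1 <= j by clear - j0; lia.
  have [i00|i1] : i = 0 \/ 1 <= i by clear - i0; lia.
    left; have [//|k1] : k = 0%N \/ (1 <= k)%coq_nat by clear; lia.
    exfalso; have := wu_norm (a ^ p) (b ^ q) k.
    rewrite (sq_abs (w_ _ _ _)) (sq_abs (u_ _ _ _)) Ew Eu i00 j00 !Z.pow_0_r !Z.mul_1_r.
    rewrite -Z.mul_add_distr_r E => H.
    have {}H : (4 ^ Z.of_nat k) ^ 2 = ((2 ^ Z0) ^ 2) ^ Z.of_nat k.
      by apply: (Z.mul_reg_l _ _ (2 ^ Z0)) => //; apply: Z.pow_nonzero => //; clear - z3; lia.
    have : 2 ^ (4 * Z.of_nat k) = 2 ^ (2 * Z0 * Z.of_nat k).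
      have -> : 2 ^ (4 * Z.of_nat k) = (4 ^ Z.of_nat k) ^ 2.
        have -> : 4 = 2 ^ 2 by []; rewrite -!Z.pow_mul_r; try by clear; lia.
        by f_equal; ring.
      rewrite H -!Z.pow_mul_r; try by clear - z3; lia.
      by f_equal; ring.
    by move/(pow_inj 2 (4 * Z.of_nat k) (2 * Z0 * Z.of_nat k) ltac:(by []) ltac:(clear; lia) ltac:(clear - z3; nia)); clear - z3 k1; nia.
  right; have [Su Sw] := u_sym (a ^ p) (b ^ q) k.
  have sg X : Z.abs ((-1) ^ Z.of_nat k * X) = Z.abs X.
    have [pe po] := pow_m1 (Z.of_nat k) ltac:(clear; lia).
    by have [/pe ->|/po ->] := Z.Even_or_Odd (Z.of_nat k); clear; lia.
  rewrite Su sg in Eu; rewrite Sw sg in Ew.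
  have ba : b <> a by move=> H; apply: ab.
  have E' : b ^ q + a ^ p = 2 ^ Z0 by rewrite -E; ring.
  by case: (two_step b a q p Z0 k j i bp ap b3 a3 ba q1 p1 z3 j0 i1 E' Eu Ew) => -[-> ->];
    [constructor 2 | constructor 1 | constructor 4].
by right; case: (two_step a b p q Z0 k i j ap bp a3 b3 ab p1 q1 z3 i0 j1 E Ew Eu) => H;
   [constructor 1 | constructor 2 | constructor 3].
Qed.

Lemma sq_cases x : x * x = 0 \/ x * x = 1 \/ 4 <= x * x.
Proof.
have [->|[->|[->|[H|H]]]] : x = 0 \/ x = 1 \/ x = -1 \/ x <= -2 \/ 2 <= x by lia.
- by left.
- by right; left.
- by right; left.
- by right; right; nia.
- by right; right; nia.
Qed.

Lemma two_same a b eps s t z s' t' z' : zprime a -> zprime b -> 3 <= a -> 3 <= b -> a <> b ->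
  ~ [\/ a = 3 /\ b = 5, a = 5 /\ b = 3, a = 13 /\ b = 3 | a = 3 /\ b = 13] ->
  eps = 1 \/ eps = b -> 0 <= s -> 0 <= t -> 0 <= s' -> 0 <= t' -> (eps = 1 -> 1 <= t /\ 1 <= t') ->
  0 <= z -> 0 <= z' ->
  a * (a ^ s) ^ 2 + eps * (b ^ t) ^ 2 = 2 ^ z -> a * (a ^ s') ^ 2 + eps * (b ^ t') ^ 2 = 2 ^ z' ->
  [/\ s = s', t = t' & z = z'].
Proof.
move=> ap bp a3 b3 ab nsp e1b s0 t0 s0' t0' et z0 z0' E E'.
have ba : b <> a by move=> H; apply: ab.
have oa := odd_prime a ap a3; have ob := odd_prime b bp b3.
pose g := if eps =? 1 then b else 1.
have gE : (eps = 1 /\ g = b) \/ (eps = b /\ g = 1).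
  rewrite /g; case: Z.eqb_spec => [|ne]; first by left.
  by case: e1b => //; right.
have cmu : (2 = 2 /\ 2 = 2) \/ (Z.Odd 2 /\ 2 = 1) by left.
have a0 : 0 < a by clear - a3; lia.
have e0 : 0 < eps by case: e1b => ->; clear - b3; lia.
have na2 : ~ (2 | a) by apply/zodd_ndvd.
have nb2 : ~ (2 | b) by apply/zodd_ndvd.
have n12 : ~ (2 | 1) by case=> q; clear; lia.
have ne2 : ~ (2 | eps) by case: e1b => ->.
have oe : Z.Odd eps by apply/zodd_ndvd.
have ng : ~ (2 | g) /\ rel_prime g 2.
  case: gE => -[_ ->]; split=> //; last exact: rel_prime_1_l.
  by apply: rel_prime_sym; apply: prime_rel_prime => //; exact: prime_2.
have nh : ~ (2 | 1) /\ rel_prime 1 2 by split=> //; exact: rel_prime_1_l.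
pose R := rep 2 2 a eps g 1.
have rsol u v n : 0 <= u -> 0 <= v -> (eps = 1 -> 1 <= v) -> 0 <= n ->
    a * (a ^ u) ^ 2 + eps * (b ^ v) ^ 2 = 2 ^ n -> 3 <= n /\ R (a ^ u) (b ^ v) (n - 2).
  move=> u0 v0 ev n0 En.
  have opow p x : zprime p -> Z.Odd p -> 0 <= x -> Z.Odd (p ^ x).
    move=> _ op x0; have [->|x1] : x = 0 \/ 0 < x by clear - x0; lia.
      by exists 0.
    by apply/Z.odd_spec; rewrite Z.odd_pow //; apply/Z.odd_spec.
  have n3 : 3 <= n.
    have [//|n2] : 3 <= n \/ n <= 2 by clear; lia.
    have := pow_ge_mono 2 n 2 ltac:(by []) ltac:(clear - n0 n2; lia); rewrite -En (_ : 2 ^ 2 = 4) //.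
    have au : 1 <= a ^ u by have := Z.pow_pos_nonneg a u a0 u0; clear; lia.
    have bv : 1 <= b ^ v by have := Z.pow_pos_nonneg b v ltac:(clear - b3; lia) v0; clear; lia.
    have X1 : 3 <= a * (a ^ u) ^ 2 by rewrite Z.pow_2_r; clear - a3 au; nia.
    have X2 : 2 <= eps * (b ^ v) ^ 2.
      have [Ee|Ee] := e1b; rewrite Ee; last by rewrite Z.pow_2_r; clear - bv b3; nia.
      have := pow_ge_base b v ltac:(clear - b3; lia) (ev Ee).
      by rewrite Z.pow_2_r; clear - b3; nia.
    by clear - X1 X2; lia.
  split=> //; split.
  - by rewrite En -Z.pow_add_r; [f_equal; clear; lia | by [] | clear - n3; lia].
  - by apply/zodd_ndvd; apply: opow.
  - by apply/zodd_ndvd; apply: opow.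
  - exact: opow.
  - split; last exact: Z.divide_1_l.
    by case: gE => -[Ee ->]; [apply: ppow_dvd; apply: ev | apply: Z.divide_1_l].
have [z3 r] := rsol s t z s0 t0 (fun h => proj1 (et h)) z0 E.
have [z3' r'] := rsol s' t' z' s0' t0' (fun h => proj2 (et h)) z0' E'.
have K_0 : True -> forall S T, (1 | S) -> (g | T) -> (Z.Odd 2 -> Z.Odd T) -> a * S ^ 2 + eps * T ^ 2 <> 2 ^ 2.
  move=> _ S T _ gT _; rewrite !Z.pow_2_r => H.
  have [T0|T1] : T = 0 \/ 1 <= T * T by clear; nia.
    rewrite T0 in H.
    have [S0|[S1|S1]] := sq_cases S.
    + by move: H; rewrite S0; clear; lia.
    + by move: H oa; rewrite S1 => H [i]; clear - H; lia.
    + by move: H; move: (S * S) S1 => Y Y1; clear - Y1 a3; nia.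
  have S0 : 0 <= S * S by clear; nia.
  case: gE => -[Ee Eg]; rewrite Ee in H; last first.
    have [S00|S1] : S * S = 0 \/ 1 <= S * S by clear; nia.
      have [T2|[T2|T2]] := sq_cases T; first by exfalso; clear - T1 T2; lia.
        by move: H ob; rewrite S00 T2 => H [i]; clear - H; lia.
      by move: H; rewrite S00; move: (T * T) T2 => Y Y1; clear - Y1 b3; nia.
    by move: H; move: (S * S) (T * T) S1 T1 => X Y X1 Y1; clear - X1 Y1 a3 b3 ab; nia.
  rewrite Eg in gT; case: gT => v Ev.
  have v0 : v <> 0 by move=> v0; rewrite Ev v0 in T1; clear - T1; lia.
  have v1 : 1 <= v * v by clear - v0; nia.
  have : 9 <= T * T by rewrite Ev; clear - v1 b3; nia.
  by move: H S0; clear - a3; move: (T * T) (S * S) => X Y; nia.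
(* The only discriminant with further units is [a = 3], [eps = 1]. But [3 S ^ 2 + T ^ 2] is 4 modulo
   8 for odd [S] and [T], while the sum here is divisible by 8. *)
have disc2 : 2 = 2 -> 4 < a * eps.
  move=> _; case: e1b => Ee; last by rewrite Ee; clear - a3 b3; nia.
  have [a4|a3'] : 4 < a \/ a = 3 by case: oa a3 => i; clear; lia.
    by rewrite Ee; clear - a4; lia.
  exfalso; case: r => N /zodd_ndvd/prime_odd_sq_mod8 [x Ex] /zodd_ndvd/prime_odd_sq_mod8 [y Ey] _ _.
  move: N; rewrite Ex Ey Ee a3'.
  have [w Ew] := pow2_even (z - 2) ltac:(clear - z3; lia).
  by rewrite Ew; clear; lia.
have [S0 [T0 [z1 [base z11 mn]]]] := min_exponent R _ _ (z - 2) r ltac:(clear - z3; lia).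
have main u v n : 0 <= u -> 0 <= v -> R (a ^ u) (b ^ v) (n - 2) -> 3 <= n ->
    [/\ Z.abs S0 = a ^ u, Z.abs T0 = b ^ v & n - 2 = z1].
  move=> u0 v0 rn n3.
  have [k [w [x [si [ta [ch [si1 ta1] [ES ET] Ez]]]]]] :=
    descent_power 2 2 a eps g 1 prime_2 cmu a0 e0 na2 ne2 oe ng nh (fun _ => True)
     (fun _ _ _ => I) (fun _ _ => I) K_0 disc2 S0 T0 z1 base z11 (fun S T n r _ h => mn S T n r h)
      _ _ _ rn I ltac:(clear - n3; lia).
  have [] := chain_wu _ _ _ _ prime_2 _ _ _ _ _ ch; rewrite (_ : 2 ^ 2 = 4) // => Ew Eu.
  have aS : a ^ u = Z.abs S0 * Z.abs w.
    rewrite -[LHS]Z.abs_eq; last by apply: Z.pow_nonneg; clear - a3; lia.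
    by rewrite ES !Z.abs_mul; case: si1 => ->; rewrite Z.mul_1_l.
  have aT : b ^ v = Z.abs T0 * Z.abs x.
    rewrite -[LHS]Z.abs_eq; last by apply: Z.pow_nonneg; clear - b3; lia.
    by rewrite ET !Z.abs_mul; case: ta1 => ->; rewrite Z.mul_1_l.
  have [i0 [i00 Ei0]] : exists i0, 0 <= i0 /\ Z.abs S0 = a ^ i0.
    by apply: (dvd_ppow_abs a u) => //; apply/Z.divide_abs_l; exists (Z.abs w); rewrite aS; ring.
  have [i [i00' Ei]] : exists i, 0 <= i /\ Z.abs w = a ^ i.
    by apply: (dvd_ppow_abs a u) => //; apply/Z.divide_abs_l; exists (Z.abs S0); rewrite aS.
  have [j0 [j00 Ej0]] : exists j0, 0 <= j0 /\ Z.abs T0 = b ^ j0.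
    by apply: (dvd_ppow_abs b v) => //; apply/Z.divide_abs_l; exists (Z.abs x); rewrite aT; ring.
  have [j [j00' Ej]] : exists j, 0 <= j /\ Z.abs x = b ^ j.
    by apply: (dvd_ppow_abs b v) => //; apply/Z.divide_abs_l; exists (Z.abs T0); rewrite aT.
  have [N _ _ _ [gT _]] := base.
  have EP : a * S0 ^ 2 = a ^ (2 * i0 + 1) by rewrite (sq_abs S0) Ei0 pow_dbl_succ.
  have [q [q1 EQ]] : exists q, 1 <= q /\ eps * T0 ^ 2 = b ^ q.
    rewrite (sq_abs T0) Ej0; case: gE => -[Ee Eg].
      exists (2 * j0); rewrite sq_pow // Ee Z.mul_1_l; split=> //.
      have [j0z|] : j0 = 0 \/ 1 <= j0 by clear - j00; lia.
        move/Z.divide_abs_r: gT; rewrite Ej0 j0z Eg Z.pow_0_r => /Z.divide_1_r; clear - b3; lia.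
      by clear; lia.
    by exists (2 * j0 + 1); rewrite pow_dbl_succ // Ee; split=> //; clear - j00; lia.
  have EPQ : a ^ (2 * i0 + 1) + b ^ q = 2 ^ (z1 + 2).
    by rewrite -EP -EQ N Z.add_comm Z.pow_add_r //; clear - z11; lia.
  rewrite EP EQ in Ew Eu.
  have f4 : Z.abs (4 ^ Z.of_nat k) = 4 ^ Z.of_nat k by apply: Z.abs_eq; apply: Z.pow_nonneg.
  have [k0|//] := two_power a b (2 * i0 + 1) q (z1 + 2) k i j ap bp a3 b3 ab
     ltac:(clear - i00; lia) q1 ltac:(clear - z11; lia) i00' j00' EPQ
     ltac:(by rewrite Ew Z.abs_mul f4 Ei) ltac:(by rewrite Eu Z.abs_mul f4 Ej).
  have [w1 x1] : w = 1 /\ x = 1 by rewrite k0 in ch; inversion ch.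
  by rewrite aS aT w1 x1 Ez k0; split; clear; lia.
have [A1 A2 A3] := main s t z s0 t0 r z3.
have [B1 B2 B3] := main s' t' z' s0' t0' r' z3'.
split.
- by apply: (pow_inj a) => //; [clear - a3; lia | rewrite -A1].
- by apply: (pow_inj b) => //; [clear - b3; lia | rewrite -A2].
- by clear - A3 B3; lia.
Qed.

(** The cofactor is a sum of an odd number of odd terms. Hence [b ^ y - r] and [b - r] have the same
    2-adic order for odd [y]. *)
Lemma odd_cofactor b r k : r * r = 1 -> Z.Odd b ->
  exists q, b ^ (2 * Z.of_nat k + 1) - r = (b - r) * (2 * q + 1).
Proof.
move=> r2 [j Ej]; elim: k => [|k [q IH]].
  by exists 0; rewrite Z.pow_1_r; ring.
have -> : 2 * Z.of_nat k.+1 + 1 = Z.succ (Z.succ (2 * Z.of_nat k + 1)) by rewrite Nat2Z.inj_succ; clear; lia.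
rewrite Z.pow_succ_r; last by clear; lia.
rewrite Z.pow_succ_r; last by clear; lia.
have oq : b * b * (2 * q + 1) + r * (b + r) = 2 * (b * b * q + 2 * j * j + 3 * j + 1 + (r - 1) * j
   + (r - 1) / 2) + 1.
  have [->|->] : r = 1 \/ r = -1 by clear - r2; nia.
    by rewrite Ej (_ : (1 - 1) / 2 = 0) //; ring.
  by rewrite Ej (_ : (-1 - 1) / 2 = -1) //; ring.
exists (b * b * q + 2 * j * j + 3 * j + 1 + (r - 1) * j + (r - 1) / 2); rewrite -oq.
transitivity (b * b * (b ^ (2 * Z.of_nat k + 1) - r) + r * (b * b) - r); first ring.
transitivity (b * b * (b ^ (2 * Z.of_nat k + 1) - r) + r * (b * b) - r * r * r); first by rewrite r2; ring.
by rewrite IH; ring.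
Qed.

Lemma odd_pow_dvd2 b r y n : r * r = 1 -> Z.Odd b -> 1 <= y -> Z.Odd y -> 0 <= n ->
  (2 ^ n | b ^ y - r) <-> (2 ^ n | b - r).
Proof.
move=> r2 ob y1 oy n0; have [t t0 Ey] := half_odd _ y1 oy.
have [q] := odd_cofactor b r (Z.to_nat t) r2 ob; rewrite Z2Nat.id // -Ey => ->.
split; last exact: dvd_mul_l.
rewrite Z.mul_comm; apply: gauss_pow => //; first exact: prime_2.
by apply/zodd_ndvd; exists q.
Qed.

Lemma dvd_gap d z X Y : X + Y = 2 ^ z -> 0 < X -> 0 < Y -> 0 <= z -> 0 <= d ->
  (2 ^ d | Y) -> (2 ^ d | X).
Proof.
move=> E X0 Y0 z0 d0 dY; have [dz|zd] : d <= z \/ z < d by clear; lia.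
  have -> : X = 2 ^ z - Y by rewrite -E; ring.
  apply: Z.divide_sub_r => //; exists (2 ^ (z - d)); rewrite -Z.pow_add_r; [f_equal| |];
  by clear - dz d0; lia.
exfalso; have : 2 ^ d <= Y by apply: Z.divide_pos_le.
have : 2 ^ z < 2 ^ d by apply: Z.pow_lt_mono_r.
by clear - E X0; lia.
Qed.

Lemma unbounded_2adic a : 0 < a -> (forall n : nat, (2 ^ Z.of_nat n | a)) -> False.
Proof.
move=> a0 H; have := Z.divide_pos_le _ _ a0 (H (Z.to_nat a)).
rewrite Z2Nat.id; last by clear - a0; lia.
by have := Z.pow_gt_lin_r 2 a ltac:(by []) ltac:(clear - a0; lia); clear; lia.
Qed.

(** In terms of 2-adic orders, [v (a + 1) >= v (b ^ 2 - 1)]. The positive numbers [a ^ x + 1] and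
    [b ^ y - 1] add up to [2 ^ z], so a power of 2 dividing the second divides the first. *)
Lemma oe_claim a b x y z : 3 <= a -> 3 <= b -> Z.Odd a -> 1 <= x -> 1 <= y -> 0 <= z ->
  Z.Odd x -> Z.Even y -> a ^ x + b ^ y = 2 ^ z ->
  forall n, 0 <= n -> (2 ^ n | b * b - 1) -> (2 ^ n | a - -1).
Proof.
move=> a3 b3 oa x1 y1 z0 ox ey E n n0 dn.
have [t t1 Et] := half_even _ y1 ey.
have pa : 0 < a ^ x by apply: Z.pow_pos_nonneg; [clear - a3 | clear - x1]; lia.
have pb : 3 <= b ^ y by have := pow_ge_base b y ltac:(clear - b3; lia) y1; clear - b3; lia.
have dY : (2 ^ n | b ^ y - 1).
  have t0 : 0 <= t by clear - t1; lia.
  rewrite Et Z.pow_mul_r // -(Z.pow_1_l t) //.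
  by apply: pow_congr => //; rewrite Z.pow_2_r.
apply/(odd_pow_dvd2 a (-1) x n) => //.
apply: (dvd_gap n z _ (b ^ y - 1)) => //; [rewrite -E; ring | clear - pa; lia | clear - pb; lia].
Qed.

Lemma oo_claim a b x y z : 3 <= a -> 3 <= b -> Z.Odd a -> Z.Odd b -> 1 <= x -> 1 <= y -> 0 <= z ->
  Z.Odd x -> Z.Odd y -> a ^ x + b ^ y = 2 ^ z ->
  forall n, 0 <= n -> (2 ^ n | a - -1) -> (2 ^ n | b - 1).
Proof.
move=> a3 b3 oa ob x1 y1 z0 ox oy E n n0 dn.
have pa : 0 < a ^ x by apply: Z.pow_pos_nonneg; [clear - a3 | clear - x1]; lia.
have pb : 3 <= b ^ y by have := pow_ge_base b y ltac:(clear - b3; lia) y1; clear - b3; lia.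
apply/(odd_pow_dvd2 b 1 y n) => //.
apply: (dvd_gap n z _ (a ^ x - -1)) => //; [rewrite -E; ring | clear - pb; lia | clear - pa; lia |].
exact/odd_pow_dvd2.
Qed.

Lemma pow2_succ_mul n x y : 0 <= n -> (2 | y) -> (2 ^ n | x) -> (2 ^ (n + 1) | x * y).
Proof.
move=> n0 [v ->] [u ->]; exists (u * v); rewrite Z.pow_add_r //; ring.
Qed.

(** The orders would satisfy [v (a + 1) >= v (b ^ 2 - 1) >= v (b + 1) >= v (a ^ 2 - 1) > v (a + 1)];
    written as an induction, every power of 2 divides [a + 1]. *)
Lemma oe_eo_absurd a b : 3 <= a -> Z.Odd a -> Z.Odd b ->
  (forall n, 0 <= n -> (2 ^ n | b * b - 1) -> (2 ^ n | a - -1)) ->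
  (forall n, 0 <= n -> (2 ^ n | a * a - 1) -> (2 ^ n | b - -1)) -> False.
Proof.
move=> a3 [i Ei] [j Ej] H1 H2; apply: (unbounded_2adic (a - -1)); first by clear - a3; lia.
elim=> [|n IH]; first by rewrite Z.pow_0_r; apply: Z.divide_1_l.
have n0 : 0 <= Z.of_nat n by clear; lia.
have -> : Z.of_nat n.+1 = Z.of_nat n + 1 by rewrite Nat2Z.inj_succ; clear; lia.
apply: H1; first by clear; lia.
have -> : b * b - 1 = (b - -1) * (b - 1) by ring.
apply: dvd_mul_l; apply: H2; first by clear; lia.
have -> : a * a - 1 = (a - -1) * (a - 1) by ring.
by apply: pow2_succ_mul => //; exists i; rewrite Ei; ring.
Qed.

Lemma oe_oo_absurd a b : 3 <= a -> Z.Odd b ->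
  (forall n, 0 <= n -> (2 ^ n | b * b - 1) -> (2 ^ n | a - -1)) ->
  (forall n, 0 <= n -> (2 ^ n | a - -1) -> (2 ^ n | b - 1)) -> False.
Proof.
move=> a3 [j Ej] H1 H2; apply: (unbounded_2adic (a - -1)); first by clear - a3; lia.
elim=> [|n IH]; first by rewrite Z.pow_0_r; apply: Z.divide_1_l.
have n0 : 0 <= Z.of_nat n by clear; lia.
have -> : Z.of_nat n.+1 = Z.of_nat n + 1 by rewrite Nat2Z.inj_succ; clear; lia.
apply: H1; first by clear; lia.
have -> : b * b - 1 = (b - 1) * (b - -1) by ring.
by apply: pow2_succ_mul => //; [exists (j + 1); rewrite Ej; ring | apply: H2].
Qed.

(** Both exponents even would make the sum 2 modulo 8. Two solutions with the same parities are
    covered by [two_same]; different parities contradict each other through the 2-adic orders of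
    [a + 1] and [b - 1] or their mirror images. *)
Lemma c2_unique a b x y z x' y' z' : zprime a -> zprime b -> 3 <= a -> 3 <= b -> a <> b ->
  ~ [\/ a = 3 /\ b = 5, a = 5 /\ b = 3, a = 13 /\ b = 3 | a = 3 /\ b = 13] ->
  1 <= x -> 1 <= y -> 1 <= z -> 1 <= x' -> 1 <= y' -> 1 <= z' ->
  a ^ x + b ^ y = 2 ^ z -> a ^ x' + b ^ y' = 2 ^ z' -> [/\ x = x', y = y' & z = z'].
Proof.
move=> ap bp a3 b3 ab nsp x1 y1 z1 x1' y1' z1' E E'.
have ba : b <> a by move=> H; apply: ab.
have nsp' : ~ [\/ b = 3 /\ a = 5, b = 5 /\ a = 3, b = 13 /\ a = 3 | b = 3 /\ a = 13].
  by case=> -[eb ea]; apply: nsp; [constructor 2|constructor 1|constructor 4|constructor 3].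
have oa := odd_prime a ap a3; have ob := odd_prime b bp b3.
have Es : b ^ y + a ^ x = 2 ^ z by rewrite -E; ring.
have Es' : b ^ y' + a ^ x' = 2 ^ z' by rewrite -E'; ring.
have z0 : 0 <= z by clear - z1; lia.
have z0' : 0 <= z' by clear - z1'; lia.
have no_ee u v n : 1 <= u -> 1 <= v -> 1 <= n -> Z.Even u -> Z.Even v -> a ^ u + b ^ v <> 2 ^ n.
  move=> u1 v1 n1 eu ev F.
  have [s s1 Eu] := half_even _ u1 eu; have [t t1 Ev] := half_even _ v1 ev.
  have sq c m : Z.Odd c -> 1 <= m -> exists q, c ^ (2 * m) = 8 * q + 1.
    move=> oc m1; rewrite -sq_pow; last by clear - m1; lia.
    by apply: prime_odd_sq_mod8; apply/Z.odd_spec; rewrite Z.odd_pow; [apply/Z.odd_spec | clear - m1; lia].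
  have [q Eq] := sq a s oa s1; have [r Er] := sq b t ob t1.
  have [n2|nn] : 2 <= n \/ n = 1 by clear - n1; lia.
    by have [w Ew] := pow2_div4 n n2; move: F; rewrite Eu Ev Eq Er Ew; clear; lia.
  have := pow_ge_base a u ltac:(clear - a3; lia) u1; have := pow_ge_base b v ltac:(clear - b3; lia) v1.
  by move: F; rewrite nn Z.pow_1_r; clear - a3 b3; lia.
have cls u v n : 1 <= u -> 1 <= v -> 1 <= n -> a ^ u + b ^ v = 2 ^ n ->
   [\/ Z.Odd u /\ Z.Even v, Z.Even u /\ Z.Odd v | Z.Odd u /\ Z.Odd v].
  move=> u1 v1 n1 F; have [eu|ou] := Z.Even_or_Odd u; have [ev|ov] := Z.Even_or_Odd v.
  - by case: (no_ee u v n u1 v1 n1 eu ev).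
  - by constructor 2.
  - by constructor 1.
  - by constructor 3.
have same_oe p q u v n u' v' n' : zprime p -> zprime q -> 3 <= p -> 3 <= q -> p <> q ->
    ~ [\/ p = 3 /\ q = 5, p = 5 /\ q = 3, p = 13 /\ q = 3 | p = 3 /\ q = 13] ->
    1 <= u -> 1 <= v -> 0 <= n -> 1 <= u' -> 1 <= v' -> 0 <= n' ->
    Z.Odd u -> Z.Even v -> Z.Odd u' -> Z.Even v' ->
    p ^ u + q ^ v = 2 ^ n -> p ^ u' + q ^ v' = 2 ^ n' -> [/\ u = u', v = v' & n = n'].
  move=> pp qp p3 q3 pq ns u1 v1 n0 u1' v1' n0' ou ev ou' ev' F F'.
  have [s s0 Eu] := half_odd _ u1 ou; have [t t1 Ev] := half_even _ v1 ev.
  have [s' s0' Eu'] := half_odd _ u1' ou'; have [t' t1' Ev'] := half_even _ v1' ev'.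
  have t0 : 0 <= t by clear - t1; lia.
  have t0' : 0 <= t' by clear - t1'; lia.
  rewrite Eu Ev pow_dbl_succ // -(sq_pow q) // in F; rewrite Eu' Ev' pow_dbl_succ // -(sq_pow q) // in F'.
  have [es et en] : [/\ s = s', t = t' & n = n'].
    by apply: (two_same p q 1) => //; [left | rewrite Z.mul_1_l | rewrite Z.mul_1_l].
  by rewrite Eu Ev Eu' Ev' es et en.
case: (cls x y z x1 y1 z1 E) => -[px py]; case: (cls x' y' z' x1' y1' z1' E') => -[px' py'].
- exact: (same_oe a b).
- have C := oe_claim a b x y z a3 b3 oa x1 y1 z0 px py E.
  have C' := oe_claim b a y' x' z' b3 a3 ob y1' x1' z0' py' px' Es'.
  by case: (oe_eo_absurd a b a3 oa ob C C').
- have C := oe_claim a b x y z a3 b3 oa x1 y1 z0 px py E.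
  have C' := oo_claim a b x' y' z' a3 b3 oa ob x1' y1' z0' px' py' E'.
  by case: (oe_oo_absurd a b a3 ob C C').
- have C := oe_claim a b x' y' z' a3 b3 oa x1' y1' z0' px' py' E'.
  have C' := oe_claim b a y x z b3 a3 ob y1 x1 z0 py px Es.
  by case: (oe_eo_absurd a b a3 oa ob C C').
- by have [-> -> ->] := same_oe b a y x z y' x' z' bp ap b3 a3 ba nsp' y1 x1 z0 y1' x1' z0' py px py' px' Es Es'.
- have C := oe_claim b a y x z b3 a3 ob y1 x1 z0 py px Es.
  have C' := oo_claim b a y' x' z' b3 a3 ob oa y1' x1' z0' py' px' Es'.
  by case: (oe_oo_absurd b a b3 oa C C').
- have C := oe_claim a b x' y' z' a3 b3 oa x1' y1' z0' px' py' E'.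
  have C' := oo_claim a b x y z a3 b3 oa ob x1 y1 z0 px py E.
  by case: (oe_oo_absurd a b a3 ob C C').
- have C := oe_claim b a y' x' z' b3 a3 ob y1' x1' z0' py' px' Es'.
  have C' := oo_claim b a y x z b3 a3 ob oa y1 x1 z0 py px Es.
  by case: (oe_oo_absurd b a b3 oa C C').
have [s s0 Eu] := half_odd _ x1 px; have [t t0 Ev] := half_odd _ y1 py.
have [s' s0' Eu'] := half_odd _ x1' px'; have [t' t0' Ev'] := half_odd _ y1' py'.
rewrite Eu Ev !pow_dbl_succ // in E; rewrite Eu' Ev' !pow_dbl_succ // in E'.
have [es et ez] : [/\ s = s', t = t' & z = z'].
  by apply: (two_same a b b) => //; [right | move=> b1; exfalso; clear - b1 b3; lia].
by rewrite Eu Ev Eu' Ev' es et ez.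
Qed.

(** * The sieve *)

Module Sieve.
Import List ListNotations.
Local Open Scope bool_scope.
Local Open Scope list_scope.
Local Open Scope N_scope.

Definition tr := PositiveMap.t.
Definition E0 {A} := PositiveMap.empty A.
(** A missing key counts as the default, which for lists and subtables means that nothing survives.
    Soundness therefore rests on showing that the entries of a true solution are present. *)
Definition get {A} (d : A) (t : tr A) (x : N) : A :=
  match PositiveMap.find (N.succ_pos x) t with Some v => v | None => d end.
Definition put {A} (x : N) (v : A) (t : tr A) : tr A := PositiveMap.add (N.succ_pos x) v t.
Fixpoint upto (x : N) (n : nat) : list N :=
  match n with O => [] | S n => x :: upto (N.succ x) n end.
Definition range (n : N) := upto 0 (N.to_nat n).
Definition stab {A} (ks : list N) (f : N -> A) : tr A :=
  fold_right (fun k t => put k (f k) t) E0 ks.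
Definition tab {A} (n : N) (f : N -> A) : tr A := stab (range n) f.
Definition memb (y : N) (l : list N) := existsb (fun a => a =? y) l.
Fixpoint pows_ (m b acc x : N) (n : nat) (t : tr N) : tr N :=
  match n with O => t | S n => pows_ m b ((acc * b) mod m) (N.succ x) n (put x acc t) end.
Definition pows (m a n : N) : tr N := pows_ m a 1 0 (N.to_nat n) E0.
Definition rows (m n : N) : tr (tr N) := tab m (fun a => pows m a n).
(* The row of 0 is filled with the impossible residue [m]. *)
Definition urows (m n : N) : tr (tr N) :=
  tab m (fun a => if a =? 0 then tab n (fun _ => m) else pows m a n).
Definition redm (m x : N) := if x <? m then x else x - m.
Definition powm (m : N) := fix go (b : N) (p : positive) : N := match p with
  | xH => b mod m | xO p => go ((b * b) mod m) p | xI p => (b * go ((b * b) mod m) p) mod m end.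
Definition pwm m b (e : N) := match e with 0 => 1 mod m | Npos p => powm m b p end.

(* For a modulus [mm] with unit group of exponent dividing 36: [ct] maps [i, b, e] to
   the powers of [2 ^ i + b ^ e], and [vt] maps [b, C, j] to the odd [y < 36] with
   [2 ^ j + b ^ y = C]. *)
Record md := Md { mm : N; adm : list N;
  ct : tr (tr (tr (tr N)));
  vt : tr (tr (tr (list N))) }.
Definition mkmd (m : N) (ok bad : N -> bool) : md :=
  let P := rows m 36 in
  let tw := get E0 P 2 in
  {| mm := m; adm := filter ok (range m);
     ct := tab 36 (fun i => let pi := get 0 tw i in
       tab m (fun b => if ok b then let rb := get E0 P b in
        tab 36 (fun e => let c := (pi + get 0 rb e) mod m in if bad c then E0 else get E0 P c) else E0));
     vt := tab m (fun b => if ok b then let rb := get E0 P b in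
        let vs := map (fun j => (j, map (fun y => ((get 0 tw j + get 0 rb y) mod m, y))
                                     (filter N.odd (range 36)))) (range 36) in
        tab m (fun C => fold_right (fun '(j, l) t =>
          put j (map snd (filter (fun q => fst q =? C) l)) t) E0 vs) else E0) |}.
Definition alist (M : md) i := let ci := get E0 (ct M) i in
  map (fun b => (b, get E0 ci b, get E0 (vt M) b)) (adm M).
Definition blist e (al : list (N * tr (tr N) * tr (tr (list N)))) :=
  map (fun '(b, cb, vb) => (b, get E0 cb e, vb)) al.
Definition clist (f : N) (bl : list (N * tr N * tr (tr (list N)))) :=
  map (fun '(b, row, vb) => (b, get E0 vb (get 0 row f))) bl.
Fixpoint addk (b : N) (ys : list N) (t : tr (list N)) := match ys with [] => t | y :: ys =>
  addk b ys (put y (b :: get [] t y) t) end.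
Definition elist (j : N) (cl : list (N * tr (list N))) : tr (list N) :=
  fold_right (fun '(b, t) acc => addk b (get [] t j) acc) E0 cl.

(* Chinese remaindering for an unknown [b < bound]: a pair [(r, rs)] consists of
   [r = b mod MM] and of (not necessarily reduced) residues of [r] modulo the next moduli. *)
Definition bound := 1000000000.
Definition inv_mod (a m : N) : N := hd 0 (filter (fun x => (a * x) mod m =? 1) (range m)).
Definition elt := (N * list N)%type.
(** [cc] is the number of residues summed in an unreduced residue [r0], so [r0 < cc m] and the index
    [b mod m + (cc m - r0)] needs no negative numbers. The entry is the multiple of [MM] to be added
    to [r]; if it reaches [bound], so would [b]. *)
Definition crt (cc m MM : N) (nxt : list N) : tr (option elt) :=
  let iv := inv_mod (MM mod m) m in
  tab (cc * m + m) (fun s => let x := MM * ((s * iv) mod m) in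
    if x <? bound then Some (x, map (fun q => x mod q) nxt) else None).
Fixpoint addres (ys xs : list N) : list N :=
  match ys, xs with y :: ys, x :: xs => y + x :: addres ys xs | _, _ => [] end.
Definition ext (cm : N) (t : tr (option elt)) (roots : list N) (R : list elt) : list elt :=
  fold_right (fun '(r, rs) acc =>
    match rs with [] => acc | r0 :: rs =>
      let k := cm - r0 in
      fold_right (fun a acc => match get None t (a + k) with
        Some (x, xs) => (r + x, addres rs xs) :: acc | None => acc end) acc roots end) [] R.

(* A family of equations [(2 ^ i + b ^ e) ^ f = 2 ^ j + b ^ y]: the lists give the classes
   of [f] and [e] modulo 12, of [i] (resp. [j]) modulo 12 if [fri] (resp. [frj]) holds and
   the exact values otherwise, and of [b] modulo [M2]; [rel4] and [rel16] list the possible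
   pairs [(2 ^ i, 2 ^ j)] modulo [M2] and [2 ^ k16].  If [sp = Some (f0, s)], the tuples with
   [f = f0] and (for [s = 0]) [i = j] modulo 36 are treated separately, the equation modulo
   the small primes being then a condition on [b] and [y - (1 - s) e] only. *)
Record cs := Cs { f0s : list N; i0s : list N; fri : bool; j0s : list N; frj : bool; e0s : list N;
  b3 : N; M2 : N; res2 : list N; rel4 : list (N * N); k16 : N; rel16 : list (N * N); sp : option (N * N) }.
Definition skipsp (c : cs) f i j :=
  match sp c with None => false | Some (f0, s) => (f =? f0) && ((s =? 1) || (i =? j)) end.
Definition lift3 (fr : bool) (x : N) := if fr then [x mod 12; x mod 12 + 12; x mod 12 + 24] else [x].
(** The test is meaningful only if [per] is a period of the powers of both bases modulo [m]. This is
    checked by computation; where it fails, the test accepts. *)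
Definition rel (o : list (N * N)) m per (k : N) : N -> N -> N -> bool :=
  match o with [] => fun _ _ _ => true | _ =>
    let pk := pows m k per in
    if negb (pwm m k per =? 1) then fun _ _ _ => true else
    let l := map (fun '(ti, tj) => (tab per (fun e => let c := (ti + get 0 pk e) mod m in
       if pwm m c per =? 1 then Some (pows m c per) else None), tj)) o in
    fun f e y => existsb (fun '(te, tj) => match get None te e with None => true | Some pc =>
      get 0 pc f =? (tj + get 0 pk y) mod m end) l end.

(** * The search over exponents modulo 12 and 36 *)

Section Cases.
Variable c : cs.
Variables m5 m7 m13 m27 m19 m37 : md.
Variables t5 t7 t13 t27 t19 : tr (option elt).
Variable rels : list (N * (N -> N -> N -> bool)).
Variable leaf : N -> N -> N -> N -> N -> list elt -> list N -> bool.
Definition nonempty {A} (l : list A) := match l with [] => false | _ => true end.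
Definition level12 f e (e5 e7 e13 : tr (list N)) : list (N * list elt) :=
  filter (fun '(y, R) => nonempty R) (map (fun y =>
    (y, match get [] e5 y with [] => [] | r5 =>
        match get [] e7 y with [] => [] | r7 =>
        match get [] e13 y with [] => [] | r13 =>
        let R0 := map (fun '(r, _) => (r, [r mod 5; r mod 7; r mod 13]))
                      (filter (fun '(r, rl) => rl (f mod 4) (e mod 4) (y mod 4)) rels) in
        map (fun '(r, _) => (r, [r mod 27; r mod 19; r mod 37; r mod 73]))
            (ext 39 t13 r13 (ext 14 t7 r7 (ext 5 t5 r5 R0))) end end end)) [1; 3; 5; 7; 9; 11]).
Definition level36 f i j e (RY : list (N * list elt)) (e27 e19 e37 : tr (list N)) : bool :=
  forallb (fun '(y, R) => forallb (fun y =>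
    match get [] e27 y with [] => true | r27 =>
    match get [] e19 y with [] => true | r19 =>
    match get [] e37 y with [] => true | r37 =>
    leaf f i j e y (ext 38 t19 r19 (ext 27 t27 r27 R)) r37
    end end end) [y; y + 12; y + 24]) RY.
(** The moduli 5, 7, 13 have periods dividing 12 and are used before exponents are split modulo 36,
    where 27, 19 and 37 enter. The table columns for [i], [e] and [f] are extracted as soon as these
    are fixed, outside the inner loops. *)
Definition cases36 : bool :=
  forallb (fun i => let a5 := alist m5 i in let a7 := alist m7 i in let a13 := alist m13 i in
   forallb (fun e => let b5 := blist e a5 in let b7 := blist e a7 in let b13 := blist e a13 in
   forallb (fun f => let c5 := clist f b5 in let c7 := clist f b7 in let c13 := clist f b13 in
    let JR := filter (fun '(j, RY) => nonempty RY)
      (map (fun j => (j, level12 f e (elist j c5) (elist j c7) (elist j c13))) (j0s c)) in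
    match JR with [] => true | _ =>
    forallb (fun i => let a27 := alist m27 i in let a19 := alist m19 i in let a37 := alist m37 i in
    forallb (fun e => let b27 := blist e a27 in let b19 := blist e a19 in let b37 := blist e a37 in
    forallb (fun f => let c27 := clist f b27 in let c19 := clist f b19 in let c37 := clist f b37 in
      forallb (fun '(j, RY) => forallb (fun j =>
        if skipsp c f i j then true else
        level36 f i j e RY (elist j c27) (elist j c19) (elist j c37)) (lift3 (frj c) j)) JR)
      (lift3 true f)) (lift3 true e)) (lift3 (fri c) i) end)
   (f0s c)) (e0s c)) (i0s c).
End Cases.

(* Modulo 73 the squares of both sides are determined, up to finitely many sign choices,
   by the exponents modulo 36. *)
Definition sq (m x : N) := (x * x) mod m.
Definition ct73 : tr (tr (tr (tr N * option (tr N)))) :=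
  let P := rows 73 72 in let tw := get E0 P 2 in
  let PP := tab 73 (fun a => if a =? 0 then E0 else let ra := get E0 P a in tab 36 (fun f => sq 73 (get 0 ra f))) in
  tab 36 (fun i => if N.odd i then E0 else let pi := get 0 tw i in
   tab 36 (fun e => tab 73 (fun b => let rb := get E0 P b in let be := get 0 rb e in
     let g x := get E0 PP (redm 73 (pi + x)) in
     (g be, if get 0 rb 36 =? 1 then None else Some (g (73 - be)))))).
Definition vt73 : tr (tr (tr (N * N))) :=
  let P := rows 73 72 in let tw := get E0 P 2 in
  tab 36 (fun j => let pj := get 0 tw j in
   tab 36 (fun y => if N.even y then E0 else tab 73 (fun b => let rb := get E0 P b in let by_ := get 0 rb y in
      (sq 73 (pj + by_), sq 73 (pj + (73 - by_)))))).
Definition chk73 (ce : tr (tr N * option (tr N))) (vy : tr (N * N)) f rho : bool :=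
  let '(r1, r2) := get (E0, None) ce rho in
  let '(s1, s2) := get (0, 0) vy rho in
  let D1 := get 73 r1 f in
  if D1 =? s1 then true else if D1 =? s2 then true else
  match r2 with None => false | Some r2 => let D2 := get 73 r2 f in
  if D2 =? s1 then true else D2 =? s2 end.

Section Leaf.
Variable x37 : tr (option (N * N)).
Variable t73 : tr N.
Variable AA AA73 : N.
Variable kmax : nat.
Variable next : N -> N -> N -> N -> N -> N -> N -> bool.
(** The product of the moduli can be smaller than [bound]. Then [b] is one of several numbers at
    distance [AA]; their residues modulo 73 are carried along without division. *)
Fixpoint up ce vy (f i j e y : N) (n : nat) rho r x : bool :=
  (let rho := get 0 t73 rho in if chk73 ce vy f rho then
     let b := r + x in if b <? bound then next rho b f i j e y else true else true)
  && match n with O => true | S n => up ce vy f i j e y n (rho + AA73) r (x + AA) end.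
Definition leaf ct vt f i j e y (R : list elt) (r37 : list N) : bool :=
  let ce := get E0 (get E0 ct i) e in let vy := get E0 (get E0 vt j) y in
  forallb (fun '(r, rs) => match rs with r0 :: r73 :: _ => let k := 111 - r0 in
    forallb (fun a => match get None x37 (a + k) with
      Some (x, t) => up ce vy f i j e y kmax (r73 + t) r x | None => true end) r37
    | _ => true end) R.
End Leaf.

Inductive tup := T5 (f i j e y : N).
Definition T17 := tr (tr (tr (tr (tr (tr (tr (list tup))))))).
Definition plus4 x := [x; x + 4; x + 8; x + 12].
(* exponents modulo 16 (modulo 8 for [i], [j]) compatible with the moduli 17 and [2 ^ k16] *)
Definition mkT17 (keys is8 js4 es4 fs4 : list N) (o : list (N * N)) (m : N) : T17 :=
  let P := urows 17 16 in let tw := get E0 P 2 in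
  stab keys (fun k =>
   let rl := rel o m 16 k in
   let tt := stab es4 (fun e0 => stab fs4 (fun f0 => stab [1; 3] (fun y0 =>
      flat_map (fun e => flat_map (fun f => flat_map (fun y => if rl f e y then [(e, f, y)] else [])
        (plus4 y0)) (plus4 f0)) (plus4 e0)))) in
   stab (tl (range 17)) (fun b => let rb := get E0 P b in
    stab is8 (fun i => let pi := get 0 tw i in
     let cs := tab 16 (fun e => get E0 P (redm 17 (pi + get 0 rb e))) in
     stab es4 (fun e0 => let te := get E0 tt e0 in stab fs4 (fun f0 => let tf := get E0 te f0 in
     stab js4 (fun j0 => stab [1; 3] (fun y0 => let l := get [] tf y0 in
       flat_map (fun j => let pj := get 0 tw j in flat_map (fun '(e, f, y) =>
          if get 0 (get E0 cs e) f =? redm 17 (pj + get 0 rb y) then [T5 f i j e y] else []) l)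
         [j0; j0 + 4]))))))).
Definition keys (c : cs) := if k16 c =? 0 then [0]
  else filter (fun k => memb (k mod M2 c) (res2 c)) (range (2 ^ k16 c)).
Definition mkT (c : cs) := mkT17 (keys c)
  (if fri c then filter (fun r => existsb (fun i => i mod 4 =? r mod 4) (i0s c)) (range 8)
   else map (fun i => i mod 8) (i0s c))
  (filter (fun r => memb r (map (fun j => j mod 4) (j0s c))) (range 4))
  (filter (fun r => memb r (map (fun j => j mod 4) (e0s c))) (range 4))
  (filter (fun r => memb r (map (fun j => j mod 4) (f0s c))) (range 4)) (rel16 c) (2 ^ k16 c).
Definition T0 := mkT17 [0] [0; 2; 4; 6] [0; 1; 2; 3] [0; 2] [0; 1; 2; 3] [] 1.
Definition crt16 : tr (tr N) := tab 36 (fun x => stab (filter (fun z => z mod 4 =? x mod 4) (range 16))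
  (fun z => hd 0 (filter (fun t => t mod 16 =? z) [x; x + 36; x + 72; x + 108]))).
Definition crt8 : tr (tr N) := tab 36 (fun x => stab (filter (fun z => z mod 4 =? x mod 4) (range 8))
  (fun z => hd 0 (filter (fun t => t mod 8 =? z) [x; x + 36]))).

Definition small := [11; 17; 23; 29; 31; 41; 43; 47; 53; 59; 61; 67; 71; 73; 79; 83; 89; 97; 101; 103; 107; 233; 307; 3343].
(** Either the prime base [2 ^ i + b ^ e] would be divisible by 257, or the congruence
    [2 ^ (i f) = 2 ^ j] modulo [b] fails. As the exponents are known only modulo [L / 2] or [L], the
    latter is raised to the power [(b - 1) / d], after which only exponents modulo [d] matter. *)
Definition final (L b : N) (t : tup) : bool :=
  let '(T5 f i j e y) := t in
  ((pwm 257 b L =? 1) && (pwm 257 2 L =? 1) && ((pwm 257 2 i + pwm 257 b e) mod 257 =? 0)) ||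
  (let d := N.gcd (L / 2) (b - 1) in let h := pwm b 2 ((b - 1) / d) in
   (pwm b h d =? 1) && negb (pwm b h ((f * i + L - j) mod d) =? 1)).
Section Chain.
Variable c : cs.
Variable t17 : T17.
Variables P73 P97 P193 P433 K16 K8 : tr (tr N).
Variable cub : tr N.
Definition cand (rho b : N) : N -> N -> N -> N -> N -> list tup :=
  let t := get E0 (get E0 t17 (N.land b (N.ones (k16 c)))) (b mod 17) in
  let rb := get E0 P73 rho in
  let tw := get E0 P73 2 in
  fun f i j e y =>
  let f4 := f mod 4 in let j4 := j mod 4 in let e4 := e mod 4 in let y4 := y mod 4 in
  fold_right (fun i8 acc =>
   match get [] (get E0 (get E0 (get E0 (get E0 t i8) e4) f4) j4) y4 with [] => acc | l =>
   let pi := get 0 tw i in let pj := get 0 tw j in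
   let ke := get E0 K16 e in let kf := get E0 K16 f in let ky := get E0 K16 y in
   let ki := get E0 K8 i in let kj := get E0 K8 j in
   let j8 := j mod 8 in
   fold_right (fun '(T5 f' _ j' e' y') acc =>
    if if frj c then false else negb (j' =? j8) then acc else
    let e := get 0 ke e' in let f := get 0 kf f' in let y := get 0 ky y' in
    if get 0 (get E0 P73 (redm 73 (pi + get 0 rb e))) f =? redm 73 (pj + get 0 rb y) then
      T5 f (if fri c then get 0 ki i8 else i) (if frj c then get 0 kj j' else j) e y :: acc else acc) acc l end) []
  (if fri c then let i4 := i mod 4 in [i4; i4 + 4] else [i mod 8]).
(** The known exponents determine powers modulo 97 only through their residues modulo 48, half the
    full period, hence up to sign. The signs of the two powers of 2 can be absorbed into the signs
    of the whole sums, so only the others are tried. *)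
Definition chk97 (rb : tr N) (t : tup) : bool :=
  let '(T5 f i j e y) := t in
  let f := f mod 48 in
  let tw := get E0 P97 2 in let be := get 0 rb (e mod 48) in let by_ := get 0 rb (y mod 48) in
  let pi := get 0 tw (i mod 48) in let p := get 0 tw (j mod 48) in
  let q := redm 97 (p + by_) in let q' := redm 97 (p + (97 - by_)) in
  let k be := let cc := redm 97 (pi + be) in if cc =? 0 then false else
     let C := get 0 (get E0 P97 cc) f in if C =? q then true else if C =? q' then true else
     let C := 97 - C in if C =? q then true else C =? q' in
  if k be then true else k (97 - be).
(* The cubes modulo 433 are determined by the exponents modulo 144 once those of the base
   [2 ^ i + b ^ e] are. *)
Definition chk433 (rb : tr N) (t : tup) : bool :=
  let '(T5 f i j e y) := t in
  let tw := get E0 P433 2 in let pi := get 0 tw i in let pj := 433 - get 0 tw j in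
  let Y := get 0 cub (get 0 rb y) in
  let f1 := f + 144 in let f2 := f + 288 in
  existsb (fun e => let cc := redm 433 (pi + get 0 rb e) in if cc =? 0 then false else
    let rc := get E0 P433 cc in
    let g f := get 0 cub (redm 433 (get 0 rc f + pj)) =? Y in
    if g f then true else if g f1 then true else g f2) [e; e + 144; e + 288].
(* from the exponents modulo [L] ([L / 2] for [i], [j]) to twice as much, testing modulo [m] *)
Definition lift2 (m : N) (pwr : N -> N -> N) (L b : N) (t : tup) : list tup :=
  let '(T5 f i j e y) := t in
  let o := m - 1 in let L2 := L / 2 in
  let il := if fri c then [i; i + L2] else [i] in let jl := if frj c then [j; j + L2] else [j] in
  let rho := b mod m in
  if rho =? 0 then
    flat_map (fun i => flat_map (fun j => flat_map (fun e => flat_map (fun f =>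
      map (fun y => T5 f i j e y) [y; y + L]) [f; f + L]) [e; e + L]) jl) il
  else
  let rb := pwr rho in let tw := pwr 2 in
  let ys := map (fun y => (y, rb (y mod o))) [y; y + L] in
  let fs := map (fun f => (f, f mod o)) [f; f + L] in
  let js := map (fun j => (j, tw (j mod o))) jl in
  flat_map (fun e => let be := rb (e mod o) in
   flat_map (fun i => let cc := redm m (tw (i mod o) + be) in if cc =? 0 then [] else let rc := pwr cc in
    flat_map (fun '(f, fo) => let C := rc fo in
     flat_map (fun '(j, pj) => flat_map (fun '(y, by_) =>
       if redm m (pj + by_) =? C then [T5 f i j e y] else []) ys) js) fs) il) [e; e + L].
Definition tabpow (P : tr (tr N)) (a : N) := let r := get E0 P a in fun e => get 0 r e.
(** The primes 97, 193, 577 and 1153 are congruent to 1 modulo 8, so 2 is a square modulo each and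
    [i], [j] are needed only modulo half the period of the other exponents. Each of the four steps
    doubles all periods. *)
Definition chain b l :=
  match (let r := b mod 97 in if r =? 0 then l else filter (chk97 (get E0 P97 r)) l) with [] => true | l =>
  match (let r := b mod 433 in if r =? 0 then l else filter (chk433 (get E0 P433 r)) l) with [] => true | l =>
  if existsb (fun p => (b mod p =? 0) && (p <? b)) small then true else
  match flat_map (lift2 97 (tabpow P97) 144 b) l with [] => true | l =>
  match flat_map (lift2 193 (tabpow P193) 288 b) l with [] => true | l =>
  match flat_map (lift2 577 (pwm 577) 576 b) l with [] => true | l =>
  match flat_map (lift2 1153 (pwm 1153) 1152 b) l with [] => true | l =>
  forallb (final 2304 b) l end end end end end end.
Definition next (rho b : N) : N -> N -> N -> N -> N -> bool :=
  if b <? 35 then fun _ _ _ _ _ => true else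
  let k := cand rho b in fun f i j e y =>
  match k f i j e y with [] => true | l => chain b l end.
End Chain.

Definition nz (x : N) := negb (x =? 0).
Definition bz (x : N) := x =? 0.
Definition mds := (mkmd 5 nz bz, mkmd 7 nz bz, mkmd 13 nz bz, mkmd 19 nz bz, mkmd 37 nz bz).
Definition md27 b3 := mkmd 27 (fun b => b mod 3 =? b3) (fun x => x mod 3 =? 0).
Section Run.
Variable T : (md * md * md * md * md)%type.
Variable m27 : md.
Variable c : cs.
Variable ct : tr (tr (tr (tr N * option (tr N)))).
Variable vt : tr (tr (tr (N * N))).
Definition A5 := M2 c.
Definition A7 := A5 * 5.
Definition A13 := A7 * 7.
Definition A27 := A13 * 13.
Definition A19 := A27 * 27.
Definition A37 := A19 * 19.
Definition A73 := A37 * 37.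
Definition wf : bool :=
  forallb (fun '(m, MM) => (MM * inv_mod (MM mod m) m) mod m =? 1)
    [(5, A5); (7, A7); (13, A13); (27, A27); (19, A19); (37, A37)]
  && forallb (fun i => i <? 36) (i0s c ++ j0s c).
Definition general (next : N -> N -> N -> N -> N -> N -> N -> bool) : bool :=
  let '(m5, m7, m13, m19, m37) := T in
  let e37 := crt 3 37 A37 [73] in
  let x37 := tab 148 (fun s => match get None e37 s with Some (x, t :: _) => Some (x, t) | _ => None end) in
  let kmax := bound / A73 in
  let t73 := tab (73 * (kmax + 5)) (fun x => x mod 73) in
  cases36 c m5 m7 m13 m27 m19 m37 (crt 1 5 A5 [7; 13]) (crt 2 7 A7 [13]) (crt 3 13 A13 [])
    (crt 1 27 A27 [19; 37; 73]) (crt 2 19 A19 [37; 73])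
    (map (fun r => (r, rel (rel4 c) (M2 c) 4 r)) (res2 c))
    (leaf x37 t73 A73 (A73 mod 73) (N.to_nat kmax) next ct vt).
Definition special (next : N -> N -> N -> N -> N -> N -> N -> bool) : bool :=
  match sp c with None => true | Some (f0, s) =>
  let '(m5, m7, m13, m19, m37) := T in
  let t5 := crt 1 5 A5 [7;13;27;19;37;73] in
  let t7 := crt 2 7 A7 [13;27;19;37;73] in
  let t13 := crt 3 13 A13 [27;19;37;73] in
  let t27 := crt 4 27 A27 [19;37;73] in
  let t19 := crt 5 19 A19 [37;73] in
  let t37 := crt 6 37 A37 [73] in
  let i := hd 0 (if fri c then j0s c else i0s c) in let j := if frj c then i else hd 0 (j0s c) in
  let ci := get E0 ct i in let vj := get E0 vt j in
  let copies := upto 0 (S (N.to_nat (bound / A73))) in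
  let es := filter (fun e => memb (e mod 12) (e0s c)) (range 36) in
  let rels := map (fun r => (r, rel (rel4 c) (M2 c) 4 r)) (res2 c) in
  forallb (fun n =>
    let rt (M : md) := let m := mm M in
      filter (fun b => (s * 2 ^ j + pwm m b n) mod m =? 1) (adm M) in
    let R0 := map (fun '(r, _) => (r, [r mod 5; r mod 7; r mod 13; r mod 27; r mod 19; r mod 37; r mod 73]))
      (filter (fun '(r, rl) => existsb (fun e => rl (f0 mod 4) e (((1 - s) * e + n) mod 4)) [0; 2]) rels) in
    let R := ext 39 t13 (rt m13) (ext 14 t7 (rt m7) (ext 5 t5 (rt m5) R0)) in
    let R := ext 222 t37 (rt m37) (ext 95 t19 (rt m19) (ext 108 t27 (rt m27) R)) in
    let L := tab 73 (fun rho => fold_right (fun e acc => let y := ((1 - s) * e + n) mod 36 in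
        if chk73 (get E0 ci e) (get E0 vj y) f0 rho then (e, y) :: acc else acc) [] es) in
    forallb (fun '(r, _) => forallb (fun k => let b := r + k * A73 in
       if b <? bound then let rho := b mod 73 in
         match get [] L rho with [] => true | l =>
         let g := next rho b f0 i j in forallb (fun '(e, y) => g e y) l end else true) copies) R)
    (filter N.odd (range 36)) end.
End Run.
Definition runall (l : list cs) : bool :=
  let T := mds in let n1 := md27 1 in let n2 := md27 2 in let P73 := urows 73 144 in let P97 := rows 97 96 in
  let K16 := crt16 in let K8 := crt8 in
  let P193 := rows 193 192 in let P433 := rows 433 432 in let cub := tab 433 (fun x => (x * ((x * x) mod 433)) mod 433) in
  let t0 := T0 in let ct := ct73 in let vt := vt73 in
  forallb (fun c => let m27 := if b3 c =? 1 then n1 else n2 in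
    let nx := next c (if k16 c =? 0 then t0 else mkT c) P73 P97 P193 P433 K16 K8 cub in
    wf c && special T m27 c ct vt nx && general T m27 c ct vt nx) l.

(** * The families submitted to the sieve *)

Definition oddf := [1; 3; 5; 7; 9; 11].
Definition evn := [0; 2; 4; 6; 8; 10].
(** A unit congruent to 1 modulo [2 ^ (2 al)] has order dividing 16 modulo [2 ^ (2 al + 4)], which
    suits the period 16 of the tables. The value 0 switches this refinement off. *)
Definition kk al := if al <? 5 then 2 * al + 4 else 0.
(** Kinds A, B, C have [f] odd, [i = 2 alpha], [j = 2 gamma] and [b] congruent to 1 modulo 3. In A
    one has [alpha < gamma], and [2 alpha] is the exact 2-adic order of [b - 1]; B is
    [gamma < alpha] with order [2 gamma], and C is [alpha = gamma] with a larger order. *)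
Definition caseA al := let V := 2 * al in let M := 2 ^ (V + 2) in
  Cs oddf [V] false evn true evn 1 M [1 + 2 ^ V; 1 + 2 ^ V + 2 ^ (V + 1)] [(2 ^ V, 0)]
    (kk al) [(2 ^ V, 0)] (if al =? 2 then Some (1, 0) else None).
(** The subcase [gamma = alpha + 1] of A, in which [2 ^ j] does not vanish modulo [2 ^ (2 al + 4)]
    and the refined table of A would not apply. *)
Definition caseA' al := let V := 2 * al in let M := 2 ^ (V + 2) in
  Cs oddf [V] false [V + 2] false evn 1 M [1 + 2 ^ V; 1 + 2 ^ V + 2 ^ (V + 1)] [(2 ^ V, 0)] 0 [] None.
Definition caseB ga := let V := 2 * ga in let M := 2 ^ (V + 2) in
  Cs oddf [0; 4; 8] true [V] false evn 1 M [1 + 2 ^ V; 1 + 2 ^ V + 2 ^ (V + 1)] [(0, 2 ^ V)]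
    (if N.even ga then kk ga else 0) [(0, 2 ^ V)] (if ga =? 2 then Some (1, 0) else None).
Definition caseC al := let V := 2 * al in let M := 2 ^ (V + 2) in
  Cs oddf [V] false [V] false evn 1 M [1; 1 + 2 ^ (V + 1)] [(2 ^ V, 2 ^ V)]
    (kk al) [(2 ^ V, 2 ^ V)] (if al =? 2 then Some (1, 0) else None).
Definition ee par := if N.even par then [0; 4; 8] else [2; 6; 10].
(** The remaining kinds have [f = 2 w] and [b] congruent to 2 modulo 3, and [alpha] and [beta] have
    the same parity. X is [j = 1], which forces [b] close to -1 in the 2-adic sense; in P, Q, R and
    S it is close to 1. *)
Definition caseX al := let V := 2 * al in let M := 2 ^ (V + 2) in
  Cs evn [V] false [1] false (ee al) 2 M [M - 1; M / 2 - 1] [(2 ^ V, 2)]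
    (if al =? 2 then 8 else 0) [(2 ^ V, 2)] (if al =? 2 then Some (0, 1) else None).
Definition caseP al := Cs [2; 6; 10] [2 * al] false oddf true (ee al) 2
  (2 ^ (2 * al + 2)) [1 + 2 ^ (2 * al + 1)] [] 0 [] None.
Definition caseQ al := Cs [0; 4; 8] [2 * al] false oddf true (ee al) 2 (2 ^ (2 * al + 2)) [1] [] 0 [] None.
Definition caseR al := Cs [2; 6; 10] [2 * al] false [2 * al + 1] false (ee al) 2 (2 ^ (2 * al + 2)) [1] [] 0 [] None.
(** Here [j] is the order [V] of [b - 1], while [alpha] is not bounded in terms of [b]; only its
    parity enters and [i] stays free. *)
Definition caseS V par := Cs evn (ee par) true [V] false (ee par) 2 (2 ^ (V + 1)) [1 + 2 ^ V] [] 0 [] None.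
Definition caseS3 par := Cs evn (ee par) true [3] false (ee par) 2 32 [9; 25] [(0, 8); (16, 8)] 7
  [(0, 8); (if N.even par then 16 else 64, 8)] None.
(** The limit 14 comes from [2 ^ (2 al) < 2 ^ 30], since this power divides [b - 1] or [b + 1]. *)
Definition evl := [2; 4; 6; 8; 10; 12; 14].
Definition alll := [2; 3; 4; 5; 6; 7; 8; 9; 10; 11; 12; 13; 14].
Definition allcases := caseA' 2 :: caseA' 4 :: map caseA evl ++ map caseB alll ++ map caseC evl ++ map caseX alll
  ++ map caseP alll ++ map caseQ alll ++ map caseR alll ++ caseS3 0 :: caseS3 1 ::
  flat_map (fun V => [caseS V 0; caseS V 1]) [5; 7; 9; 11; 13; 15; 17; 19; 21; 23; 25; 27; 29].
End Sieve.

(** * Correctness of the sieve *)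

Module Tables.
Import List ListNotations Sieve.
Local Open Scope bool_scope.
Local Open Scope list_scope.
Local Open Scope N_scope.
Local Arguments N.pow : simpl never.
Local Arguments N.mul : simpl never.
Local Arguments N.add : simpl never.
Local Arguments N.sub : simpl never.
Local Arguments N.modulo : simpl never.

Lemma get_put A (d : A) x v t : get d (put x v t) x = v.
Proof. by rewrite /get /put PositiveMap.gss. Qed.

Lemma get_put_other A (d : A) x y v t : x <> y -> get d (put x v t) y = get d t y.
Proof.
move=> h; rewrite /get /put PositiveMap.gso // => e; apply: h.
by rewrite -(N.pos_pred_succ x) -(N.pos_pred_succ y) e.
Qed.

Lemma get_stab A (d : A) ks f x : In x ks -> get d (stab ks f) x = f x.
Proof.
elim: ks => [|k ks IH] //= h; rewrite /stab /= -/(stab ks f).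
case: (N.eq_dec k x) => [->|ne]; first by rewrite get_put.
by rewrite get_put_other //; apply: IH; case: h.
Qed.

Lemma in_upto x n k : In k (upto x n) <-> x <= k < x + N.of_nat n.
Proof. elim: n x => [|n IH] x /=; [lia | rewrite IH; lia]. Qed.

Lemma in_range n k : In k (range n) <-> k < n.
Proof. by rewrite /range in_upto; lia. Qed.

Lemma get_tab A (d : A) n f x : x < n -> get d (tab n f) x = f x.
Proof. by move=> h; apply/get_stab/in_range. Qed.

Lemma memb_in x l : In x l -> memb x l = true.
Proof. by move=> h; apply/existsb_exists; exists x; split => //; apply/N.eqb_eq. Qed.

Lemma get_pows_ m b acc x n t e : m <> 0 -> acc < m -> x <= e < x + N.of_nat n ->
  get 0 (pows_ m b acc x n t) e = (acc * b ^ (e - x)) mod m.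
Proof.
move=> hm; elim: n acc x t => [|n IH] acc x t ha he; first lia.
have keep n' acc' x' t' : x' > e -> get 0 (pows_ m b acc' x' n' t') e = get 0 t' e.
  elim: n' acc' x' t' => [|n' IH'] acc' x' t' h //=.
  by rewrite IH' ?get_put_other //; lia.
rewrite /=; case: (N.eq_dec x e) => [xe|ne].
  rewrite keep; last lia.
  by rewrite -xe get_put N.sub_diag N.mul_1_r N.mod_small.
rewrite IH; [|exact: N.mod_lt|lia].
rewrite N.Div0.mul_mod_idemp_l -N.mul_assoc -N.pow_succ_r'.
by congr (_ * _ ^ _ mod _); lia.
Qed.

Lemma get_pows m a n e : 1 < m -> e < n -> get 0 (pows m a n) e = a ^ e mod m.
Proof.
move=> hm he; rewrite /pows get_pows_; [|lia|lia|lia].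
by rewrite N.mul_1_l N.sub_0_r.
Qed.

Lemma get_rows m n a : a < m -> get E0 (rows m n) a = pows m a n.
Proof. exact: get_tab. Qed.

Lemma get_urows m n a : a < m -> a <> 0 -> get E0 (urows m n) a = pows m a n.
Proof. by move=> h ne; rewrite get_tab //; case: N.eqb_spec. Qed.

Lemma mod_pow_l m a x : (a mod m) ^ x mod m = a ^ x mod m.
Proof.
elim/N.peano_ind: x => [|x IH] //.
by rewrite !N.pow_succ_r' N.Div0.mul_mod IH N.Div0.mod_mod -N.Div0.mul_mod.
Qed.

Lemma powm_spec m b p : m <> 0 -> powm m b p = b ^ N.pos p mod m.
Proof.
move=> hm; elim: p b => [p IH|p IH|] b /=.
- rewrite IH mod_pow_l N.Div0.mul_mod_idemp_r (_ : N.pos p~1 = N.succ (2 * N.pos p)); last lia.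
  by rewrite N.pow_succ_r' N.pow_mul_r N.pow_2_r.
- rewrite IH mod_pow_l (_ : N.pos p~0 = 2 * N.pos p); last lia.
  by rewrite N.pow_mul_r N.pow_2_r.
- by rewrite N.pow_1_r.
Qed.

Lemma pwm_spec m b e : m <> 0 -> pwm m b e = b ^ e mod m.
Proof. by case: e => [|p] hm //; exact: powm_spec. Qed.

Lemma redm_spec m x : x < 2 * m -> redm m x = x mod m.
Proof.
move=> h; rewrite /redm; case: N.ltb_spec => h'; first by rewrite N.mod_small.
by apply: (N.mod_unique _ _ 1); lia.
Qed.

Lemma pow_period m n a x : 1 < m -> a ^ n mod m = 1 -> a ^ x mod m = a ^ (x mod n) mod m.
Proof.
move=> hm h; case: (N.eq_dec n 0) => [->|n0].
  by case: x => [|p]; rewrite /= ?N.mod_0_r.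
rewrite {1}(N.div_mod x n n0) N.pow_add_r N.pow_mul_r N.Div0.mul_mod -(mod_pow_l m (a ^ n)) h.
by rewrite N.pow_1_l N.mod_1_l // N.mul_1_l N.Div0.mod_mod.
Qed.

(* the exponent of a power may be replaced by its residue modulo a multiple [L] of the period [n], and then reduced modulo [n] *)
Lemma pow_period2 m n L a x : 1 < m -> a ^ n mod m = 1 -> (n | L) ->
  a ^ x mod m = a ^ (x mod L mod n) mod m.
Proof.
move=> hm h [q ->]; rewrite -(pow_period _ n _ _ hm h); apply: pow_period => //.
by rewrite N.mul_comm N.pow_mul_r -mod_pow_l h N.pow_1_l N.mod_1_l.
Qed.

Lemma match_nil A B (l : list A) (x : A) (u v : B) : In x l -> match l with [] => u | _ => v end = v.
Proof. by case: l. Qed.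
End Tables.

(** * Residues of [b] compatible with the equation modulo one number *)

Module Columns.
Import List ListNotations Sieve Tables.
Local Open Scope bool_scope.
Local Open Scope list_scope.
Local Open Scope N_scope.
Local Arguments N.pow : simpl never.
Local Arguments N.mul : simpl never.
Local Arguments N.add : simpl never.
Local Arguments N.sub : simpl never.
Local Arguments N.modulo : simpl never.
Local Opaque tab range get rows pows.

Lemma addk_mono b ys t x y : In x (get [] t y) -> In x (get [] (addk b ys t) y).
Proof.
elim: ys t => [|y' ys IH] t h //=; apply: IH.
case: (N.eq_dec y' y) => [e|ne]; last by rewrite get_put_other.
by rewrite e get_put; right.
Qed.

Lemma addk_in b ys t y : In y ys -> In b (get [] (addk b ys t) y).
Proof.
elim: ys t => [|y' ys IH] t //= [e|h]; last exact: IH.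
by apply: addk_mono; rewrite e get_put; left.
Qed.

Lemma elist_in j cl b t y : In (b, t) cl -> In y (get [] t j) -> In b (get [] (elist j cl) y).
Proof.
elim: cl => [|[b' t'] cl IH] //= [[-> ->]|h] hy; first exact: addk_in.
by apply: addk_mono; apply: IH.
Qed.

Lemma get_fold A B (d : B) (g : A -> B) (l : list (N * A)) x a :
  In (x, a) l -> (forall a', In (x, a') l -> a' = a) ->
  get d (fold_right (fun '(j, l) t => put j (g l) t) E0 l) x = g a.
Proof.
elim: l => [|[x' a'] l IH] //= h u.
case: (N.eq_dec x' x) => [e|ne].
  by rewrite e get_put (u a') //; left; rewrite e.
rewrite get_put_other //; apply: IH => [|a'' h'']; last by apply: u; right.
by case: h => // [[]].
Qed.

Lemma pick_sound m ok bad b i e f j y : 2 < m -> b < m -> ok b = true ->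
  i < 36 -> e < 36 -> f < 36 -> j < 36 -> y < 36 -> N.odd y = true ->
  bad ((2 ^ i mod m + b ^ e mod m) mod m) = false ->
  ((2 ^ i mod m + b ^ e mod m) mod m) ^ f mod m = (2 ^ j mod m + b ^ y mod m) mod m ->
  In b (get [] (elist j (clist f (blist e (alist (mkmd m ok bad) i)))) y).
Proof.
move=> hm hb hok hi he hf hj hy oy hbad heq.
set C := (_ + _) mod m in hbad heq.
have m1 : 1 < m by lia.
have hC : C < m by apply: N.mod_lt; lia.
have P2 : get E0 (rows m 36) 2 = pows m 2 36 by apply: get_rows; lia.
have Pb : get E0 (rows m 36) b = pows m b 36 by apply: get_rows; lia.
pose M := mkmd m ok bad.
apply: (elist_in _ _ _ (get E0 (get E0 (vt M) b) (get 0 (get E0 (get E0 (get E0 (ct M) i) b) e) f))).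
  apply/in_map_iff; exists (b, get E0 (get E0 (get E0 (ct M) i) b) e, get E0 (vt M) b); split => //.
  apply/in_map_iff; exists (b, get E0 (get E0 (ct M) i) b, get E0 (vt M) b); split => //.
  apply/in_map_iff; exists b; split => //.
  by apply/filter_In; split => //; apply/in_range.
have -> : get E0 (get E0 (get E0 (ct M) i) b) e = pows m C 36.
  rewrite /M /mkmd; cbn [ct].
  rewrite get_tab // get_tab // hok; cbv beta iota zeta; rewrite get_tab //; cbv beta iota zeta.
  by rewrite P2 Pb !get_pows // -/C hbad get_rows.
rewrite get_pows // heq /M /mkmd; cbn [vt].
rewrite get_tab // hok get_tab; last by apply: N.mod_lt; lia.
cbv beta iota zeta; rewrite Pb P2.
rewrite (get_fold _ _ _ _ _ j (map (fun y => ((get 0 (pows m 2 36) j + get 0 (pows m b 36) y) mod m, y))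
  (filter N.odd (range 36)))).
- apply/in_map_iff; exists ((2 ^ j mod m + b ^ y mod m) mod m, y); split => //.
  apply/filter_In; split; last by apply/N.eqb_eq.
  apply/in_map_iff; exists y; split; first by rewrite !get_pows.
  by apply/filter_In; split => //; apply/in_range.
- by apply/in_map_iff; exists j; split => //; apply/in_range.
- by move=> a' /in_map_iff [j' [[-> <-] _]].
Qed.

(** The period of the unit group is verified residue by residue, so no structure theory of this
    group is invoked. *)
Definition upow (m q n : N) : bool := forallb (fun a => (a mod q =? 0) || (pwm m a n =? 1)) (range m).

Lemma upowP m q n a : 1 < m -> (q | m) -> upow m q n = true -> a mod q <> 0 -> a ^ n mod m = 1.
Proof.
move=> hm [d dq] /forallb_forall h hq.
have q0 : q <> 0 by lia.
have /h : In (a mod m) (range m) by apply/in_range/N.mod_lt; lia.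
rewrite pwm_spec; last lia.
rewrite mod_pow_l dq N.mul_comm N.Div0.mod_mul_r.
rewrite {1}N.mul_comm N.Div0.mod_add N.Div0.mod_mod.
by case: N.eqb_spec => // _ /=; move/N.eqb_eq; rewrite N.mul_comm.
Qed.

Lemma eqn_mod m n b f i j e y f0 i0 j0 e0 y0 : 1 < m ->
  (2 ^ i + b ^ e) ^ f = 2 ^ j + b ^ y ->
  2 ^ n mod m = 1 -> b ^ n mod m = 1 -> (2 ^ i + b ^ e) ^ n mod m = 1 ->
  f mod n = f0 mod n -> i mod n = i0 mod n -> j mod n = j0 mod n -> e mod n = e0 mod n -> y mod n = y0 mod n ->
  (2 ^ i0 mod m + (b mod m) ^ e0 mod m) mod m = (2 ^ i + b ^ e) mod m /\
  ((2 ^ i0 mod m + (b mod m) ^ e0 mod m) mod m) ^ f0 mod m = (2 ^ j0 mod m + (b mod m) ^ y0 mod m) mod m.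
Proof.
move=> hm heq h2 hb hc hf hi hj he hy.
have red a x x' : a ^ n mod m = 1 -> x mod n = x' mod n -> a ^ x' mod m = a ^ x mod m.
  by move=> h hx; rewrite (pow_period _ _ _ x' hm h) (pow_period _ _ _ x hm h) hx.
rewrite !(mod_pow_l m b) (red 2 i i0) // (red b e e0) // (red 2 j j0) // (red b y y0) //.
rewrite -!N.Div0.add_mod; split => //.
by rewrite mod_pow_l (red _ f f0) // heq.
Qed.
End Columns.

(** * Chinese remaindering and square roots modulo primes *)

Module Crt.
Import List ListNotations Sieve Tables Columns.
Local Open Scope bool_scope.
Local Open Scope list_scope.
Local Open Scope N_scope.
Local Arguments N.pow : simpl never.
Local Arguments N.mul : simpl never.
Local Arguments N.add : simpl never.
Local Arguments N.sub : simpl never.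
Local Arguments N.modulo : simpl never.
Local Opaque tab range get rows pows urows.

(** The second components bound the unreduced residues; they grow by one modulus with every
    extension and guarantee that the truncated subtraction in [ext] is exact. *)
Definition rep (MM : N) (qs : list (N * N)) (b : N) (p : elt) : Prop :=
  fst p = b mod MM /\ Forall2 (fun qc x => x mod fst qc = fst p mod fst qc /\ x < snd qc * fst qc) qs (snd p).

Lemma add_cancel m s t u : m <> 0 -> (s + t) mod m = (u + t) mod m -> s mod m = u mod m.
Proof.
move=> m0 e.
have k v : v mod m = ((v + t) mod m + (m * t - t)) mod m.
  rewrite N.Div0.add_mod_idemp_l (_ : v + t + _ = v + t * m) ?N.Div0.mod_add //; nia.
by rewrite (k s) e -k.
Qed.

Lemma in_ext cm t roots R r r0 rs a x xs : In (r, r0 :: rs) R -> In a roots ->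
  get None t (a + (cm - r0)) = Some (x, xs) -> In (r + x, addres rs xs) (ext cm t roots R).
Proof.
move=> hR ha hx.
have mono (k : N) r' rs' acc roots' p : In p acc -> In p (fold_right (fun a acc => match get None t (a + k) with
        Some (x, xs) => (r' + x, addres rs' xs) :: acc | None => acc end) acc roots').
  by elim: roots' => [|a' l IH] //= h; case: (get _ _ _) => [[? ?]|]; [right|]; exact: IH.
elim: R hR => [|[r1 rs1] R IH] //= [[-> ->]|/IH h]; last by case: rs1 => [|r0' rs1] //; exact: mono.
move: (ext cm t roots R) => acc; clear IH mono; elim: roots ha => [|a' l IHl] //= [->|/IHl h]; first by rewrite hx; left.
by case: (get _ _ _) => [[? ?]|] //; right.
Qed.

Lemma forall2_addres r qs rs x : (forall q, In q qs -> 0 < fst q) ->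
  Forall2 (fun qc x => x mod fst qc = r mod fst qc /\ x < snd qc * fst qc) qs rs ->
  Forall2 (fun qc x' => x' mod fst qc = (r + x) mod fst qc /\ x' < snd qc * fst qc)
    (map (fun qc => (fst qc, snd qc + 1)) qs) (addres rs (map (fun q => x mod q) (map fst qs))).
Proof.
move=> hq h; elim: h hq => {qs rs} [|[q cc] y qs rs /= [h1 h2] h IH] hq; first exact: Forall2_nil.
have q0 : 0 < q by apply: (hq (q, cc)); left.
apply: Forall2_cons; last by apply: IH => q' h'; apply: hq; right.
split => /=; first by rewrite N.Div0.add_mod h1 N.Div0.mod_mod -N.Div0.add_mod.
have := N.mod_lt x q; nia.
Qed.

(** Write [b = b mod MM + MM (b / MM)]. The quotient modulo [m] is the difference of the residues of
    [b] and [r] times the inverse of [MM]; since [b < bound], the entry has not been discarded. *)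
Lemma crt_step m cc cm MM nxt b r r0 : 1 < m -> 0 < MM -> cm = cc * m -> b < bound ->
  (MM * inv_mod (MM mod m) m) mod m = 1 ->
  r = b mod MM -> r0 mod m = r mod m -> r0 < cc * m ->
  exists x, get None (crt cc m MM nxt) (b mod m + (cm - r0)) = Some (x, map (fun q => x mod q) nxt) /\
            r + x = b mod (MM * m).
Proof.
move=> hm hMM -> hb hinv -> h0 h0'.
set iv := inv_mod _ _ in hinv.
pose s := b mod m + (cc * m - r0).
pose x := MM * ((s * iv) mod m).
have m0 : m <> 0 by lia.
have bm := N.mod_lt b m m0.
have hs : s < cc * m + m by rewrite /s; lia.
have dm := N.Div0.div_mod b MM.
have hsq : (s * iv) mod m = (b / MM) mod m.
  have e : (s + r0) mod m = b mod m.
    rewrite /s (_ : b mod m + (cc * m - r0) + r0 = b mod m + cc * m); last lia.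
    by rewrite N.Div0.mod_add N.Div0.mod_mod.
  have e2 : (s + b mod MM) mod m = (MM * (b / MM) + b mod MM) mod m.
    by rewrite -dm -e N.Div0.add_mod -h0 -N.Div0.add_mod.
  have e3 : s mod m = (MM * (b / MM)) mod m by exact: (add_cancel _ _ _ _ m0 e2).
  by rewrite -N.Div0.mul_mod_idemp_l e3 N.Div0.mul_mod_idemp_l (_ : MM * _ * iv = (b / MM) * (MM * iv));
    [rewrite -N.Div0.mul_mod_idemp_r hinv N.mul_1_r | lia].
have hx : b mod MM + x = b mod (MM * m) by rewrite N.Div0.mod_mul_r /x hsq.
have hxb : x < bound.
  have h := N.Div0.mod_le b (MM * m); rewrite -hx in h.
  by apply: N.le_lt_trans hb; apply: N.le_trans h; exact: N.le_add_l.
exists x; split => //.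
by rewrite -/s /crt -/iv get_tab // -/x; move/N.ltb_lt: hxb => ->.
Qed.

Lemma rep_cons MM q cc qs b r rs : rep MM ((q, cc) :: qs) b (r, rs) ->
  exists r0 rs', [/\ rs = r0 :: rs', r = b mod MM, r0 mod q = r mod q, r0 < cc * q & rep MM qs b (r, rs')].
Proof.
case=> /= hr hF; inversion hF as [|? r0 ? rs' [h0 h0'] hF']; subst rs.
by exists r0, rs'.
Qed.

Lemma ext_sound m cc cm MM qs b roots R : 1 < m -> 0 < MM -> cm = cc * m -> b < bound ->
  (forall q, In q qs -> 0 < fst q) -> (MM * inv_mod (MM mod m) m) mod m = 1 ->
  (exists p, In p R /\ rep MM ((m, cc) :: qs) b p) -> In (b mod m) roots ->
  exists p, In p (ext cm (crt cc m MM (map fst qs)) roots R) /\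
            rep (MM * m) (map (fun qc => (fst qc, snd qc + 1)) qs) b p.
Proof.
move=> hm hMM hcm hb hq hinv [[r rs] [hR /rep_cons [r0 [rs' [ers hr h0 h0' [_ hF']]]]]] hroot; subst rs.
have [x [hx hx']] := crt_step m cc cm MM (map fst qs) b r r0 hm hMM hcm hb hinv hr h0 h0'.
exists (r + x, addres rs' (map (fun q => x mod q) (map fst qs))); split.
  exact: (in_ext _ _ _ _ _ r0 _ _ _ _ hR hroot).
split => //=; exact: forall2_addres.
Qed.

Definition sqp p := forallb (fun x => forallb (fun y =>
  implb (sq p x =? sq p y) ((x =? y) || (x =? p - y))) (range p)) (range p).

Lemma sqpP p x y : sqp p = true -> x < p -> y < p -> (x * x) mod p = (y * y) mod p -> x = y \/ x = p - y.
Proof.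
move=> /forallb_forall h /in_range hx /in_range hy e.
move/h: hx => /forallb_forall/(_ y hy); rewrite /sq e N.eqb_refl /=.
by case: N.eqb_spec => [->|_]; [left | case: N.eqb_spec => // ->; right].
Qed.

Lemma sq_period p n a x : 1 < p -> a ^ (2 * n) mod p = 1 ->
  (a ^ x * a ^ x) mod p = (a ^ (x mod n) mod p * (a ^ (x mod n) mod p)) mod p.
Proof.
move=> hp h; rewrite -N.Div0.mul_mod -!N.pow_add_r.
have e z : z + z = 2 * z by lia.
rewrite !e (pow_period _ _ _ _ hp h) [in RHS](pow_period _ _ _ _ hp h).
by rewrite !N.Div0.mul_mod_distr_l N.Div0.mod_mod.
Qed.

(** Knowing an exponent modulo half a period determines the power up to sign, if square roots modulo
    [p] are unique up to sign. *)
Lemma half_period p n a x : 1 < p -> sqp p = true -> a ^ (2 * n) mod p = 1 ->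
  a ^ x mod p = a ^ (x mod n) mod p \/ a ^ x mod p = p - a ^ (x mod n) mod p.
Proof.
move=> hp hs h; apply: sqpP => //; try (apply: N.mod_lt; lia).
by rewrite -N.Div0.mul_mod (sq_period _ _ _ _ hp h).
Qed.

Lemma sq_mod p x : sq p (x mod p) = sq p x.
Proof. by rewrite /sq -N.Div0.mul_mod. Qed.
End Crt.

(** * Solutions and their residues modulo the sieving primes *)

Module Residues.
Import List ListNotations Sieve Tables Columns Crt.
Local Open Scope bool_scope.
Local Open Scope list_scope.
Local Open Scope N_scope.
Local Arguments N.pow : simpl never.
Local Arguments N.mul : simpl never.
Local Arguments N.add : simpl never.
Local Arguments N.sub : simpl never.
Local Arguments N.modulo : simpl never.

(** The lower bounds make units out of the bases: [2 ^ i + b ^ e] is a prime beyond the largest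
    modulus 1153, and [b] is a prime beyond 37 and different from 73. Larger moduli may still equal
    [b] and are then skipped. *)
Record sol (b f i j e y : N) : Prop := Sol {
  s_eq : (2 ^ i + b ^ e) ^ f = 2 ^ j + b ^ y;
  s_b : 41 <= b < bound;
  s_73 : b <> 73;
  s_bp : forall p, 1 < p -> b mod p = 0 -> p = b;
  s_c : 1153 < 2 ^ i + b ^ e;
  s_cp : forall p, 1 < p -> (2 ^ i + b ^ e) mod p = 0 -> p = 2 ^ i + b ^ e;
  s_y : N.odd y = true;
  s_e : N.even e = true;
  s_e0 : e <> 0;
  s_i : N.even i = true }.

Definition upows := [(5, 5, 12); (7, 7, 12); (13, 13, 12); (27, 3, 36); (19, 19, 36); (37, 37, 36);
  (73, 73, 72); (17, 17, 16); (97, 97, 96); (193, 193, 192); (433, 433, 432); (577, 577, 576); (1153, 1153, 1152)].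

Lemma upows_ok : forallb (fun '(m, q, n) => (1 <? m) && (m mod q =? 0) && negb (2 mod q =? 0) && (q <? 1154) && upow m q n) upows = true.
Proof. by vm_compute. Qed.

Lemma upowsP m q n a : In (m, q, n) upows -> a mod q <> 0 -> a ^ n mod m = 1.
Proof.
move=> h; have := upows_ok; move/forallb_forall/(_ _ h).
move=> /andP [/andP [/andP [/andP [/N.ltb_lt h1 /N.eqb_eq h2] _] _] h3].
apply: upowP h3 => //; exists (m / q).
have := N.Div0.div_mod m q; rewrite h2; lia.
Qed.

Lemma pow2_unit m q n : In (m, q, n) upows -> 2 ^ n mod m = 1.
Proof.
move=> h; have := upows_ok; move/forallb_forall/(_ _ h).
move=> /andP [/andP [/andP [_ /negP h2] _] _].
by apply: upowsP h _ => h'; apply: h2; apply/N.eqb_eq.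
Qed.

Section Sol.
Variables b f i j e y : N.
Hypothesis S : sol b f i j e y.
Local Notation c := (2 ^ i + b ^ e).

Lemma powc_unit m q n : In (m, q, n) upows -> 1 < q -> c ^ n mod m = 1.
Proof.
move=> h q1; have := upows_ok; move/forallb_forall/(_ _ h).
move=> /andP [/andP [_ /N.ltb_lt h2] _].
apply: upowsP h _ => h'; have e1 := s_cp _ _ _ _ _ _ S _ q1 h'; have := s_c _ _ _ _ _ _ S.
rewrite -e1; lia.
Qed.

Lemma c_mod p : 1 < p < 1154 -> c mod p <> 0.
Proof. move=> [h1 h2] h; have e1 := s_cp _ _ _ _ _ _ S _ h1 h; have := s_c _ _ _ _ _ _ S; rewrite -e1; lia. Qed.

Lemma powb_unit m q n : In (m, q, n) upows -> b mod q <> 0 -> b ^ n mod m = 1.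
Proof. exact: upowsP. Qed.

End Sol.

Lemma sq73 : sqp 73 = true. Proof. by vm_compute. Qed.
Lemma sq97 : sqp 97 = true. Proof. by vm_compute. Qed.

Lemma mod_mod_mul a k n : n <> 0 -> a mod (k * n) mod n = a mod n.
Proof.
move=> n0; rewrite N.mul_comm N.Div0.mod_mul_r N.mul_comm N.Div0.mod_add.
exact: N.Div0.mod_mod.
Qed.

Lemma even_mod x n : n <> 0 -> N.even n = true -> N.even (x mod n) = N.even x.
Proof.
move=> n0 hn; have h := N.div_mod x n n0.
by rewrite [in RHS]h N.even_add N.even_mul hn; case: (N.even _).
Qed.

Local Opaque tab range get rows pows urows.

Lemma chk73_sound b f i j e y : sol b f i j e y -> b mod 73 <> 0 ->
  chk73 (get E0 (get E0 ct73 (i mod 36)) (e mod 36)) (get E0 (get E0 vt73 (j mod 36)) (y mod 36))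
    (f mod 36) (b mod 73) = true.
Proof.
move=> S hb.
have lt36 x : x mod 36 < 36 by apply: N.mod_lt.
have lt73 x : x mod 73 < 73 by apply: N.mod_lt.
have in73 : In (73, 73, 72) upows by do 6 right; left.
have b72 := powb_unit b 73 73 72 in73 hb.
have c72 : (2 ^ i + b ^ e) ^ 72 mod 73 = 1 by apply: (powc_unit _ _ _ _ _ _ S _ 73).
have h173 : 1 < 73 by [].
have lt2 u v : u < 73 -> v <= 73 -> u + v < 2 * 73 by clear; lia.
have lt3 v : v < 73 -> v <= 73 by clear; lia.
have lt4 v : 73 - v <= 73 by clear; lia.
have t36 : 2 ^ 36 mod 73 = 1 by [].
have hi : N.odd (i mod 36) = false by rewrite -N.negb_even even_mod // (s_i _ _ _ _ _ _ S).
have hy : N.even (y mod 36) = false by rewrite even_mod // -N.negb_odd (s_y _ _ _ _ _ _ S).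
rewrite /chk73 /ct73 /vt73.
rewrite (get_tab _ _ 36 _ (i mod 36)) // hi (get_tab _ _ 36 _ (e mod 36)) // (get_tab _ _ 73 _ (b mod 73)) //.
rewrite (get_tab _ _ 36 _ (j mod 36)) // (get_tab _ _ 36 _ (y mod 36)) // hy (get_tab _ _ 73 _ (b mod 73)) //.
have P2 : get E0 (rows 73 72) 2 = pows 73 2 72 by apply: get_rows.
have Pb : get E0 (rows 73 72) (b mod 73) = pows 73 (b mod 73) 72 by apply: get_rows.
have lt72 x : x mod 36 < 72 by have := lt36 x; lia.
rewrite !{}P2 !{}Pb !get_pows // !mod_pow_l -!(pow_period 73 36 2) //.
set PP := tab 73 _.
have PPs (a : N) : a < 73 -> a <> 0 -> get 73 (get E0 PP a) (f mod 36) = sq 73 (a ^ (f mod 36) mod 73).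
  move=> h0 h1; rewrite /PP get_tab //; case: N.eqb_spec => // _.
  by rewrite get_tab // get_rows // get_pows.
set pi := 2 ^ i mod 73; set pj := 2 ^ j mod 73.
set be := b ^ (e mod 36) mod 73; set by_ := b ^ (y mod 36) mod 73.
have hR : sq 73 (pj + by_) = sq 73 (2 ^ j + b ^ y) \/ sq 73 (pj + (73 - by_)) = sq 73 (2 ^ j + b ^ y).
  case: (half_period 73 36 b y h173 sq73 b72) => h; [left|right];
  rewrite -[LHS]sq_mod -[RHS]sq_mod [in RHS]N.Div0.add_mod h /pj; congr (sq _ _);
  by rewrite ?N.Div0.mod_mod ?N.Div0.add_mod_idemp_l ?N.Div0.add_mod_idemp_r.
have hL : forall x, redm 73 (pi + x) = (2 ^ i + b ^ e) mod 73 ->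
    get 73 (get E0 PP (redm 73 (pi + x))) (f mod 36) = sq 73 (2 ^ j + b ^ y).
  move=> x ->; rewrite PPs //; last by apply: (c_mod _ _ _ _ _ _ S).
  rewrite mod_pow_l -(s_eq _ _ _ _ _ _ S) /sq.
  by rewrite (sq_period 73 36 _ f) // -N.Div0.mul_mod.
have lpi : pi < 73 by exact: lt73.
have lbe : be < 73 by exact: lt73.
(* The sign of [b ^ e] is unknown because 72 is a period and [e] is given modulo 36. If 36 is
   already a period, there is no ambiguity, which is what the optional second table of [ct73]
   encodes. *)
have hE : redm 73 (pi + be) = (2 ^ i + b ^ e) mod 73 \/
    (b ^ 36 mod 73 <> 1 /\ redm 73 (pi + (73 - be)) = (2 ^ i + b ^ e) mod 73).
  case: (N.eq_dec (b ^ 36 mod 73) 1) => h36.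
    left; rewrite redm_spec; last by apply: lt2 => //; exact: lt3.
    by rewrite /be -(pow_period 73 36 b) // -N.Div0.add_mod.
  case: (half_period 73 36 b e h173 sq73 b72) => h; [left|right; split => //];
  (rewrite redm_spec; last by apply: lt2 => //; exact: lt3);
  by rewrite [in RHS]N.Div0.add_mod h.
case: hE => [|[h36]] /hL {hL} h.
  by rewrite h; case: hR => ->; rewrite N.eqb_refl //; case: (_ =? _).
move/N.eqb_neq: h36 => ->; rewrite h.
by do 2 case: (_ =? _) => //; case: hR => ->; rewrite N.eqb_refl //; case: (_ =? _).
Qed.
End Residues.

Module LeafSound.
Import List ListNotations Sieve Tables Columns Crt Residues.
Local Open Scope bool_scope.
Local Open Scope list_scope.
Local Open Scope N_scope.
Local Arguments N.pow : simpl never.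
Local Arguments N.mul : simpl never.
Local Arguments N.add : simpl never.
Local Arguments N.sub : simpl never.
Local Arguments N.modulo : simpl never.
Local Opaque tab range get rows pows urows.

Lemma mod_addc q u u' v v' : u mod q = u' mod q -> v mod q = v' mod q -> (u + v) mod q = (u' + v') mod q.
Proof. by move=> h1 h2; rewrite N.Div0.add_mod h1 h2 -N.Div0.add_mod. Qed.

Lemma up_sound t73 AA AA73 next ce vy f i j e y n rho r x k b K :
  up t73 AA AA73 next ce vy f i j e y n rho r x = true -> t73 = tab K (fun x => x mod 73) ->
  Peano.le k n -> rho + N.of_nat k * AA73 < K -> (rho + N.of_nat k * AA73) mod 73 = b mod 73 ->
  r + x + N.of_nat k * AA = b -> b < bound -> chk73 ce vy f (b mod 73) = true ->
  next (b mod 73) b f i j e y = true.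
Proof.
move=> + ht + + + + hb hc; subst t73.
have base rho' x' : (let rho := get 0 (tab K (fun x => x mod 73)) rho' in if chk73 ce vy f rho then
     let b := r + x' in if b <? bound then next rho b f i j e y else true else true) = true ->
     rho' < K -> rho' mod 73 = b mod 73 -> r + x' = b -> next (b mod 73) b f i j e y = true.
  move=> + h1 h2 h3; cbv zeta; rewrite get_tab // h2 hc h3.
  by case: N.ltb_spec => // h; case: (N.lt_irrefl b); apply: N.lt_le_trans h.
elim: n k rho x => [|n IH] k rho x /=; move/andP=> [h1 h2] hk hK hm hbk.
  have k0 : k = 0%nat by lia.
  subst k; apply: (base rho x h1); [lia|rewrite -hm; congr (_ mod _); lia|lia].
case: k hk hK hm hbk => [|k] hk hK hm hbk.
  apply: (base rho x h1); [lia|rewrite -hm; congr (_ mod _); lia|lia].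
apply: (IH k _ _ h2); [lia|lia| |lia].
by rewrite -hm; congr (_ mod _); lia.
Qed.

Lemma leaf_sound b f i j e y next R r37 MM : sol b f i j e y ->
  0 < MM -> (MM * inv_mod (MM mod 37) 37) mod 37 = 1 ->
  let AA := MM * 37 in let kmax := bound / AA in
  let e37 := crt 3 37 MM [73] in
  let x37 := tab 148 (fun s => match get None e37 s with Some (x, t :: _) => Some (x, t) | _ => None end) in
  leaf x37 (tab (73 * (kmax + 5)) (fun x => x mod 73)) AA (AA mod 73) (N.to_nat kmax) next ct73 vt73
    (f mod 36) (i mod 36) (j mod 36) (e mod 36) (y mod 36) R r37 = true ->
  (exists p, In p R /\ rep MM [(37, 3); (73, 3)] b p) -> In (b mod 37) r37 ->
  next (b mod 73) b (f mod 36) (i mod 36) (j mod 36) (e mod 36) (y mod 36) = true.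
Proof.
move=> S hMM hinv AA kmax e37 x37 /forallb_forall hl [[r rs] [hR /rep_cons [r0 [rs' [ers hr h0 h0' /rep_cons [r73 [rs'' [ers' _ h1 h1' _]]]]]]]] hroot.
subst rs rs'.
have [hb1 hb2] := s_b _ _ _ _ _ _ S.
have h37 : 1 < 37 by [].
have [x [hx hx']] := crt_step 37 3 111 MM [73] b r r0 h37 hMM erefl hb2 hinv hr h0 h0'.
move/hl: hR; move/forallb_forall/(_ _ hroot).
have lts : b mod 37 + (111 - r0) < 148 by have := N.mod_lt b 37; lia.
rewrite /x37 get_tab // /e37 hx [map _ _]/=.
pose k := b / AA.
have AA0 : AA <> 0 by rewrite /AA; lia.
have hkm : k <= kmax by apply: N.Div0.div_le_mono; lia.
have lx := N.mod_lt x 73; have lA := N.mod_lt AA 73.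
have db := N.div_mod b AA AA0.
have h73 : b mod 73 <> 0.
  move=> h; have e1 := s_bp _ _ _ _ _ _ S 73 erefl h; exact: (s_73 _ _ _ _ _ _ S (esym e1)).
move/up_sound; apply; first by [].
- by instantiate (1 := N.to_nat k); lia.
- rewrite N2Nat.id; nia.
- rewrite N2Nat.id [in RHS]db -/k -hx' (N.add_comm (AA * k)) (N.mul_comm AA).
  apply: mod_addc; first by apply: mod_addc => //; rewrite N.Div0.mod_mod.
  by rewrite N.Div0.mul_mod_idemp_r.
- by rewrite N2Nat.id hx' -/AA /k [RHS]db; lia.
- by [].
- exact: chk73_sound.
Qed.
End LeafSound.

(** * No solution is lost at the levels 12 and 36 *)

Module Levels.
Import List ListNotations Sieve Tables Columns Crt Residues LeafSound.
Local Open Scope bool_scope.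
Local Open Scope list_scope.
Local Open Scope N_scope.
Local Arguments N.pow : simpl never.
Local Arguments N.mul : simpl never.
Local Arguments N.add : simpl never.
Local Arguments N.sub : simpl never.
Local Arguments N.modulo : simpl never.
Local Opaque tab range get rows pows urows.

Definition relc (o : list (N * N)) (m i j : N) : Prop :=
  o = [] \/ exists t, [/\ In t o, 2 ^ i mod m = fst t mod m & 2 ^ j mod m = snd t mod m].

Record cls (c : cs) (b f i j e y : N) : Prop := Cls {
  c_f : In (f mod 12) (f0s c);
  c_e : In (e mod 12) (e0s c);
  c_i : if fri c then In (i mod 12) (i0s c) else In i (i0s c);
  c_j : if frj c then In (j mod 12) (j0s c) else In j (j0s c);
  c_b3 : b mod 3 = b3 c;
  c_b : In (b mod M2 c) (res2 c);
  c_M2 : 1 < M2 c;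
  c_rel4 : relc (rel4 c) (M2 c) i j;
  c_k16 : k16 c = 0 \/ (M2 c | 2 ^ k16 c) /\ relc (rel16 c) (2 ^ k16 c) i j }.

Lemma rel_sound o m per b f i j e y : 1 < m -> per <> 0 -> relc o m i j ->
  (2 ^ i + b ^ e) ^ f = 2 ^ j + b ^ y ->
  rel o m per (b mod m) (f mod per) (e mod per) (y mod per) = true.
Proof.
move=> hm hp [->|] // [[ti tj] [ho hi hj]] heq.
rewrite /rel; case: o ho => [|p0 o] // ho.
move: (p0 :: o) ho => l ho.
have lt x : x mod per < per by exact: N.mod_lt.
rewrite pwm_spec ?mod_pow_l; last lia.
case: N.eqb_spec => //= hb.
have bx x : get 0 (pows m (b mod m) per) (x mod per) = b ^ x mod m.
  by rewrite get_pows // mod_pow_l -pow_period.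
apply/existsb_exists; eexists; split.
  by apply/in_map_iff; exists (ti, tj); split; [reflexivity|].
cbv beta iota zeta; rewrite get_tab // bx pwm_spec; last lia.
cbn [fst snd] in hi, hj.
have hc : (ti + b ^ e mod m) mod m = (2 ^ i + b ^ e) mod m.
  by apply: mod_addc => //; rewrite N.Div0.mod_mod.
rewrite hc !mod_pow_l; case: N.eqb_spec => //= hc1.
rewrite get_pows // mod_pow_l -pow_period // bx heq.
apply/N.eqb_eq; apply: mod_addc => //; rewrite ?N.Div0.mod_mod //.
Qed.

Section General.
Variables (c : cs) (b f i j e y : N).
Hypothesis S : sol b f i j e y.
Hypothesis C : cls c b f i j e y.
Hypothesis W : wf c = true.

Lemma b_unit p : 1 < p -> p <= 40 -> b mod p <> 0.
Proof.
move=> h1 h2 h; have e1 := s_bp _ _ _ _ _ _ S p h1 h; have := s_b _ _ _ _ _ _ S; lia.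
Qed.

Lemma b_unit73 : b mod 73 <> 0.
Proof. move=> h; have e1 := s_bp _ _ _ _ _ _ S 73 erefl h; exact: (s_73 _ _ _ _ _ _ S (esym e1)). Qed.

Lemma pick_level m q n ok bad f0 i0 j0 e0 y0 : In (m, q, n) upows -> 1 < q -> 2 < m -> b mod q <> 0 ->
  ok (b mod m) = true -> bad ((2 ^ i + b ^ e) mod m) = false ->
  f mod n = f0 mod n -> i mod n = i0 mod n -> j mod n = j0 mod n -> e mod n = e0 mod n -> y mod n = y0 mod n ->
  i0 < 36 -> e0 < 36 -> f0 < 36 -> j0 < 36 -> y0 < 36 -> N.odd y0 = true ->
  In (b mod m) (get [] (elist j0 (clist f0 (blist e0 (alist (mkmd m ok bad) i0)))) y0).
Proof.
move=> hin q1 m2 hb hok hbad hf hi hj he hy li le_ lf lj ly oy.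
have m1 : 1 < m by lia.
have [e1 e2] := eqn_mod m n b f i j e y f0 i0 j0 e0 y0 m1 (s_eq _ _ _ _ _ _ S) (pow2_unit _ _ _ hin)
  (powb_unit b _ _ _ hin hb) (powc_unit _ _ _ _ _ _ S _ _ _ hin q1) hf hi hj he hy.
by apply: pick_sound => //; [apply: N.mod_lt; lia | rewrite e1].
Qed.

Lemma mod36_12 x : x mod 36 mod 12 = x mod 12.
Proof. by rewrite -[36]/(3 * 12) mod_mod_mul. Qed.

Lemma in_lift36 x : In (x mod 36) [x mod 12; x mod 12 + 12; x mod 12 + 24].
Proof.
have h := mod36_12 x; have l : x mod 36 < 36 by apply: N.mod_lt.
have d := N.div_mod (x mod 36) 12; have l2 : x mod 36 mod 12 < 12 by apply: N.mod_lt.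
rewrite -h /=; set r := _ mod 12 in d l2 *; set q := _ / 12 in d; lia.
Qed.

Lemma in_lift36' x : In (x mod 36) (lift3 true (x mod 12)).
Proof. by rewrite /lift3 N.Div0.mod_mod; exact: in_lift36. Qed.

Lemma mod_odd x n : n <> 0 -> N.even n = true -> N.odd (x mod n) = N.odd x.
Proof. by move=> h1 h2; rewrite -!N.negb_even even_mod. Qed.

Lemma wf_inv m MM : In (m, MM) [(5, A5 c); (7, A7 c); (13, A13 c); (27, A27 c); (19, A19 c); (37, A37 c)] ->
  (MM * inv_mod (MM mod m) m) mod m = 1.
Proof. by move=> h; have /andP [/forallb_forall/(_ _ h)/N.eqb_eq] := W. Qed.

Lemma wf_i : fri c = false -> i < 36.
Proof.
move=> h; have := c_i _ _ _ _ _ _ _ C; rewrite h => hi.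
have /andP [_ /forallb_forall/(_ i)] := W.
by move=> h'; apply/N.ltb_lt/h'/in_or_app; left.
Qed.

Lemma wf_j : frj c = false -> j < 36.
Proof.
move=> h; have := c_j _ _ _ _ _ _ _ C; rewrite h => hi.
have /andP [_ /forallb_forall/(_ j)] := W.
by move=> h'; apply/N.ltb_lt/h'/in_or_app; right.
Qed.

Lemma free_level (fr : bool) (l : list N) x : (fr = false -> x < 36) ->
  (if fr then In (x mod 12) l else In x l) ->
  exists x0, [/\ In x0 l, x mod 12 = x0 mod 12, x0 < 36 & In (x mod 36) (lift3 fr x0)].
Proof.
case: fr => hx h; [exists (x mod 12)|exists x]; split => //.
- by rewrite N.Div0.mod_mod.
- by have : x mod 12 < 12 by [apply: N.mod_lt]; lia.
- by rewrite /lift3 N.Div0.mod_mod; exact: in_lift36.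
- exact: hx.
- by left; rewrite N.mod_small //; apply: hx.
Qed.

Lemma rels_in : In (b mod M2 c, rel (rel4 c) (M2 c) 4 (b mod M2 c)) (map (fun r => (r, rel (rel4 c) (M2 c) 4 r)) (res2 c)).
Proof. by apply/in_map_iff; exists (b mod M2 c); split => //; exact: (c_b _ _ _ _ _ _ _ C). Qed.

Lemma rels_ok : rel (rel4 c) (M2 c) 4 (b mod M2 c) (f mod 4) (e mod 4) (y mod 4) = true.
Proof.
by apply: rel_sound (s_eq _ _ _ _ _ _ S) => //; [exact: (c_M2 _ _ _ _ _ _ _ C) | exact: (c_rel4 _ _ _ _ _ _ _ C)].
Qed.

Lemma rep_res MM qs r : r = b mod MM -> (forall qc, In qc qs -> 0 < fst qc /\ 0 < snd qc) ->
  rep MM qs b (r, map (fun qc => r mod fst qc) qs).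
Proof.
move=> hr h; split => //=; elim: qs h => [|[q k] qs IH] h /=; first exact: Forall2_nil.
apply: Forall2_cons; last by apply: IH => qc hqc; apply: h; right.
split; first by rewrite N.Div0.mod_mod.
by have /= := h (q, k) (or_introl erefl); have := N.mod_lt r q; nia.
Qed.

Lemma m_in m (ok : N -> bool) : m <> 0 -> ok (b mod m) = true -> In (b mod m) (filter ok (range m)).
Proof. by move=> h1 h2; apply/filter_In; split => //; apply/in_range/N.mod_lt. Qed.

Lemma A_pos : 0 < A5 c /\ 0 < A7 c /\ 0 < A13 c /\ 0 < A27 c /\ 0 < A19 c /\ 0 < A37 c.
Proof.
have M1 := c_M2 _ _ _ _ _ _ _ C; have p5 : 0 < A5 c by rewrite /A5; lia.
have p7 : 0 < A7 c by rewrite /A7; lia.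
have p13 : 0 < A13 c by rewrite /A13; lia.
have p27 : 0 < A27 c by rewrite /A27; lia.
have p19 : 0 < A19 c by rewrite /A19; lia.
by do !split => //; rewrite /A37; lia.
Qed.

Lemma level12_sound f0 e0 e5 e7 e13 : f mod 4 = f0 mod 4 -> e mod 4 = e0 mod 4 ->
  In (b mod 5) (get [] e5 (y mod 12)) -> In (b mod 7) (get [] e7 (y mod 12)) -> In (b mod 13) (get [] e13 (y mod 12)) ->
  exists R, In (y mod 12, R) (level12 (crt 1 5 (A5 c) [7; 13]) (crt 2 7 (A7 c) [13]) (crt 3 13 (A13 c) [])
    (map (fun r => (r, rel (rel4 c) (M2 c) 4 r)) (res2 c)) f0 e0 e5 e7 e13) /\
    exists p, In p R /\ rep (A27 c) [(27, 1); (19, 1); (37, 1); (73, 1)] b p.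
Proof.
move=> hf he h5 h7 h13.
have [p5 [p7 [p13 [p27 _]]]] := A_pos; have [_ hb] := s_b _ _ _ _ _ _ S.
have hR0 : exists p, In p (map (fun '(r, _) => (r, [r mod 5; r mod 7; r mod 13]))
  (filter (fun '(r, rl) => rl (f0 mod 4) (e0 mod 4) (y mod 12 mod 4)) (map (fun r => (r, rel (rel4 c) (M2 c) 4 r)) (res2 c))))
    /\ rep (A5 c) [(5, 1); (7, 1); (13, 1)] b p.
  exists (b mod M2 c, [b mod M2 c mod 5; b mod M2 c mod 7; b mod M2 c mod 13]); split.
    apply/in_map_iff; exists (b mod M2 c, rel (rel4 c) (M2 c) 4 (b mod M2 c)); split => //.
    apply/filter_In; split; first exact: rels_in.
    rewrite -hf -he (_ : y mod 12 mod 4 = y mod 4); first exact: rels_ok.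
    by rewrite -[12]/(3 * 4) mod_mod_mul.
  apply: (rep_res (A5 c) [(5, 1); (7, 1); (13, 1)] (b mod M2 c)) => // qc.
  by move=> /= [<-|[<-|[<-|]]].
have h1 := ext_sound 5 1 5 (A5 c) [(7, 1); (13, 1)] b _ _ erefl p5 erefl hb _ (wf_inv _ _ (or_introl erefl)) hR0 h5.
have {h1 hR0} h1 := h1 ltac:(by move=> q /= [<-|[<-|]]).
have h2 := ext_sound 7 2 14 (A7 c) [(13, 2)] b _ _ erefl p7 erefl hb _ (wf_inv _ _ (or_intror (or_introl erefl))) h1 h7.
have {h1 h2} h2 := h2 ltac:(by move=> q /= [<-|]).
have h3 := ext_sound 13 3 39 (A13 c) [] b _ _ erefl p13 erefl hb _ (wf_inv _ _ (or_intror (or_intror (or_introl erefl)))) h2 h13.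
have {h2 h3} [[r rs] [h3 [/= hr _]]] := h3 ltac:(by []).
have hrep : rep (A27 c) [(27, 1); (19, 1); (37, 1); (73, 1)] b (r, [r mod 27; r mod 19; r mod 37; r mod 73]).
  by apply: (rep_res (A27 c) [(27, 1); (19, 1); (37, 1); (73, 1)] r) => // qc /= [<-|[<-|[<-|[<-|]]]].
have in12 : In (y mod 12) [1; 3; 5; 7; 9; 11].
  have o12 : N.odd (y mod 12) = true by rewrite mod_odd // (s_y _ _ _ _ _ _ S).
  have l12 : y mod 12 < 12 by apply: N.mod_lt.
  move: (y mod 12) o12 l12 => z o12 l12; clear - o12 l12.
  have : In z (filter N.odd (range 12)) by apply/filter_In; split => //; apply/in_range.
  by [].
have hin := in_map (fun '(r, _) => (r, [r mod 27; r mod 19; r mod 37; r mod 73])) _ _ h3.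
match type of hin with In _ ?X => exists X end; split; last by eexists; split; [exact: hin|].
apply/filter_In; split; last by move: hin; case: (map _ (ext _ _ _ _)).
apply/in_map_iff; exists (y mod 12); split => //.
congr (_, _); move: h5 h7 h13.
by case: (get [] e5 _) => // ? ? _; case: (get [] e7 _) => // ? ? _; case: (get [] e13 _).
Qed.

Lemma level36_sound next RY f0 i0 j0 e0 e27 e19 e37 :
  f0 = f mod 36 -> i0 = i mod 36 -> j0 = j mod 36 -> e0 = e mod 36 ->
  let kmax := bound / A73 c in
  let e37' := crt 3 37 (A37 c) [73] in
  let x37 := tab 148 (fun s => match get None e37' s with Some (x, t :: _) => Some (x, t) | _ => None end) in
  level36 (crt 1 27 (A27 c) [19; 37; 73]) (crt 2 19 (A19 c) [37; 73])
    (leaf x37 (tab (73 * (kmax + 5)) (fun x => x mod 73)) (A73 c) (A73 c mod 73) (N.to_nat kmax) next ct73 vt73)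
    f0 i0 j0 e0 RY e27 e19 e37 = true ->
  (exists R, In (y mod 12, R) RY /\ exists p, In p R /\ rep (A27 c) [(27, 1); (19, 1); (37, 1); (73, 1)] b p) ->
  In (b mod 27) (get [] e27 (y mod 36)) -> In (b mod 19) (get [] e19 (y mod 36)) -> In (b mod 37) (get [] e37 (y mod 36)) ->
  next (b mod 73) b (f mod 36) (i mod 36) (j mod 36) (e mod 36) (y mod 36) = true.
Proof.
move=> -> -> -> -> kmax e37' x37 /forallb_forall hl [R [hR hp]] h27 h19 h37.
have [_ [_ [_ [p27 [p19 p37]]]]] := A_pos; have [_ hb] := s_b _ _ _ _ _ _ S.
have h1 := ext_sound 27 1 27 (A27 c) [(19, 1); (37, 1); (73, 1)] b _ _ erefl p27 erefl hb _ (wf_inv _ _ _) hp h27.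
have {h1 hp} h1 := h1 ltac:(by move=> q /= [<-|[<-|[<-|]]]) ltac:(by do 3 right; left).
have h2 := ext_sound 19 2 38 (A19 c) [(37, 2); (73, 2)] b _ _ erefl p19 erefl hb _ (wf_inv _ _ _) h1 h19.
have {h1 h2} h2 := h2 ltac:(by move=> q /= [<-|[<-|]]) ltac:(by do 4 right; left).
move/hl: hR; move/forallb_forall/(_ (y mod 36) (in_lift36 y)) => hleaf.
have {}hleaf : leaf x37 (tab (73 * (kmax + 5)) (fun x => x mod 73)) (A73 c) (A73 c mod 73) (N.to_nat kmax) next ct73 vt73
    (f mod 36) (i mod 36) (j mod 36) (e mod 36) (y mod 36) (ext 38 (crt 2 19 (A19 c) [37; 73]) (get [] e19 (y mod 36))
      (ext 27 (crt 1 27 (A27 c) [19; 37; 73]) (get [] e27 (y mod 36)) R)) (get [] e37 (y mod 36)) = true.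
  by move: hleaf h27 h19 h37; case: (get [] e27 _) => // ? ?; case: (get [] e19 _) => // ? ?; case: (get [] e37 _).
by apply: (leaf_sound _ _ _ _ _ _ _ _ _ (A37 c) S p37 _ hleaf h2 h37); apply: wf_inv; do 5 right; left.
Qed.

Lemma general_sound next : skipsp c (f mod 36) (i mod 36) (j mod 36) = false ->
  general mds (md27 (b3 c)) c ct73 vt73 next = true ->
  next (b mod 73) b (f mod 36) (i mod 36) (j mod 36) (e mod 36) (y mod 36) = true.
Proof.
move=> hsk.
have [i0 [ini hi li ini36]] := free_level (fri c) (i0s c) i wf_i (c_i _ _ _ _ _ _ _ C).
have [j0 [inj hj lj inj36]] := free_level (frj c) (j0s c) j wf_j (c_j _ _ _ _ _ _ _ C).
rewrite /general /mds; cbv beta iota zeta.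
move/forallb_forall/(_ _ ini)/forallb_forall/(_ _ (c_e _ _ _ _ _ _ _ C))/forallb_forall/(_ _ (c_f _ _ _ _ _ _ _ C)).
cbv zeta; match goal with |- context [match ?X with [] => true | _ => _ end = true] => set JR := X end.
have l12 x : x mod 12 < 36 by have : x mod 12 < 12 by [apply: N.mod_lt]; lia.
have l36 x : x mod 36 < 36 by apply: N.mod_lt.
have m12 x : x mod 12 = x mod 12 mod 12 by rewrite N.Div0.mod_mod.
have m36 x : x mod 36 = x mod 36 mod 36 by rewrite N.Div0.mod_mod.
have m4 x : x mod 4 = x mod 12 mod 4 by rewrite -[12]/(3 * 4) mod_mod_mul.
have oy12 : N.odd (y mod 12) = true by rewrite mod_odd // (s_y _ _ _ _ _ _ S).
have oy36 : N.odd (y mod 36) = true by rewrite mod_odd // (s_y _ _ _ _ _ _ S).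
have nzb p : 1 < p -> p <= 40 -> nz (b mod p) = true by move=> h1 h2; rewrite /nz; case: N.eqb_spec => // /b_unit; case.
have bzc p : 1 < p < 1154 -> bz ((2 ^ i + b ^ e) mod p) = false.
  by move=> h; rewrite /bz; case: N.eqb_spec => // e0; case: (c_mod _ _ _ _ _ _ S p h e0).
have [R [hR hp]] : exists R, In (j0, R) JR /\ exists R', In (y mod 12, R') R /\
    exists p, In p R' /\ rep (A27 c) [(27, 1); (19, 1); (37, 1); (73, 1)] b p.
  have pk m : In (m, m, 12) upows -> 2 < m -> m <= 40 -> In (b mod m)
    (get [] (elist j0 (clist (f mod 12) (blist (e mod 12) (alist (mkmd m nz bz) i0)))) (y mod 12)).
    move=> hin h2 h40; apply: (pick_level m m 12) => //; [lia|by apply: b_unit; lia|apply: nzb; lia|apply: bzc; lia].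
  have p5 := pk 5 (or_introl erefl) erefl ltac:(by []).
  have p7 := pk 7 (or_intror (or_introl erefl)) erefl ltac:(by []).
  have p13 := pk 13 (or_intror (or_intror (or_introl erefl))) erefl ltac:(by []).
  have [R' [hR' hp]] := level12_sound _ _ _ _ _ (m4 f) (m4 e) p5 p7 p13.
  eexists; split; last by exists R'; split; [exact: hR'|exact: hp].
  apply/filter_In; split; last by case: (level12 _ _ _ _ _ _ _ _ _) hR'.
  by apply/in_map_iff; exists j0; split.
rewrite (match_nil _ _ _ _ _ _ hR).
move/forallb_forall/(_ _ ini36)/forallb_forall/(_ (e mod 36) (in_lift36' e))/forallb_forall/(_ (f mod 36) (in_lift36' f)).
move/forallb_forall/(_ _ hR)/forallb_forall/(_ _ inj36); rewrite hsk.
have pk m q ok bad : In (m, q, 36) upows -> 1 < q -> 2 < m -> q <= 40 -> ok (b mod m) = true ->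
  bad ((2 ^ i + b ^ e) mod m) = false -> In (b mod m)
    (get [] (elist (j mod 36) (clist (f mod 36) (blist (e mod 36) (alist (mkmd m ok bad) (i mod 36))))) (y mod 36)).
  by move=> hin h1 h2 h40 h3 h4; apply: (pick_level m q 36) => //; apply: b_unit.
have in27 : In (27, 3, 36) upows by do 3 right; left.
have in19 : In (19, 19, 36) upows by do 4 right; left.
have in37 : In (37, 37, 36) upows by do 5 right; left.
move/level36_sound; apply => //.
- apply: (pk 27 3) => //.
  + by apply/N.eqb_eq; rewrite -[27]/(9 * 3) mod_mod_mul // (c_b3 _ _ _ _ _ _ _ C).
  + by rewrite -[27]/(9 * 3) mod_mod_mul //; apply/N.eqb_neq; apply: (c_mod _ _ _ _ _ _ S).
- by apply: (pk 19 19) => //; [exact: nzb | exact: bzc].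
- by apply: (pk 37 37) => //; [exact: nzb | exact: bzc].
Qed.
End General.
End Levels.

(** * Exponents modulo 144 and the doubling of the period *)

Module Lifting.
Import List ListNotations Sieve Tables Columns Crt Residues LeafSound Levels.
Local Open Scope bool_scope.
Local Open Scope list_scope.
Local Open Scope N_scope.
Local Arguments N.pow : simpl never.
Local Arguments N.mul : simpl never.
Local Arguments N.add : simpl never.
Local Arguments N.sub : simpl never.
Local Arguments N.modulo : simpl never.

Lemma crt16_spec x : get 0 (get E0 crt16 (x mod 36)) (x mod 16) = x mod 144.
Proof.
have h : forallb (fun x => get 0 (get E0 crt16 (x mod 36)) (x mod 16) =? x) (range 144) = true by vm_compute.
have /in_range : x mod 144 < 144 by apply: N.mod_lt.
move/(proj1 (forallb_forall _ _) h)/N.eqb_eq.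
by rewrite -[X in x mod X mod 36]/(4 * 36) -[X in x mod X mod 16]/(9 * 16) !mod_mod_mul.
Qed.

Lemma crt8_spec x : get 0 (get E0 crt8 (x mod 36)) (x mod 8) = x mod 72.
Proof.
have h : forallb (fun x => get 0 (get E0 crt8 (x mod 36)) (x mod 8) =? x) (range 72) = true by vm_compute.
have /in_range : x mod 72 < 72 by apply: N.mod_lt.
move/(proj1 (forallb_forall _ _) h)/N.eqb_eq.
by rewrite -[X in x mod X mod 36]/(2 * 36) -[X in x mod X mod 8]/(9 * 8) !mod_mod_mul.
Qed.

Local Opaque tab range get rows pows urows crt8 crt16.

Lemma in_fold A B (F : A -> list B -> list B) l x p acc : (forall a acc, In p acc -> In p (F a acc)) ->
  (forall acc, In p (F x acc)) -> In x l -> In p (fold_right F acc l).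
Proof. by move=> h1 h2; elim: l => [|a l IH] //= [->|/IH]; [apply: h2 | apply: h1]. Qed.

Lemma in_lift2 x n : n <> 0 -> In (x mod (2 * n)) [x mod n; x mod n + n].
Proof.
move=> n0; rewrite N.mul_comm N.Div0.mod_mul_r.
have h : (x / n) mod 2 < 2 by apply: N.mod_lt.
move: (_ mod 2) h => z h; have [->|->] : z = 0 \/ z = 1 by clear - h; lia.
  by left; rewrite N.mul_0_r N.add_0_r.
by right; left; rewrite N.mul_1_r.
Qed.

Lemma neg_sq p u v k : u + v = p * k -> (u * u) mod p = (v * v) mod p.
Proof.
case: (N.eq_dec p 0) => [->|p0] h; first by have -> : u = v by lia.
apply: (add_cancel _ _ (u * v) _ p0).
have -> : u * u + u * v = u * k * p by rewrite -N.mul_add_distr_l h; lia.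
have -> : v * v + u * v = v * k * p by rewrite -N.mul_add_distr_r (N.add_comm v) h; lia.
by rewrite !N.Div0.mod_mul.
Qed.

Lemma redm_add m u v : u < m -> v <= m -> redm m (u + v) = (u + v) mod m.
Proof. by move=> h1 h2; apply: redm_spec; lia. Qed.

(** Both summands are known up to sign, and a common change of sign does not affect the square of
    the sum; so only the relative sign remains. *)
Lemma sum_sq p x z a d : sqp p = true -> a < p -> d < p -> (x * x) mod p = (a * a) mod p ->
  (z * z) mod p = (d * d) mod p ->
  ((x + z) * (x + z)) mod p = ((a + d) * (a + d)) mod p \/
  ((x + z) * (x + z)) mod p = ((a + (p - d)) * (a + (p - d))) mod p.
Proof.
move=> hs ha hd hx hz; have p0 : p <> 0 by lia.
have lx := N.mod_lt x p p0; have lz := N.mod_lt z p p0.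
have cx : x mod p = a \/ x mod p = p - a by apply: sqpP => //; rewrite -N.Div0.mul_mod.
have cz : z mod p = d \/ z mod p = p - d by apply: sqpP => //; rewrite -N.Div0.mul_mod.
have e : ((x + z) * (x + z)) mod p = ((x mod p + z mod p) * (x mod p + z mod p)) mod p.
  by rewrite N.Div0.mul_mod (N.Div0.add_mod x z) -N.Div0.mul_mod.
rewrite e; case: cx cz => -> [] ->; [by left | by right | right | left].
- by apply: (neg_sq _ _ _ 2); lia.
- by apply: (neg_sq _ _ _ 2); lia.
Qed.

Lemma first_lift (g : N -> bool) x x' : x = x' \/ x + 144 = x' \/ x + 288 = x' \/ False -> g x' = true ->
  (if g x then true else if g (x + 144) then true else g (x + 288)) = true.
Proof. by case=> [->|[->|[->|[]]]] ->; case: (g _) => //; case: (g _). Qed.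

Section Next.
Variables (c : cs) (b f i j e y : N).
Hypothesis S : sol b f i j e y.
Hypothesis C : cls c b f i j e y.
Hypothesis W : wf c = true.
Local Notation cc := (2 ^ i + b ^ e).
Definition tupl L H := T5 (f mod L) (i mod H) (j mod H) (e mod L) (y mod L).

Definition entry (t17 : T17) := get [] (get E0 (get E0 (get E0 (get E0 (get E0 (get E0 t17
  (b mod 2 ^ k16 c)) (b mod 17)) (i mod 8)) (e mod 4)) (f mod 4)) (j mod 4)) (y mod 4).

Lemma mod4 x n : x mod (n * 4) mod 4 = x mod 4.
Proof. exact: mod_mod_mul. Qed.

Lemma in_plus4 x : In (x mod 16) (plus4 (x mod 4)).
Proof.
have h := mod4 x 4; have l : x mod 16 < 16 by apply: N.mod_lt.
have d := N.div_mod (x mod 16) 4; have l2 : x mod 16 mod 4 < 4 by apply: N.mod_lt.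
rewrite -h /plus4 /=; set r := _ mod 4 in d l2 *; set q := _ / 4 in d; lia.
Qed.

Lemma T17_sound keys is8 js4 es4 fs4 o : In (b mod 2 ^ k16 c) keys -> In (i mod 8) is8 -> In (j mod 4) js4 ->
  In (e mod 4) es4 -> In (f mod 4) fs4 -> o = [] \/ 1 < 2 ^ k16 c /\ relc o (2 ^ k16 c) i j ->
  In (T5 (f mod 16) (i mod 8) (j mod 8) (e mod 16) (y mod 16)) (entry (mkT17 keys is8 js4 es4 fs4 o (2 ^ k16 c))).
Proof.
move=> hk hi hj he hf ho; rewrite /entry /mkT17; set m := 2 ^ k16 c.
have lt16 x : x mod 16 < 16 by apply: N.mod_lt.
have in17 : In (17, 17, 16) upows by do 7 right; left.
have hb : b mod 17 <> 0 by apply: (b_unit _ _ _ _ _ _ S).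
have l17 : b mod 17 < 17 by apply: N.mod_lt.
have hc : cc mod 17 <> 0 by apply: (c_mod _ _ _ _ _ _ S).
have h1y : In (y mod 4) [1; 3].
  have o4 : N.odd (y mod 4) = true by rewrite mod_odd // (s_y _ _ _ _ _ _ S).
  have l4 : y mod 4 < 4 by apply: N.mod_lt.
  move: (y mod 4) o4 l4 => z o4 l4; clear - o4 l4.
  have : In z (filter N.odd (range 4)) by apply/filter_In; split => //; apply/in_range.
  by [].
rewrite get_stab //; cbv zeta; rewrite get_stab; last first.
  have E17 : range 17 = 0 :: tl (range 17) by vm_compute.
  have : In (b mod 17) (range 17) by apply/in_range.
  by rewrite {1}E17; case=> // h; case: hb.
cbv zeta; rewrite !get_stab //; try by apply/in_range.
apply/in_flat_map; exists (j mod 8); split.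
  have -> : j mod 4 = j mod 8 mod 4 by rewrite -[8]/(2 * 4) mod4.
  have l : j mod 8 < 8 by apply: N.mod_lt.
  have d := N.div_mod (j mod 8) 4; have l2 : j mod 8 mod 4 < 4 by apply: N.mod_lt.
  rewrite /=; set r := _ mod 4 in d l2 *; set q := _ / 4 in d; lia.
apply/in_flat_map; exists (e mod 16, f mod 16, y mod 16); split.
  apply/in_flat_map; exists (e mod 16); split; first exact: in_plus4.
  apply/in_flat_map; exists (f mod 16); split; first exact: in_plus4.
  apply/in_flat_map; exists (y mod 16); split; first exact: in_plus4.
  have -> : rel o m 16 (b mod m) (f mod 16) (e mod 16) (y mod 16) = true.
    by case: ho => [->|[h1 h2]] //; apply: rel_sound (s_eq _ _ _ _ _ _ S).
  by left.
have t16 : 2 ^ 8 mod 17 = 1 by [].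
have b16 := powb_unit b 17 17 16 in17 hb.
have c16 : cc ^ 16 mod 17 = 1 by apply: (powc_unit _ _ _ _ _ _ S _ 17).
have l8 x : x mod 8 < 16 by apply: N.lt_trans (N.mod_lt x 8 _) _.
have hb0 : (b mod 17 =? 0) = false by apply/N.eqb_neq.
rewrite get_tab // hb0 [2 =? 0]/= !get_pows //.
rewrite !mod_pow_l -!(pow_period 17 16) // -!(pow_period 17 8 2) //.
have lt17 x : x mod 17 < 17 by apply: N.mod_lt.
have r2 u v : redm 17 (u mod 17 + v mod 17) = (u + v) mod 17.
  by rewrite redm_add -?N.Div0.add_mod //; apply: N.lt_le_incl.
rewrite !r2.
rewrite get_urows //.
rewrite get_pows // mod_pow_l -(pow_period 17 16) // (s_eq _ _ _ _ _ _ S) N.eqb_refl.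
by left.
Qed.

Lemma cand_sound t17 : In (T5 (f mod 16) (i mod 8) (j mod 8) (e mod 16) (y mod 16)) (entry t17) ->
  In (tupl 144 72) (cand c t17 (urows 73 144) crt16 crt8 (b mod 73) b (f mod 36) (i mod 36) (j mod 36) (e mod 36) (y mod 36)).
Proof.
move=> hT; have hb := b_unit73 _ _ _ _ _ _ S.
have in73 : In (73, 73, 72) upows by do 6 right; left.
have b72 := powb_unit b 73 73 72 in73 hb.
have c72 : cc ^ 72 mod 73 = 1 by apply: (powc_unit _ _ _ _ _ _ S _ 73).
have b144 : b ^ 144 mod 73 = 1 by rewrite (pow_period 73 72).
have c144 : cc ^ 144 mod 73 = 1 by rewrite (pow_period 73 72).
have hc : cc mod 73 <> 0 by apply: (c_mod _ _ _ _ _ _ S).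
have t36 : 2 ^ 36 mod 73 = 1 by [].
have m364 x : x mod 36 mod 4 = x mod 4 by rewrite -[36]/(9 * 4) mod4.
rewrite /cand; cbv zeta; rewrite N.land_ones !m364.
have m36144 x : x mod 36 = x mod 144 mod 36 by rewrite -[144]/(4 * 36) mod_mod_mul.
apply: (in_fold _ _ _ _ (i mod 8)).
- move=> i8 acc h; case: (get [] _ _) => // t l; move: (t :: l) => {t}l.
  elim: l => [|[f' i' j' e' y'] l IH] //=.
  by case: (if frj c then _ else _) => //; case: (_ =? _) => //; right.
- move=> acc; move: hT; rewrite /entry; case: (get [] _ _) => // t l; move: (t :: l) => {t}l hT.
  apply: in_fold hT => [[f' i' j' e' y'] acc' h|acc'].
    by case: (if frj c then _ else _) => //; case: (_ =? _) => //; right.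
  rewrite (crt16_spec e) (crt16_spec f) (crt16_spec y) (crt8_spec i) (crt8_spec j).
  have -> : (if frj c then false else negb (j mod 8 =? j mod 36 mod 8)) = false.
    by case E: (frj c) => //; rewrite (N.mod_small j 36) ?N.eqb_refl //; apply: (wf_j _ _ _ _ _ _ _ C W).
  have -> : (if fri c then i mod 72 else i mod 36) = i mod 72.
    by case E: (fri c) => //; have h := wf_i _ _ _ _ _ _ _ C W E; rewrite !N.mod_small //; apply: N.lt_trans h _.
  have -> : (if frj c then j mod 72 else j mod 36) = j mod 72.
    by case E: (frj c) => //; have h := wf_j _ _ _ _ _ _ _ C W E; rewrite !N.mod_small //; apply: N.lt_trans h _.
  have l73 x : x mod 73 < 73 by apply: N.mod_lt.
  have l144 x : x mod 144 < 144 by apply: N.mod_lt.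
  have l36 x : x mod 36 < 144 by apply: N.lt_trans (N.mod_lt x 36 _) _.
  have r2 u v : redm 73 (u mod 73 + v mod 73) = (u + v) mod 73.
    by rewrite redm_add -?N.Div0.add_mod //; apply: N.lt_le_incl.
  have -> : get E0 (urows 73 144) 2 = pows 73 2 144 by apply: get_urows.
  have -> : get E0 (urows 73 144) (b mod 73) = pows 73 (b mod 73) 144 by apply: get_urows.
  have g2 x : get 0 (pows 73 2 144) (x mod 36) = 2 ^ x mod 73 by rewrite get_pows // -pow_period.
  have gb x : get 0 (pows 73 (b mod 73) 144) (x mod 144) = b ^ x mod 73.
    by rewrite get_pows // mod_pow_l -pow_period.
  have gc x : get 0 (get E0 (urows 73 144) (cc mod 73)) (x mod 144) = cc ^ x mod 73.
    by rewrite get_urows // get_pows // mod_pow_l -pow_period.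
  rewrite !g2 !gb !r2 gc (s_eq _ _ _ _ _ _ S) N.eqb_refl.
  by left.
- case E: (fri c); last by left; rewrite (N.mod_small i 36) //; apply: (wf_i _ _ _ _ _ _ _ C W).
  by have := in_lift2 i 4; apply.
Qed.

Lemma chk97_sound : b mod 97 <> 0 -> chk97 (rows 97 96) (get E0 (rows 97 96) (b mod 97)) (tupl 144 72) = true.
Proof.
move=> hb.
have in97 : In (97, 97, 96) upows by do 8 right; left.
have b96 : b ^ (2 * 48) mod 97 = 1 := powb_unit b 97 97 96 in97 hb.
have b288 : b ^ (2 * 144) mod 97 = 1 by rewrite (pow_period 97 96).
have c96 : cc ^ (2 * 48) mod 97 = 1 by apply: (powc_unit _ _ _ _ _ _ S _ 97).
have t96 : 2 ^ (2 * 48) mod 97 = 1 by [].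
have t144 : 2 ^ (2 * 72) mod 97 = 1 by [].
have hc : cc mod 97 <> 0 by apply: (c_mod _ _ _ _ _ _ S).
have l48 x : x mod 48 < 96 by apply: N.lt_trans (N.mod_lt x 48 _) _.
have l97 x : x mod 97 < 97 by apply: N.mod_lt.
have r2 u v : u < 97 -> v <= 97 -> redm 97 (u + v) = (u + v) mod 97 by exact: redm_add.
have le97 v : v < 97 -> v <= 97 by exact: N.lt_le_incl.
have sub97 v : 97 - v <= 97 by exact: N.le_sub_l.
rewrite /chk97 /tupl !(get_rows 97 96 2) // (get_rows 97 96 (b mod 97)) // !get_pows // !mod_pow_l.
set pi := 2 ^ (i mod 72 mod 48) mod 97; set p := 2 ^ (j mod 72 mod 48) mod 97.
set be := b ^ (e mod 144 mod 48) mod 97; set by_ := b ^ (y mod 144 mod 48) mod 97.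
have h1 : 1 < 97 by [].
have sq2 x : (2 ^ x * 2 ^ x) mod 97 = (2 ^ (x mod 72 mod 48) mod 97 * (2 ^ (x mod 72 mod 48) mod 97)) mod 97.
  by rewrite (sq_period 97 72 2 x h1 t144) -N.Div0.mul_mod (sq_period 97 48 2 _ h1 t96).
have sqb x : (b ^ x * b ^ x) mod 97 = (b ^ (x mod 144 mod 48) mod 97 * (b ^ (x mod 144 mod 48) mod 97)) mod 97.
  by rewrite (sq_period 97 144 b x h1 b288) -N.Div0.mul_mod (sq_period 97 48 b _ h1 b96).
rewrite !r2 //; try by [apply: l97 | apply: le97; apply: l97].
have hq := sum_sq 97 (2 ^ j) (b ^ y) p by_ sq97 (l97 _) (l97 _) (sq2 j) (sqb y).
have key z : (cc * cc) mod 97 = (z * z) mod 97 ->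
  (if z mod 97 =? 0 then false else
   let C := get 0 (get E0 (rows 97 96) (z mod 97)) (f mod 144 mod 48) in
   if C =? (p + by_) mod 97 then true else if C =? (p + (97 - by_)) mod 97 then true
   else let C := 97 - C in if C =? (p + by_) mod 97 then true else C =? (p + (97 - by_)) mod 97) = true.
  move=> hz.
  have z0 : z mod 97 <> 0.
    move=> h; move: hz; rewrite (N.Div0.mul_mod z) h => hz.
    have := sqpP 97 (cc mod 97) 0 sq97 (l97 _) erefl; rewrite -N.Div0.mul_mod => /(_ hz) [h'|h'] //.
    by have := l97 cc; rewrite h'.
  have z96 : z ^ (2 * 48) mod 97 = 1 := upowsP _ _ _ z in97 z0.
  rewrite (proj2 (N.eqb_neq _ _) z0) get_rows // get_pows // mod_pow_l; cbv zeta.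
  have -> : f mod 144 mod 48 = f mod 48 by rewrite -[144]/(3 * 48) mod_mod_mul.
  set D := z ^ (f mod 48) mod 97.
  have hD : (D * D) mod 97 = ((2 ^ j + b ^ y) * (2 ^ j + b ^ y)) mod 97.
    rewrite -(s_eq _ _ _ _ _ _ S) -(sq_period 97 48 z f h1 z96) -!N.pow_mul_l -mod_pow_l -hz mod_pow_l.
    by rewrite !N.pow_mul_l.
  have sel q : ((2 ^ j + b ^ y) * (2 ^ j + b ^ y)) mod 97 = (q * q) mod 97 -> D = q mod 97 \/ 97 - D = q mod 97.
    move=> h; have := sqpP 97 D (q mod 97) sq97 (l97 _) (l97 _).
    rewrite -(N.Div0.mul_mod q) -h hD => /(_ erefl) [->|h']; [by left | right].
    rewrite h'; move: (q mod 97) (l97 q) => v hv; clear - hv; lia.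
  have fin : [\/ D = (p + by_) mod 97, 97 - D = (p + by_) mod 97, D = (p + (97 - by_)) mod 97 | 97 - D = (p + (97 - by_)) mod 97].
    by case: hq => /sel [h|h]; [apply: Or41|apply: Or42|apply: Or43|apply: Or44].
  move: D ((p + by_) mod 97) ((p + (97 - by_)) mod 97) fin {hD sel} => u v w.
  by case=> ->; rewrite N.eqb_refl; case: (_ =? _) => //; case: (_ =? _) => //; case: (_ =? _).
have := sum_sq 97 (2 ^ i) (b ^ e) pi be sq97 (l97 _) (l97 _) (sq2 i) (sqb e).
by case=> /key h; rewrite h //; case: (if _ then false else _).
Qed.
Lemma chk433_sound : b mod 433 <> 0 ->
  chk433 (rows 433 432) (tab 433 (fun x => (x * ((x * x) mod 433)) mod 433)) (get E0 (rows 433 432) (b mod 433)) (tupl 144 72) = true.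
Proof.
move=> hb; set cub := tab _ _.
have in433 : In (433, 433, 432) upows by do 10 right; left.
have b432 : b ^ 432 mod 433 = 1 := powb_unit b 433 433 432 in433 hb.
have c432 : cc ^ 432 mod 433 = 1 by apply: (powc_unit _ _ _ _ _ _ S _ 433).
have t72 : 2 ^ 72 mod 433 = 1 by vm_compute.
have hc : cc mod 433 <> 0 by apply: (c_mod _ _ _ _ _ _ S).
have lt433 x : x mod 433 < 433 by apply: N.mod_lt.
have lt432 x : x mod 432 < 432 by apply: N.mod_lt.
have l72 x : x mod 72 < 432 by apply: N.lt_trans (N.mod_lt x 72 _) _.
have l144 x : x mod 144 < 432 by apply: N.lt_trans (N.mod_lt x 144 _) _.
have h1 : 1 < 433 by [].
have g2 x : get 0 (get E0 (rows 433 432) 2) (x mod 72) = 2 ^ x mod 433.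
  by rewrite get_rows // get_pows // -(pow_period 433 72).
have gb x : x < 432 -> get 0 (get E0 (rows 433 432) (b mod 433)) x = b ^ x mod 433.
  by move=> hx; rewrite get_rows // get_pows // mod_pow_l.
have gc x : x < 432 -> get 0 (get E0 (rows 433 432) (cc mod 433)) x = cc ^ x mod 433.
  by move=> hx; rewrite get_rows // get_pows // mod_pow_l.
have lifts x : exists x', [/\ In x' [x mod 144; x mod 144 + 144; x mod 144 + 288], x' < 432 &
    forall a, a ^ 432 mod 433 = 1 -> a ^ x' mod 433 = a ^ x mod 433].
  exists (x mod 432); split; [|exact: lt432|by move=> a ha; rewrite (pow_period 433 432 a x)].
  have h : x mod 432 = x mod 144 + 144 * ((x / 144) mod 3) by rewrite -[432]/(144 * 3) N.Div0.mod_mul_r.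
  rewrite h; have : (x / 144) mod 3 < 3 by apply: N.mod_lt.
  move: (_ mod 3) (x mod 144) => z u hz; rewrite /=; clear - hz; lia.
have cubs x : x < 433 -> get 0 cub x = x ^ 3 mod 433.
  move=> hx; rewrite /cub get_tab // N.Div0.mul_mod_idemp_r; congr (_ mod _); lia.
rewrite /chk433 /tupl !g2 (gb _ (l144 y)) (cubs _ (lt433 _)).
apply/existsb_exists; have [e' [he' le' pe']] := lifts e; exists e'; split => //.
have -> : redm 433 (2 ^ i mod 433 + get 0 (get E0 (rows 433 432) (b mod 433)) e') = cc mod 433.
  rewrite (gb _ le') (pe' _ b432) redm_add; [by rewrite -N.Div0.add_mod | exact: lt433 | exact/N.lt_le_incl].
rewrite (proj2 (N.eqb_neq _ _) hc); cbv zeta.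
have key f' : f' < 432 -> (forall a, a ^ 432 mod 433 = 1 -> a ^ f' mod 433 = a ^ f mod 433) ->
   (get 0 cub (redm 433 (get 0 (get E0 (rows 433 432) (cc mod 433)) f' + (433 - 2 ^ j mod 433))) =?
    (b ^ (y mod 144) mod 433) ^ 3 mod 433) = true.
  move=> lf pf; rewrite (gc _ lf) (pf _ c432) redm_add; [|exact: lt433|exact: N.le_sub_l].
  have -> : (cc ^ f mod 433 + (433 - 2 ^ j mod 433)) mod 433 = b ^ y mod 433.
    rewrite (s_eq _ _ _ _ _ _ S); apply: (add_cancel 433 _ (2 ^ j mod 433)); first by [].
    have -> : (2 ^ j + b ^ y) mod 433 + (433 - 2 ^ j mod 433) + 2 ^ j mod 433 = (2 ^ j + b ^ y) mod 433 + 1 * 433.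
      by have := lt433 (2 ^ j); move: (_ mod 433) (_ mod 433) => u v; clear; lia.
    by rewrite N.Div0.mod_add N.Div0.mod_mod N.Div0.add_mod_idemp_r N.add_comm.
  rewrite (cubs _ (lt433 _)) !mod_pow_l -!N.pow_mul_r; apply/N.eqb_eq.
  rewrite (pow_period 433 432 b (y * 3)) // (pow_period 433 432 b (_ * 3)) //.
  by rewrite -[432]/(144 * 3) !N.Div0.mul_mod_distr_r N.Div0.mod_mod.
have [f' [/= hf' lf' pf']] := lifts f.
pose g f0 := get 0 cub (redm 433 (get 0 (get E0 (rows 433 432) (cc mod 433)) f0 + (433 - 2 ^ j mod 433)))
  =? (b ^ (y mod 144) mod 433) ^ 3 mod 433.
exact: (first_lift g _ _ hf' (key _ lf' pf')).
Qed.

Lemma in_free (fr : bool) H x : H <> 0 -> (fr = false -> x < H) ->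
  In (x mod (2 * H)) (if fr then [x mod H; x mod H + H] else [x mod H]).
Proof.
move=> h0; case: fr => h; first exact: in_lift2.
by left; have l := h erefl; rewrite !N.mod_small //; lia.
Qed.

Lemma lift2_sound m pwr L H : In (m, m, m - 1) upows -> 1 < m < 1154 -> 36 <= H -> L = 2 * H -> L / 2 = H ->
  (m - 1 | 2 * L) -> 2 ^ L mod m = 1 ->
  (forall a x, a < m -> a <> 0 -> x < m - 1 -> pwr a x = a ^ x mod m) ->
  In (tupl (2 * L) L) (lift2 c m pwr L b (tupl L H)).
Proof.
move=> hin hm h36 hL hH hd t1 hp; have m0 : m <> 0 by clear - hm; lia.
have H0 : H <> 0 by clear - h36; lia.
have L0 : L <> 0 by clear - hL H0; lia.
have o0 : m - 1 <> 0 by clear - hm; lia.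
have m1 : 1 < m by case: hm.
have ei := in_free (fri c) H i H0 (fun h => N.lt_le_trans _ _ _ (wf_i _ _ _ _ _ _ _ C W h) h36).
have ej := in_free (frj c) H j H0 (fun h => N.lt_le_trans _ _ _ (wf_j _ _ _ _ _ _ _ C W h) h36).
have el x := in_lift2 x L L0.
rewrite -hL in ei ej.
rewrite /lift2 /tupl hH.
(* If [m] divides [b], nothing is tested and all lifts are kept. *)
case: N.eqb_spec => hb.
  apply/in_flat_map; exists (i mod L); split => //.
  apply/in_flat_map; exists (j mod L); split => //.
  apply/in_flat_map; exists (e mod (2 * L)); split => //.
  apply/in_flat_map; exists (f mod (2 * L)); split => //.
  by apply/in_map_iff; exists (y mod (2 * L)); split.
have hc : cc mod m <> 0 by apply: (c_mod _ _ _ _ _ _ S).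
have lm x : x mod m < m by apply: N.mod_lt.
have lo x : x mod (m - 1) < m - 1 by apply: N.mod_lt.
have bo := powb_unit b m m _ hin hb.
have co : cc ^ (m - 1) mod m = 1 by apply: (powc_unit _ _ _ _ _ _ S _ m).
have t0 : 2 ^ (m - 1) mod m = 1 := pow2_unit m m _ hin.
have n20 : 2 mod m <> 0.
  move=> h; have := t0; rewrite -mod_pow_l h N.pow_0_l // N.mod_0_l //.
have l2 : 2 < m.
  by move: n20; case: (N.lt_ge_cases 2 m) => // h; have -> : m = 2 by [clear - m1 h; lia]; case.
have p2 x : pwr 2 (x mod L mod (m - 1)) = 2 ^ x mod m.
  by rewrite hp // -(pow_period m (m - 1) 2) // -(pow_period m L 2).
have pb x : pwr (b mod m) (x mod (2 * L) mod (m - 1)) = b ^ x mod m.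
  by rewrite hp // mod_pow_l -(pow_period2 m (m - 1) (2 * L) b).
have pc x : pwr (cc mod m) (x mod (2 * L) mod (m - 1)) = cc ^ x mod m.
  by rewrite hp // mod_pow_l -(pow_period2 m (m - 1) (2 * L) cc).
have r2 u v : redm m (u mod m + v mod m) = (u + v) mod m.
  by rewrite redm_add -?N.Div0.add_mod //; apply: N.lt_le_incl.
apply/in_flat_map; exists (e mod (2 * L)); split => //.
apply/in_flat_map; exists (i mod L); split => //.
rewrite p2 pb r2 (proj2 (N.eqb_neq _ _) hc).
apply/in_flat_map; exists (f mod (2 * L), f mod (2 * L) mod (m - 1)); split.
  by apply/in_map_iff; exists (f mod (2 * L)).
apply/in_flat_map; exists (j mod L, pwr 2 (j mod L mod (m - 1))); split.
  by apply/in_map_iff; exists (j mod L).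
apply/in_flat_map; exists (y mod (2 * L), pwr (b mod m) (y mod (2 * L) mod (m - 1))); split.
  by apply/in_map_iff; exists (y mod (2 * L)).
by rewrite p2 pb r2 pc (s_eq _ _ _ _ _ _ S) N.eqb_refl; left.
Qed.
End Next.
End Lifting.

Module Candidates.
Import List ListNotations Sieve Tables Columns Crt Residues LeafSound Levels Lifting.
Local Open Scope bool_scope.
Local Open Scope list_scope.
Local Open Scope N_scope.
Local Arguments N.pow : simpl never.
Local Arguments N.mul : simpl never.
Local Arguments N.add : simpl never.
Local Arguments N.sub : simpl never.
Local Arguments N.modulo : simpl never.
Local Opaque tab range get rows pows urows crt8 crt16.

Lemma mod_mulc q u u' v v' : u mod q = u' mod q -> v mod q = v' mod q -> (u * v) mod q = (u' * v') mod q.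
Proof. by move=> h1 h2; rewrite N.Div0.mul_mod h1 h2 -N.Div0.mul_mod. Qed.

Lemma mod_powc q u u' x : u mod q = u' mod q -> (u ^ x) mod q = (u' ^ x) mod q.
Proof. by move=> h; rewrite -mod_pow_l h mod_pow_l. Qed.

Lemma mod_div_dvd x d n : d <> 0 -> (d | n) -> x mod n mod d = x mod d.
Proof. by move=> d0 [k ->]; exact: mod_mod_mul. Qed.

Section Next.
Variables (c : cs) (b f i j e y : N).
Hypothesis S : sol b f i j e y.
Hypothesis C : cls c b f i j e y.
Hypothesis W : wf c = true.
Local Notation cc := (2 ^ i + b ^ e).

(* Modulo [b] the equation reads [2 ^ (i f) = 2 ^ j]. *)
Lemma final_sound : final 2304 b (tupl f i j e y 2304 1152) = true -> False.
Proof.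
have [hb _] := s_b _ _ _ _ _ _ S; have b1 : 1 < b by clear - hb; lia.
have b0 : b <> 0 by clear - hb; lia.
have h257 : 1 < 257 by [].
rewrite /final /tupl => /orP [/andP [/andP [h1 h2] h3]|].
  move: h1 h3; rewrite !pwm_spec // => /N.eqb_eq h1 /N.eqb_eq h3.
  apply: (c_mod _ _ _ _ _ _ S 257); first by [].
  have t : 2 ^ 1152 mod 257 = 1 by vm_compute.
  by rewrite -h3; apply: mod_addc; rewrite N.Div0.mod_mod; [exact: pow_period | exact: pow_period].
rewrite -[2304 / 2]/1152; set d := N.gcd 1152 (b - 1); set g := (b - 1) / d.
rewrite !pwm_spec //; cbv zeta; move=> /andP [/N.eqb_eq h1 /negP h2]; apply: h2; apply/N.eqb_eq.
have d1152 : (d | 1152) := N.gcd_divide_l _ _.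
have d0 : d <> 0 by move=> h; have [k] := d1152; rewrite h; clear; lia.
have d2304 : (d | 2304) by have [k hk] := d1152; exists (2 * k); rewrite -N.mul_assoc -hk.
set h := 2 ^ g mod b in h1 *.
set i0 := i mod 1152; set j0 := j mod 1152; set f0 := f mod 2304.
have key : (2 ^ (i * f)) mod b = (2 ^ j) mod b.
  have e1 : b ^ e mod b = 0.
    have [k ->] : exists k, e = N.succ k by exists (N.pred e); rewrite N.succ_pred //; exact: (s_e0 _ _ _ _ _ _ S).
    by rewrite N.pow_succ_r' N.mul_comm N.Div0.mod_mul.
  have y0 : y <> 0 by move=> hy; have := s_y _ _ _ _ _ _ S; rewrite hy.
  have e2 : b ^ y mod b = 0.
    have [k ->] : exists k, y = N.succ k by exists (N.pred y); rewrite N.succ_pred.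
    by rewrite N.pow_succ_r' N.mul_comm N.Div0.mod_mul.
  have k1 : cc mod b = 2 ^ i mod b by rewrite N.Div0.add_mod e1 N.add_0_r N.Div0.mod_mod.
  have k2 : (2 ^ j + b ^ y) mod b = 2 ^ j mod b by rewrite N.Div0.add_mod e2 N.add_0_r N.Div0.mod_mod.
  by rewrite N.pow_mul_r -k2 -(s_eq _ _ _ _ _ _ S); apply/esym/mod_powc.
have hkey : h ^ (i * f) mod b = h ^ j mod b.
  rewrite /h !mod_pow_l -!N.pow_mul_r (N.mul_comm g (i * f)) (N.mul_comm g j) !(N.pow_mul_r 2 _ g).
  exact: mod_powc key.
have per u v : u mod d = v mod d -> h ^ u mod b = h ^ v mod b.
  by move=> huv; rewrite (pow_period b d h u b1 h1) (pow_period b d h v b1 h1) huv.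
rewrite -(pow_period b d h _ b1 h1).
have lj : j0 < 1152 by apply: N.mod_lt.
have hY : (f0 * i0 + 2304 - j0 + j) mod d = (i * f) mod d.
  apply: (add_cancel _ _ j0) => //.
  have -> : f0 * i0 + 2304 - j0 + j + j0 = (f0 * i0 + j) + 2304 by clear - lj; lia.
  have [k hk] := d2304; rewrite {1}hk N.Div0.mod_add.
  apply: mod_addc; last by rewrite /j0 mod_div_dvd.
  by rewrite N.mul_comm; apply: mod_mulc; rewrite /i0 /f0 mod_div_dvd.
set Y := f0 * i0 + 2304 - j0 in hY *.
(* As [h ^ d = 1], the factor [h ^ ((d - 1) j)] is the inverse of [h ^ j]; it stands in for the
   subtraction of exponents. *)
have -> : h ^ Y mod b = h ^ (Y + j + (d - 1) * j) mod b.
  apply: per; have -> : Y + j + (d - 1) * j = Y + j * d by clear - d0; nia.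
  by rewrite N.Div0.mod_add.
rewrite N.pow_add_r N.Div0.mul_mod (per _ _ hY) hkey -N.Div0.mul_mod -N.pow_add_r.
have -> : j + (d - 1) * j = d * j by clear - d0; nia.
by rewrite (per _ 0) ?N.pow_0_r ?N.mod_1_l // N.mul_comm N.Div0.mod_mul N.mod_0_l.
Qed.

Lemma tabpow_rows m a x : a < m -> 1 < m -> x < m - 1 -> tabpow (rows m (m - 1)) a x = a ^ x mod m.
Proof. by move=> h1 h2 h3; rewrite /tabpow get_rows // get_pows. Qed.

Definition cub433 := tab 433 (fun x => (x * ((x * x) mod 433)) mod 433).

Lemma chain_sound l : In (tupl f i j e y 144 72) l ->
  chain c (rows 97 96) (rows 193 192) (rows 433 432) cub433 b l = true -> False.
Proof.
rewrite /chain.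
move=> hl; match goal with |- match ?X with [] => true | _ => _ end = true -> False => set l1 := X end.
have {hl} : In (tupl f i j e y 144 72) l1.
  rewrite /l1; cbv zeta; case: N.eqb_spec => // h; apply/filter_In; split => //.
  exact: (chk97_sound _ _ _ _ _ _ S h).
case: l1 => // t1 l1; move: (t1 :: l1) => {t1}l1.
move=> hl; match goal with |- match ?X with [] => true | _ => _ end = true -> False => set l2 := X end.
have {hl} : In (tupl f i j e y 144 72) l2.
  rewrite /l2; cbv zeta; case: N.eqb_spec => // h; apply/filter_In; split => //.
  exact: (chk433_sound _ _ _ _ _ _ S h).
case: l2 => // t2 l2; move: (t2 :: l2) => {t2}l2 {l1} hl.
case E: (existsb _ small).
  move/existsb_exists: E => [p [hp /andP [/N.eqb_eq h1 /N.ltb_lt h2]]].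
  have p1 : 1 < p.
    have : forallb (fun p => 1 <? p) small = true by vm_compute.
    by move/forallb_forall/(_ _ hp)/N.ltb_lt.
  by have := s_bp _ _ _ _ _ _ S p p1 h1; move: h2; clear; lia.
have stp m pwr L H l0 : In (m, m, m - 1) upows -> 1 < m < 1154 -> 36 <= H -> L = 2 * H -> L / 2 = H ->
  (m - 1 | 2 * L) -> 2 ^ L mod m = 1 ->
  (forall a x, a < m -> a <> 0 -> x < m - 1 -> pwr a x = a ^ x mod m) -> In (tupl f i j e y L H) l0 ->
  In (tupl f i j e y (2 * L) L) (flat_map (lift2 c m pwr L b) l0).
  move=> *; apply/in_flat_map; exists (tupl f i j e y L H); split => //.
  by apply: (lift2_sound _ _ _ _ _ _ _ S C W).
have h97 := stp 97 (tabpow (rows 97 96)) 144 72 l2 ltac:(by do 8 right; left) ltac:(by []) ltac:(by []) erefl erefl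
  ltac:(by exists 3) ltac:(by vm_compute) ltac:(by move=> a x h _ h'; exact: tabpow_rows) hl.
move: h97; case: (flat_map _ l2) => // t3 l3; move: (t3 :: l3) => {t3 l2 hl E}l3 hl.
have h193 := stp 193 (tabpow (rows 193 192)) 288 144 l3 ltac:(by do 9 right; left) ltac:(by []) ltac:(by []) erefl erefl
  ltac:(by exists 3) ltac:(by vm_compute) ltac:(by move=> a x h _ h'; exact: tabpow_rows) hl.
move: h193; case: (flat_map _ l3) => // t4 l4; move: (t4 :: l4) => {t4 l3 hl}l4 hl.
have h577 := stp 577 (pwm 577) 576 288 l4 ltac:(by do 11 right; left) ltac:(by []) ltac:(by []) erefl erefl
  ltac:(by exists 2) ltac:(by vm_compute) ltac:(by move=> a x _ _ _; exact: pwm_spec) hl.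
move: h577; case: (flat_map _ l4) => // t5 l5; move: (t5 :: l5) => {t5 l4 hl}l5 hl.
have h1153 := stp 1153 (pwm 1153) 1152 576 l5 ltac:(by do 12 right; left) ltac:(by []) ltac:(by []) erefl erefl
  ltac:(by exists 2) ltac:(by vm_compute) ltac:(by move=> a x _ _ _; exact: pwm_spec) hl.
move: h1153; case: (flat_map _ l5) => // t6 l6; move: (t6 :: l6) => {t6 l5 hl}l6 hl.
by move/forallb_forall/(_ _ hl)/final_sound.
Qed.

Definition tables_ok (t17 : T17) : Prop :=
  In (T5 (f mod 16) (i mod 8) (j mod 8) (e mod 16) (y mod 16)) (entry c b f i j e y t17).

Lemma next_sound t17 : tables_ok t17 ->
  next c t17 (urows 73 144) (rows 97 96) (rows 193 192) (rows 433 432) crt16 crt8 cub433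
    (b mod 73) b (f mod 36) (i mod 36) (j mod 36) (e mod 36) (y mod 36) = true -> False.
Proof.
move=> ht; rewrite /next.
have [hb _] := s_b _ _ _ _ _ _ S.
have -> : (b <? 35) = false by apply/N.ltb_ge; clear - hb; lia.
have := cand_sound _ _ _ _ _ _ _ S C W _ ht.
by case: (cand _ _ _ _ _ _ _ _ _ _ _ _) => // t l hl; exact: chain_sound.
Qed.

Lemma tables_T0 : k16 c = 0 -> tables_ok T0.
Proof.
move=> hk; rewrite /tables_ok.
have -> : T0 = mkT17 [0] [0; 2; 4; 6] [0; 1; 2; 3] [0; 2] [0; 1; 2; 3] [] (2 ^ k16 c) by rewrite hk.
have r4 x : In (x mod 4) (range 4) by apply/in_range/N.mod_lt.
have ev x n : n <> 0 -> N.even n = true -> N.even x = true -> In (x mod n) (filter N.even (range n)).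
  by move=> h1 h2 h3; apply/filter_In; rewrite even_mod //; split => //; apply/in_range/N.mod_lt.
have E4 : range 4 = [0; 1; 2; 3] by vm_compute.
have Ee : filter N.even [0; 1; 2; 3] = [0; 2] by [].
have E8 : filter N.even (range 8) = [0; 2; 4; 6] by vm_compute.
have hi := ev i 8 ltac:(by []) erefl (s_i _ _ _ _ _ _ S).
have he := ev e 4 ltac:(by []) erefl (s_e _ _ _ _ _ _ S).
rewrite E8 in hi; rewrite E4 Ee in he.
have hj := r4 j; have hf := r4 f; rewrite E4 in hj hf.
by apply: (T17_sound _ _ _ _ _ _ _ S); first [assumption | by rewrite hk N.pow_0_r N.mod_1_r; left | by left].
Qed.

Lemma tables_mkT : (if k16 c =? 0 then false else true) = true -> tables_ok (mkT c).
Proof.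
case: N.eqb_spec => // hk _; rewrite /tables_ok /mkT.
have m12 x : x mod 4 = x mod 12 mod 4 by rewrite -[12]/(3 * 4) mod_mod_mul.
have r4 x : In (x mod 4) (range 4) by apply/in_range/N.mod_lt.
have [//|[M2d R16]] := c_k16 _ _ _ _ _ _ _ C.
have M1 := c_M2 _ _ _ _ _ _ _ C.
have in4 x l : In (x mod 12) l -> In (x mod 4) (filter (fun r => memb r (map (fun j => j mod 4) l)) (range 4)).
  move=> h; apply/filter_In; split => //; apply: memb_in; apply/in_map_iff; exists (x mod 12); split => //.
apply: (T17_sound _ _ _ _ _ _ _ S).
- rewrite /keys; case: N.eqb_spec => // _; apply/filter_In; split; first by apply/in_range/N.mod_lt/N.pow_nonzero.
  by apply: memb_in; rewrite mod_div_dvd //; [exact: (c_b _ _ _ _ _ _ _ C) | clear - M1; lia].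
- have := c_i _ _ _ _ _ _ _ C; case: (fri c) => h; last by apply/in_map_iff; exists i.
  apply/filter_In; split; first by apply/in_range/N.mod_lt.
  apply/existsb_exists; exists (i mod 12); split => //; apply/N.eqb_eq.
  by rewrite -m12 -[8]/(2 * 4) mod_mod_mul.
- have := c_j _ _ _ _ _ _ _ C; case: (frj c) => h; first exact: in4.
  by apply/filter_In; split => //; apply: memb_in; apply/in_map_iff; exists j.
- exact/in4/(c_e _ _ _ _ _ _ _ C).
- exact/in4/(c_f _ _ _ _ _ _ _ C).
- right; split; last exact: R16.
  by case: (N.eq_dec (k16 c) 1) => [->|h] //; apply: N.pow_gt_1.
Qed.
End Next.
End Candidates.

Module SieveSound.
Import List ListNotations Sieve Tables Columns Crt Residues LeafSound Levels Lifting Candidates.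
Local Open Scope bool_scope.
Local Open Scope list_scope.
Local Open Scope N_scope.
Local Arguments N.pow : simpl never.
Local Arguments N.mul : simpl never.
Local Arguments N.add : simpl never.
Local Arguments N.sub : simpl never.
Local Arguments N.modulo : simpl never.
Local Opaque tab range get rows pows urows crt8 crt16.

Definition one {A} (l : list A) : bool := match l with [_] => true | _ => false end.
(** Conditions under which [special] may read off the values of [i] and [j] modulo 36 as heads of
    lists: a list that is used has a single element, or the value is copied from the other
    exponent. *)
Definition spok (c : cs) : bool := match sp c with None => true | Some (f0, s) =>
  if s =? 0 then (f0 =? 1) && (if fri c then negb (frj c) && one (j0s c) else one (i0s c) && (if frj c then true else one (j0s c)))
  else (s =? 1) && (f0 =? 0) && negb (fri c) && negb (frj c) && one (i0s c) && one (j0s c) end.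

Lemma one_hd (l : list N) x : one l = true -> In x l -> hd 0 l = x.
Proof. by case: l => [|a [|b l]] //= _ [->|]. Qed.

Section Special.
Variables (c : cs) (b f i j e y : N).
Hypothesis S : sol b f i j e y.
Hypothesis C : cls c b f i j e y.
Hypothesis W : wf c = true.
Local Notation cc := (2 ^ i + b ^ e).

Section Root.
Variables (s n : N).
Hypothesis hs : s = 0 /\ f mod 36 = 1 /\ i mod 36 = j mod 36 /\ n = (y + (36 - e mod 36)) mod 36
  \/ s = 1 /\ f mod 36 = 0 /\ n = y mod 36.

(** For [f = 1] and [i = j] modulo 36 the two powers of 2 cancel and [b ^ (y - e) = 1] remains; for
    [f = 0] the left side is 1 and [2 ^ j + b ^ y = 1] remains. The number [36 - e mod 36] replaces
    [- e]. *)
Lemma root_sound m ok bad : 2 < m < 1154 -> ok (b mod m) = true -> 2 ^ 36 mod m = 1 -> b ^ 36 mod m = 1 -> cc ^ 36 mod m = 1 ->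
  In (b mod m) (filter (fun r => (s * 2 ^ (j mod 36) + pwm m r n) mod m =? 1) (adm (mkmd m ok bad))).
Proof.
move=> hm hok h2 hb hc; have m1 : 1 < m by clear - hm; lia.
have m0 : m <> 0 by clear - hm; lia.
apply/filter_In; split; first exact: m_in.
rewrite pwm_spec // mod_pow_l; apply/N.eqb_eq.
case: hs => [[-> [hf [hij ->]]]|[-> [hf ->]]].
  rewrite N.mul_0_l N.add_0_l N.Div0.mod_mod -(pow_period m 36 b _ m1 hb) N.pow_add_r.
  have eb : b ^ y mod m = b ^ e mod m.
    have e1 : cc mod m = cc ^ f mod m by rewrite (pow_period m 36 cc f m1 hc) hf N.pow_1_r.
    move: e1; rewrite (s_eq _ _ _ _ _ _ S) N.Div0.add_mod (pow_period m 36 2 i m1 h2) hij -(pow_period m 36 2 j m1 h2).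
    rewrite -N.Div0.add_mod (N.add_comm (2 ^ j)) (N.add_comm (2 ^ j)) => h.
    exact/esym/(add_cancel _ _ _ _ m0 h).
  rewrite (mod_mulc _ _ (b ^ e) _ (b ^ (36 - e mod 36)) eb erefl) -N.pow_add_r (pow_period m 36 b _ m1 hb).
  have l := N.mod_lt e 36 ltac:(by []); have d := N.div_mod e 36 ltac:(by []).
  have -> : e + (36 - e mod 36) = (e / 36 + 1) * 36.
    by rewrite {1}d; move: (e mod 36) (e / 36) l => u v; clear; lia.
  by rewrite N.Div0.mod_mul N.pow_0_r N.mod_1_l.
rewrite N.mul_1_l -(N.Div0.add_mod_idemp_l) -(pow_period m 36 2 j m1 h2) N.Div0.add_mod_idemp_l.
rewrite -N.Div0.add_mod_idemp_r N.Div0.mod_mod -(pow_period m 36 b y m1 hb) N.Div0.add_mod_idemp_r.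
by rewrite -(s_eq _ _ _ _ _ _ S) (pow_period m 36 cc f m1 hc) hf N.pow_0_r N.mod_1_l.
Qed.
End Root.

Lemma special_sound next : spok c = true -> skipsp c (f mod 36) (i mod 36) (j mod 36) = true ->
  special mds (md27 (b3 c)) c ct73 vt73 next = true ->
  next (b mod 73) b (f mod 36) (i mod 36) (j mod 36) (e mod 36) (y mod 36) = true.
Proof.
rewrite /spok /skipsp /special /mds; case: (sp c) => [[f0 s]|] // hok.
move=> /andP [/N.eqb_eq hf hsk].
have ci := c_i _ _ _ _ _ _ _ C; have cj := c_j _ _ _ _ _ _ _ C.
have wi := wf_i _ _ _ _ _ _ _ C W; have wj := wf_j _ _ _ _ _ _ _ C W.
have hidx : hd 0 (if fri c then j0s c else i0s c) = i mod 36 /\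
    (if frj c then i mod 36 else hd 0 (j0s c)) = j mod 36.
  have hi : fri c = false -> one (i0s c) = true -> hd 0 (i0s c) = i mod 36.
    by move=> h1 h2; rewrite h1 in ci; rewrite (one_hd _ i) // N.mod_small //; apply: wi.
  have hj : frj c = false -> one (j0s c) = true -> hd 0 (j0s c) = j mod 36.
    by move=> h1 h2; rewrite h1 in cj; rewrite (one_hd _ j) // N.mod_small //; apply: wj.
  move: hok hsk; case: N.eqb_spec => s0.
    rewrite s0 /= => /andP [_]; case E: (fri c).
      by move=> /andP [/negPf h1 h2] /N.eqb_eq ->; rewrite h1 hj.
    move=> /andP [h1]; case E': (frj c) => h2 /N.eqb_eq hij; first by rewrite hi.
    by rewrite hi // hj.
  by move=> /andP [/andP [/andP [/andP [_ /negPf h1] /negPf h2] h3] h4] _; rewrite h1 h2 hi // hj.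
pose n := (y + (1 - s) * (36 - e mod 36)) mod 36.
have hs : s = 0 /\ f mod 36 = 1 /\ i mod 36 = j mod 36 /\ n = (y + (36 - e mod 36)) mod 36
  \/ s = 1 /\ f mod 36 = 0 /\ n = y mod 36.
  move: hok hsk; case: N.eqb_spec => s0.
    move=> /andP [/N.eqb_eq h1 _]; rewrite s0 /= => /N.eqb_eq h2; left.
    by rewrite hf h1 /n s0 N.mul_1_l.
  move=> /andP [/andP [/andP [/andP [/andP [/N.eqb_eq h0 /N.eqb_eq h1] _] _] _] _] _; right.
  by rewrite hf h1 /n h0 N.mul_0_l N.add_0_r.
have hy : ((1 - s) * (e mod 36) + n) mod 36 = y mod 36.
  have l := N.mod_lt e 36 ltac:(by []).
  case: hs => [[-> [_ [_ ->]]]|[-> [_ ->]]]; last by rewrite N.mul_0_l N.add_0_l N.Div0.mod_mod.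
  rewrite N.Div0.add_mod_idemp_r N.mul_1_l.
  have -> : e mod 36 + (y + (36 - e mod 36)) = y + 1 * 36 by move: (e mod 36) l => u l; clear - l; lia.
  by rewrite N.Div0.mod_add.
have on : In n (filter N.odd (range 36)).
  have ln : n < 36 by apply: N.mod_lt.
  apply/filter_In; split; first exact/in_range.
  rewrite -N.negb_even; apply/negP => h.
  have : N.even (((1 - s) * (e mod 36) + n) mod 36) = false.
    by rewrite hy even_mod // -N.negb_odd (s_y _ _ _ _ _ _ S).
  by rewrite even_mod // N.even_add N.even_mul h even_mod // (s_e _ _ _ _ _ _ S) orbT.
cbv zeta; match goal with |- context [upto 0 ?k] => have [cp ecp] : exists cp, cp = upto 0 k; [by eexists | rewrite -ecp] end.
move=> hall; have {hall} := proj1 (forallb_forall _ _) hall n on.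
have [-> ->] := hidx; rewrite -hf.
have [p5 [p7 [p13 [p27 [p19 p37]]]]] := A_pos _ _ _ _ _ _ _ C; have [_ hb] := s_b _ _ _ _ _ _ S.
have nzb p : 1 < p -> p <= 40 -> nz (b mod p) = true.
  by move=> h1 h2; rewrite /nz; case: N.eqb_spec => // h; case: (b_unit _ _ _ _ _ _ S _ h1 h2 h).
have rt12 m : In (m, m, 12) upows -> 2 < m -> m <= 40 ->
    In (b mod m) (filter (fun r => (s * 2 ^ (j mod 36) + pwm m r n) mod m =? 1) (adm (mkmd m nz bz))).
  move=> hin h2 h40; have m1 : 1 < m by clear - h2; lia.
  have p36 a : a ^ 12 mod m = 1 -> a ^ 36 mod m = 1.
    by move=> h; rewrite (pow_period m 12 a 36 m1 h) N.pow_0_r N.mod_1_l.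
  apply: (root_sound s n hs); [clear - h2 h40; lia | exact: nzb | | |]; apply: p36.
  - exact: pow2_unit hin.
  - by apply: (powb_unit b m m 12 hin); apply: (b_unit _ _ _ _ _ _ S).
  - exact: (powc_unit _ _ _ _ _ _ S _ _ _ hin m1).
have rt36 m q ok bad : In (m, q, 36) upows -> 1 < q -> q <= 40 -> 2 < m < 1154 -> ok (b mod m) = true ->
    In (b mod m) (filter (fun r => (s * 2 ^ (j mod 36) + pwm m r n) mod m =? 1) (adm (mkmd m ok bad))).
  move=> hin h1 h40 hm hok'; apply: (root_sound s n hs) => //.
  - exact: pow2_unit hin.
  - by apply: (powb_unit b m q 36 hin); apply: (b_unit _ _ _ _ _ _ S).
  - exact: (powc_unit _ _ _ _ _ _ S _ _ _ hin h1).
have r5 := rt12 5 ltac:(by left) ltac:(by []) ltac:(by []).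
have r7 := rt12 7 ltac:(by right; left) ltac:(by []) ltac:(by []).
have r13 := rt12 13 ltac:(by do 2 right; left) ltac:(by []) ltac:(by []).
have r27 := rt36 27 3 (fun b => b mod 3 =? b3 c) (fun x => x mod 3 =? 0) ltac:(by do 3 right; left) ltac:(by []) ltac:(by []) ltac:(by [])
  ltac:(by apply/N.eqb_eq; rewrite -[27]/(9 * 3) mod_mod_mul // (c_b3 _ _ _ _ _ _ _ C)).
have r19 := rt36 19 19 nz bz ltac:(by do 4 right; left) ltac:(by []) ltac:(by []) ltac:(by []) (nzb 19 ltac:(by []) ltac:(by [])).
have r37 := rt36 37 37 nz bz ltac:(by do 5 right; left) ltac:(by []) ltac:(by []) ltac:(by []) (nzb 37 ltac:(by []) ltac:(by [])).
set R0 := map _ (filter _ _).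
have hR0 : exists p, In p R0 /\ rep (A5 c) [(5, 1); (7, 1); (13, 1); (27, 1); (19, 1); (37, 1); (73, 1)] b p.
  set r := b mod M2 c.
  exists (r, [r mod 5; r mod 7; r mod 13; r mod 27; r mod 19; r mod 37; r mod 73]); split.
    apply/in_map_iff; exists (r, rel (rel4 c) (M2 c) 4 r); split => //.
    apply/filter_In; split; first exact: (rels_in _ _ _ _ _ _ _ C).
    have m4 x : x mod 36 mod 4 = x mod 4 by rewrite -[36]/(9 * 4) mod_mod_mul.
    apply/existsb_exists; exists (e mod 4); split.
      have : In (e mod 4) (filter N.even (range 4)).
        by apply/filter_In; rewrite even_mod // (s_e _ _ _ _ _ _ S); split => //; apply/in_range/N.mod_lt.
      by have -> : filter N.even (range 4) = [0; 2] by vm_compute.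
    have -> : ((1 - s) * (e mod 4) + n) mod 4 = y mod 4.
      rewrite -(m4 y) -hy m4; apply: mod_addc => //; apply: mod_mulc => //.
      by rewrite N.Div0.mod_mod m4.
    rewrite m4; exact: (rels_ok _ _ _ _ _ _ _ S C).
  apply: (rep_res b (A5 c) [(5, 1); (7, 1); (13, 1); (27, 1); (19, 1); (37, 1); (73, 1)] r) => // qc.
  by move=> /= [<-|[<-|[<-|[<-|[<-|[<-|[<-|]]]]]]].
have hinv := wf_inv c W.
have h1 := ext_sound 5 1 5 (A5 c) [(7, 1); (13, 1); (27, 1); (19, 1); (37, 1); (73, 1)] b _ _ erefl p5 erefl hb
  ltac:(by move=> q /= [<-|[<-|[<-|[<-|[<-|[<-|]]]]]]) (hinv _ _ ltac:(by left)) hR0 r5.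
have h2 := ext_sound 7 2 14 (A7 c) [(13, 2); (27, 2); (19, 2); (37, 2); (73, 2)] b _ _ erefl p7 erefl hb
  ltac:(by move=> q /= [<-|[<-|[<-|[<-|[<-|]]]]]) (hinv _ _ ltac:(by right; left)) h1 r7.
have h3 := ext_sound 13 3 39 (A13 c) [(27, 3); (19, 3); (37, 3); (73, 3)] b _ _ erefl p13 erefl hb
  ltac:(by move=> q /= [<-|[<-|[<-|[<-|]]]]) (hinv _ _ ltac:(by do 2 right; left)) h2 r13.
have h4 := ext_sound 27 4 108 (A27 c) [(19, 4); (37, 4); (73, 4)] b _ _ erefl p27 erefl hb
  ltac:(by move=> q /= [<-|[<-|[<-|]]]) (hinv _ _ ltac:(by do 3 right; left)) h3 r27.
have h5 := ext_sound 19 5 95 (A19 c) [(37, 5); (73, 5)] b _ _ erefl p19 erefl hb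
  ltac:(by move=> q /= [<-|[<-|]]) (hinv _ _ ltac:(by do 4 right; left)) h4 r19.
have [[r rs] [hr [/= er _]]] := ext_sound 37 6 222 (A37 c) [(73, 6)] b _ _ erefl p37 erefl hb
  ltac:(by move=> q /= [<-|]) (hinv _ _ ltac:(by do 5 right; left)) h5 r37.
move=> hall; have {}hall := proj1 (forallb_forall _ _) hall _ hr; cbv beta iota in hall.
have hk : In (b / A73 c) cp; first rewrite ecp.
  have := N.Div0.div_le_mono b bound (A73 c) ltac:(exact: N.lt_le_incl).
  by move=> h; apply/in_upto; move: (b / _) (bound / _) h => u v; clear; lia.
have {}hall := proj1 (forallb_forall _ _) hall _ hk; move: hall.
have eb : r + b / A73 c * A73 c = b.
  by have h := N.Div0.div_mod b (A73 c); rewrite er -/(A73 c) [RHS]h N.add_comm (N.mul_comm (b / _)).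
cbv beta iota zeta; rewrite eb (proj2 (N.ltb_lt _ _) hb) get_tab; last by apply: N.mod_lt.
set L := fold_right _ _ _.
have hL : In (e mod 36, y mod 36) L.
  apply: (in_fold _ _ _ _ (e mod 36)).
  - by move=> e' acc h; case: (chk73 _ _ _ _) => //; right.
  - move=> acc; rewrite hy.
    by have -> := chk73_sound _ _ _ _ _ _ S (b_unit73 _ _ _ _ _ _ S); left.
  - apply/filter_In; split; first by apply/in_range/N.mod_lt.
    by apply: memb_in; rewrite mod36_12; exact: (c_e _ _ _ _ _ _ _ C).
case: L hL => // t L hL hall.
exact: (proj1 (forallb_forall (fun '(e, y) => next (b mod 73) b (f mod 36) (i mod 36) (j mod 36) e y) (t :: L)) hall _ hL).
Qed.
Lemma run_sound : spok c = true -> 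
  (let nx := next c (if k16 c =? 0 then T0 else mkT c) (urows 73 144) (rows 97 96) (rows 193 192) (rows 433 432) crt16 crt8 cub433 in
   special mds (md27 (b3 c)) c ct73 vt73 nx && general mds (md27 (b3 c)) c ct73 vt73 nx) = true -> False.
Proof.
move=> hok; cbv zeta => /andP [h1 h2].
apply: (next_sound _ _ _ _ _ _ _ S C W (if k16 c =? 0 then T0 else mkT c)).
  case E: (k16 c =? 0); first by apply: (tables_T0 _ _ _ _ _ _ _ S); apply/N.eqb_eq.
  by apply: (tables_mkT _ _ _ _ _ _ _ S C); rewrite E.
case E: (skipsp c (f mod 36) (i mod 36) (j mod 36)).
  exact: special_sound h1.
exact: (general_sound _ _ _ _ _ _ _ S C W _ E h2).
Qed.
End Special.

Lemma cases_ok : forallb (fun c => spok c && ((b3 c =? 1) || (b3 c =? 2))) allcases = true.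
Proof. by vm_compute. Qed.

Theorem sieve c b f i j e y : runall allcases = true -> In c allcases -> sol b f i j e y -> cls c b f i j e y -> False.
Proof.
move=> /forallb_forall hr hc S C; have := hr _ hc; have /forallb_forall/(_ _ hc)/andP [h1 h2] := cases_ok.
cbv zeta => /andP [/andP [W h3] h4].
apply: (run_sound _ _ _ _ _ _ _ S C W h1); cbv zeta.
have hm : (if b3 c =? 1 then md27 1 else md27 2) = md27 (b3 c).
  by move: h2; case: N.eqb_spec => [->|_ /N.eqb_eq ->].
by rewrite hm in h3 h4; apply/andP; split.
Qed.
End SieveSound.

(** * The case a = 2 with b and c at least 5 *)

Lemma sq_neq_2sq x y : x ^ 2 = 2 * y ^ 2 -> x = 0.
Proof.
have : Z.abs x <= Z.of_nat (Z.to_nat (Z.abs x)) by lia.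
move: (Z.to_nat _) => n; elim: n x y => [|n IH] x y xn E; first by clear - xn; lia.
have [x' Ex] : (2 | x).
  by apply: (zprime_dvd_pow 2 x 2 prime_2) => //; rewrite E; exists (y ^ 2); ring.
have Ey2 : y ^ 2 = 2 * x' ^ 2 by move: E; rewrite Ex !Z.pow_2_r; clear; lia.
have [y' Ey] : (2 | y).
  by apply: (zprime_dvd_pow 2 y 2 prime_2) => //; rewrite Ey2; exists (x' ^ 2); ring.
have [x0|x0] : x = 0 \/ x <> 0 by clear; lia.
  exact: x0.
have : x' = 0.
  apply: (IH x' y'); first by clear - xn Ex x0; lia.
  by move: Ey2; rewrite Ey !Z.pow_2_r; clear; lia.
by move=> h; rewrite Ex h.
Qed.

Lemma sq_mod8 y : exists q, 2 * y ^ 2 = 8 * q \/ 2 * y ^ 2 = 8 * q + 2.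
Proof.
case: (Z.Even_or_Odd y) => [[k ->]|/prime_odd_sq_mod8 [q ->]].
  by exists (k ^ 2); left; ring.
by exists (2 * q); right; ring.
Qed.

(** Neither 2 nor -2 is a square modulo a prime congruent to 5 modulo 8. Otherwise Thue's lemma
    would write [p] or [- p] as [x ^ 2 + 2 y ^ 2] or [x ^ 2 - 2 y ^ 2], which squares modulo 8
    forbid. *)
Lemma two_nonres p q X Y s : zprime p -> p = 8 * q + 5 -> s = 1 \/ s = -1 ->
  (p | X ^ 2 + s * 2 * Y ^ 2) -> (p | Y).
Proof.
move=> pp Ep s1 dv; apply: NNPP => nY; have p2 := prime_ge_2 _ pp.
have key x y : ~ (exists r, x ^ 2 + s * 2 * y ^ 2 = s * p * r * r /\ (r = 1 \/ r = -1)).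
  case=> r [E r1].
  have {r1}E : x ^ 2 + s * 2 * y ^ 2 = s * p by move: E; case: r1 => ->; clear; lia.
  have [y' hy] := sq_mod8 y.
  case: (Z.Even_or_Odd x) => [[k Ek]|/prime_odd_sq_mod8 [k Ek]].
    by move: E; rewrite Ek !Z.pow_2_r; move: (k * k) (y * y) s1 Ep; clear; lia.
  by move: E hy; rewrite Ek; move: (y ^ 2) s1 Ep => w s1 Ep; clear - s1 Ep; case: s1 => ->; lia.
case: s1 => Es.
  have [x [y [m [E m12]]]] := thue p 2 X Y pp ltac:(by []) nY ltac:(by move: dv; rewrite Es).
  have [m1|m2] : m = 1 \/ m = 2 by clear - m12; lia.
    by apply: (key x y); exists 1; split; [move: E; rewrite m1 Es; clear; lia | left].
  have [x' Ex] : (2 | x).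
    apply: (zprime_dvd_pow 2 x 2 prime_2) => //; exists (p - y ^ 2).
    by move: E; rewrite m2; clear; lia.
  apply: (key y x'); exists 1; split; last by left.
  by move: E; rewrite m2 Es Ex !Z.pow_2_r; clear; lia.
(* The form [x ^ 2 - 2 y ^ 2] is indefinite: its value lies strictly between [- 2 p] and [p], so it
   is 0 or [- p], and 0 contradicts the irrationality of [sqrt 2]. *)
have [x [y [dvd bx by' pos]]] := thue_small p X Y pp.
have [m Em] : (p | x ^ 2 - 2 * y ^ 2).
  have : (p | Y ^ 2 * (x ^ 2 - 2 * y ^ 2)).
    have -> : Y ^ 2 * (x ^ 2 - 2 * y ^ 2) =
      (Y * x - X * y) * (Y * x + X * y) + y ^ 2 * (X ^ 2 + s * 2 * Y ^ 2) by rewrite Es; ring.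
    by apply: Z.divide_add_r; [apply: dvd_mul_l | apply: dvd_mul_r].
  by case/(prime_mult _ pp) => // /(zprime_dvd_pow _ _ 2 pp) H; case: nY; apply: H.
have x20 : 0 <= x ^ 2 by rewrite Z.pow_2_r; clear; nia.
have y20 : 0 <= y ^ 2 by rewrite Z.pow_2_r; clear; nia.
have [m0|m1] : m = 0 \/ m = -1 by move: (x ^ 2) (y ^ 2) Em bx by' x20 y20 p2; clear; nia.
  have E : x ^ 2 = 2 * y ^ 2 by move: Em; rewrite m0; clear; lia.
  by have x0 := sq_neq_2sq _ _ E; move: pos E; rewrite x0 Z.pow_2_r; clear; lia.
by apply: (key x y); exists 1; split; [move: Em; rewrite m1 Es; clear; lia | left].
Qed.

(** The prime [c] divides [(p s) ^ 2 - (q r) ^ 2]. The divisible factor must vanish, since its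
    square and a positive square add up to [c ^ 2]. *)
Lemma two_squares c p q r s : zprime c -> Z.Odd p -> Z.Odd r -> Z.Even q -> Z.Even s ->
  p ^ 2 + q ^ 2 = c -> r ^ 2 + s ^ 2 = c -> p ^ 2 = r ^ 2.
Proof.
move=> cp op or_ eq es E1 E2; have c2 := prime_ge_2 _ cp.
have key t : t = 1 \/ t = -1 -> (c | p * s - t * (q * r)) -> p ^ 2 = r ^ 2.
  move=> t1 [k Ek].
  have E : (p * r + t * (q * s)) ^ 2 + (p * s - t * (q * r)) ^ 2 = c * c.
    by rewrite -{1}E1 -E2; case: t1 => ->; ring.
  have nz : 0 < (p * r + t * (q * s)) ^ 2.
    have : Z.Odd (p * r + t * (q * s)).
      case: op or_ eq es => [a ->] [b ->] [d ->] [e ->].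
      by exists (2 * a * b + a + b + 2 * t * d * e); ring.
    by case=> h ->; rewrite Z.pow_2_r; clear; nia.
  have k0 : k = 0.
    have [//|k1] : k = 0 \/ 1 <= k * k by clear; nia.
    exfalso; move: E nz; rewrite Ek; have -> : (k * c) ^ 2 = k * k * (c * c) by ring.
    have cc : 0 < c * c by clear - c2; nia.
    by move: ((_ + _) ^ 2) (k * k) (c * c) k1 cc => w u v; clear; nia.
  have E3 : p * s = t * (q * r) by move: Ek; rewrite k0; clear; lia.
  have E4 : p ^ 2 * s ^ 2 = q ^ 2 * r ^ 2.
    transitivity ((p * s) ^ 2); first ring.
    by rewrite E3; case: t1 => ->; ring.
  have -> : p ^ 2 = c - q ^ 2 by move: E1; clear; lia.
  have E5 : s ^ 2 = c - r ^ 2 by move: E2; clear; lia.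
  have E6 : p ^ 2 = c - q ^ 2 by move: E1; clear; lia.
  move: E4; rewrite E5 E6; move: (q ^ 2) (r ^ 2) c2; clear; nia.
have : (c | (p * s - 1 * (q * r)) * (p * s - (-1) * (q * r))).
  exists (p ^ 2 - r ^ 2).
  transitivity (p ^ 2 * s ^ 2 - q ^ 2 * r ^ 2); first ring.
  transitivity (p ^ 2 * (r ^ 2 + s ^ 2) - (p ^ 2 + q ^ 2) * r ^ 2); first ring.
  by rewrite E1 E2; ring.
by case/(prime_mult _ cp); apply: key; [left | right].
Qed.

Lemma val2 m : 0 < m -> exists V, [/\ 0 <= V, (2 ^ V | m) & ~ (2 ^ (V + 1) | m)].
Proof.
move=> m0; apply: NNPP => no; apply: (unbounded_2adic m m0); elim=> [|n IH].
  by exists m; rewrite Z.pow_0_r; ring.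
apply: NNPP => h; apply: no; exists (Z.of_nat n); split; [clear; lia | exact: IH | ].
by move=> h'; apply: h; have -> : Z.of_nat n.+1 = Z.of_nat n + 1 by clear; lia.
Qed.

Definition exact2 V m := exists q, m = 2 ^ V * (2 * q + 1).

Lemma exact2_of V m : 0 <= V -> (2 ^ V | m) -> ~ (2 ^ (V + 1) | m) -> exact2 V m.
Proof.
move=> V0 [k Ek] n; case: (Z.Even_or_Odd k) => -[q Eq].
  by case: n; exists q; rewrite Ek Eq Z.pow_add_r //; ring.
by exists q; rewrite Ek Eq; ring.
Qed.

Lemma exact2_ndvd V m n : 0 <= V -> V < n -> exact2 V m -> ~ (2 ^ n | m).
Proof.
move=> V0 Vn [q ->] [k]; have -> : n = V + (1 + (n - V - 1)) by ring.
rewrite Z.pow_add_r //; last by clear - Vn; lia.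
rewrite Z.pow_add_r //; last by clear - Vn; lia.
have p0 : 0 < 2 ^ V by apply: Z.pow_pos_nonneg.
move: (2 ^ (n - V - 1)) => w; rewrite Z.pow_1_r => E.
have : 2 * q + 1 = k * (2 * w); last by clear; lia.
by apply: (Z.mul_reg_l _ _ (2 ^ V)); [clear - p0; lia | rewrite E; ring].
Qed.

Lemma pow2_dvd m n : 0 <= m <= n -> (2 ^ m | 2 ^ n).
Proof.
move=> mn; exists (2 ^ (n - m)); rewrite -Z.pow_add_r; [congr (2 ^ _); ring | |]; clear - mn; lia.
Qed.

Lemma pow2_dvd_le m n : 0 <= m -> 0 <= n -> (2 ^ m | 2 ^ n) -> m <= n.
Proof.
move=> m0 n0 /Z.divide_pos_le h.
by apply/(Z.pow_le_mono_r_iff 2) => //; apply: h; apply: Z.pow_pos_nonneg.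
Qed.

Lemma exact2_pow V n : 0 <= V -> 0 <= n -> exact2 V (2 ^ n) -> n = V.
Proof.
move=> V0 n0 E; have h : V <= n.
  by apply: pow2_dvd_le => //; case: E => q ->; exists (2 * q + 1); ring.
have [//|l] : n = V \/ V < n by clear - h; lia.
by case: (exact2_ndvd V _ n V0 l E); exists 1; ring.
Qed.

Lemma exact2_add V a b : 0 <= V -> exact2 V a -> exact2 V b -> (2 ^ (V + 1) | a + b).
Proof.
by move=> V0 [p ->] [q ->]; exists (p + q + 1); rewrite Z.pow_add_r //; ring.
Qed.

Lemma exact2_dvd V a b : 0 <= V -> exact2 V a -> (2 ^ (V + 1) | b) -> exact2 V (a + b).
Proof.
by move=> V0 [p ->] [q ->]; exists (p + q); rewrite Z.pow_add_r //; ring.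
Qed.

Lemma exact2_opp V a : exact2 V a -> exact2 V (- a).
Proof. by case=> p ->; exists (- p - 1); ring. Qed.

Lemma dvd_sq_sub1 n r b t : 1 <= n -> r * r = 1 -> 0 <= t -> (2 ^ n | b - r) -> (2 ^ (n + 1) | b ^ (2 * t) - 1).
Proof.
move=> n1 r1 t0 h; rewrite Z.pow_mul_r //.
have E : 1 = 1 ^ t by rewrite Z.pow_1_l.
rewrite {2}E; apply: pow_congr => //.
have -> : b ^ 2 - 1 = (b - r) * (b + r) by transitivity (b ^ 2 - r * r); [rewrite r1 | ring].
case: h => k Ek; have [m Em] : (2 | b + r).
  exists (k * 2 ^ (n - 1) + r).
  have : 2 ^ n = 2 * 2 ^ (n - 1).
    by rewrite -Z.pow_succ_r; [congr (2 ^ _); ring | clear - n1; lia].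
  by move=> E2; move: Ek; rewrite E2; clear; lia.
by rewrite Ek Em; exists (k * m); rewrite Z.pow_add_r ?Z.pow_1_r //; [ring | clear - n1; lia].
Qed.

(** * Consequences of a representation of [c] with two even exponents *)

Section EvenEven.
Variables (b c alpha beta : Z).
Hypotheses (bp : zprime b) (cp : zprime c) (b5 : 5 <= b) (a1 : 1 <= alpha) (be1 : 1 <= beta).
Hypothesis Ec : c = (2 ^ alpha) ^ 2 + (b ^ beta) ^ 2.

Lemma ee_b_odd n : 0 <= n -> Z.Odd (b ^ n).
Proof.
move=> n0; apply/zodd_ndvd => /(zprime_dvd_pow 2 b n prime_2 n0) /(prime_div_prime _ _ prime_2 bp).
by move: b5; clear; lia.
Qed.

Lemma ee_e_odd : Z.Odd (b ^ beta - 2 ^ alpha).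
Proof.
have [k Ek] : Z.Odd (b ^ beta) by apply: ee_b_odd; move: be1; clear; lia.
have -> : alpha = (alpha - 1) + 1 by ring.
rewrite Z.pow_add_r ?Z.pow_1_r //; last by move: a1; clear; lia.
by exists (k - 2 ^ (alpha - 1)); rewrite Ek; ring.
Qed.

Lemma ee_c_odd : Z.Odd c.
Proof.
have [k Ek] := ee_e_odd.
by exists (2 * k ^ 2 + 2 * k + 2 ^ alpha * b ^ beta); rewrite Ec;
   transitivity ((b ^ beta - 2 ^ alpha) ^ 2 + 2 * (2 ^ alpha * b ^ beta)); [ring | rewrite Ek; ring].
Qed.

Lemma ee_c_gt_b : b < c.
Proof.
have h : b <= b ^ beta by apply: pow_ge_base; move: b5 be1; clear; lia.
have := Z.pow_nonneg 2 alpha ltac:(by []).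
by rewrite Ec !Z.pow_2_r; move: b5 h; clear; nia.
Qed.

Lemma ee_c_ndvd_b : ~ (c | b).
Proof. by move/(prime_div_prime _ _ cp bp); move: ee_c_gt_b; clear; lia. Qed.

Lemma ee_c_ndvd_2 : ~ (c | 2).
Proof. by move/(prime_div_prime _ _ cp prime_2); move: ee_c_gt_b b5; clear; lia. Qed.

(** In [c = (b ^ beta - 2 ^ alpha) ^ 2 + 2 * 2 ^ alpha * b ^ beta] the last term would be a square
    too, so the prime [c] would be a sum of two squares in a second way. *)
Lemma ee_not_oe : Z.Odd alpha -> Z.Even beta -> False.
Proof.
case=> a Ea [d Ed].
have o : Z.Odd (b ^ beta) by apply: ee_b_odd; move: be1; clear; lia.
have E1 : 2 ^ alpha = 2 * (2 ^ a) ^ 2 by rewrite Ea pow_dbl_succ //; move: a1; rewrite Ea; clear; lia.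
have E2 : b ^ beta = (b ^ d) ^ 2 by rewrite Ed sq_pow //; move: be1; rewrite Ed; clear; lia.
have := two_squares c (b ^ beta) (2 ^ alpha) (b ^ beta - 2 ^ alpha) (2 * 2 ^ a * b ^ d) cp o ee_e_odd.
have h1 : Z.Even (2 ^ alpha) by exists ((2 ^ a) ^ 2); rewrite E1.
have h2 : Z.Even (2 * 2 ^ a * b ^ d) by exists (2 ^ a * b ^ d); ring.
move=> /(_ h1 h2).
have -> : (b ^ beta) ^ 2 + (2 ^ alpha) ^ 2 = c by rewrite Ec; ring.
have -> : (b ^ beta - 2 ^ alpha) ^ 2 + (2 * 2 ^ a * b ^ d) ^ 2 = c.
  transitivity ((b ^ beta - 2 ^ alpha) ^ 2 + 2 * (2 * (2 ^ a) ^ 2) * (b ^ d) ^ 2); first ring.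
  by rewrite -E1 -E2 Ec; ring.
move=> /(_ erefl erefl) E.
have p0 : 0 < 2 ^ alpha by apply: Z.pow_pos_nonneg => //; move: a1; clear; lia.
have E3 : 2 ^ alpha = 2 * b ^ beta.
  by apply: (Z.mul_reg_l _ _ (2 ^ alpha)); [move: p0; clear; lia | move: E; rewrite !Z.pow_2_r; clear; lia].
have : (b | 2 ^ alpha) by rewrite E3; apply: dvd_mul_r; apply: ppow_dvd.
by apply: prime_ndvd_pow => //; [exact: prime_2 | |]; move: b5 a1; clear; lia.
Qed.

(** The same identity now represents [c] by the principal form [e ^ 2 + delta b f ^ 2], so the form
    [delta S ^ 2 + b T ^ 2] represents no power of [c]. *)
Lemma ee_no_twist delta d g t z : delta = 1 /\ Z.Odd alpha \/ delta = 2 /\ Z.Even alpha -> 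
  beta = 2 * d + 1 -> 0 <= t -> 0 <= z -> delta * (2 ^ g) ^ 2 + b * (b ^ t) ^ 2 = c ^ z -> False.
Proof.
move=> da Ed t0 z0.
have d0 : 0 <= d by move: be1; rewrite Ed; clear; lia.
have [k [k0 Ek]] : exists k, 0 <= k /\ 2 * 2 ^ alpha = delta * (2 ^ k) ^ 2.
  case: da => -[-> [a Ea]].
    by exists (a + 1); rewrite sq_pow ?Z.mul_1_l -?Z.pow_succ_r; first split; [|congr (2 ^ _)| |]; move: a1; rewrite Ea; clear; lia.
  by exists a; rewrite sq_pow -?Ea; move: a1; rewrite Ea; clear; lia.
apply: (no_twist c delta b (b ^ beta - 2 ^ alpha) (2 ^ k * b ^ d)) => //.
- exact: ee_c_odd.
- by case: da => -[-> _].
- by move: b5; clear; lia.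
- exact: ee_c_ndvd_b.
- by have := ee_b_odd 1; rewrite Z.pow_1_r; apply.
- exact: ee_e_odd.
- transitivity ((b ^ beta - 2 ^ alpha) ^ 2 + (delta * (2 ^ k) ^ 2) * (b * (b ^ d) ^ 2)); first ring.
  by rewrite -Ek -pow_dbl_succ // -Ed Ec; ring.
- exact: ee_b_odd.
Qed.
End EvenEven.

Lemma nonres_2pm1 b q n : zprime b -> b = 8 * q + 5 -> 0 <= n -> (b | 2 ^ (2 * n + 1) - 1) \/ (b | 2 ^ (2 * n + 1) + 1) -> False.
Proof.
move=> bp Eb n0 h.
have : (b | 1).
  case: h => h.
    apply: (two_nonres b q (2 ^ (n + 1)) 1 (-1) bp Eb); first by right.
    rewrite sq_pow; last by clear - n0; lia.
    have -> : 2 * (n + 1) = Z.succ (2 * n + 1) by ring.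
    rewrite Z.pow_succ_r; last by clear - n0; lia.
    have -> : 2 * 2 ^ (2 * n + 1) + -1 * 2 * 1 ^ 2 = 2 * (2 ^ (2 * n + 1) - 1) by ring.
    exact: dvd_mul_r.
  apply: (two_nonres b q (2 ^ (n + 1)) 1 1 bp Eb); first by left.
  rewrite sq_pow; last by clear - n0; lia.
  have -> : 2 * (n + 1) = Z.succ (2 * n + 1) by ring.
  rewrite Z.pow_succ_r; last by clear - n0; lia.
  have -> : 2 * 2 ^ (2 * n + 1) + 1 * 2 * 1 ^ 2 = 2 * (2 ^ (2 * n + 1) + 1) by ring.
  exact: dvd_mul_r.
by move/Z.divide_1_r; have := prime_ge_2 _ bp; clear; lia.
Qed.

(** [c] is a sum of two squares by Thue's lemma, so the minimal exponent is 1. If the given solution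
    is a proper power, then [T0] is 1 or -1 and [w_unit] leaves [c = 1 + 4], with
    [4 + 11 ^ 2 = 5 ^ 3]. *)
Lemma ee_form b c s t z : zprime b -> zprime c -> 5 <= b -> 5 <= c -> b <> c ->
  1 <= s -> 1 <= t -> 1 <= z -> Z.Odd z -> (2 ^ s) ^ 2 + (b ^ t) ^ 2 = c ^ z ->
  c = (2 ^ s) ^ 2 + (b ^ t) ^ 2 \/ b = 11.
Proof.
move=> bp cp b5 c5 bc s1 t1 z1 oz E.
have s0 : 0 <= s by clear - s1; lia.
have t0 : 0 <= t by clear - t1; lia.
have c3 : 3 <= c by clear - c5; lia.
have b3 : 3 <= b by clear - b5; lia.
have oc := odd_prime c cp c3.
have n1 : ~ (c | 1) by move/Z.divide_1_r; clear - c5; lia.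
have nb : ~ (c | b ^ t).
  by move/(zprime_dvd_pow c b t cp t0) /(prime_div_prime _ _ cp bp) => E'; apply: bc.
have d : (c | (2 ^ s) ^ 2 + 1 * (b ^ t) ^ 2) by rewrite Z.mul_1_l E; apply: ppow_dvd.
have [x [y [m [Exy m1]]]] := thue c 1 (2 ^ s) (b ^ t) cp ltac:(by []) nb d.
have {m1}Em : m = 1 by clear - m1; lia.
have [S [T [EST oT]]] : exists S T, 1 * S ^ 2 + 1 * T ^ 2 = c /\ Z.Odd T.
  have [ey|oy] := Z.Even_or_Odd y; last by exists x, y; split=> //; move: Exy; rewrite Em; clear; lia.
  exists y, x; split; first by move: Exy; rewrite Em; clear; lia.
  have [[i Ei]|//] := Z.Even_or_Odd x; case: ey => j Ej; exfalso.
  by move: Exy oc; rewrite Em Ei Ej !Z.pow_2_r => Exy [k]; move: Exy; move: (i * i) (j * j); clear; lia.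
have [cS cT] := rep_prime_units c 1 1 S T cp n1 oT ltac:(by []) ltac:(by []) EST.
have base : orep c 1 1 1 S T 1.
  by split=> //; [rewrite EST Z.pow_1_r; ring | split; apply: Z.divide_1_l].
have E1 : 1 * (2 ^ s) ^ 2 + 1 * (b ^ t) ^ 2 = c ^ z by rewrite -E; ring.
have r := orep_sol b c 1 1 1 cp c3 bp b3 bc (or_introl erefl) (or_introl erefl) (or_introl erefl)
  s t z s0 t0 (or_introl erefl) E1.
have [k [j [ES [j0 ET] Ew Eu [Ez kk]]]] := odd_power b c 1 1 1 cp c3 bp b3 bc (or_introl erefl)
  (or_introl erefl) (or_introl erefl) S T 1 base ltac:(by []) (fun _ _ _ _ _ H => H) s t z
  s0 t0 r (or_introl oz) z1.
have [k0|[k1 jz]] : k = 0%N \/ k <> 0%N /\ j = 0 by case: k kk {Ew Eu Ez} => [|k]; [left | case=> // -[_ ->]; right].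
  by left; move: E; rewrite Ez k0 Z.pow_1_r.
right.
have ES2 : S ^ 2 = 2 ^ (2 * s) by rewrite (sq_abs S) ES sq_pow.
have ET2 : T ^ 2 = 1 by rewrite (sq_abs T) ET jz.
rewrite !Z.mul_1_l ES2 ET2 in Ew Eu EST.
rewrite jz Z.pow_0_r Z.mul_1_l in Eu.
have [//|[{}k1 [|s2]]] := w_unit c (2 * s) 1 k cp ltac:(clear - s1; lia) ltac:(by []) ltac:(by exists 0) ltac:(by rewrite Z.pow_1_r -EST; ring) Ew.
- by clear; lia.
have {Eu}Eu : b ^ t = 11 by rewrite Eu k1 s2.
have [b11|b12] : b <= 11 \/ 12 <= b by clear; lia.
  have [q Eq] : (b | b ^ t) by apply: ppow_dvd.
  rewrite Eu in Eq.
  have : b = 5 \/ b = 6 \/ b = 7 \/ b = 8 \/ b = 9 \/ b = 10 \/ b = 11 by clear - b5 b11; lia.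
  by move: Eq; clear => Eq; (do 6 (case=> [Eb|]; first by rewrite Eb in Eq; lia)).
by have := pow_ge_base b t ltac:(clear - b5; lia) t1; rewrite Eu; clear - b12; lia.
Qed.

Section EvenEven2.
Variables (b c alpha beta : Z).
Hypotheses (bp : zprime b) (cp : zprime c) (b5 : 5 <= b) (a1 : 1 <= alpha) (be1 : 1 <= beta).
Hypothesis Ec : c = (2 ^ alpha) ^ 2 + (b ^ beta) ^ 2.

Let Ec' : c - 1 = 2 ^ (2 * alpha) + (b ^ (2 * beta) - 1).
Proof.
by rewrite Ec !sq_pow; [ring | |]; move: a1 be1; clear; lia.
Qed.
Let ob : Z.Odd b.
Proof. by have := ee_b_odd b bp b5 1; rewrite Z.pow_1_r; apply. Qed.
Let oc : Z.Odd c := ee_c_odd b c alpha beta bp b5 a1 be1 Ec.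

(** In [c - 1 = 2 ^ (2 alpha) + (b ^ (2 beta) - 1)] the even power of [b] gains a factor 2 over
    [b - 1] or [b + 1]. Alternating this gain with the second equation raises the 2-adic order step
    by step. *)
Lemma c_sub1_dvd n : 1 <= n -> n + 1 <= 2 * alpha -> (2 ^ n | b - 1) \/ (2 ^ n | b - -1) -> (2 ^ (n + 1) | c - 1).
Proof.
move=> n1 n2 h; rewrite Ec'; apply: Z.divide_add_r; first by apply: pow2_dvd; clear - n1 n2; lia.
by case: h => h; [apply: (dvd_sq_sub1 n 1) | apply: (dvd_sq_sub1 n (-1))] => //; move: be1; clear; lia.
Qed.

Lemma c_sub1_dvd' n : 1 <= n -> n <= 2 * alpha -> (2 ^ n | b - 1) \/ (2 ^ n | b - -1) -> (2 ^ n | c - 1).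
Proof.
move=> n1 n2 h; rewrite Ec'; apply: Z.divide_add_r; first by apply: pow2_dvd; clear - n1 n2; lia.
apply: (Z.divide_trans _ (2 ^ (n + 1))); first by apply: pow2_dvd; clear - n1; lia.
by case: h => h; [apply: (dvd_sq_sub1 n 1) | apply: (dvd_sq_sub1 n (-1))] => //; move: be1; clear; lia.
Qed.

Lemma c_sub1_exact n : 2 * alpha <= n -> (2 ^ n | b - 1) \/ (2 ^ n | b - -1) -> exact2 (2 * alpha) (c - 1).
Proof.
move=> n2 h; rewrite Ec'; apply: exact2_dvd; [by move: a1; clear; lia | by exists 0; ring |].
apply: (Z.divide_trans _ (2 ^ (n + 1))); first by apply: pow2_dvd; move: a1 n2; clear; lia.
by case: h => h; [apply: (dvd_sq_sub1 n 1) | apply: (dvd_sq_sub1 n (-1))] => //; move: a1 be1 n2; clear; lia.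
Qed.

Lemma exact2_odd_pow a n y : Z.Odd a -> 0 <= n -> 1 <= y -> Z.Odd y -> exact2 n (a - 1) -> exact2 n (a ^ y - 1).
Proof.
move=> oa n0 y1 oy ex.
have h m : 0 <= m -> (2 ^ m | a ^ y - 1) <-> (2 ^ m | a - 1) by apply: odd_pow_dvd2.
apply: exact2_of => //; first by apply/h => //; case: ex => q ->; exists (2 * q + 1); ring.
by move/h => H; apply: (exact2_ndvd n (a - 1) (n + 1)) => //; [clear; lia | apply: H; clear - n0; lia].
Qed.

Lemma b_mod8 : 2 <= alpha -> (8 | c - 1).
Proof.
move=> a2; rewrite Ec'; apply: Z.divide_add_r; first by apply: pow2_ge8; clear - a2; lia.
have -> : 8 = 2 ^ (2 + 1) by [].
have [k Ek] := ob; have [[j Ej]|[j Ej]] := Z.Even_or_Odd k.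
  by apply: (dvd_sq_sub1 2 1) => //; [move: be1; clear; lia | exists j; rewrite Ek Ej; ring].
by apply: (dvd_sq_sub1 2 (-1)) => //; [move: be1; clear; lia | exists (j + 1); rewrite Ek Ej; ring].
Qed.

(** * Second solution with even power of 2 and odd exponents of [b] and [c] *)

Section CaseI.
Variables gamma f y : Z.
Hypotheses (g1 : 1 <= gamma) (f1 : 1 <= f) (y1 : 1 <= y) (of_ : Z.Odd f) (oy : Z.Odd y).
Hypothesis E : 2 ^ (2 * gamma) + b ^ y = c ^ f.

(** For odd [alpha], even [beta] gives a second sum of two squares and odd [beta] contradicts the
    class of the second equation. *)
Lemma caseI_even : Z.Even alpha.
Proof.
have [//|oa] := Z.Even_or_Odd alpha; exfalso.
have [eb|[d Ed]] := Z.Even_or_Odd beta; first exact: (ee_not_oe b c alpha beta).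
have [t t0 Ey] := half_odd _ y1 oy.
apply: (ee_no_twist b c alpha beta bp cp b5 a1 be1 Ec 1 d gamma t f) => //; first by left.
  by move: f1; clear; lia.
by rewrite -E -pow_dbl_succ // -Ey sq_pow; [ring | move: g1; clear; lia].
Qed.

Lemma caseI_alpha2 : 2 <= alpha.
Proof. by have [k] := caseI_even; move: a1; clear; lia. Qed.

(** If [gamma = 1], then [b] is 5 modulo 8. Modulo [b] the two equations give [2 ^ (2 alpha f) = 4],
    so [b] divides [2 ^ n - 1] or [2 ^ n + 1] with [n = alpha f - 1] odd, making 2 or -2 a
    square. *)
Lemma caseI_gamma2 : 2 <= gamma.
Proof.
have [g2|//] : gamma = 1 \/ 2 <= gamma by move: g1; clear; lia.
exfalso; have a2 := caseI_alpha2.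
have [q Eq] : exists q, b = 8 * q + 5.
  have [q1 E1] := pow_odd_mod8 b y y1 oy ob.
  have [q2 E2] := pow_odd_congr 8 c 1 f f1 of_ (b_mod8 a2) erefl.
  exists (q2 - q1 - 1); move: E E1 E2; rewrite g2; have -> : 2 ^ (2 * 1) = 4 by [].
  by clear; lia.
have [k Ek] : exists k, alpha * f - 1 = 2 * k + 1.
  by have [j Ej] := caseI_even; exists (j * f - 1); rewrite Ej; ring.
have k0 : 0 <= k by move: f1; clear - Ek a2; nia.
apply: (nonres_2pm1 b q k bp Eq k0).
have : (b | 2 ^ 2 * ((2 ^ (2 * k + 1) - 1) * (2 ^ (2 * k + 1) + 1))).
  have -> : 2 ^ 2 * ((2 ^ (2 * k + 1) - 1) * (2 ^ (2 * k + 1) + 1)) =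
    (2 * 2 ^ (2 * k + 1)) ^ 2 - 2 ^ 2 by ring.
  rewrite -Z.pow_succ_r; last by clear - k0; lia.
  have -> : Z.succ (2 * k + 1) = alpha * f by rewrite -Ek; clear; lia.
  have -> : (2 ^ (alpha * f)) ^ 2 = (2 ^ (2 * alpha)) ^ f.
    rewrite sq_pow; last by move: f1 a1; clear; nia.
    by rewrite -Z.pow_mul_r; [congr (2 ^ _); ring | move: a1; clear; lia | move: f1; clear; lia].
  have -> : (2 ^ (2 * alpha)) ^ f - 2 ^ 2 = b ^ y - (c ^ f - (2 ^ (2 * alpha)) ^ f).
    by rewrite -E g2 Z.mul_1_r; ring.
  apply: Z.divide_sub_r; first exact: ppow_dvd.
  apply: pow_congr; first by move: f1; clear; lia.
  exists (b ^ (2 * beta - 1)).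
  have -> : b ^ (2 * beta - 1) * b = b ^ (2 * beta).
    by rewrite -[in RHS](Z.sub_simpl_r (2 * beta) 1) Z.pow_add_r ?Z.pow_1_r //; move: be1; clear; lia.
  by move: Ec'; clear; lia.
case/(prime_mult _ bp) => [|/(prime_mult _ bp) //].
by move/(prime_ndvd_pow b 2 2 bp prime_2) => []; move: b5; clear; lia.
Qed.

Lemma caseI_dvd n : 0 <= n -> (2 ^ n | c ^ f - 1) <-> (2 ^ n | c - 1).
Proof. by apply: odd_pow_dvd2. Qed.

Lemma caseI_b16 : (2 ^ 4 | b - 1).
Proof.
have a2 := caseI_alpha2; have g2 := caseI_gamma2.
have step n : 2 <= n <= 4 -> (2 ^ n | c - 1) -> (2 ^ n | b - 1).
  move=> n3 h; apply/(odd_pow_dvd2 b 1 y) => //; first by clear - n3; lia.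
  have -> : b ^ y - 1 = (c ^ f - 1) - 2 ^ (2 * gamma) by rewrite -E; ring.
  apply: Z.divide_sub_r; first by apply/caseI_dvd => //; clear - n3; lia.
  by apply: pow2_dvd; clear - n3 g2; lia.
have h3 : (2 ^ 3 | b - 1) by apply: step => //; exact: b_mod8.
by apply: step => //; have -> : 4 = 3 + 1 by []; apply: c_sub1_dvd; [by [] | clear - a2; lia | left].
Qed.

(** [2 ^ (2 gamma)] is the difference of [c ^ f - 1] and [b ^ y - 1], whose orders are those of
    [c - 1] and [b - 1]. Comparing [V] with [2 alpha] decides which order is smaller, and equal
    orders push [gamma] above [alpha]. *)
Lemma caseI_cases : exists V, [/\ 4 <= V, exact2 V (b - 1) &
  [\/ 2 * alpha < V /\ gamma = alpha, 2 * alpha = V /\ alpha < gamma | 2 * gamma = V /\ gamma < alpha]].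
Proof.
have [V [V0 dV nV]] := val2 (b - 1) ltac:(move: b5; clear; lia).
have V4 : 4 <= V.
  have [//|l] : 4 <= V \/ V + 1 <= 4 by clear; lia.
  by case: nV; apply: (Z.divide_trans _ (2 ^ 4)); [apply: pow2_dvd; clear - V0 l; lia | exact: caseI_b16].
have ex : exact2 V (b - 1) by apply: exact2_of.
have exy : exact2 V (b ^ y - 1) by apply: exact2_odd_pow.
have E2 : 2 ^ (2 * gamma) = (c ^ f - 1) + - (b ^ y - 1) by rewrite -E; ring.
have gg : 0 <= 2 * gamma by move: g1; clear; lia.
exists V; split=> //.
have [l|[l|l]] : 2 * alpha < V \/ 2 * alpha = V \/ V < 2 * alpha by clear; lia.
- apply: Or31; split=> //.
  have exc : exact2 (2 * alpha) (c - 1) by apply: (c_sub1_exact V); [clear - l; lia | left].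
  have : exact2 (2 * alpha) (2 ^ (2 * gamma)).
    rewrite E2; apply: exact2_dvd; [by move: a1; clear; lia | by apply: exact2_odd_pow => //; move: a1; clear; lia|].
    apply/Z.divide_opp_r.
    have [q ->] := exy; apply: dvd_mul_l; apply: pow2_dvd; move: a1; clear - l; lia.
  by move/exact2_pow => h; move: a1 g1; clear - h; lia.
- apply: Or32; split=> //.
  have exc : exact2 (2 * alpha) (c - 1) by apply: (c_sub1_exact V); [clear - l; lia | left].
  have : (2 ^ (V + 1) | 2 ^ (2 * gamma)).
    rewrite E2; apply: exact2_add => //; last exact: exact2_opp.
    by apply: exact2_odd_pow => //; rewrite -l.
  by move/pow2_dvd_le => h; move: g1; clear - h l V0; lia.
apply: Or33.
have : exact2 V (2 ^ (2 * gamma)).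
  rewrite E2 Z.add_comm; apply: exact2_dvd => //; first exact: exact2_opp.
  apply/caseI_dvd; first by clear - V0; lia.
  by apply: c_sub1_dvd; [clear - V4; lia | clear - l; lia | left].
by move/exact2_pow => h; move: g1; clear - h l V0; lia.
Qed.
End CaseI.

(** * Second solution with odd exponents of 2 and [b] and an even exponent of [c] *)

Section CaseII.
Variables x y w : Z.
Hypotheses (x1 : 1 <= x) (y1 : 1 <= y) (w1 : 1 <= w) (ox : Z.Odd x) (oy : Z.Odd y).
Hypothesis E : 2 ^ x + b ^ y = c ^ (2 * w).

Lemma caseII_parity : Z.Even alpha /\ Z.Even beta \/ Z.Odd alpha /\ Z.Odd beta.
Proof.
have [s s0 Ex] := half_odd _ x1 ox; have [t t0 Ey] := half_odd _ y1 oy.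
have [ea|oa] := Z.Even_or_Odd alpha; have [eb|ob'] := Z.Even_or_Odd beta; [by left | | | by right]; exfalso.
  case: ob' => d Ed.
  apply: (ee_no_twist b c alpha beta bp cp b5 a1 be1 Ec 2 d s t (2 * w)) => //; first by right.
    by move: w1; clear; lia.
  by rewrite -E -!pow_dbl_succ // -Ey -Ex.
exact: (ee_not_oe b c alpha beta).
Qed.

Lemma caseII_alpha2 : 2 <= alpha.
Proof.
have [Ea|//] : alpha = 1 \/ 2 <= alpha by move: a1; clear; lia.
exfalso; have [[_ [d Ed]]|[[k]]] : Z.Odd alpha /\ Z.Odd beta \/ Z.Even alpha /\ Z.Even beta by have := caseII_parity; tauto.
  have d0 : 0 <= d by move: be1; rewrite Ed; clear; lia.
  have [s s0 Ex] := half_odd _ x1 ox; have [t t0 Ey] := half_odd _ y1 oy.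
  have [q Eq] : exists q, c = 8 * q + 5.
    have [q Eq] := prime_odd_sq_mod8 (b ^ beta) (ee_b_odd b bp b5 beta ltac:(move: be1; clear; lia)).
    by exists q; rewrite Ec Ea Eq; have -> : (2 ^ 1) ^ 2 = 4 by []; ring.
  (* For [alpha = 1] the prime [c] is 5 modulo 8. Modulo [c], [(b ^ beta - 2) ^ 2] is
     [- 4 b ^ beta], while the second equation makes [2 ^ x] equal to [- b ^ y]; together they make
     2 a square. *)
  have : (c | 2 ^ s * (2 * b ^ d)).
    apply: (two_nonres c q ((b ^ beta - 2) * b ^ t) _ (-1) cp Eq); first by right.
    exists ((b ^ t) ^ 2 - c ^ (2 * w - 1) * (2 * b ^ d) ^ 2).
    have -> : ((b ^ t) ^ 2 - c ^ (2 * w - 1) * (2 * b ^ d) ^ 2) * c =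
       c * (b ^ t) ^ 2 - (c * c ^ (2 * w - 1)) * (2 * b ^ d) ^ 2 by ring.
    rewrite -[X in _ - X * _]Z.pow_succ_r; last by move: w1; clear; lia.
    have -> : Z.succ (2 * w - 1) = 2 * w by ring.
    rewrite -E Ex Ey !pow_dbl_succ // Ec Ea Ed pow_dbl_succ // Z.pow_1_r; ring.
  case/(prime_mult _ cp) => [|/(prime_mult _ cp) [|]].
  - by move/(zprime_dvd_pow _ _ _ cp s0); apply: (ee_c_ndvd_2 b c alpha beta).
  - by apply: (ee_c_ndvd_2 b c alpha beta).
  - by move/(zprime_dvd_pow _ _ _ cp d0); apply: (ee_c_ndvd_b b c alpha beta).
by move: Ea; clear; lia.
Qed.

Lemma caseII_step n : 1 <= n -> (2 ^ n | c - 1) -> (2 ^ (n + 1) | c ^ (2 * w) - 1).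
Proof. by move=> n1; apply: (dvd_sq_sub1 n 1) => //; move: w1; clear; lia. Qed.

(** A bootstrap: [2 ^ n | b + 1] gives [2 ^ n | c - 1], the even exponent of [c] gains one factor 2,
    and the second equation returns it to [b + 1]. It stops when [2 ^ (2 alpha)] limits the order of
    [c - 1]. *)
Lemma caseII_x1 : x = 1 -> (2 ^ (2 * alpha + 1) | b - -1).
Proof.
move=> Ex; have a2 := caseII_alpha2.
have Eb : b ^ y - -1 = c ^ (2 * w) - 1 by rewrite -E Ex Z.pow_1_r; ring.
have up n : 1 <= n -> (2 ^ n | c - 1) -> (2 ^ (n + 1) | b - -1).
  by move=> n1 h; apply/(odd_pow_dvd2 b (-1) y) => //; [clear - n1; lia | rewrite Eb; exact: caseII_step].
have b3 : (2 ^ 3 | b - -1).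
  by have := up 3 ltac:(by []) (b_mod8 a2); apply: Z.divide_trans; apply: pow2_dvd.
have climb (k : nat) : 3 + Z.of_nat k <= 2 * alpha + 1 -> (2 ^ (3 + Z.of_nat k) | b - -1).
  elim: k => [|k IH] h //.
  have -> : 3 + Z.of_nat k.+1 = 3 + Z.of_nat k + 1 by clear; lia.
  apply: up; first by clear; lia.
  by apply: c_sub1_dvd'; [clear; lia | move: h; clear; lia | right; apply: IH; move: h; clear; lia].
have := climb (Z.to_nat (2 * alpha - 2)).
have -> : 3 + Z.of_nat (Z.to_nat (2 * alpha - 2)) = 2 * alpha + 1 by clear - a2; lia.
by apply; clear; lia.
Qed.

(** For [x > 1] and [V] the order of [b - 1]: up to [2 alpha], [c ^ (2 w) - 1] has larger order and
    [x = V]. Beyond that, [c ^ 2 - 1] has order exactly [2 alpha + 1], and the parity of [w] decides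
    whether the power keeps this order or exceeds it. *)
Lemma caseII_cases : [\/ x = 1 /\ (2 ^ (2 * alpha + 1) | b - -1),
  exists V, [/\ 3 <= V, exact2 V (b - 1) & x = V],
  Z.Odd w /\ exact2 (2 * alpha + 1) (b - 1) |
  (2 ^ (2 * alpha + 2) | b - 1) /\ (Z.Odd w /\ x = 2 * alpha + 1 \/ Z.Even w)].
Proof.
have [Ex|x3] : x = 1 \/ 3 <= x by case: ox => k Ek; move: x1; rewrite Ek; clear; lia.
  by apply: Or41; split=> //; apply: caseII_x1.
have a2 := caseII_alpha2.
have [V [V0 dV nV]] := val2 (b - 1) ltac:(move: b5; clear; lia).
have ex : exact2 V (b - 1) by apply: exact2_of.
have exy : exact2 V (b ^ y - 1) by apply: exact2_odd_pow.
have E2 : 2 ^ x = (c ^ (2 * w) - 1) + - (b ^ y - 1) by rewrite -E; ring.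
have V3 : 3 <= V.
  have [//|l] : 3 <= V \/ V + 1 <= 3 by clear; lia.
  case: nV; apply: (Z.divide_trans _ (2 ^ 3)); first by apply: pow2_dvd; clear - V0 l; lia.
  apply/(odd_pow_dvd2 b 1 y) => //.
  have -> : b ^ y - 1 = (c ^ (2 * w) - 1) - 2 ^ x by rewrite E2; ring.
  apply: Z.divide_sub_r; last exact: pow2_ge8.
  apply: (Z.divide_trans _ (2 ^ (3 + 1))); first exact: pow2_dvd.
  by apply: caseII_step => //; exact: b_mod8.
have xV : (2 ^ (V + 1) | c ^ (2 * w) - 1) -> x = V.
  move=> h; apply: exact2_pow => //; first by move: x1; clear; lia.
  by rewrite E2 Z.add_comm; apply: exact2_dvd => //; exact: exact2_opp.
have [l|l] : V <= 2 * alpha \/ 2 * alpha + 1 <= V by clear; lia.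
  apply: Or42; exists V; split=> //; apply: xV; apply: caseII_step; first by clear - V3; lia.
  by apply: c_sub1_dvd'; [clear - V3; lia | exact: l | left].
have [p Ep] : exact2 (2 * alpha) (c - 1) by apply: (c_sub1_exact V); [clear - l; lia | left].
have exc2 : exact2 (2 * alpha + 1) (c ^ 2 - 1).
  have E1 : 2 ^ (2 * alpha) = 2 ^ 2 * 2 ^ (2 * alpha - 2).
    by rewrite -Z.pow_add_r //; [congr (2 ^ _); ring | clear - a2; lia].
  exists ((2 * p + 1) ^ 2 * 2 ^ (2 * alpha - 2) + p).
  have -> : c ^ 2 - 1 = (c - 1) * (c - 1 + 2) by ring.
  by rewrite Ep Z.pow_add_r //; [rewrite E1 Z.pow_1_r; ring | clear - a2; lia].
have oc2 : Z.Odd (c ^ 2) by case: oc => k ->; exists (2 * k ^ 2 + 2 * k); ring.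
have Ecw : c ^ (2 * w) = (c ^ 2) ^ w by rewrite Z.pow_mul_r //; move: w1; clear; lia.
have [ew|ow] := Z.Even_or_Odd w.
  have [l1|l1] : V = 2 * alpha + 1 \/ 2 * alpha + 2 <= V by clear - l; lia.
    apply: Or42; exists V; split=> //; apply: xV; rewrite l1 Ecw.
    case: ew => k Ek; rewrite Ek; apply: (dvd_sq_sub1 _ 1) => //; first by clear - a2; lia.
      by move: w1; rewrite Ek; clear; lia.
    by case: exc2 => q ->; exists (2 * q + 1); ring.
  by apply: Or44; split; [apply: (Z.divide_trans _ (2 ^ V)) => //; apply: pow2_dvd; clear - l1 a2; lia | right].
have [l1|l1] : V = 2 * alpha + 1 \/ 2 * alpha + 2 <= V by clear - l; lia.
  by apply: Or43; rewrite -l1.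
have dv : (2 ^ (2 * alpha + 2) | b - 1).
  by apply: (Z.divide_trans _ (2 ^ V)) => //; apply: pow2_dvd; clear - l1 a2; lia.
apply: Or44; split=> //; left; split=> //.
apply: exact2_pow; [by clear - a2; lia | by move: x1; clear; lia |].
rewrite E2 Ecw; apply: exact2_dvd; first by clear - a2; lia.
  by apply: exact2_odd_pow => //; clear - a2; lia.
have -> : 2 * alpha + 1 + 1 = 2 * alpha + 2 by ring.
by apply/Z.divide_opp_r/odd_pow_dvd2 => //; clear - a2; lia.
Qed.
End CaseII.
End EvenEven2.

(** * The families of the sieve *)

Module Families.
Import List ListNotations Sieve Residues Levels SieveSound.
Local Open Scope list_scope.
Local Open Scope N_scope.
Local Arguments N.pow : simpl never.
Local Arguments N.mul : simpl never.
Local Arguments N.add : simpl never.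
Local Arguments N.sub : simpl never.
Local Arguments N.modulo : simpl never.
Local Arguments N.div : simpl never.
Local Notation z := Z.of_N.

Lemma prime_divN a p : zprime (z a) -> 1 < p -> a mod p = 0 -> p = a.
Proof.
move=> ap p1 /N.Div0.div_exact E.
have : ((z p) | (z a))%Z by exists (z (a / p)); rewrite [in LHS]E N2Z.inj_mul Z.mul_comm.
by case/(prime_divisors _ ap) => [|[|[|]]]; have := prime_ge_2 _ ap; move: p1; clear; lia.
Qed.

Lemma sol_of_Z b f i j e y c : zprime (z b) -> zprime c -> 41 <= b < bound -> b <> 73 ->
  (c = 2 ^ (z i) + (z b) ^ (z e))%Z -> (2 ^ (z j) + (z b) ^ (z y) = c ^ (z f))%Z ->
  N.odd y = true -> N.even e = true -> e <> 0 -> N.even i = true -> sol b f i j e y.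
Proof.
move=> bp cp hb b73 Ec E oy ee e0 ei.
have EcN : c = (z (2 ^ i + b ^ e)) by rewrite Ec N2Z.inj_add !N2Z.inj_pow.
split=> //.
- by apply: N2Z.inj; rewrite N2Z.inj_add !N2Z.inj_pow -EcN -E.
- by move=> p; apply: prime_divN.
- have h : b ^ 2 <= b ^ e.
    apply: N.pow_le_mono_r; first by move: hb; clear; lia.
    by case/N.even_spec: ee => k Ek; move: e0; rewrite Ek; clear; lia.
  have h2 : 41 ^ 2 <= b ^ 2 by apply: N.pow_le_mono_l; move: hb; clear; lia.
  have -> : 1153 = 0 + 1153 by [].
  apply: N.add_le_lt_mono; first by apply: N.le_0_l.
  by apply: (N.lt_le_trans _ (41 ^ 2)) => //; apply: (N.le_trans _ (b ^ 2)).
- by move=> p; apply: prime_divN; rewrite -EcN.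
Qed.

Lemma mod12 f : exists q r, [/\ f = 12 * q + r, r < 12 & f mod 12 = r].
Proof.
exists (f / 12), (f mod 12); split=> //; first by have := N.div_mod' f 12; clear; lia.
by apply: N.mod_lt.
Qed.

Lemma odd12 f : N.odd f = true -> In (f mod 12) oddf.
Proof.
case/N.odd_spec => k Ek; have [q [r [E l ->]]] := mod12 f.
by rewrite /oddf /=; move: Ek E l; clear; lia.
Qed.

Lemma even12 f : N.even f = true -> In (f mod 12) evn.
Proof.
case/N.even_spec => k Ek; have [q [r [E l ->]]] := mod12 f.
by rewrite /evn /=; move: Ek E l; clear; lia.
Qed.

Lemma even_dbl k : N.even (2 * k) = true.
Proof. by apply/N.even_spec; exists k. Qed.

Lemma dbl_even12 k : N.even k = true -> In ((2 * k) mod 12) [0; 4; 8].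
Proof.
case/N.even_spec => m Em; have [q [r [E l ->]]] := mod12 (2 * k).
by rewrite /=; move: Em E l; clear; lia.
Qed.

Lemma dbl_odd12 k : N.odd k = true -> In ((2 * k) mod 12) [2; 6; 10].
Proof.
case/N.odd_spec => m Em; have [q [r [E l ->]]] := mod12 (2 * k).
by rewrite /=; move: Em E l; clear; lia.
Qed.

Lemma ee12 k al : N.even k = N.even al -> In ((2 * k) mod 12) (ee al).
Proof.
rewrite /ee; case E: (N.even al) => h; first exact: dbl_even12.
by apply: dbl_odd12; rewrite -N.negb_even h.
Qed.

Lemma mod_of_Z b M r : r < M -> ((z M) | (z b) - (z r))%Z -> b mod M = r.
Proof.
move=> rM [q Eq]; symmetry; apply: (N.mod_unique _ _ (Z.to_N q)) => //.
have q0 : (0 <= q)%Z by move: Eq rM; clear; nia.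
by apply: N2Z.inj; rewrite N2Z.inj_add N2Z.inj_mul Z2N.id //; move: Eq; clear; lia.
Qed.

Lemma pow2S n : 2 ^ (n + 1) = 2 * 2 ^ n.
Proof. by rewrite N.add_1_r N.pow_succ_r'. Qed.

Lemma mod_exact b n r m : r < 2 ^ n -> m = n + 1 -> exact2 (z n) ((z b) - (z r)) -> b mod 2 ^ m = r + 2 ^ n.
Proof.
move=> rn -> [q Eq]; apply: mod_of_Z; rewrite pow2S; first by clear - rn; lia.
exists q; rewrite N2Z.inj_mul N2Z.inj_add N2Z.inj_pow.
by move: Eq; change ((z 2))%Z with 2%Z; clear; lia.
Qed.

Lemma mod_dvd b n r m : r < 2 ^ n -> m = n + 1 -> (2 ^ (z n) | (z b) - (z r))%Z -> b mod 2 ^ m = r \/ b mod 2 ^ m = r + 2 ^ n.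
Proof.
move=> rn Em [k Ek]; case: (Z.Even_or_Odd k) => -[q Eq].
  left; rewrite Em; apply: mod_of_Z; rewrite pow2S; first by clear - rn; lia.
  exists q; rewrite N2Z.inj_mul N2Z.inj_pow.
  by move: Ek; rewrite Eq; change ((z 2))%Z with 2%Z; clear; lia.
right; apply: mod_exact => //; exists q.
by rewrite Ek Eq; ring.
Qed.

Lemma dvd_pow_lt n m : (0 < m < 2 ^ 30)%Z -> (2 ^ (z n) | m)%Z -> n < 30.
Proof.
move=> [m0 m1] dv; have h := Z.divide_pos_le _ _ m0 dv.
have [//|l] : n < 30 \/ 30 <= n by clear; lia.
have : (2 ^ 30 <= 2 ^ (z n))%Z by apply: Z.pow_le_mono_r => //; clear - l; lia.
by clear - h m1; lia.
Qed.

Lemma pow_mod0 j m : m <= j -> 2 ^ j mod 2 ^ m = 0 mod 2 ^ m.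
Proof.
move=> h; have -> : j = m + (j - m) by clear - h; lia.
by rewrite N.pow_add_r N.mul_comm N.Div0.mod_mul N.Div0.mod_0_l.
Qed.

Lemma relc1 ti tj m i j : 2 ^ i mod m = ti mod m -> 2 ^ j mod m = tj mod m -> relc [(ti, tj)] m i j.
Proof. by move=> h1 h2; right; exists (ti, tj); split=> //; left. Qed.

Lemma pow2_dvdN m n : m <= n -> (2 ^ m | 2 ^ n).
Proof.
by move=> h; exists (2 ^ (n - m)); rewrite -N.pow_add_r; congr (2 ^ _); clear - h; lia.
Qed.

Lemma one_lt_pow2 n : 1 < 2 ^ (n + 1).
Proof. by apply: N.pow_gt_1 => //; clear; lia. Qed.

Lemma in_alll al : 2 <= al <= 14 -> In al alll.
Proof. by rewrite /alll /=; clear; lia. Qed.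
Lemma in_evl al : 2 <= al <= 14 -> N.even al = true -> In al evl.
Proof. by move=> h /N.even_spec [k Ek]; rewrite /evl /=; move: h Ek; clear; lia. Qed.

Section Families.
Variables b f al be j y : N.
Hypothesis S : sol b f (2 * al) j (2 * be) y.
Hypothesis sieveS : forall c, In c allcases -> cls c b f (2 * al) j (2 * be) y -> False.
Hypothesis al2 : 2 <= al.

Let oy : N.odd y = true := s_y _ _ _ _ _ _ S.
Let b0 : (0 < (z b) - 1 < 2 ^ 30)%Z.
Proof. by have := s_b _ _ _ _ _ _ S; rewrite /bound; clear; lia. Qed.
Let b0' : (0 < (z b) - -1 < 2 ^ 30)%Z.
Proof. by have := s_b _ _ _ _ _ _ S; rewrite /bound; clear; lia. Qed.
Let pow2gt n : 2 <= n -> 1 < 2 ^ n.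
Proof. by move=> h; apply: N.pow_gt_1 => //; clear - h; lia. Qed.

Lemma famA ga : N.odd f = true -> b mod 3 = 1 -> N.even al = true -> j = 2 * ga -> al < ga ->
  exact2 (z (2 * al)) ((z b) - 1) -> False.
Proof.
move=> of_ b3 ea Ej ag ex.
have V30 : 2 * al < 30 by apply: (dvd_pow_lt _ _ b0); case: ex => q ->; exists (2 * q + 1)%Z; rewrite Z.mul_comm.
have dv : (2 ^ (z (2 * al + 1)) | (z b) - (z (1 + 2 ^ (2 * al))))%Z.
  case: ex => q Eq; exists q; rewrite (N2Z.inj_add (2 * al)) Z.pow_add_r ?N2Z.inj_add ?N2Z.inj_pow; try (clear; lia).
  by move: Eq; change ((z 2))%Z with 2%Z; change ((z 1))%Z with 1%Z; rewrite Z.pow_1_r; clear; lia.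
have h1 : 1 + 2 ^ (2 * al) < 2 ^ (2 * al + 1) by rewrite pow2S; have := pow2gt (2 * al) ltac:(clear - al2; lia); move: (2 ^ _); clear; lia.
have res := mod_dvd b (2 * al + 1) _ (2 * al + 2) h1 ltac:(clear; lia) dv.
have res' : In (b mod 2 ^ (2 * al + 2)) [1 + 2 ^ (2 * al); 1 + 2 ^ (2 * al) + 2 ^ (2 * al + 1)].
  by case: res => ->; [left | right; left].
(* The refined table of A has modulus [2 ^ (2 al + 4)] and needs [gamma >= alpha + 2]; the table
   exists only for small even [al], that is, 2 and 4. *)
have [sp|sp] : (al = 2 \/ al = 4) /\ ga = al + 1 \/ (al = 2 \/ al = 4 -> al + 2 <= ga) by move: ag; clear; lia.
  apply: (sieveS (caseA' al)).
    by case: sp => -[->|->] _; [left | right; left].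
  apply: Cls => //=; [exact: odd12 | exact/even12/even_dbl | by left | | | | by left].
    by left; rewrite Ej; move: sp; clear; lia.
  by apply: pow2gt; clear; lia.
  by apply: relc1 => //; rewrite Ej; apply: pow_mod0; clear - ag; lia.
apply: (sieveS (caseA al)).
  do 2 right; apply/in_or_app; left; apply: in_map; apply: in_evl => //; clear - al2 V30; lia.
apply: Cls => //=; [exact: odd12 | exact/even12/even_dbl | by left | by rewrite Ej; exact/even12/even_dbl | | | ].
- by apply: pow2gt; clear; lia.
- by apply: relc1 => //; rewrite Ej; apply: pow_mod0; clear - ag; lia.
rewrite /kk; case: N.ltb_spec => l; last by left.
right; split; first by apply: pow2_dvdN; clear; lia.
apply: relc1 => //; rewrite Ej; apply: pow_mod0.
by case/N.even_spec: ea => k Ek; move: sp al2 l Ek; clear; lia.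
Qed.

Lemma famB ga : N.odd f = true -> b mod 3 = 1 -> N.even al = true -> j = 2 * ga -> 2 <= ga < al ->
  exact2 (z (2 * ga)) ((z b) - 1) -> False.
Proof.
move=> of_ b3 ea Ej ag ex.
have V30 : 2 * ga < 30 by apply: (dvd_pow_lt _ _ b0); case: ex => q ->; exists (2 * q + 1)%Z; rewrite Z.mul_comm.
have dv : (2 ^ (z (2 * ga + 1)) | (z b) - (z (1 + 2 ^ (2 * ga))))%Z.
  case: ex => q Eq; exists q; rewrite (N2Z.inj_add (2 * ga)) Z.pow_add_r ?N2Z.inj_add ?N2Z.inj_pow; try (clear; lia).
  by move: Eq; change ((z 2))%Z with 2%Z; change ((z 1))%Z with 1%Z; rewrite Z.pow_1_r; clear; lia.
have h1 : 1 + 2 ^ (2 * ga) < 2 ^ (2 * ga + 1) by rewrite pow2S; have := pow2gt (2 * ga) ltac:(clear - ag; lia); move: (2 ^ _); clear; lia.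
have res := mod_dvd b (2 * ga + 1) _ (2 * ga + 2) h1 ltac:(clear; lia) dv.
apply: (sieveS (caseB ga)).
  do 2 right; apply/in_or_app; right; apply/in_or_app; left; apply: in_map; apply: in_alll; clear - ag V30; lia.
apply: Cls => //=; [exact: odd12 | exact/even12/even_dbl | exact: dbl_even12 | by left | | | | ].
- by case: res => ->; [left | right; left].
- by apply: pow2gt; clear; lia.
- by apply: relc1; rewrite ?Ej //; apply: pow_mod0; clear - ag; lia.
case Eg: (N.even ga); last by left.
rewrite /kk; case: N.ltb_spec => l; last by left.
right; split; first by apply: pow2_dvdN; clear; lia.
apply: relc1; rewrite ?Ej //; apply: pow_mod0.
by case/N.even_spec: ea => k Ek; case/N.even_spec: Eg => m Em; move: ag Ek Em; clear; lia.
Qed.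

Lemma famC : N.odd f = true -> b mod 3 = 1 -> N.even al = true -> j = 2 * al ->
  (2 ^ (z (2 * al + 1)) | (z b) - 1)%Z -> False.
Proof.
move=> of_ b3 ea Ej dv.
have V30 := dvd_pow_lt _ _ b0 dv.
have res := mod_dvd b (2 * al + 1) 1 (2 * al + 2) ltac:(apply: one_lt_pow2) ltac:(clear; lia) dv.
apply: (sieveS (caseC al)).
  do 2 right; do 2 (apply/in_or_app; right); apply/in_or_app; left; apply: in_map; apply: in_evl => //; clear - al2 V30; lia.
apply: Cls => //=; [exact: odd12 | exact/even12/even_dbl | by left | by left | | | | ].
- by case: res => ->; [left | right; left].
- by apply: pow2gt; clear; lia.
- by apply: relc1; rewrite ?Ej.
rewrite /kk; case: N.ltb_spec => l; last by left.
right; split; first by apply: pow2_dvdN; clear; lia.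
by apply: relc1; rewrite ?Ej.
Qed.

Lemma famX w : f = 2 * w -> b mod 3 = 2 -> N.even be = N.even al -> j = 1 ->
  (2 ^ (z (2 * al + 1)) | (z b) - -1)%Z -> False.
Proof.
move=> Ef b3 ea Ej dv.
have V30 := dvd_pow_lt _ _ b0' dv.
have dv' : (2 ^ (z (2 * al + 1)) | (z b) - (z (2 ^ (2 * al + 1) - 1)))%Z.
  case: dv => q Eq; exists (q - 1)%Z; rewrite N2Z.inj_sub ?N2Z.inj_pow; last first.
    by have := one_lt_pow2 (2 * al); clear; lia.
  by move: Eq; change ((z 2))%Z with 2%Z; change ((z 1))%Z with 1%Z; clear; lia.
have h0 : 2 ^ (2 * al + 1) - 1 < 2 ^ (2 * al + 1) by have := one_lt_pow2 (2 * al); clear; lia.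
have res := mod_dvd b (2 * al + 1) _ (2 * al + 2) h0 ltac:(clear; lia) dv'.
have E2 : 2 ^ (2 * al + 2) = 2 * 2 ^ (2 * al + 1) by rewrite -pow2S; congr (2 ^ _); clear; lia.
have E3 : 2 ^ (2 * al + 2) / 2 = 2 ^ (2 * al + 1) by rewrite E2 N.mul_comm N.div_mul.
apply: (sieveS (caseX al)).
  do 2 right; do 3 (apply/in_or_app; right); apply/in_or_app; left; apply: in_map; apply: in_alll; clear - al2 V30; lia.
apply: Cls => //=; [rewrite Ef; exact/even12/even_dbl | exact: ee12 | by left | by rewrite Ej; left | | | | ].
- rewrite E3; case: res => ->; first by right; left.
  by left; rewrite E2; move: (one_lt_pow2 (2 * al)); clear; lia.
- by apply: pow2gt; clear; lia.
- by apply: relc1; rewrite ?Ej.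
case: N.eqb_spec => l; last by left.
right; split; first by rewrite l; apply: pow2_dvdN; clear; lia.
by apply: relc1; rewrite ?Ej.
Qed.

Lemma famP w : f = 2 * w -> N.odd w = true -> b mod 3 = 2 -> N.even be = N.even al -> N.odd j = true ->
  exact2 (z (2 * al + 1)) ((z b) - 1) -> False.
Proof.
move=> Ef ow b3 ea oj ex.
have dv : (2 ^ (z (2 * al + 1)) | (z b) - 1)%Z by case: ex => q ->; exists (2 * q + 1)%Z; rewrite Z.mul_comm.
have V30 := dvd_pow_lt _ _ b0 dv.
have res := mod_exact b (2 * al + 1) 1 (2 * al + 2) ltac:(apply: one_lt_pow2) ltac:(clear; lia) ex.
apply: (sieveS (caseP al)).
  do 2 right; do 4 (apply/in_or_app; right); apply/in_or_app; left; apply: in_map; apply: in_alll; clear - al2 V30; lia.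
apply: Cls => //=; [rewrite Ef; exact: dbl_odd12 | exact: ee12 | by left | exact: odd12 | | | by left | by left ].
- by rewrite res; left.
- by apply: pow2gt; clear; lia.
Qed.

Lemma famQ w : f = 2 * w -> N.even w = true -> b mod 3 = 2 -> N.even be = N.even al -> N.odd j = true ->
  (2 ^ (z (2 * al + 2)) | (z b) - 1)%Z -> False.
Proof.
move=> Ef ow b3 ea oj dv.
have V30 := dvd_pow_lt _ _ b0 dv.
apply: (sieveS (caseQ al)).
  do 2 right; do 5 (apply/in_or_app; right); apply/in_or_app; left; apply: in_map; apply: in_alll; clear - al2 V30; lia.
have M1 : 1 < 2 ^ (2 * al + 2) by apply: pow2gt; clear; lia.
apply: Cls => //=; [rewrite Ef; exact: dbl_even12 | exact: ee12 | by left | exact: odd12 | | by left | by left ].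
by left; symmetry; apply: mod_of_Z => //; rewrite N2Z.inj_pow.
Qed.

Lemma famR w : f = 2 * w -> N.odd w = true -> b mod 3 = 2 -> N.even be = N.even al -> j = 2 * al + 1 ->
  (2 ^ (z (2 * al + 2)) | (z b) - 1)%Z -> False.
Proof.
move=> Ef ow b3 ea Ej dv.
have V30 := dvd_pow_lt _ _ b0 dv.
apply: (sieveS (caseR al)).
  do 2 right; do 6 (apply/in_or_app; right); apply/in_or_app; left; apply: in_map; apply: in_alll; clear - al2 V30; lia.
have M1 : 1 < 2 ^ (2 * al + 2) by apply: pow2gt; clear; lia.
apply: Cls => //=; [rewrite Ef; exact: dbl_odd12 | exact: ee12 | by left | by rewrite Ej; left | | by left | by left ].
by left; symmetry; apply: mod_of_Z => //; rewrite N2Z.inj_pow.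
Qed.

Lemma famS w V : f = 2 * w -> b mod 3 = 2 -> N.even be = N.even al -> j = V -> N.odd V = true -> 3 <= V ->
  exact2 (z V) ((z b) - 1) -> False.
Proof.
move=> Ef b3 ea Ej oV V3 ex.
have dv : (2 ^ (z V) | (z b) - 1)%Z by case: ex => q ->; exists (2 * q + 1)%Z; rewrite Z.mul_comm.
have V30 := dvd_pow_lt _ _ b0 dv.
(* [alpha] is unbounded here, so the family is indexed by its parity. *)
have [par [Ep par01]] : exists par, N.even par = N.even al /\ (par = 0 \/ par = 1).
  by case Ea: (N.even al); [exists 0 | exists 1]; split=> //; [left | right].
have eep k : N.even k = N.even al -> In ((2 * k) mod 12) (ee par) by move=> h; apply: ee12; rewrite Ep.
have [E3|V5] : V = 3 \/ 5 <= V by case/N.odd_spec: oV => k Ek; move: V3 Ek; clear; lia.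
  apply: (sieveS (caseS3 par)).
    do 2 right; do 7 (apply/in_or_app; right).
    by case: par01 => ->; [left | right; left].
  apply: Cls => //=; [rewrite Ef; exact/even12/even_dbl | exact: eep | exact: eep | by rewrite Ej E3; left | | | ].
  - have dv' : (2 ^ (z 4) | (z b) - (z 9))%Z.
      by case: ex => q Eq; exists q; move: Eq; rewrite E3; change (2 ^ (z 3))%Z with 8%Z; change (2 ^ (z 4))%Z with 16%Z; clear; lia.
    by case: (mod_dvd b 4 9 5 ltac:(by []) ltac:(by []) dv') => ->; [left | right; left].
  - right; have [A2|A3] : al = 2 \/ 3 <= al by clear - al2; lia.
      by exists (16, 8); split; [right; left | rewrite A2 | rewrite Ej E3].
    exists (0, 8); split; [by left | | by rewrite Ej E3].
    by apply: (pow_mod0 _ 5); clear - A3; lia.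
  right; split; first by apply: (pow2_dvdN 5 7).
  (* Modulo [2 ^ 7] the number [2 ^ (2 alpha)] is 16 for [alpha = 2], 64 for [alpha = 3] and 0 from
     then on. *)
  right; have [[Ea pe]|A4] : (al = 2 \/ al = 3) /\ par = al - 2 \/ 4 <= al.
    have [A4|A23] : 4 <= al \/ (al = 2 \/ al = 3) by clear - al2; lia.
      by right.
    left; split=> //; move: Ep; case: A23 => -> /=; by case: par01 => ->.
    exists (if N.even par then 16 else 64, 8); split; [by right; left | | by rewrite Ej E3].
    by rewrite pe; case: Ea => ->.
  exists (0, 8); split; [by left | | by rewrite Ej E3].
  by apply: (pow_mod0 _ 7); clear - A4; lia.
apply: (sieveS (caseS V par)).
  do 2 right; do 7 (apply/in_or_app; right); do 2 right.
  apply/in_flat_map; exists V; split; last by case: par01 => ->; [left | right; left].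
  by case/N.odd_spec: oV => k Ek; rewrite /=; move: V5 V30 Ek; clear; lia.
have res := mod_exact b V 1 (V + 1) ltac:(apply: pow2gt; clear - V3; lia) erefl ex.
apply: Cls => //=; [rewrite Ef; exact/even12/even_dbl | exact: eep | exact: eep | by left | by rewrite res; left | | by left | by left].
exact: one_lt_pow2.
Qed.
End Families.
End Families.

(** * Exclusion of both cases below the bound *)

Module SieveTheorem.
Import List ListNotations Sieve Residues Levels SieveSound Families.
Local Open Scope Z_scope.
(** The whole numerical search, evaluated once by the virtual machine when the proof is closed. *)
Lemma runall_ok : runall allcases = true.
Proof. by vm_cast_no_check (erefl true). Qed.

Lemma oddN n : Z.Odd (Z.of_N n) -> N.odd n = true.
Proof. by case=> k Ek; apply/N.odd_spec; exists (Z.to_N k); move: Ek; clear; lia. Qed.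
Lemma evenN n : Z.Even (Z.of_N n) -> N.even n = true.
Proof. by case=> k Ek; apply/N.even_spec; exists (Z.to_N k); move: Ek; clear; lia. Qed.
Lemma exN x : 0 <= x -> exists n, x = Z.of_N n.
Proof. by exists (Z.to_N x); rewrite Z2N.id. Qed.
Lemma z_dbl n : Z.of_N (2 * n) = 2 * Z.of_N n.
Proof. by rewrite N2Z.inj_mul. Qed.

Lemma sieveZ b f al be j y c : zprime (Z.of_N b) -> zprime c -> 41 <= Z.of_N b < 10 ^ 9 -> Z.of_N b <> 73 ->
  c = (2 ^ Z.of_N al) ^ 2 + (Z.of_N b ^ Z.of_N be) ^ 2 -> 2 ^ Z.of_N j + Z.of_N b ^ Z.of_N y = c ^ Z.of_N f ->
  Z.Odd (Z.of_N y) -> 1 <= Z.of_N be ->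
  sol b f (2 * al)%num j (2 * be)%num y /\
  (forall cc, In cc allcases -> cls cc b f (2 * al)%num j (2 * be)%num y -> False).
Proof.
move=> bp cp hb b73 Ec E oy be1.
have S : sol b f (2 * al)%num j (2 * be)%num y.
  apply: (sol_of_Z _ _ _ _ _ _ c bp cp) => //.
  - by split; [|change bound with 1000000000%num]; move: hb; change (10 ^ 9) with 1000000000; clear; lia.
  - by move: b73; clear; lia.
  - by rewrite !z_dbl -!sq_pow //; clear; lia.
  - exact: oddN.
  - exact: even_dbl.
  - by move: be1; clear; lia.
  - exact: even_dbl.
split=> // cc hc; exact: (sieve cc _ _ _ _ _ _ runall_ok hc S).
Qed.

Lemma caseI_absurd b c al be ga f y : zprime b -> zprime c -> 5 <= b -> b < 10 ^ 9 -> (3 | b - 1) ->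
  1 <= al -> 1 <= be -> 1 <= ga -> 1 <= f -> 1 <= y -> Z.Odd f -> Z.Odd y ->
  c = (2 ^ al) ^ 2 + (b ^ be) ^ 2 -> 2 ^ (2 * ga) + b ^ y = c ^ f -> False.
Proof.
move=> bp cp b5 b9 b3 al1 be1 ga1 f1 y1 of_ oy Ec E.
have a2 := caseI_alpha2 b c al be bp cp b5 al1 be1 Ec ga f y ga1 f1 y1 oy E.
have ea := caseI_even b c al be bp cp b5 al1 be1 Ec ga f y ga1 f1 y1 oy E.
have g2 := caseI_gamma2 b c al be bp cp b5 al1 be1 Ec ga f y ga1 f1 y1 of_ oy E.
have [V [V4 ex cases]] := caseI_cases b c al be bp cp b5 al1 be1 Ec ga f y ga1 f1 y1 of_ oy E.
have dvV n : 0 <= n <= V -> (2 ^ n | b - 1).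
  by move=> h; apply: (Z.divide_trans _ (2 ^ V)); [exact: pow2_dvd | case: ex => q ->; exists (2 * q + 1); ring].
have [k16 E16] := dvV 4 ltac:(clear - V4; lia).
have [k3 E3] := b3.
(* [b] is 1 modulo 16 and modulo 3, hence modulo 48, so it is at least 49; 73 is not of this
   form. *)
have hb : 41 <= b < 10 ^ 9 by split=> //; move: E16 b5; change (2 ^ 4) with 16; clear - E3; lia.
have b73 : b <> 73 by move: E16; change (2 ^ 4) with 16; clear; lia.
have nn n : 1 <= n -> 0 <= n by clear; lia.
have [B EB] := exN b ltac:(clear - b5; lia).
have [A EA] := exN al (nn _ al1); have [BE EBE] := exN be (nn _ be1); have [G EG] := exN ga (nn _ ga1).
have [F EF] := exN f (nn _ f1); have [Y EY] := exN y (nn _ y1).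
subst b al be ga f y.
rewrite -z_dbl in E.
have [S sv] := sieveZ _ _ _ _ _ _ c bp cp hb b73 Ec E oy be1.
have bm : (B mod 3 = 1)%num by apply: mod_of_Z.
have A2 : (2 <= A)%num by clear - a2; lia.
have {}of_ := oddN _ of_; have {}ea := evenN _ ea.
case: cases => -[h1 h2].
- apply: (famC _ _ _ _ _ _ S sv A2) => //; first by congr (2 * _)%num; clear - h2; lia.
  by apply: dvV; clear - h1; lia.
- apply: (famA _ _ _ _ _ _ S sv A2 G) => //; first by clear - h2; lia.
  by rewrite z_dbl h1.
apply: (famB _ _ _ _ _ _ S sv G) => //; first by clear - h2 g2; lia.
by rewrite z_dbl h1.
Qed.

Lemma caseII_absurd b c al be x y w : zprime b -> zprime c -> 5 <= b -> b < 10 ^ 9 -> (3 | b - -1) ->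
  1 <= al -> 1 <= be -> 1 <= x -> 1 <= y -> 1 <= w -> Z.Odd x -> Z.Odd y ->
  c = (2 ^ al) ^ 2 + (b ^ be) ^ 2 -> 2 ^ x + b ^ y = c ^ (2 * w) -> False.
Proof.
move=> bp cp b5 b9 b3 al1 be1 x1 y1 w1 ox oy Ec E.
have a2 := caseII_alpha2 b c al be bp cp b5 al1 be1 Ec x y w x1 y1 w1 ox oy E.
have par := caseII_parity b c al be bp cp b5 al1 be1 Ec x y w x1 y1 w1 ox oy E.
have cases := caseII_cases b c al be bp cp b5 al1 be1 Ec x y w x1 y1 w1 ox oy E.
have [k3 E3] := b3.
have b73 : b <> 73 by clear - E3; lia.
have big n : 5 <= n -> (2 ^ n | b - 1) \/ (2 ^ n | b - -1) -> 41 <= b.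
  move=> n5 h.
  have : (2 ^ 5 | b - 1) \/ (2 ^ 5 | b - -1).
    by case: h => h; [left | right]; apply: (Z.divide_trans _ (2 ^ n)) => //; exact: pow2_dvd.
  by change (2 ^ 5) with 32; case=> -[k Ek]; clear - b5 Ek E3; lia.
have exd V : exact2 V (b - 1) -> (2 ^ V | b - 1) by case=> q ->; exists (2 * q + 1); ring.
(* Either [b] is 1 or -1 modulo 32, or [V = 3] and [b] is 9 modulo 16; being also 2 modulo 3, it is
   at least 41 in the latter case. *)
have b41 : 41 <= b.
  case: cases => [[_ h]|[V [V3 ex xV]]|[_ h]|[h _]].
  - by apply: (big (2 * al + 1)); [clear - a2; lia | right].
  - have [V5|V3'] : 5 <= V \/ V = 3 by case: ox => k; rewrite xV; clear - V3; lia.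
      by apply: (big V) => //; left; exact: exd.
    by case: ex => q; rewrite V3'; change (2 ^ 3) with 8; clear - b5 E3; lia.
  - by apply: (big (2 * al + 1)); [clear - a2; lia | left; exact: exd].
  - by apply: (big (2 * al + 2)); [clear - a2; lia | left].
have hb : 41 <= b < 10 ^ 9 by split.
have nn n : 1 <= n -> 0 <= n by clear; lia.
have [B EB] := exN b ltac:(clear - b5; lia).
have [A EA] := exN al (nn _ al1); have [BE EBE] := exN be (nn _ be1); have [X EX] := exN x (nn _ x1).
have [W EW] := exN w (nn _ w1); have [Y EY] := exN y (nn _ y1).
subst b al be x w y.
rewrite -z_dbl in E.
have [S sv] := sieveZ _ _ _ _ _ _ c bp cp hb b73 Ec E oy be1.
have bm : (B mod 3 = 2)%num by apply: mod_of_Z => //; exists (k3 - 1); move: E3; clear; lia.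
have A2 : (2 <= A)%num by clear - a2; lia.
have {}ox := oddN _ ox.
have ee : N.even BE = N.even A.
  case: par => -[h1 h2]; first by rewrite (evenN _ h1) (evenN _ h2).
  by rewrite -!N.negb_odd (oddN _ h1) (oddN _ h2).
case: cases => [[h1 h]|[V [V3 ex xV]]|[ow h]|[h [[ow h1]|ew]]].
- apply: (famX _ _ _ _ _ _ S sv A2 W) => //; first by clear - h1; lia.
  by rewrite N2Z.inj_add z_dbl.
- subst V; apply: (famS _ _ _ _ _ _ S sv A2 W X) => //; by clear - V3; lia.
- apply: (famP _ _ _ _ _ _ S sv A2 W) => //; first exact: oddN.
  by rewrite N2Z.inj_add z_dbl.
- apply: (famR _ _ _ _ _ _ S sv A2 W) => //; [exact: oddN | by clear - h1; lia |].
  by rewrite N2Z.inj_add z_dbl.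
apply: (famQ _ _ _ _ _ _ S sv A2 W) => //; first exact: evenN.
by rewrite N2Z.inj_add z_dbl.
Qed.
End SieveTheorem.

Import SieveTheorem.
(** Modulo 3 all three terms are 1 or -1, and two signs add up to a third only if they agree with
    each other and differ from it. *)
Lemma mod3_classes b c x y z : ~ (3 | b) -> ~ (3 | c) -> 1 <= x -> 1 <= y -> 1 <= z -> 2 ^ x + b ^ y = c ^ z ->
  [/\ Z.Even x, Z.Odd z, (3 | c - -1) & Z.Even y \/ (3 | b - 1)] \/
  [/\ Z.Odd x, Z.Odd y, (3 | b - -1) & Z.Even z \/ (3 | c - 1)].
Proof.
move=> nb nc x1 y1 z1 E.
have n3 r s : r = 1 \/ r = -1 -> s = 1 \/ s = -1 -> forall t, t = 1 \/ t = -1 -> (3 | r + s - t) -> r = s /\ s = - t.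
  by move=> r1 s1 t t1 [k]; move: r1 s1 t1; clear; lia.
have key r s : (3 | b - r) -> (3 | c - s) -> (3 | (-1) ^ x + r ^ y - s ^ z).
  move=> br cs.
  have -> : (-1) ^ x + r ^ y - s ^ z = (c ^ z - s ^ z) - (2 ^ x - (-1) ^ x) - (b ^ y - r ^ y) by rewrite -E; ring.
  apply: Z.divide_sub_r; first apply: Z.divide_sub_r.
  - by apply: pow_congr => //; clear - z1; lia.
  - by apply: mod3_pow2; clear - x1; lia.
  - by apply: pow_congr => //; clear - y1; lia.
have p1 n : 1 <= n -> 1 ^ n = 1 by move=> h; rewrite Z.pow_1_l //; clear - h; lia.
have [ex ox] := pow_m1 x ltac:(clear - x1; lia).
have [ey oy] := pow_m1 y ltac:(clear - y1; lia).
have [ez oz] := pow_m1 z ltac:(clear - z1; lia).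
by case: (mod3_unit b nb) => br; case: (mod3_unit c nc) => cs; have := key _ _ br cs; rewrite ?p1 //;
  case: (Z.Even_or_Odd x) => hx; case: (Z.Even_or_Odd y) => hy; case: (Z.Even_or_Odd z) => hz;
  rewrite ?(ex hx) ?(ox hx) ?(ey hy) ?(oy hy) ?(ez hz) ?(oz hz) => -[k Ek];
  first [by exfalso; clear - Ek; lia | by left; split=> //; auto | by right; split=> //; auto].
Qed.

Section TwoUnique.
Variables b c : Z.
Hypotheses (bp : zprime b) (cp : zprime c) (b5 : 5 <= b) (c5 : 5 <= c) (bc : b <> c).
Let large := 10 ^ 9 <= b /\ exists al be, [/\ 1 <= al, 1 <= be & c = (2 ^ al) ^ 2 + (b ^ be) ^ 2].

Lemma ee_form_sol x y z : 1 <= x -> 1 <= y -> 1 <= z -> Z.Even x -> Z.Even y -> Z.Odd z -> 2 ^ x + b ^ y = c ^ z ->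
  b = 11 \/ exists al be, [/\ 1 <= al, 1 <= be & c = (2 ^ al) ^ 2 + (b ^ be) ^ 2].
Proof.
move=> x1 y1 z1 ex ey oz E.
have [s s1 Es] := half_even _ x1 ex; have [t t1 Et] := half_even _ y1 ey.
have E' : (2 ^ s) ^ 2 + (b ^ t) ^ 2 = c ^ z.
  by rewrite -E Es Et !sq_pow //; [clear - t1; lia | clear - s1; lia].
have [Ec|E11] := ee_form b c s t z bp cp b5 c5 bc s1 t1 z1 oz E'; last by left.
by right; exists s, t.
Qed.

Lemma ee_eo_large x y z x' y' z' : 1 <= x -> 1 <= y -> 1 <= z -> 1 <= x' -> 1 <= y' -> 1 <= z' ->
  2 ^ x + b ^ y = c ^ z -> 2 ^ x' + b ^ y' = c ^ z' -> (3 | b - 1) ->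
  Z.Even x -> Z.Even y -> Z.Odd z -> Z.Even x' -> Z.Odd y' -> Z.Odd z' -> large.
Proof.
move=> x1 y1 z1 x1' y1' z1' E E' b3 ex ey oz ex' oy' oz'.
have [E11|[al [be [al1 be1 Ec]]]] := ee_form_sol x y z x1 y1 z1 ex ey oz E.
  by exfalso; case: b3 => k; rewrite E11; clear; lia.
have [b9|b9] : b < 10 ^ 9 \/ 10 ^ 9 <= b by clear; lia.
  exfalso; have [g g1 Eg] := half_even _ x1' ex'.
  apply: (caseI_absurd b c al be g z' y') => //; by rewrite -Eg.
by split=> //; exists al, be.
Qed.

Lemma ee_oo_large x y z x' y' z' : 1 <= x -> 1 <= y -> 1 <= z -> 1 <= x' -> 1 <= y' -> 1 <= z' ->
  2 ^ x + b ^ y = c ^ z -> 2 ^ x' + b ^ y' = c ^ z' -> (3 | b - -1) ->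
  Z.Even x -> Z.Even y -> Z.Odd z -> Z.Odd x' -> Z.Odd y' -> Z.Even z' -> large.
Proof.
move=> x1 y1 z1 x1' y1' z1' E E' b3 ex ey oz ox' oy' ez'.
have [w w1 Ew] := half_even _ z1' ez'.
have [E11|[al [be [al1 be1 Ec]]]] := ee_form_sol x y z x1 y1 z1 ex ey oz E; last first.
  have [b9|b9] : b < 10 ^ 9 \/ 10 ^ 9 <= b by clear; lia.
    by exfalso; apply: (caseII_absurd b c al be x' y' w) => //; rewrite -Ew.
  by split=> //; exists al, be.
(* For [b = 11] the left side of the second equation is 5 or 3 modulo 8, but the right side is an
   odd square. *)
exfalso.
have ob : Z.Odd b by have := ee_b_odd b bp b5 1; rewrite Z.pow_1_r; apply.
have [p Ep] := pow_odd_mod8 b y' y1' oy' ob.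
have [q Eq] := prime_odd_sq_mod8 (c ^ w) (ee_b_odd c cp c5 w ltac:(clear - w1; lia)).
move: E'; rewrite Ew -sq_pow; last by clear - w1; lia.
rewrite Eq => E'.
have [Ex|x3] : x' = 1 \/ 3 <= x' by case: ox' => k Ek; move: x1'; rewrite Ek; clear; lia.
  by move: E' Ep; rewrite Ex E11; change (2 ^ 1) with 2; clear; lia.
have [r Er] := pow2_ge8 x' x3.
by move: E' Ep; rewrite Er E11; clear; lia.
Qed.

(** Solutions with equal parities of [x] and [y] are unique. If the parities differ, the residues
    modulo 3 make one solution even in both [x] and [y] with [z] odd, and the other one of the two
    types excluded by the sieve. *)
Lemma a2_unique x y z x' y' z' : 1 <= x -> 1 <= y -> 1 <= z -> 1 <= x' -> 1 <= y' -> 1 <= z' ->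
  2 ^ x + b ^ y = c ^ z -> 2 ^ x' + b ^ y' = c ^ z' -> [/\ x = x', y = y' & z = z'] \/ large.
Proof.
move=> x1 y1 z1 x1' y1' z1' E E'.
have nb : ~ (3 | b) by move/(prime_div_prime _ _ prime_3 bp); clear - b5; lia.
have nc : ~ (3 | c) by move/(prime_div_prime _ _ prime_3 cp); clear - c5; lia.
have b3 : 3 <= b by clear - b5; lia.
have c3 : 3 <= c by clear - c5; lia.
have bn1 : b <> 1 by clear - b5; lia.
case: (mod3_classes b c x y z nb nc x1 y1 z1 E) => [[ex oz c2 hy]|[ox oy b2 hz]];
case: (mod3_classes b c x' y' z' nb nc x1' y1' z1' E') => [[ex' oz' c2' hy']|[ox' oy' b2' hz']].
- case: (Z.Even_or_Odd y) => py; case: (Z.Even_or_Odd y') => py'.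
  + have [s s1 Ex] := half_even _ x1 ex; have [t t1 Ey] := half_even _ y1 py.
    have [s' s1' Ex'] := half_even _ x1' ex'; have [t' t1' Ey'] := half_even _ y1' py'.
    left; rewrite Ex Ex' Ey Ey'; have [-> -> ->] : [/\ s = s', t = t' & z = z'].
      apply: (unique_in_class b c 1 1) => //; try (by left); try (by clear - s1 t1 s1' t1'; lia).
        by rewrite !Z.mul_1_l !sq_pow; [rewrite -Ex -Ey | clear - t1; lia | clear - s1; lia].
      by rewrite !Z.mul_1_l !sq_pow; [rewrite -Ex' -Ey' | clear - t1'; lia | clear - s1'; lia].
    by [].
  + right; case: hy' => [ey'|b1]; first case: (even_odd_odd _ ey' py').
    exact: (ee_eo_large x y z x' y' z').
  + right; case: hy => [ey|b1]; first case: (even_odd_odd _ ey py).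
    exact: (ee_eo_large x' y' z' x y z).
  + have [s s1 Ex] := half_even _ x1 ex; have [t t1 Ey] := half_odd _ y1 py.
    have [s' s1' Ex'] := half_even _ x1' ex'; have [t' t1' Ey'] := half_odd _ y1' py'.
    left; rewrite Ex Ex' Ey Ey'; have [-> -> ->] : [/\ s = s', t = t' & z = z'].
      apply: (unique_in_class b c 1 b) => //; try (by left); try (by right); try (by move/bn1); try (by clear - s1 s1'; lia).
        by rewrite Z.mul_1_l -pow_dbl_succ // sq_pow; [rewrite -Ex -Ey | clear - s1; lia].
      by rewrite Z.mul_1_l -pow_dbl_succ // sq_pow; [rewrite -Ex' -Ey' | clear - s1'; lia].
    by [].
- right.
  have [ey|[k Ek]] := hy; last by exfalso; case: b2' => j Ej; clear - Ek Ej; lia.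
  have [ez|[k Ek]] := hz'; last by exfalso; case: c2 => j Ej; clear - Ek Ej; lia.
  exact: (ee_oo_large x y z x' y' z').
- right.
  have [ey|[k Ek]] := hy'; last by exfalso; case: b2 => j Ej; clear - Ek Ej; lia.
  have [ez|[k Ek]] := hz; last by exfalso; case: c2' => j Ej; clear - Ek Ej; lia.
  exact: (ee_oo_large x' y' z' x y z).
have [s s1 Ex] := half_odd _ x1 ox; have [t t1 Ey] := half_odd _ y1 oy.
have [s' s1' Ex'] := half_odd _ x1' ox'; have [t' t1' Ey'] := half_odd _ y1' oy'.
left; rewrite Ex Ex' Ey Ey'; have [-> -> ->] : [/\ s = s', t = t' & z = z'].
  apply: (unique_in_class b c 2 b) => //; try (by right); try (by move/bn1);
    by rewrite -?pow_dbl_succ // -?Ex -?Ey -?Ex' -?Ey'.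
by [].
Qed.
End TwoUnique.

Lemma two_b_large b c x y z x' y' z' : zprime b -> zprime c -> 5 <= b -> 5 <= c -> b <> c ->
  1 <= x -> 1 <= y -> 1 <= z -> 1 <= x' -> 1 <= y' -> 1 <= z' ->
  2 ^ x + b ^ y = c ^ z -> 2 ^ x' + b ^ y' = c ^ z' -> [/\ x = x', y = y' & z = z'] \/ 10 ^ 9 < b /\ 10 ^ 18 < c.
Proof.
move=> bp cp b5 c5 bc x1 y1 z1 x1' y1' z1' E E'.
have [|[b9 [al [be [al1 be1 Ec]]]]] := a2_unique b c bp cp b5 c5 bc x y z x' y' z' x1 y1 z1 x1' y1' z1' E E'; first by left.
right; have {}b9 : 10 ^ 9 < b.
  have [Eb|//] : b = 10 ^ 9 \/ 10 ^ 9 < b by clear - b9; lia.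
  exfalso; have : (2 | b) by rewrite Eb; exists (5 * 10 ^ 8).
  by move/(prime_div_prime _ _ prime_2 bp); clear - b5; lia.
split=> //.
have h : b <= b ^ be by apply: pow_ge_base => //; clear - b5; lia.
rewrite Ec !Z.pow_2_r; change (10 ^ 18) with (10 ^ 9 * 10 ^ 9).
move: h b9; move: (b ^ be) (2 ^ al) (10 ^ 9) (ltac:(by []) : 0 <= 10 ^ 9) => B A T; clear; nia.
Qed.

(** * The theorem *)

Lemma zprime_of_nat p : prime p -> zprime (Z.of_nat p).
Proof.
move=> pp; have p1 := prime_gt1 pp; apply/prime_alt; split.
  by move/ltP: p1; clear; lia.
move=> n [n1 np] [k Ek].
have k0 : 0 <= k by clear - n1 np Ek; nia.
have : Z.to_nat n %| p.
  apply/dvdnP; exists (Z.to_nat k); apply: Nat2Z.inj.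
  by rewrite -multE Nat2Z.inj_mul !Z2Nat.id //; clear - n1; lia.
have /primeP [_ h] := pp; move/h => /orP [] /eqP; clear - n1 np; lia.
Qed.

Lemma pow_of_nat a n : Z.of_nat (expn a n) = Z.of_nat a ^ Z.of_nat n.
Proof.
elim: n => [|n IH] //.
by rewrite expnS -multE Nat2Z.inj_mul IH Nat2Z.inj_succ Z.pow_succ_r //; clear; lia.
Qed.

Lemma is_sol_Z a b c x y z : is_sol a b c (x, y, z) ->
  [/\ 1 <= Z.of_nat x, 1 <= Z.of_nat y, 1 <= Z.of_nat z &
    Z.of_nat a ^ Z.of_nat x + Z.of_nat b ^ Z.of_nat y = Z.of_nat c ^ Z.of_nat z].
Proof.
move=> [/ltP x0 [/ltP y0 [/ltP z0 E]]].
split; [by clear - x0; lia | by clear - y0; lia | by clear - z0; lia |].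
by rewrite -!pow_of_nat -E -plusE Nat2Z.inj_add.
Qed.

Close Scope Z_scope.

Theorem theorem1p8 (a b c : nat) :
  prime a -> prime b -> prime c ->
  a <> b -> b <> c -> a <> c ->
  a < b ->
  N_ge2 a b c ->
  (a, b, c) \notin [:: (2, 3, 5); (2, 3, 11); (2, 5, 3); (2, 7, 3); (3, 5, 2); (3, 13, 2)] ->
  10 ^ 9 < b /\ 10 ^ 18 < c.
Proof.
move=> pa pb pc ab bc ac lab [[[x y] z] [[[x' y'] z'] [ne [s1 s2]]]] out.
have za := zprime_of_nat a pa; have zb := zprime_of_nat b pb; have zc := zprime_of_nat c pc.
have [x1 y1 z1 E] := is_sol_Z _ _ _ _ _ _ s1.
have [x1' y1' z1' E'] := is_sol_Z _ _ _ _ _ _ s2.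
have absurd : [/\ Z.of_nat x = Z.of_nat x', Z.of_nat y = Z.of_nat y' & Z.of_nat z = Z.of_nat z'] -> False.
  by case=> /Nat2Z.inj Ex /Nat2Z.inj Ey /Nat2Z.inj Ez; apply: ne; rewrite Ex Ey Ez.
have /ltP a2 := prime_gt1 pa; have /ltP c2 := prime_gt1 pc; have /ltP lab' := lab.
have [Ec|oc] := even_prime pc.
  subst c; exfalso; apply: absurd.
  apply: (c2_unique (Z.of_nat a) (Z.of_nat b)) => //; try (by clear - a2 ac lab'; lia).
  case=> -[h1 h2].
  - have [Ea Eb] : a = 3 /\ b = 5 by clear - h1 h2; lia.
    by move: out; rewrite Ea Eb.
  - by clear - h1 h2 lab'; lia.
  - by clear - h1 h2 lab'; lia.
  - have [Ea Eb] : a = 3 /\ b = 13 by clear - h1 h2; lia.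
    by move: out; rewrite Ea Eb.
have n4 p : prime p -> p <> 2 -> p <> 3 -> (5 <= Z.of_nat p)%Z.
  move=> pp p2 p3; have /ltP p1 := prime_gt1 pp; have [E4|] : p = 4 \/ p <> 4 by clear; lia.
    by move: pp; rewrite E4.
  by clear - p1 p2 p3; lia.
have [Ea|oa] := even_prime pa; last first.
  have [Eb|ob] := even_prime pb; first by exfalso; clear - Eb a2 lab'; lia.
  have [x0 [y0 [z0 F]]] := s1; exfalso.
  have := f_equal odd F; rewrite oddD !oddX oa ob oc !orbT.
  by [].
subst a.
have c3 : c <> 2 by move=> h; apply: ac.
have [Eb|nb] : b = 3 \/ b <> 3 by clear; lia.
  subst b; exfalso; apply: absurd.
  have c5 := n4 c pc c3 ltac:(by move=> h; apply: bc).
  apply: (b3_unique (Z.of_nat c)) => // h.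
    have Ec : c = 5 by clear - h; lia.
    by move: out; rewrite Ec.
  have Ec : c = 11 by clear - h; lia.
  by move: out; rewrite Ec.
have b5 := n4 b pb ltac:(clear - lab'; lia) nb.
have [Ec|nc] : c = 3 \/ c <> 3 by clear; lia.
  subst c; exfalso; apply: absurd.
  apply: (c3_unique (Z.of_nat b)) => // h.
    have Eb : b = 5 by clear - h; lia.
    by move: out; rewrite Eb.
  have Eb : b = 7 by clear - h; lia.
  by move: out; rewrite Eb.
have c5 := n4 c pc c3 nc.
have bcZ : Z.of_nat b <> Z.of_nat c by move/Nat2Z.inj.
case: (two_b_large _ _ _ _ _ _ _ _ zb zc b5 c5 bcZ x1 y1 z1 x1' y1' z1' E E') => [/absurd //|[h1 h2]].
by split; apply/ltP/Nat2Z.inj_lt; rewrite pow_of_nat.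
Qed.
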